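(* Let $1\le q_1<\dots<q_k$ be integers ($k\ge 1$) and let $F=E[F]+\sum_{i=1}^k I_{q_i}(f_i)$, where each $f_i$ is a nonzero element of $L^2_s(\mu^{q_i})$ and the family $\{f_i\}$ satisfies the technical assumptions (i)–(iii) listed in the context. Let $\sigma>0$ be such that $\sigma^2=\mathrm{Var}(F)$, and set $$B_2(F;\sigma)=\frac1\sigma\sqrt{E\big[(\sigma^2-\langle DF,-DL^{-1}F\rangle_{L^2(\mu)})^2\big]}+\frac1{\sigma^2}\int_Z E\big[(D_zF)^2|D_zL^{-1}F|\big]\,\mu(dz),$$ $$B_3(F;\sigma)=\frac1\sigma\Big\{\max_1\|f_i\star_r^l f_i\|_{L^2(\mu^{2q_i-r-l})}+\max_2\|f_i\star_r^l f_j\|_{L^2(\mu^{q_i+q_j-r-l})}+\max_{i=1,\dots,k}\|f_i\|^2_{L^4(\mu^{q_i})}\Big\},$$ where $\max_1$ ranges over all $1\le i\le k$ such that $q_i>1$ and all pairs $(r,l)$ with $r\in\{1,\dots,q_i\}$ and $1\le l\le r\wedge(q_i-1)$, and $\max_2$ ranges over all $1\le i<j\le k$ and all pairs $(r,l)$ with $r\in\{1,\dots,q_i\}$ and $l\in\{1,\dots,r\}$ (a maximum over an empty set is $0$). Then there exists a constant $C_0=C_0(q_1,\dots,q_k)\in(0,\infty)$, depending only on $q_1,\dots,q_k$, such that $$B_2(F;\sigma)\le C_0\, B_3(F;\sigma).$$ When $q_1=1$, one can replace $\|f_1\|^2_{L^4(\mu)}$ in this bound by the smaller quantity $\|f_1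\|^3_{L^3(\mu)}/\|f_1\|_{L^2(\mu)}$.
   Context: $(Z,\mathscr Z,\mu)$ is a Borel space with its Borel $\sigma$-field and a $\sigma$-finite measure $\mu$ without atoms. $\eta$ is a Poisson measure on $Z$ with control $\mu$: $\eta(B)$ is Poisson with mean $\mu(B)$ whenever $\mu(B)<\infty$, and $\eta(B),\eta(C)$ are independent for disjoint $B,C$; $\hat\eta=\eta-\mu$. All random variables are measurable with respect to the ($P$-completed) $\sigma$-field generated by $\eta$. $L^2_s(\mu^q)$ is the space of $\mu^q$-a.e. symmetric functions in $L^2(\mu^q)$, and $I_q(f)$ is the multiple Wiener–Itô integral of order $q$ of $f\in L^2_s(\mu^q)$ with respect to $\hat\eta$, normalized so that $E[I_q(f)I_m(g)]=q!\langle f,g\rangle_{L^2(\mu^q)}\mathbf 1_{q=m}$; $I_0(b)=b$ for constants. Malliavin operators: if $F=E[F]+\sum_{m\ge1}I_m(h_m)$ (with $h_m\in L^2_s(\mu^m)$ and the relevant series converging), then $D_zF=\sum_{m\ge1} m I_{m-1}(h_m(z,\cdot))$, and $L^{-1}F=-\sum_{m\ge1}\frac1m I_m(h_m)$ (when $F$ is not centered, $L^{-1}F$ means $L^{-1}(F-E[F])$). Contractions: for $f$ and $g$ symmetric functions of $p$ and $q$ variables, $0\le l\le r\le p\wedge q$, $$f\star_r^l g(\gamma_1,\dots,\gamma_{r-l},t_1,\dots,t_{p-r},s_1,\dots,s_{q-r})=\int_{Z^l}f(z_1,\dots,z_l,\gamma_1,\dots,\gamma_{r-l},t_1,\dots,t_{p-r})\,g(z_1,\dots,z_l,\gamma_1,\dots,\gamma_{r-l},s_1,\dots,s_{q-r})\,\mu^l(dz_1,\dots,dz_l),$$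 with no integration when $l=0$. Technical assumptions on $\{f_i:i=1,\dots,k\}$: (i) for every $i$ and every $r=1,\dots,q_i$, the kernel $f_i\star_{q_i}^{q_i-r}f_i$ is in $L^2(\mu^r)$; (ii) for every $i$ with $q_i\ge2$, every $r=1,\dots,q_i$ and $l=1,\dots,r$, the contraction $|f_i|\star_r^l|f_i|(z_1,\dots,z_{2q_i-r-l})$ is well defined and finite at every $(z_1,\dots,z_{2q_i-r-l})\in Z^{2q_i-r-l}$; (iii) for every $i,j$ with $\max(q_i,q_j)>1$, every integer $m$ with $|q_i-q_j|\vee1\le m\le q_i+q_j-2$, and every $(r,l)$ (with $0\le l\le r\le q_i\wedge q_j-1$) such that $m=q_i+q_j-2-r-l$, $$\int_Z\Big[\int_{Z^m}(f_i(z,\cdot)\star_r^l f_j(z,\cdot))^2\,d\mu^m\Big]^{1/2}\mu(dz)<\infty,$$ where $f_i(z,\cdot)$ is the function of $q_i-1$ variables obtained by fixing one argument equal to $z$. *)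

(* Defs.v *)
From HB Require Import structures.
From mathcomp Require Import all_boot all_order all_algebra all_fingroup.
From mathcomp Require Import all_classical all_reals all_analysis.
From mathcomp Require Import measurable_realfun.

Set Implicit Arguments.
Unset Strict Implicit.
Unset Printing Implicit Defensive.

Import Order.TTheory GRing.Theory Num.Theory.
Import numFieldNormedType.Exports.

Local Open Scope classical_set_scope.
Local Open Scope ring_scope.
Local Open Scope ereal_scope.

Section CarrierSpace.
Context d (Z : measurableType d) (R : realType).

(* Borel space in the sense of probability theory: measurably isomorphic to a
   Borel subset of [0, 1]. *)
Definition borel_space : Prop :=
  exists phi : Z -> R,
    [/\ measurable_fun [set: Z] phi, injective phi,
        forall z, (0 <= phi z <= 1)%R &
        forall A, measurable A -> measurable (phi @` A)].

Definition non_atomic (mu : {measure set Z -> \bar R}) : Prop :=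
  forall A, measurable A -> 0 < mu A ->
    exists B, [/\ measurable B, B `<=` A & 0 < mu B < mu A].

End CarrierSpace.

Section PowerStep.
Context d (Z : measurableType d) (R : realType).
Variables (mu : {sigma_finite_measure set Z -> \bar R}) (n : nat).
Variable m : {sigma_finite_measure set (n.-tuple Z) -> \bar R}.

Definition pair_cons (x : Z * n.-tuple Z) : n.+1.-tuple Z :=
  [tuple of x.1 :: x.2].

Lemma measurable_pair_cons : measurable_fun [set: Z * n.-tuple Z] pair_cons.
Proof. exact: measurable_cons. Qed.

Definition power_step : set (n.+1.-tuple Z) -> \bar R :=
  pushforward (mu \x m) pair_cons.

Let power_step0 : power_step set0 = 0.
Proof. by rewrite /power_step /pushforward preimage_set0 measure0. Qed.

Let power_step_ge0 A : 0 <= power_step A.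
Proof. by apply: integral_ge0 => x _; exact: measure_ge0. Qed.

Let power_step_sigma_additive : semi_sigma_additive power_step.
Proof.
move=> F mF tF mUF; rewrite /power_step /pushforward preimage_bigcup.
have mp A : measurable A -> measurable (pair_cons @^-1` A).
  by move=> mA; rewrite -[X in measurable X]setTI; exact: measurable_pair_cons.
apply: measure_semi_sigma_additive.
- by move=> k; exact: mp.
- apply/trivIsetP => /= i j _ _ ij; rewrite -preimage_setI.
  by move/trivIsetP : tF => /(_ _ _ _ _ ij) ->//; rewrite preimage_set0.
- by rewrite -preimage_bigcup; exact: mp.
Qed.

HB.instance Definition _ := isMeasure.Build _ _ _ power_step
  power_step0 power_step_ge0 power_step_sigma_additive.

Let power_step_sigma_finite : sigma_finite [set: n.+1.-tuple Z] power_step.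
Proof.
have /sigma_finiteP[F [TF ndF Foo]] := sigma_finiteT mu.
have /sigma_finiteP[G [TG ndG Goo]] := sigma_finiteT m.
have mthead : measurable_fun [set: n.+1.-tuple Z] (fun t => thead t).
  exact: measurable_tnth.
pose tl (t : n.+1.-tuple Z) : n.-tuple Z := [tuple of behead t].
exists (fun j => (fun t : n.+1.-tuple Z => thead t) @^-1` F j `&` tl @^-1` G j).
  apply/esym/seteqP; split=> // t _.
  have [i _ Fi] : (\bigcup_i F i) (thead t) by rewrite -TF.
  have [j _ Gj] : (\bigcup_i G i) (tl t) by rewrite -TG.
  exists (maxn i j) => //; split.
    by move: Fi; apply: (subsetPset _ _ (ndF _ _ (leq_maxl i j))).
  by move: Gj; apply: (subsetPset _ _ (ndG _ _ (leq_maxr i j))).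
move=> j; have [mFj Fj] := Foo j; have [mGj Gj] := Goo j; split.
  apply: measurableI.
    by rewrite -[X in measurable X]setTI; exact: mthead.
  by rewrite -[X in measurable X]setTI; exact: (@measurable_behead _ Z n).
rewrite /power_step /pushforward.
rewrite [X in (mu \x m) X](_ : _ = F j `*` G j).
  by rewrite product_measure1E// lte_mul_pinfty// ge0_fin_numE.
have tlK (x : Z * n.-tuple Z) : tl (pair_cons x) = x.2 by exact: val_inj.
by apply/seteqP; split=> x /=; rewrite tlK theadE.
Qed.

HB.instance Definition _ :=
  Measure_isSigmaFinite.Build _ _ _ power_step power_step_sigma_finite.

End PowerStep.

(* The product measure mu^n on Z^n. The library has no n-fold product of a
   sigma-finite measure; it is obtained from the binary one, Z^(n+1) being
   identified with Z * Z^n. Z^0 is a point of mass 1. *)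
Fixpoint mpow d (Z : measurableType d) (R : realType)
    (mu : {sigma_finite_measure set Z -> \bar R}) (n : nat) :
    {sigma_finite_measure set (n.-tuple Z) -> \bar R} :=
  match n with
  | 0 => dirac [tuple]
  | n'.+1 => power_step mu (mpow mu n')
  end.

Section Kernels.
Context d (Z : measurableType d) (R : realType).
Variable mu : {sigma_finite_measure set Z -> \bar R}.

(* L^2_s(mu^n); elements are represented by actual functions. *)
Definition L2_sym n (f : n.-tuple Z -> R) : Prop :=
  f \in Lfun (mpow mu n) 2%:E /\
  {ae mpow mu n, forall t, forall s : 'S_n,
    f [tuple tnth t (s i) | i < n] = f t}.

(* f applied to a list of arguments. It is only ever used on lists of length n
   (the default value 0 is irrelevant) and avoids casts between tuple types. *)
Definition app_seq n (f : n.-tuple Z -> R) (s : seq Z) : R :=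
  if insub s is Some t then f t else 0%R.

(* f(z, .) *)
Definition fix_first n (f : n.-tuple Z -> R) (z : Z) : n.-1.-tuple Z -> R :=
  fun t => app_seq f (z :: t).

(* The contraction of f and g, x being the concatenation of
   gamma (r - l variables), t (p - r variables) and s (q - r variables). *)
Definition star_contraction p q (r l : nat)
    (f : p.-tuple Z -> R) (g : q.-tuple Z -> R) :
    (p + q - r - l).-tuple Z -> \bar R :=
  fun x =>
    let gamma := take (r - l) x in
    let t := take (p - r) (drop (r - l) x) in
    let s := drop (p - l) x in
    \int[mpow mu l]_z (app_seq f (z ++ gamma ++ t) *
                       app_seq g (z ++ gamma ++ s))%:E.

Arguments star_contraction {p q} r l f g x.

Definition contraction_norm p q (r l : nat)
    (f : p.-tuple Z -> R) (g : q.-tuple Z -> R) : \bar R :=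
  'N[mpow mu (p + q - r - l)]_2%:E[star_contraction r l f g].

End Kernels.
Arguments star_contraction {d Z R} mu {p q} r l f g x.

Section TechnicalAssumptions.
Context d (Z : measurableType d) (R : realType).
Variable mu : {sigma_finite_measure set Z -> \bar R}.
Variables (k : nat) (q : 'I_k -> nat).
Variable f : forall i : 'I_k, (q i).-tuple Z -> R.
Arguments f : clear implicits.

Definition assumption_i : Prop :=
  forall (i : 'I_k) (r : nat), (1 <= r <= q i)%N ->
    contraction_norm mu (q i) (q i - r) (f i) (f i) < +oo.

Definition assumption_ii : Prop :=
  forall (i : 'I_k) (r l : nat),
    (2 <= q i)%N -> (1 <= r <= q i)%N -> (1 <= l <= r)%N ->
    let absf := fun t => `|f i t|%R in
    forall x, star_contraction mu r l absf absf x < +oo.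

Definition assumption_iii : Prop :=
  forall (i j : 'I_k) (m r l : nat),
    (1 < maxn (q i) (q j))%N ->
    (maxn (maxn (q i - q j) (q j - q i)) 1 <= m <= q i + q j - 2)%N ->
    (l <= r)%N -> (r <= minn (q i) (q j) - 1)%N ->
    m = (q i + q j - 2 - r - l)%N ->
    \int[mu]_z contraction_norm mu r l
                 (fix_first (f i) z) (fix_first (f j) z) < +oo.

End TechnicalAssumptions.

Section PoissonMeasure.
Context d d' (Z : measurableType d) (Omega : measurableType d') (R : realType).
Variables (P : probability Omega R) (mu : {sigma_finite_measure set Z -> \bar R}).
Variable eta : R.-ker Omega ~> Z.

(* The mass function is written out because the library's poisson_pmf is
   constantly 1 at rate 0, whereas mu B = 0 is allowed here. *)
Definition poisson_measure : Prop :=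
  (forall B, measurable B -> mu B < +oo ->
    forall n : nat,
      P [set w | eta w B = n%:R%:E] =
      (fine (mu B) ^+ n / n`!%:R * expR (- fine (mu B)))%R%:E) /\
  (forall B C, measurable B -> measurable C -> B `&` C = set0 ->
    forall U V : set (\bar R), measurable U -> measurable V ->
      P [set w | U (eta w B) /\ V (eta w C)] =
      P [set w | U (eta w B)] * P [set w | V (eta w C)]).

Definition sigma_eta : set (set Omega) :=
  <<s [set E | exists B (U : set (\bar R)),
         [/\ measurable B, measurable U & E = [set w | U (eta w B)]]] >>.

(* Measurability with respect to the P-completion of sigma(eta). *)
Definition eta_measurable (X : Omega -> R) : Prop :=
  forall U : set R, measurable U ->
    exists2 E, sigma_eta E & P.-negligible ((X @^-1` U) `+` E).

End PoissonMeasure.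

Section ChaosExpansions.
Context d d' (Z : measurableType d) (Omega : measurableType d') (R : realType).
Variables (P : probability Omega R) (mu : {sigma_finite_measure set Z -> \bar R}).
Variable eta : R.-ker Omega ~> Z.

Definition cvg_L2 dT (T : measurableType dT) (m : {measure set T -> \bar R})
    (F_ : nat -> T -> R) (F : T -> R) : Prop :=
  F \in Lfun m 2%:E /\
  (fun n => 'N[m]_2%:E[EFin \o (F_ n \- F)%R]) @ \oo --> 0.

Definition compensated (A : set Z) (w : Omega) : R :=
  (fine (eta w A) - fine (mu A))%R.

(* g is a finite linear combination of indicators of off-diagonal rectangles
   A_1 * ... * A_n (pairwise disjoint sets of finite measure) and X is the same
   linear combination of the products of the compensated masses of the A_i. *)
Definition elementary_integral n (g : n.-tuple Z -> R) (X : Omega -> R) : Prop :=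
  exists (N : nat) (c : 'I_N -> R) (A : 'I_N -> 'I_n -> set Z),
    [/\ forall j i, measurable (A j i) /\ mu (A j i) < +oo,
        forall j, trivIset [set: 'I_n] (A j),
        g = (fun t => \sum_(j < N) c j * \prod_(i < n) \1_(A j i) (tnth t i))%R &
        X = (fun w => \sum_(j < N) c j * \prod_(i < n) compensated (A j i) w)%R].

(* X is (a version of) the multiple Wiener-Ito integral I_n(f), f in L^2_s(mu^n):
   the extension by L^2 continuity of the elementary integrals. *)
Definition wiener_ito n (f : n.-tuple Z -> R) (X : Omega -> R) : Prop :=
  L2_sym mu f /\
  exists (g_ : nat -> n.-tuple Z -> R) (X_ : nat -> Omega -> R),
    [/\ forall N, elementary_integral (g_ N) (X_ N),
        cvg_L2 (mpow mu n) g_ f &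
        cvg_L2 P X_ X].

(* F = E[F] + \sum_(m >= 1) I_m(h_m) in L^2(P); h_0 plays no role. *)
Definition chaos_expansion (F : Omega -> R)
    (h : forall m, m.-tuple Z -> R) : Prop :=
  exists I_ : nat -> Omega -> R,
    (forall m, (0 < m)%N -> wiener_ito (h m) (I_ m)) /\
    cvg_L2 P (fun n w => fine 'E_P[F] + \sum_(1 <= m < n.+1) I_ m w)%R F.

(* DF is a jointly measurable version of (z, w) |-> D_z F(w); the summability
   condition on the kernels is the domain of D. *)
Definition malliavin_derivative (F : Omega -> R) (DF : Z -> Omega -> R) : Prop :=
  exists h : forall m, m.-tuple Z -> R,
    [/\ chaos_expansion F h,
        \sum_(0 <= m <oo) (m * m`!)%:R%:E * 'N[mpow mu m]_2%:E[EFin \o h m] ^+ 2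
          < +oo,
        measurable_fun [set: Z * Omega] (fun x => DF x.1 x.2) &
        {ae mu, forall z, exists I_ : nat -> Omega -> R,
          (forall m, (0 < m)%N -> wiener_ito (fix_first (h m) z) (I_ m)) /\
          cvg_L2 P (fun n w => \sum_(1 <= m < n.+1) m%:R * I_ m w)%R (DF z)}].

(* G is a version of L^{-1}(F - E[F]). *)
Definition inverse_generator (F G : Omega -> R) : Prop :=
  exists (h : forall m, m.-tuple Z -> R) (I_ : nat -> Omega -> R),
    [/\ chaos_expansion F h,
        forall m, (0 < m)%N -> wiener_ito (h m) (I_ m) &
        cvg_L2 P (fun n w => - \sum_(1 <= m < n.+1) m%:R^-1 * I_ m w)%R G].

(* DF and DLF stand for D F and D L^{-1} F. *)
Definition B2 (sigma : R) (DF DLF : Z -> Omega -> R) : \bar R :=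
  sigma^-1%:E *
    sqrte (\int[P]_w ((sigma ^+ 2)%:E -
                      \int[mu]_z (DF z w * - DLF z w)%:E) ^+ 2) +
  (sigma ^- 2)%:E * \int[mu]_z 'E_P[(fun w => DF z w ^+ 2 * `|DLF z w|)%R].

End ChaosExpansions.

Section Bound.
Context d (Z : measurableType d) (R : realType).
Variable mu : {sigma_finite_measure set Z -> \bar R}.
Variables (k : nat) (q : 'I_k -> nat).
Variable f : forall i : 'I_k, (q i).-tuple Z -> R.
Arguments f : clear implicits.

Definition max1 : \bar R :=
  \big[maxe/0]_(i < k | (1 < q i)%N)
    \big[maxe/0]_(1 <= r < (q i).+1)
      \big[maxe/0]_(1 <= l < (minn r (q i - 1)).+1)
        contraction_norm mu r l (f i) (f i).

Definition max2 : \bar R :=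
  \big[maxe/0]_(i < k) \big[maxe/0]_(j < k | (i < j)%N)
    \big[maxe/0]_(1 <= r < (q i).+1)
      \big[maxe/0]_(1 <= l < r.+1)
        contraction_norm mu r l (f i) (f j).

Definition normf (p : R) (i : 'I_k) : \bar R :=
  'N[mpow mu (q i)]_p%:E[EFin \o f i].

(* B_3 with a i in place of the squared L^4 norm of f_i. *)
Definition B3_with (sigma : R) (a : 'I_k -> \bar R) : \bar R :=
  sigma^-1%:E * (max1 + max2 + \big[maxe/0]_(i < k) a i).

Definition B3 (sigma : R) : \bar R := B3_with sigma (fun i => normf 4 i ^+ 2).

(* The variant of B_3 for q_1 = 1; q_1 has index 0 here. *)
Definition B3_first (sigma : R) : \bar R :=
  B3_with sigma (fun i =>
    if i == 0%N :> nat then normf 3 i ^+ 3 / normf 2 i else normf 4 i ^+ 2).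

End Bound.

(* Main.v *)
(**
Everything is discretised. Cut a set of finite measure into small atoms a of
mass w a; the centred and rescaled indicators x a of the void events
eta a = 0 are orthogonal, together with all their products over finite sets of
atoms, because the void probabilities are multiplicative (pairwise
independence of eta on disjoint sets gives no more than this). They satisfy
x a ^ 2 = w a + kap a * x a with |kap a| <= 2, hence the polynomials
sum_S k S * prod_(a in S) x a obey an exact finite product formula. Applied to
a discrete F and its discrete derivative, it bounds the variance of
<DF, - DL^-1 F> and the fourth moment of the part of order greater than one of
DF by sums of squares of discrete contractions, up to an error caused by
repeated atoms which vanishes with the mesh.

The discrete kernels are averages of the f_i over products of coarse cells, and
averaging does not increase the norms of the contractions
||f star_(l+g)^l f||; so the bounds are uniform in the grid. As the void
indicators approximate the compensated masses, the discrete objects converge in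
L^2 to F, DF and - DL^-1 F, whose chaos kernels are unique, and lower
semicontinuity of the integral of a square transfers the bounds. In the cubic
term of B_2 the part of DF of order one contributes ||f_1||_L3^3, the rest is
interpolated between its second and fourth moments.
*)
Require Import Defs.
From mathcomp Require Import all_boot all_order all_algebra.
From mathcomp Require Import ring lra zify.
Set Implicit Arguments.
Unset Strict Implicit.
Unset Printing Implicit Defensive.
Import Order.TTheory GRing.Theory Num.Theory.
Local Open Scope ring_scope.

(** * Polynomials in variables indexed by a finite set *)

Section SetSums.
Variables (R : comNzRingType) (A : finType).
Implicit Types (L M S T W : {set A}) (w x : A -> R).

(** All orders are merged into one function on lists, whose value on a list of length q i is f_i;
    contracting it with itself covers f_i with f_j for all i and j at once. A discrete contraction
    has a shape (l, g, u, v): l variables integrated, g shared, u and v free. Cauchy-Schwarz on Gram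
    kernels bounds the shape (l, g, u, v) by (l, g, u, u) and (l, g, v, v), hence mixed pairs by
    each f_i with itself. The obstacle is g = u = 0 or g = v = 0: the shape (l, 0, 0, 0) is the
    fourth power of an L^2 norm, which is not small. There f_i is contracted completely into f_j,
    and this is where [max2] enters. For equal free orders averaging is harmless because the quartic
    form is convex and its tangent inequality is linear in the kernel. The exceptional shape is only
    bilinear and pays the L^2 distance from the kernel to its averages, which is made small. In the
    cubic term Young's inequality with ratio sigma / m gives a multiple of sigma * m, which the
    prefactor sigma^-2 turns into m / sigma, the form of [B3]. *)

Definition setprod w S : R := \prod_(a in S) w a.

Lemma setprod0 w : setprod w set0 = 1.
Proof. exact: big_set0. Qed.

Lemma setprodU w S T : [disjoint S & T] ->
  setprod w (S :|: T) = setprod w S * setprod w T.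
Proof.
by move=> ST; rewrite /setprod -bigU //=; apply: eq_bigl => a; rewrite !inE.
Qed.

Lemma setprod1 w b : setprod w [set b] = w b.
Proof. exact: big_set1. Qed.

Lemma sum_supersets (V : nmodType) L (phi : {set A} -> V) :
  \sum_(S : {set A} | L \subset S) phi S
  = \sum_(S : {set A} | [disjoint L & S]) phi (L :|: S).
Proof.
rewrite (reindex_onto (fun S => L :|: S) (fun S => S :\: L)) /=; last first.
  move=> S LS; apply/setP => a; rewrite !inE.
  by have := subsetP LS a; case: (a \in L) => //= ->.
apply: eq_bigl => S; rewrite subsetUl /= setDUl setDv set0U.
by rewrite disjoint_sym; apply/eqP/idP => [/setDidPl//|/setDidPl].
Qed.

Lemma sum_supersets1 (V : nmodType) b (phi : {set A} -> V) :
  \sum_(S : {set A} | b \in S) phi S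
  = \sum_(S : {set A} | b \notin S) phi (b |: S).
Proof.
transitivity (\sum_(S : {set A} | [set b] \subset S) phi S).
  by apply: eq_bigl => S; rewrite sub1set.
by rewrite sum_supersets; apply: eq_bigl => S; rewrite disjoints1.
Qed.

(** Double counting of the pairs of a set and one of its points: the factor #|M| of a number
    operator becomes a sum over the removed point b. *)
Lemma sum_card_points (V : nmodType) (Pr : pred {set A}) (phi : {set A} -> V) :
  \sum_(M : {set A} | Pr M) phi M *+ #|M|
  = \sum_b \sum_(M : {set A} | (b \notin M) && Pr (b |: M)) phi (b |: M).
Proof.
transitivity (\sum_(M : {set A} | Pr M) \sum_(b in M) phi M).
  by apply: eq_bigr => M _; rewrite sumr_const.
rewrite (exchange_big_dep xpredT) //=; apply: eq_bigr => b _.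
under eq_bigl => M do rewrite andbC.
by rewrite big_mkcondr sum_supersets1 -big_mkcondr.
Qed.

End SetSums.

(** * Discrete product formula *)

Section Chaos.
Variables (R : comNzRingType) (A : finType).
Implicit Types (L M S T W : {set A}) (w x kap : A -> R) (k : {set A} -> R).

(** Sets rather than tuples index the monomials, so the diagonals are excluded from the start. With
    orthogonal monomials this is a finite sum of multiple integrals of all orders, k S standing for
    #|S|! times a symmetric kernel at the points of S. *)
Definition chaos x k : R := \sum_S k S * setprod x S.

Definition set_contract w k k' S T : R :=
  \sum_(L : {set A} | [disjoint L & S :|: T]) setprod w L * k (L :|: S) * k' (L :|: T).

(* In a product of two chaoses a common index a gives x a ^ 2 = w a + kap a * x a:
   set_contract collects the terms in w, and collect those in kap. *)
Definition collect kap (Q : {set A} -> {set A} -> R) W : R :=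
  \sum_(p : {set A} * {set A} | p.1 :|: p.2 == W)
    setprod kap (p.1 :&: p.2) * Q p.1 p.2.

Variables (w kap x : A -> R).
Hypothesis xx : forall a, x a ^+ 2 = w a + kap a * x a.

(** Only the indices in S :&: T give squares. Expanding each square by [xx], L is the set of indices
    where the term w a is chosen; at the other common indices kap a * x a is chosen and x a
    survives. *)
Lemma setprod_mul S T :
  setprod x S * setprod x T = \sum_(L : {set A} | L \subset S :&: T)
    setprod w L * setprod kap ((S :&: T) :\: L) * setprod x ((S :|: T) :\: L).
Proof.
pose F a := if a \in S :&: T then w a else 0.
pose G a := if a \in S :&: T then kap a * x a else if a \in S :|: T then x a else 1.
transitivity (\prod_a (F a + G a)).
  rewrite /setprod big_mkcond [X in _ * X]big_mkcond -big_split /=.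
  apply: eq_bigr => a _; rewrite /F /G !inE.
  by case: (a \in S); case: (a \in T); rewrite //= ?add0r ?mulr1 ?mul1r // -expr2.
rewrite bigA_distr; rewrite (bigID (fun L => L \subset S :&: T)) /=.
rewrite [X in _ + X]big1 ?addr0; last first.
  move=> J /subsetPn[a aJ aST]; rewrite (bigD1 a) //= aJ /F (negbTE aST).
  by rewrite mul0r.
apply: eq_bigr => L LST; rewrite /setprod.
transitivity (\prod_a ((if a \in L then w a else 1) *
    (if a \in S :&: T :\: L then kap a else 1) *
    (if a \in (S :|: T) :\: L then x a else 1))).
  apply: eq_bigr => a _; rewrite /F /G !inE.
  have := subsetP LST a; rewrite !inE.
  by case: (a \in L) => [/(_ isT)->|_]; case: (a \in S); case: (a \in T);
    rewrite /= ?mulr1 ?mul1r.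
by rewrite !big_split /= -!big_mkcond.
Qed.

Lemma chaos_collect Q : chaos x (collect kap Q)
  = \sum_S \sum_T setprod kap (S :&: T) * Q S T * setprod x (S :|: T).
Proof.
rewrite pair_big /= /chaos.
rewrite (partition_big (fun p : {set A} * {set A} => p.1 :|: p.2) xpredT) //=.
apply: eq_bigr => W _; rewrite /collect mulr_suml.
by apply: eq_bigr => p /eqP <-.
Qed.

(** The index sets containing L are written L :|: S and L :|: T with S and T disjoint from L. The
    sum over L is then the contraction, and what remains of the two monomials is supported by S :|:
    T. *)
Lemma chaos_mul k k' :
  chaos x k * chaos x k' = chaos x (collect kap (set_contract w k k')).
Proof.
transitivity (\sum_(L : {set A}) \sum_(S : {set A} | L \subset S)
    \sum_(T : {set A} | L \subset T)
    k S * k' T * (setprod w L * setprod kap ((S :&: T) :\: L) *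
                  setprod x ((S :|: T) :\: L))).
  rewrite /chaos big_distrlr /=.
  under eq_bigr => S _ do under eq_bigr => T _ do
    rewrite mulrACA setprod_mul mulr_sumr.
  under eq_bigr => S _ do rewrite (exchange_big_dep xpredT) //=.
  rewrite exchange_big /=; apply: eq_bigr => L _.
  rewrite [RHS]big_mkcond; apply: eq_bigr => S _ /=.
  case: ifP => LS; first by apply: eq_bigl => T; rewrite subsetI LS.
  by rewrite big_pred0 // => T; rewrite subsetI LS.
rewrite chaos_collect.
under [RHS]eq_bigr => S _ do under eq_bigr => T _ do
  rewrite /set_contract mulr_sumr mulr_suml.
under [RHS]eq_bigr => S _ do rewrite (exchange_big_dep xpredT) //=.
rewrite [RHS]exchange_big /=; apply: eq_bigr => L _.
rewrite sum_supersets [LHS]big_mkcond; apply: eq_bigr => S _ /=.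
have dU (T : {set A}) : [disjoint L & S :|: T] = [disjoint L & S] && [disjoint L & T].
  by rewrite -!setI_eq0 setIUr setU_eq0.
case: ifP => LS; last by rewrite big_pred0 // => T; rewrite dU LS.
rewrite sum_supersets; apply: eq_big => [T|T LT]; first by rewrite dU LS.
have e1 : (L :|: S) :&: (L :|: T) :\: L = S :&: T.
  rewrite -setUIr setDUl setDv set0U; apply/setDidPl.
  by rewrite disjoint_sym -setI_eq0 setIA (eqP (_ : L :&: S == set0)) ?set0I ?setI_eq0.
have e2 : ((L :|: S) :|: (L :|: T)) :\: L = S :|: T.
  rewrite setUACA setUid setDUl setDv set0U; apply/setDidPl.
  by rewrite disjoint_sym dU LS.
by rewrite e1 e2; ring.
Qed.

End Chaos.

Lemma cards_disjU (A : finType) (S T : {set A}) :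
  [disjoint S & T] -> #|S :|: T| = (#|S| + #|T|)%N.
Proof. by rewrite -setI_eq0 cardsU => /eqP ->; rewrite cards0 subn0. Qed.

Lemma disjoint_setUP (A : finType) (M S T : {set A}) :
  [disjoint M & S :|: T] -> [disjoint M & S] /\ [disjoint M & T].
Proof. by rewrite -!setI_eq0 setIUr setU_eq0 => /andP[]. Qed.

(** * Discrete derivative and its contractions *)

Section DiscreteDerivative.
Variables (R : comNzRingType) (A : finType) (w : A -> R).
Implicit Types (L M S T W : {set A}) (k : {set A} -> R).

(** Kernel of the discrete derivative at the atom b. Monomials have no repeated factor, so it
    vanishes on sets containing b; no factor #|S| + 1 appears since k already carries the
    factorial. *)
Definition dkern k b S : R := if b \in S then 0 else k (b |: S).

Lemma contract_dkern k k' b S T :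
  set_contract w (dkern k b) (dkern k' b) S T
  = if b \in S :|: T then 0 else set_contract w k k' (b |: S) (b |: T).
Proof.
rewrite /set_contract; case: ifPn => [|bST].
  rewrite !inE => /orP[] bS; apply: big1 => L _; rewrite /dkern !inE bS orbT.
    by rewrite mulr0 mul0r.
  by rewrite mulr0.
rewrite big_mkcond [RHS]big_mkcond; apply: eq_bigr => L _.
have -> : [disjoint L & (b |: S) :|: (b |: T)] = (b \notin L) && [disjoint L & S :|: T].
  rewrite setUACA setUid -!setI_eq0 setIUr setU_eq0 setI_eq0 disjoint_sym.
  by rewrite disjoints1.
move: bST; rewrite !inE negb_or => /andP[/negbTE bS /negbTE bT].
rewrite /dkern !inE bS bT !orbF; case: (b \in L) => /=.
  by case: ifP; rewrite ?mulr0.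
by rewrite !setUA ![b |: L]setUC.
Qed.

(** Integrating over b adds b to the contracted variables, and a contracted set M arises once from
    each of its points, whence the multiplicity #|M|. *)
Lemma sum_contract_dkern k k' S T :
  \sum_b w b * set_contract w (dkern k b) (dkern k' b) S T
  = \sum_(M : {set A} | [disjoint M & S :|: T])
      (setprod w M * k (M :|: S) * k' (M :|: T)) *+ #|M|.
Proof.
rewrite sum_card_points; apply: eq_bigr => b _; rewrite contract_dkern.
have dU M : [disjoint b |: M & S :|: T] = (b \notin S :|: T) && [disjoint M & S :|: T].
  rewrite -!setI_eq0 setIUl setU_eq0; congr (_ && _).
  by rewrite setI_eq0 disjoints1.
case: ifPn => bST; first by rewrite mulr0 big_pred0 // => M; rewrite dU bST andbF.
rewrite /set_contract mulr_sumr; apply: eq_big => [M|M dM].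
  rewrite dU bST setUACA setUid -!setI_eq0 setIUr setU_eq0 /=; congr (_ && _).
  by rewrite setI_eq0 disjoint_sym disjoints1.
have bM : b \notin M.
  move: dM; rewrite disjoint_sym setUACA setUid => /disjointFr -> //.
  by rewrite !inE eqxx.
rewrite setprodU ?disjoints1 // setprod1 !setUA ![b |: M]setUC; ring.
Qed.

End DiscreteDerivative.

(** * Energy bounds by discrete contractions *)

Section Bounds.
Variables (R : realFieldType) (A : finType) (w kap : A -> R) (n : nat).
Hypothesis w0 : forall a, 0 <= w a.
Hypothesis kap2 : forall a, `|kap a| <= 2.
Implicit Types (L M S T W : {set A}) (k h : {set A} -> R).

Lemma setprod_ge0 S : 0 <= setprod w S.
Proof. by apply: prodr_ge0. Qed.

(** The second moment of [chaos x k] as soon as the monomials are orthogonal with squared norms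
    [setprod w S], which holds for the void variables by [chaos_void_energy]. *)
Definition energy k : R := \sum_W setprod w W * k W ^+ 2.

Lemma sqr_sum_le (I : finType) (P : pred I) (u : I -> R) :
  (\sum_(i | P i) u i) ^+ 2 <= #|P|%:R * \sum_(i | P i) u i ^+ 2.
Proof.
rewrite -(@ler_pM2l _ 2) // expr2 big_distrlr /=.
rewrite (_ : 2 * (_ * _) =
   \sum_(i | P i) \sum_(j | P j) (u i ^+ 2 + u j ^+ 2)); last first.
  transitivity (\sum_(i | P i) (#|P|%:R * u i ^+ 2 + \sum_(j | P j) u j ^+ 2)).
    by rewrite big_split /= sumr_const -mulr_sumr -[in RHS]mulr_natl; ring.
  by apply: eq_bigr => i _; rewrite big_split /= sumr_const mulr_natl.
rewrite mulr_sumr; apply: ler_sum => i _; rewrite mulr_sumr; apply: ler_sum => j _.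
by have := sqr_ge0 (u i - u j); lra.
Qed.

(** Origin of 64 = 16 * 4. A set W of at most 2n elements has at most 16^n pairs of subsets, the
    price of Cauchy-Schwarz for the sum defining [collect], and the square of [setprod kap] over at
    most n atoms is at most 4^n. *)
Lemma collect_energy Q :
  (forall S T, Q S T != 0 -> (#|S| <= n)%N /\ (#|T| <= n)%N) ->
  energy (collect kap Q)
  <= (64 ^ n)%:R * \sum_S \sum_T setprod w (S :|: T) * Q S T ^+ 2.
Proof.
move=> Qn.
have kapn S : (#|S| <= n)%N -> setprod kap S ^+ 2 <= (4 ^ n)%:R.
  move=> Sn; rewrite -[X in X <= _]ger0_norm ?sqr_ge0 // normrX /setprod normr_prod.
  rewrite (_ : 4 = 2 ^ 2)%N // -expnM mulnC expnM natrX.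
  rewrite ler_pXn2r ?nnegrE ?ler0n ?prodr_ge0 // .
  apply: (@le_trans _ _ (2 ^+ #|S|)).
    by rewrite -prodr_const; apply: ler_prod => a _; rewrite normr_ge0 kap2.
  by rewrite natrX ler_weXn2l // ler1n.
have step W : collect kap Q W ^+ 2 <= (64 ^ n)%:R *
    \sum_(p : {set A} * {set A} | p.1 :|: p.2 == W) Q p.1 p.2 ^+ 2.
  (* Cauchy-Schwarz is applied to the pairs with nonzero Q only: if there is one, W has at most 2n
     elements and the number of pairs is controlled. *)
  pose P (p : {set A} * {set A}) := (p.1 :|: p.2 == W) && (Q p.1 p.2 != 0).
  have eP (f : {set A} * {set A} -> R) : (forall p, Q p.1 p.2 = 0 -> f p = 0) ->
      \sum_(p | p.1 :|: p.2 == W) f p = \sum_(p | P p) f p.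
    move=> f0; rewrite [RHS]big_mkcondr; apply: eq_bigr => p _.
    by case: eqP => // /f0.
  rewrite /collect eP; last by move=> p ->; rewrite mulr0.
  rewrite [X in _ <= _ * X]eP; last by move=> p ->; rewrite expr0n.
  apply: le_trans (sqr_sum_le _ _) _.
  have [p0 Pp0|noP] := pickP P; last first.
    by rewrite !(big_pred0 _ _ _ _ noP) !mulr0.
  have Wn : (#|W| <= 2 * n)%N.
    have /andP[/eqP <- /Qn[S T]] := Pp0.
    by apply: leq_trans (leq_card_setU _ _) _; rewrite mul2n -addnn leq_add.
  have cP : (#|P| <= 16 ^ n)%N.
    apply: (@leq_trans #|setX (powerset W) (powerset W)|).
      apply: subset_leq_card; apply/subsetP => p /andP[/eqP <- _].
      by rewrite !inE subsetUl subsetUr.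
    rewrite cardsX card_powerset -expnD -[16%N]/(2 ^ 4)%N -expnM.
    by rewrite leq_exp2l // addnn -mul2n -[4%N]/(2 * 2)%N -mulnA leq_mul2l.
  rewrite (_ : 64 = 16 * 4)%N // expnMn natrM -mulrA.
  apply: ler_pM; rewrite ?ler0n ?sumr_ge0 ?ler_nat //.
    by move=> p _; rewrite sqr_ge0.
  rewrite mulr_sumr; apply: ler_sum => p /andP[_ /Qn[S T]].
  rewrite exprMn ler_wpM2r ?sqr_ge0 // kapn //.
  by apply: leq_trans S; rewrite subset_leq_card ?subsetIl.
rewrite /energy pair_big /=.
rewrite [X in _ <= _ * X](partition_big (fun p : {set A} * {set A} => p.1 :|: p.2) xpredT) //=.
rewrite mulr_sumr; apply: ler_sum => W _.
apply: le_trans (ler_wpM2l (setprod_ge0 W) (step W)) _.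
rewrite mulrCA ler_wpM2l ?ler0n // mulr_sumr.
by apply: ler_sum => p /eqP ->.
Qed.

(** The contraction restricted to l integrated variables. The coefficients met below depend on sets
    only through their cardinalities, so they are constant on a layer and can be taken out of the
    sum. *)
Definition layer h l S T : R :=
  \sum_(M : {set A} | [disjoint M & S :|: T] && (#|M| == l))
    setprod w M * h (M :|: S) * h (M :|: T).

Variable h : {set A} -> R.
Hypothesis hn : forall S, h S != 0 -> (#|S| <= n)%N.

Lemma layer_neq0 l S T : layer h l S T != 0 -> (l + #|S| <= n)%N /\ (l + #|T| <= n)%N.
Proof.
move=> lay.
have [M /andP[/andP[dM /eqP cM] hM]] : exists M : {set A},
    ([disjoint M & S :|: T] && (#|M| == l)) && (setprod w M * h (M :|: S) * h (M :|: T) != 0).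
  apply/existsP/negbNE/negP => /existsPn no; move/negP: lay; apply; apply/eqP.
  by apply: big1 => M PM; apply/eqP/negbNE; have := no M; rewrite PM.
move: hM; rewrite !mulf_eq0 !negb_or => /andP[/andP[_ /hn hS] /hn hT].
by move: hS hT; have [dS dT] := disjoint_setUP dM; rewrite !cards_disjU // cM.
Qed.

(** On the layer l the three coefficients are e l, c (l + #|S|) and c' (l + #|T|); Cauchy-Schwarz
    over at most n + 1 layers finishes. The condition e l != 0 is kept because the choice e l = l
    removes the layer l = 0, where no variable is integrated. *)
Lemma layers_sqr_le (B : R) (e c c' : nat -> R) S T : 0 <= B ->
  (forall l s t, (l + s <= n)%N -> (l + t <= n)%N ->
     `|e l * c (l + s)%N * c' (l + t)%N| <= B) ->
  (\sum_(M : {set A} | [disjoint M & S :|: T])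
     e #|M| * (setprod w M * (c #|M :|: S| * h (M :|: S)) *
               (c' #|M :|: T| * h (M :|: T)))) ^+ 2
  <= n.+1%:R * B ^+ 2 * \sum_(l < n.+1 | e l != 0) layer h l S T ^+ 2.
Proof.
move=> B0 eB.
have -> : \sum_(M : {set A} | [disjoint M & S :|: T])
     e #|M| * (setprod w M * (c #|M :|: S| * h (M :|: S)) *
               (c' #|M :|: T| * h (M :|: T)))
  = \sum_(l < n.+1 | e l != 0) e l * c (l + #|S|)%N * c' (l + #|T|)%N * layer h l S T.
  rewrite [RHS]big_mkcond /=.
  rewrite (bigID (fun M : {set A} => (#|M| < n.+1)%N)) /= [X in _ + X]big1 ?addr0.
    rewrite (partition_big (fun M : {set A} => inord #|M| : 'I_n.+1) xpredT) //=.
    apply: eq_bigr => l _; rewrite /layer.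
    case: eqP => [el|_]; last first.
    - rewrite mulr_sumr; apply: eq_big => [M|M].
        have [Mn|Mn] := boolP (#|M| < n.+1)%N; rewrite /= ?andbT ?andbF.
          by rewrite -val_eqE /= inordK.
        by case: (#|M| =P l) Mn => [->|_]; rewrite ?ltn_ord ?andbF.
      move=> /andP[/andP[dM Mn] /eqP <-]; rewrite inordK //.
      have [dS dT] := disjoint_setUP dM.
      rewrite (cards_disjU dS) (cards_disjU dT); ring.
    apply: big1 => M /andP[/andP[_ Mn] /eqP Ml].
    by rewrite -(inordK Mn) Ml el mul0r.
  move=> M /andP[_]; rewrite ltnS -ltnNge => nM.
  have [->|/hn] := eqVneq (h (M :|: S)) 0; first by rewrite !mulr0 mul0r mulr0.
  move=> /(leq_trans (subset_leq_card (subsetUl M S))).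
  by rewrite leqNgt nM.
apply: le_trans (sqr_sum_le _ _) _; rewrite -!mulrA.
apply: ler_pM; rewrite ?ler0n ?sumr_ge0 ?ler_nat //.
- by move=> l _; rewrite sqr_ge0.
- by rewrite -[X in (_ <= X)%N]card_ord max_card.
rewrite mulrA -expr2 mulr_sumr; apply: ler_sum => l _; rewrite exprMn.
have [->|/layer_neq0[lS lT]] := eqVneq (layer h l S T) 0.
  by rewrite expr0n !mulr0.
rewrite ler_wpM2r ?sqr_ge0 // -[X in X <= _]ger0_norm ?sqr_ge0 // normrX.
by rewrite ler_pXn2r ?nnegrE // eB.
Qed.

Section ContractEnergy.
Variables (B : R) (e c c' : nat -> R).
Hypothesis B0 : 0 <= B.
Hypothesis eB : forall l s t, (l + s <= n)%N -> (l + t <= n)%N ->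
     `|e l * c (l + s)%N * c' (l + t)%N| <= B.
Variable Q : {set A} -> {set A} -> R.
Hypothesis QE : forall S T, Q S T = \sum_(M : {set A} | [disjoint M & S :|: T])
     e #|M| * (setprod w M * (c #|M :|: S| * h (M :|: S)) *
               (c' #|M :|: T| * h (M :|: T))).

Lemma contracted_neq0 S T : Q S T != 0 -> (#|S| <= n)%N /\ (#|T| <= n)%N.
Proof.
move=> Q0; have : 0 < Q S T ^+ 2 by rewrite exprn_even_gt0.
rewrite QE => /lt_le_trans/(_ (layers_sqr_le _ _ B0 eB)) /lt0r_neq0.
rewrite mulf_eq0 negb_or => /andP[_ lay].
have [l /andP[_ l0]] : exists l : 'I_n.+1, (e l != 0) && (layer h l S T != 0).
  apply/existsP/negbNE/negP => /existsPn no; move/negP: lay; apply; apply/eqP.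
  apply: big1 => l el; have := no l; rewrite el /= negbK => /eqP ->.
  by rewrite expr0n.
have [lS lT] := layer_neq0 l0.
by split; [apply: leq_trans lS | apply: leq_trans lT]; rewrite leq_addl.
Qed.

Lemma contract_energy (pr : {set A} -> {set A} -> bool) :
  energy (collect kap (fun S T => if pr S T then Q S T else 0))
  <= (64 ^ n)%:R * (n.+1%:R * B ^+ 2) * \sum_(l < n.+1 | e l != 0)
     \sum_S \sum_T (if pr S T then setprod w (S :|: T) * layer h l S T ^+ 2 else 0).
Proof.
apply: le_trans (collect_energy _) _.
  by move=> S T; case: ifP => [_|]; [exact: contracted_neq0 | rewrite eqxx].
rewrite -mulrA ler_wpM2l ?ler0n // [X in _ <= _ * X]exchange_big /= mulr_sumr.
apply: ler_sum => S _; rewrite [X in _ <= _ * X]exchange_big /= mulr_sumr.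
apply: ler_sum => T _; case: ifP => _; last first.
  by rewrite expr0n mulr0 big1 ?mulr0.
rewrite -mulr_sumr [X in _ <= X]mulrCA ler_wpM2l ?setprod_ge0 //.
by rewrite QE layers_sqr_le.
Qed.

End ContractEnergy.

(** With orthogonal monomials the left side is the discrete integral over b of the fourth moment of
    the derivative. The contraction of the derived kernels at (S, T) is that of k at (b |: S, b |:
    T); after renaming these two sets, the pairs that occur have a common point, and each is counted
    #|S :&: T| <= n times. Hence the condition on S :&: T and the factor n. *)
Lemma derivative_energy (B : R) (c : nat -> R) k : 0 <= B ->
  (forall m, (m <= n)%N -> `|c m| <= B) ->
  (forall S, k S = c #|S| * h S) ->
  \sum_b w b * energy (collect kap (set_contract w (dkern k b) (dkern k b)))
  <= (64 ^ n)%:R * (n.+1%:R * (B * B) ^+ 2) * n%:R * \sum_(l < n.+1)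
     \sum_S \sum_T (if S :&: T != set0
                    then setprod w (S :|: T) * layer h l S T ^+ 2 else 0).
Proof.
move=> B0 cB kE.
have eB l s t : (l + s <= n)%N -> (l + t <= n)%N ->
    `|1 * c (l + s)%N * c (l + t)%N| <= B * B.
  by move=> ls lt; rewrite mul1r normrM ler_pM ?cB.
have QE S T : set_contract w k k S T = \sum_(M : {set A} | [disjoint M & S :|: T])
     1 * (setprod w M * (c #|M :|: S| * h (M :|: S)) *
               (c #|M :|: T| * h (M :|: T))).
  by apply: eq_bigr => M _; rewrite mul1r !kE mulrA.
have BB : 0 <= B * B by rewrite mulr_ge0.
have Qn S T : set_contract w k k S T != 0 -> (#|S| <= n)%N /\ (#|T| <= n)%N.
  exact: (contracted_neq0 BB (e := fun=> 1) eB QE).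
apply: (@le_trans _ _ (\sum_b w b * ((64 ^ n)%:R * \sum_S \sum_T
   setprod w (S :|: T) * set_contract w (dkern k b) (dkern k b) S T ^+ 2))).
  apply: ler_sum => b _; rewrite ler_wpM2l //; apply: collect_energy => S T.
  rewrite contract_dkern; case: ifPn => [_|bST /Qn[nS nT]]; first by rewrite eqxx.
  split; [apply: leq_trans nS | apply: leq_trans nT];
    by rewrite subset_leq_card // subsetUr.
under eq_bigr => b _ do rewrite mulrCA.
rewrite -mulr_sumr -[_ * _ * n%:R]mulrA -[X in _ <= X]mulrA ler_wpM2l ?ler0n //.
apply: (@le_trans _ _ (\sum_S \sum_T #|S :&: T|%:R *
    (setprod w (S :|: T) * set_contract w k k S T ^+ 2))).
  rewrite le_eqVlt; apply/orP; left; apply/eqP.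
  transitivity (\sum_b \sum_(S : {set A} | b \in S) \sum_(T : {set A} | b \in T)
      setprod w (S :|: T) * set_contract w k k S T ^+ 2).
    apply: eq_bigr => b _; rewrite sum_supersets1 mulr_sumr [RHS]big_mkcond.
    apply: eq_bigr => S _; rewrite sum_supersets1 mulr_sumr.
    case: ifPn => bS; last first.
      apply: big1 => T _; rewrite contract_dkern inE.
      by rewrite (negbNE bS) expr0n !mulr0.
    rewrite [RHS]big_mkcond; apply: eq_bigr => T _.
    rewrite contract_dkern inE (negbTE bS) /=; case: ifPn => bT /=.
      by rewrite expr0n !mulr0.
    rewrite setUACA setUid (@setprodU _ _ _ [set b]) ?setprod1 ?mulrA //.
    by rewrite disjoints1 inE negb_or bS.
  rewrite (exchange_big_dep xpredT) //=; apply: eq_bigr => S _.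
  rewrite (exchange_big_dep xpredT) //=; apply: eq_bigr => T _.
  rewrite -sumr_const mulr_suml [RHS]big_mkcond [LHS]big_mkcond.
  apply: eq_bigr => b _; rewrite inE.
  by case: (b \in S); case: (b \in T); rewrite ?mul1r.
rewrite [X in _ <= _ * X]exchange_big /= mulr_sumr.
apply: ler_sum => S _; rewrite [X in _ <= _ * X]exchange_big /= mulr_sumr.
apply: ler_sum => T _.
have [->|ST] := eqVneq (S :&: T) set0.
  by rewrite cards0 mul0r big1 ?mulr0.
rewrite -mulr_sumr mulrCA [X in _ <= X]mulrCA ler_wpM2l ?setprod_ge0 //.
rewrite [_ * n%:R]mulrC -mulrA.
have [->|/Qn[nS nT]] := eqVneq (set_contract w k k S T) 0.
  by rewrite expr0n mulr0 !mulr_ge0 ?sumr_ge0 ?sqr_ge0 // => l _; rewrite sqr_ge0.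
rewrite ler_pM ?ler0n ?sqr_ge0 // ?ler_nat.
  by apply: leq_trans nS; rewrite subset_leq_card ?subsetIl.
have := layers_sqr_le S T BB (e := fun=> 1) eB; rewrite -QE.
by rewrite (eq_bigl xpredT) // => l; rewrite oner_eq0.
Qed.

Definition shaped (g u v : nat) (p : {set A} * {set A}) :=
  [&& #|p.1 :&: p.2| == g, #|p.1 :\: p.2| == u & #|p.2 :\: p.1| == v].

Lemma sum_by_shape (F : {set A} -> {set A} -> R) (pr : nat -> nat -> nat -> bool) :
  (forall S T, F S T != 0 -> (#|S| <= n)%N /\ (#|T| <= n)%N) ->
  \sum_S \sum_T (if pr #|S :&: T| #|S :\: T| #|T :\: S| then F S T else 0)
  = \sum_(g < n.+1) \sum_(u < n.+1) \sum_(v < n.+1)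
      (if pr g u v then \sum_(p | shaped g u v p) F p.1 p.2 else 0).
Proof.
move=> Fn; rewrite pair_big /=.
transitivity (\sum_(p : {set A} * {set A}) \sum_(g < n.+1) \sum_(u < n.+1)
    \sum_(v < n.+1) (if shaped g u v p && pr g u v then F p.1 p.2 else 0)).
  apply: eq_bigr => -[S T] _ /=.
  have [F0|/Fn[nS nT]] := eqVneq (F S T) 0.
    rewrite F0 if_same big1 // => g _; rewrite big1 // => u _; rewrite big1 // => v _.
    by rewrite if_same.
  have lt1 : (#|S :&: T| < n.+1)%N.
    by rewrite ltnS (leq_trans _ nS) // subset_leq_card ?subsetIl.
  have lt2 : (#|S :\: T| < n.+1)%N.
    by rewrite ltnS (leq_trans _ nS) // subset_leq_card ?subsetDl.
  have lt3 : (#|T :\: S| < n.+1)%N.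
    by rewrite ltnS (leq_trans _ nT) // subset_leq_card ?subsetDl.
  rewrite (bigD1 (Ordinal lt1)) //= [X in _ = _ + X]big1 ?addr0; last first.
    move=> g; rewrite -val_eqE /= eq_sym => /negbTE gS; apply: big1 => u _.
    by apply: big1 => v _; rewrite /shaped /= gS.
  rewrite (bigD1 (Ordinal lt2)) //= [X in _ = _ + X]big1 ?addr0; last first.
    move=> g; rewrite -val_eqE /= eq_sym => /negbTE gS.
    by apply: big1 => v _; rewrite /shaped /= gS andbF.
  rewrite (bigD1 (Ordinal lt3)) //= [X in _ = _ + X]big1 ?addr0; last first.
    by move=> g; rewrite -val_eqE /= eq_sym => /negbTE gS; rewrite /shaped /= gS !andbF.
  by rewrite /shaped /= !eqxx.
rewrite exchange_big /=; apply: eq_bigr => g _.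
rewrite exchange_big /=; apply: eq_bigr => u _.
rewrite exchange_big /=; apply: eq_bigr => v _.
by case: ifP => prg; [rewrite [RHS]big_mkcond; apply: eq_bigr => p _; rewrite andbT
  | apply: big1 => p _; rewrite andbF].
Qed.

(** A pair of sets amounts to three disjoint sets, the common part G and the two differences U and
    V. They become the shared variables and the two groups of free variables of a contraction. *)
Lemma sum_shaped (F : {set A} -> {set A} -> R) g u v :
  \sum_(p | shaped g u v p) setprod w (p.1 :|: p.2) * F p.1 p.2
  = \sum_(G : {set A} | #|G| == g) \sum_(U : {set A} | (#|U| == u) && [disjoint U & G])
    \sum_(V : {set A} | (#|V| == v) && [disjoint V & U :|: G])
      setprod w G * (setprod w U * (setprod w V * F (G :|: U) (G :|: V))).
Proof.
pose P (t : {set A} * ({set A} * {set A})) := [&& #|t.1| == g,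
  (#|t.2.1| == u) && [disjoint t.2.1 & t.1] &
  (#|t.2.2| == v) && [disjoint t.2.2 & t.2.1 :|: t.1]].
under [RHS]eq_bigr => G _ do rewrite pair_big_dep.
rewrite pair_big_dep /= (eq_bigl P) //.
rewrite (reindex_onto (fun p : {set A} * {set A} => (p.1 :&: p.2, (p.1 :\: p.2, p.2 :\: p.1)))
  (fun t : {set A} * ({set A} * {set A}) => (t.1 :|: t.2.1, t.1 :|: t.2.2))) /=; last first.
  move=> [G [U V]] /and3P[/= _ /andP[_ dU] /andP[_ dV]].
  have [dVU dVG] := disjoint_setUP dV.
  have nU a : ~~ ((a \in U) && (a \in G)) by apply/andP => -[/(disjointFr dU) ->].
  have nVU a : ~~ ((a \in V) && (a \in U)) by apply/andP => -[/(disjointFr dVU) ->].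
  have nVG a : ~~ ((a \in V) && (a \in G)) by apply/andP => -[/(disjointFr dVG) ->].
  congr (_, (_, _)); apply/setP => a; rewrite !inE; move: (nU a) (nVU a) (nVG a);
  by case: (a \in U); case: (a \in V); case: (a \in G).
have e3 (S T : {set A}) : S :|: T = (S :&: T) :|: ((S :\: T) :|: (T :\: S)).
  by apply/setP => a; rewrite !inE; case: (a \in S); case: (a \in T).
have d1 (S T : {set A}) : [disjoint S :\: T & S :&: T].
  by rewrite -setI_eq0; apply/eqP/setP => a; rewrite !inE; case: (a \in S); case: (a \in T).
have d2 (S T : {set A}) : [disjoint T :\: S & (S :\: T) :|: (S :&: T)].
  by rewrite -setI_eq0; apply/eqP/setP => a; rewrite !inE; case: (a \in S); case: (a \in T).
have eS (S T : {set A}) : (S :&: T) :|: (S :\: T) = S by exact: setID.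
have eT (S T : {set A}) : (S :&: T) :|: (T :\: S) = T by rewrite setIC setID.
apply: eq_big => -[S T] /=.
  by rewrite /P /shaped /= d1 d2 !andbT eS eT eqxx andbT.
move=> _; rewrite eS eT {1}e3 setprodU; last first.
  rewrite disjoint_sym -setI_eq0 setIUl setU_eq0 !setI_eq0 d1 /=.
  by have [] := disjoint_setUP (d2 S T).
rewrite setprodU ?mulrA // disjoint_sym.
by have [] := disjoint_setUP (d2 S T).
Qed.

End Bounds.

(** * Sums over tuples with and without repetitions *)

Section TupleSums.
Variables (R : realFieldType).

Fixpoint tsum (A : finType) (w : A -> R) n (phi : seq A -> R) : R :=
  if n is n'.+1 then \sum_a w a * tsum w n' (fun s => phi (a :: s)) else phi [::].

(** The part of [tsum] off the diagonals: entries are distinct and avoid X, which records those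
    already chosen. Sums over sets are of this kind up to a factorial, whereas Fubini and
    Cauchy-Schwarz work with [tsum]. *)
Fixpoint gsum (A : finType) (w : A -> R) n (X : seq A) (phi : seq A -> R) : R :=
  if n is n'.+1
  then \sum_(a | a \notin X) w a * gsum w n' (a :: X) (fun s => phi (a :: s))
  else phi [::].

Section Basics.
Variables (A : finType) (w : A -> R).
Implicit Types (X s : seq A) (phi psi : seq A -> R).

Lemma eq_tsum n phi psi : (forall s, size s = n -> phi s = psi s) ->
  tsum w n phi = tsum w n psi.
Proof.
elim: n phi psi => [|n IH] phi psi e /=; first exact: e.
by apply: eq_bigr => a _; congr (_ * _); apply: IH => s sn; apply: e; rewrite /= sn.
Qed.

Lemma eq_gsum n X phi psi :
  (forall s, size s = n -> uniq s -> ~~ has [in X] s -> phi s = psi s) ->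
  gsum w n X phi = gsum w n X psi.
Proof.
elim: n X phi psi => [|n IH] X phi psi e /=; first exact: e.
apply: eq_bigr => a aX; congr (_ * _); apply: IH => s sn us sX.
have /norP[aS sX'] : ~~ ((a \in s) || has [in X] s).
  rewrite -has_pred1 -has_predU; apply: contra sX; apply: sub_has => b /=.
  by rewrite !inE => /orP[->|->]; rewrite ?orbT.
by apply: e; rewrite /= ?sn ?us ?aS ?andbT //= (negbTE aX).
Qed.

Lemma tsumD n phi psi :
  tsum w n (fun s => phi s + psi s) = tsum w n phi + tsum w n psi.
Proof.
elim: n phi psi => [|n IH] phi psi //=; rewrite -big_split /=.
by apply: eq_bigr => a _; rewrite IH mulrDr.
Qed.

Lemma tsumZ n c phi : tsum w n (fun s => c * phi s) = c * tsum w n phi.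
Proof.
elim: n phi => [|n IH] phi //=; rewrite mulr_sumr.
by apply: eq_bigr => a _; rewrite IH mulrCA.
Qed.

Lemma tsum_sum n (I : Type) (r : seq I) (P : pred I) (phi : I -> seq A -> R) :
  tsum w n (fun s => \sum_(i <- r | P i) phi i s) = \sum_(i <- r | P i) tsum w n (phi i).
Proof.
elim: n phi => [|n IH] phi //=; rewrite exchange_big /=.
by apply: eq_bigr => a _; rewrite IH mulr_sumr.
Qed.

Lemma tsum_tuple n phi : tsum w n phi = \sum_(t : n.-tuple A) (\prod_(a <- t) w a) * phi t.
Proof.
elim: n phi => [|n IH] phi /=.
  rewrite (bigD1 [tuple]) //= big_nil mul1r big1 ?addr0 // => t.
  by case/eqP; exact: tuple0.
rewrite (reindex (fun p : A * n.-tuple A => cons_tuple p.1 p.2)) /=; last first.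
  exists (fun t => (thead t, behead_tuple t)) => [[a t] _|t _] /=.
    by rewrite theadE; congr (_, _); apply: val_inj.
  by case/tupleP: t => a t; apply: val_inj; rewrite /= theadE.
rewrite -(pair_bigA _ (fun (a : A) (t : n.-tuple A) => (\prod_(b <- a :: t) w b) * phi (a :: t))) /=.
apply: eq_bigr => a _; rewrite IH mulr_sumr.
by apply: eq_bigr => t _; rewrite big_cons mulrA.
Qed.

Lemma tsum_cat n m phi : tsum w (n + m) phi = tsum w n (fun s => tsum w m (fun t => phi (s ++ t))).
Proof.
elim: n phi => [|n IH] phi //=.
by apply: eq_bigr => a _; rewrite IH.
Qed.

End Basics.

Lemma exchange_tsum (A B : finType) (w : A -> R) (v : B -> R) n m
    (phi : seq A -> seq B -> R) :
  tsum w n (fun s => tsum v m (phi s)) = tsum v m (fun t => tsum w n (phi^~ t)).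
Proof.
elim: n phi => [|n IH] phi //=.
under eq_bigr => a _ do rewrite IH -tsumZ.
by rewrite -tsum_sum.
Qed.

(** A function of the first components sees only the total weights of the fibres. For kernels
    constant on coarse cells this turns a sum over fine atoms into a sum over cells that no longer
    depends on the grid. *)
Lemma tsum_fst (A B : finType) (w : A * B -> R) n (phi : seq A -> R) :
  tsum w n (fun s => phi (map fst s)) = tsum (fun a => \sum_b w (a, b)) n phi.
Proof.
elim: n phi => [|n IH] phi //=.
transitivity (\sum_a \sum_b w (a, b) * tsum w n (fun s => phi (a :: map fst s))).
  by rewrite pair_bigA; apply: eq_bigr => -[a b].
by apply: eq_bigr => a _; rewrite -mulr_suml (IH (fun s => phi (a :: s))).
Qed.

Section Order.
Variables (A : finType) (w : A -> R).
Hypothesis w0 : forall a, 0 <= w a.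
Implicit Types (X s : seq A) (phi psi : seq A -> R).

Lemma ler_tsum n phi psi : (forall s, size s = n -> phi s <= psi s) ->
  tsum w n phi <= tsum w n psi.
Proof.
elim: n phi psi => [|n IH] phi psi e /=; first exact: e.
apply: ler_sum => a _; rewrite ler_wpM2l //; apply: IH => s sn.
by apply: e; rewrite /= sn.
Qed.

Lemma tsum_ge0 n phi : (forall s, size s = n -> 0 <= phi s) -> 0 <= tsum w n phi.
Proof.
move=> p0; apply: le_trans (ler_tsum p0).
by rewrite (@eq_tsum _ _ _ _ (fun s => 0 * 0)) ?tsumZ ?mul0r // => s _; rewrite mul0r.
Qed.

Lemma ler_gsum n X phi psi :
  (forall s, size s = n -> uniq s -> ~~ has [in X] s -> phi s <= psi s) ->
  gsum w n X phi <= gsum w n X psi.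
Proof.
elim: n X phi psi => [|n IH] X phi psi e /=; first exact: e.
apply: ler_sum => a aX; rewrite ler_wpM2l //; apply: IH => s sn us sX.
have /norP[aS sX'] : ~~ ((a \in s) || has [in X] s).
  rewrite -has_pred1 -has_predU; apply: contra sX; apply: sub_has => b /=.
  by rewrite !inE => /orP[->|->]; rewrite ?orbT.
by apply: e; rewrite /= ?sn ?us ?aS ?andbT //= (negbTE aX).
Qed.

Lemma gsum_le_tsum n X phi : (forall s, size s = n -> 0 <= phi s) ->
  gsum w n X phi <= tsum w n phi.
Proof.
elim: n X phi => [|n IH] X phi p0 //=.
rewrite [X in _ <= X](bigID (fun a => a \notin X)) /=.
apply: ler_wpDr.
  apply: sumr_ge0 => a _; rewrite mulr_ge0 // tsum_ge0 // => s sn.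
  by apply: p0; rewrite /= sn.
apply: ler_sum => a _; rewrite ler_wpM2l // IH // => s sn.
by apply: p0; rewrite /= sn.
Qed.

Lemma tsum_cst n c : tsum w n (fun=> c) = c * (\sum_a w a) ^+ n.
Proof.
elim: n => [|n IH] /=; first by rewrite expr0 mulr1.
by rewrite -mulr_suml IH exprS mulrCA.
Qed.

Variables (eps Tot K : R).
Hypothesis eps0 : 0 <= eps.
Hypothesis w_eps : forall a, w a <= eps.
Hypothesis w_tot : \sum_a w a <= Tot.
Hypothesis Tot1 : 1 <= Tot.
Hypothesis K0 : 0 <= K.

Lemma tsum_norm_le n phi : (forall s, size s = n -> `|phi s| <= K) ->
  `|tsum w n phi| <= K * Tot ^+ n.
Proof.
elim: n phi => [|n IH] phi pK /=; first by rewrite expr0 mulr1 pK.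
apply: le_trans (ler_norm_sum _ _ _) _.
apply: (@le_trans _ _ (\sum_a w a * (K * Tot ^+ n))).
  apply: ler_sum => a _; rewrite normrM (ger0_norm (w0 _)) ler_wpM2l //.
  by apply: IH => s sn; rewrite pK //= sn.
rewrite -mulr_suml [X in _ <= X](_ : _ = Tot * (K * Tot ^+ n)); last first.
  by rewrite exprS; ring.
by rewrite ler_wpM2r // mulr_ge0 // exprn_ge0 // (le_trans ler01).
Qed.

(** Two positions coincide, or a position falls in X, in at most n * (size X + n) ways, and forcing
    a coordinate to a given atom costs eps instead of Tot. The full power Tot ^+ n is affordable
    because 1 <= Tot. *)
Lemma gsum_near n X phi : (forall s, size s = n -> `|phi s| <= K) ->
  `|tsum w n phi - gsum w n X phi| <= K * eps * (n * (size X + n))%:R * Tot ^+ n.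
Proof.
have T0 : 0 <= Tot by rewrite (le_trans ler01).
elim: n X phi => [|n IH] X phi pK /=; first by rewrite subrr normr0 !mulr0 mul0r.
have pK' a s : size s = n -> `|phi (a :: s)| <= K by move=> sn; rewrite pK //= sn.
rewrite [X in `|X - _|](bigID (fun a => a \in X)) /= -addrA -sumrB.
apply: le_trans (ler_normD _ _) _.
have b1 : `|\sum_(a in X) w a * tsum w n (fun s => phi (a :: s))| <=
    K * eps * (size X)%:R * Tot ^+ n.+1.
  apply: le_trans (ler_norm_sum _ _ _) _.
  apply: (@le_trans _ _ (\sum_(a in X) eps * (K * Tot ^+ n))).
    apply: ler_sum => a _; rewrite normrM (ger0_norm (w0 _)).
    by rewrite ler_pM // tsum_norm_le // => s; apply: pK'.
  rewrite sumr_const -mulr_natr.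
  rewrite [X in X <= _](_ : _ = (K * eps * #|X|%:R) * Tot ^+ n); last by ring.
  rewrite ler_pM ?mulr_ge0 ?exprn_ge0 //; last by rewrite exprS ler_peMl ?exprn_ge0.
  by rewrite mul1r ler_wpM2l ?mulr_ge0 // ler_nat card_size.
have b2 : `|\sum_(a | a \notin X) (w a * tsum w n (fun s => phi (a :: s)) -
     w a * gsum w n (a :: X) (fun s => phi (a :: s)))| <=
   K * eps * (n * (size X + n.+1))%:R * Tot ^+ n.+1.
  apply: le_trans (ler_norm_sum _ _ _) _.
  apply: (@le_trans _ _ (\sum_a w a * (K * eps * (n * (size X + n.+1))%:R * Tot ^+ n))).
    rewrite [X in X <= _]big_mkcond; apply: ler_sum => a _; case: ifP => _.
      rewrite -mulrBr normrM (ger0_norm (w0 _)) ler_wpM2l //.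
      apply: le_trans (IH _ _ (pK' a)) _.
      by rewrite /= addSnnS.
    by rewrite !mulr_ge0 ?exprn_ge0 ?ler0n.
  rewrite -mulr_suml exprS [X in _ <= X]mulrCA ler_wpM2r //.
  by rewrite !mulr_ge0 ?exprn_ge0 ?ler0n.
apply: le_trans (lerD b1 b2) _.
rewrite -mulrDl -mulrDr ler_wpM2r ?exprn_ge0 // ler_wpM2l ?mulr_ge0 //.
by rewrite -natrD ler_nat mulSn leq_add2r leq_addr.
Qed.

End Order.

Section SetTuple.
Variables (A : finType) (w : A -> R).
Implicit Types (X s : seq A) (M : {set A}).

(** A set of l elements has l! enumerations; the induction removes one element at a time, which is
    what [sum_card_points] counts. *)
Lemma gsum_set l X (psi : {set A} -> R) :
  (\sum_(M : {set A} | (#|M| == l) && [disjoint M & X]) setprod w M * psi M) *+ l`!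
  = gsum w l X (fun s => psi [set a in s]).
Proof.
elim: l X psi => [|l IH] X psi /=.
  rewrite mulr1n (bigD1 set0) /= ?cards0 ?eqxx ?disjoints0 //; last first.
    by rewrite disjoint_subset; apply/subsetP => a; rewrite inE.
  rewrite setprod0 mul1r big1 ?addr0; last first.
    by move=> M /andP[/andP[/eqP/cards0_eq -> _]]; rewrite eqxx.
  by congr psi; apply/setP => a; rewrite !inE.
rewrite factS mulrnA -sumrMnl.
rewrite (eq_bigr (fun M : {set A} => (setprod w M * psi M) *+ #|M|)); last first.
  by move=> M /andP[/eqP -> _].
rewrite sum_card_points -sumrMnl [RHS]big_mkcond; apply: eq_bigr => a _ /=.
case: ifPn => aX; last first.
  rewrite big1 ?mul0rn // => M /and3P[_ _]; rewrite disjoint_subset.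
  by move/subsetP/(_ a); rewrite !inE eqxx => /(_ isT); rewrite (negbNE aX).
have eS s : psi [set b in a :: s] = psi (a |: [set b in s]) by rewrite set_cons.
have -> : gsum w l (a :: X) (fun s => psi [set b in a :: s])
    = gsum w l (a :: X) (fun s => psi (a |: [set b in s])) by exact: eq_gsum.
rewrite -(IH (a :: X) (fun M => psi (a |: M))) mulrnAr mulr_sumr; congr (_ *+ _).
apply: eq_big => [M|M /and3P[aM _ _]]; last first.
  by rewrite setprodU ?disjoints1 // setprod1 mulrA.
rewrite cardsU1; case aM : (a \in M) => /=.
  rewrite andbC disjoint_sym; apply/esym/negP => /andP[dM _]; move: dM.
  by rewrite disjoint_cons aM.
rewrite add1n eqSS; congr (_ && _).
rewrite (disjoint_sym (mem M)) disjoint_cons aM /=.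
have -> : [disjoint a |: M & X] = [disjoint [predU1 a & M] & X].
  by apply: eq_disjoint => b; rewrite !inE.
by rewrite disjointU1 aX /= disjoint_sym.
Qed.

Hypothesis w0 : forall a, 0 <= w a.

Lemma sum_card_le_gsum l X (psi : {set A} -> R) : (forall M, 0 <= psi M) ->
  \sum_(M : {set A} | (#|M| == l) && [disjoint M & X]) setprod w M * psi M
  <= gsum w l X (fun s => psi [set a in s]).
Proof.
move=> p0; rewrite -gsum_set -[X in X <= _]mulr1n.
have : 0 <= \sum_(M : {set A} | (#|M| == l) && [disjoint M & X]) setprod w M * psi M.
  by apply: sumr_ge0 => M _; rewrite mulr_ge0 // prodr_ge0.
move=> s0; rewrite -[X in _ <= X]mulr_natr -[X in X <= _]mulr1 mulr1n.
by rewrite ler_wpM2l // ler1n fact_gt0.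
Qed.

Variables (f : seq A -> R).
Hypothesis f_perm : forall s s', perm_eq s s' -> f s = f s'.

Lemma perm_enum_set s : uniq s -> f (enum [set a in s]) = f s.
Proof.
move=> us; apply: f_perm; apply: uniq_perm => //; first exact: enum_uniq.
by move=> a; rewrite mem_enum inE.
Qed.

(** The sums over the sets G, U, V and M are tuple sums divided by factorials. Dropping these
    divisions only increases the value, as everything outside the layer is nonnegative and the layer
    enters squared. The lists stay disjoint, so their concatenations are duplicate free and f can be
    evaluated through sets. *)
Lemma shaped_le_gsum l g u v :
  \sum_(p | shaped g u v p) setprod w (p.1 :|: p.2) *
     layer w (fun S => f (enum S)) l p.1 p.2 ^+ 2
  <= gsum w g [::] (fun a => gsum w u a (fun b => gsum w v (b ++ a) (fun c =>
       gsum w l (c ++ b ++ a) (fun m => f (m ++ a ++ b) * f (m ++ a ++ c)) ^+ 2))).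
Proof.
pose F S T := layer w (fun S => f (enum S)) l S T ^+ 2.
have F0 S T : 0 <= F S T by exact: sqr_ge0.
rewrite (sum_shaped w (fun S T => F S T)).
pose F3 (G U V : {set A}) := F (G :|: U) (G :|: V).
pose F2 (G U : {set A}) := \sum_(V : {set A} | (#|V| == v) && [disjoint V & U :|: G])
  setprod w V * F3 G U V.
pose F1 (G : {set A}) := \sum_(U : {set A} | (#|U| == u) && [disjoint U & G])
  setprod w U * F2 G U.
have sp0 (S : {set A}) : 0 <= setprod w S by exact: prodr_ge0.
have F20 G U : 0 <= F2 G U by apply: sumr_ge0 => V _; rewrite mulr_ge0 // F0.
have F10 G : 0 <= F1 G by apply: sumr_ge0 => V _; rewrite mulr_ge0 // F0.
have -> : \sum_(G : {set A} | #|G| == g)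
    \sum_(U : {set A} | (#|U| == u) && [disjoint U & G])
    \sum_(V : {set A} | (#|V| == v) && [disjoint V & U :|: G])
      setprod w G * (setprod w U * (setprod w V * F (G :|: U) (G :|: V)))
  = \sum_(G : {set A} | (#|G| == g) && [disjoint G & [::]]) setprod w G * F1 G.
  apply: eq_big => [G|G _].
    rewrite disjoint_sym (_ : [disjoint [::] & G] = true) ?andbT //.
    by rewrite disjoint_subset; apply/subsetP.
  rewrite /F1 mulr_sumr; apply: eq_bigr => U _.
  by rewrite /F2 !mulr_sumr.
apply: le_trans (sum_card_le_gsum _ _ F10) _; apply: ler_gsum => // a sa ua _.
rewrite /F1 (eq_bigl (fun U : {set A} => (#|U| == u) && [disjoint U & a])); last first.
  by move=> U; congr (_ && _); apply: eq_disjoint_r => x; rewrite !inE.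
apply: le_trans (sum_card_le_gsum _ _ (F20 _)) _; apply: ler_gsum => // b sb ub ab.
rewrite /F2 (eq_bigl (fun V : {set A} => (#|V| == v) && [disjoint V & b ++ a])); last first.
  by move=> U; congr (_ && _); apply: eq_disjoint_r => x; rewrite !inE mem_cat.
apply: le_trans (sum_card_le_gsum _ _ (fun V => F0 _ _)) _; apply: ler_gsum => // c sc uc abc.
rewrite /F3 /F.
have -> : gsum w l (c ++ b ++ a) (fun m => f (m ++ a ++ b) * f (m ++ a ++ c))
  = layer w (fun S => f (enum S)) l ([set x in a] :|: [set x in b])
      ([set x in a] :|: [set x in c]) *+ l`!.
  rewrite /layer (eq_bigl (fun M : {set A} => (#|M| == l) && [disjoint M & c ++ b ++ a])); last first.
    move=> M; rewrite andbC; congr (_ && _); apply: eq_disjoint_r => x.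
    by rewrite !inE !mem_cat; case: (x \in a); case: (x \in b); case: (x \in c).
  under eq_bigr => M _ do rewrite -mulrA.
  rewrite gsum_set; apply: eq_gsum => m sm um mabc.
  have setU3 (x y z : seq A) : [set i in x] :|: ([set i in y] :|: [set i in z]) = [set i in x ++ y ++ z].
    by apply/setP => i; rewrite !inE !mem_cat.
  have U : uniq (m ++ c ++ b ++ a).
    rewrite cat_uniq um (has_sym m) mabc /= cat_uniq uc (has_sym c) abc /=.
    by rewrite cat_uniq ub (has_sym b) ab.
  have Ub : uniq (m ++ a ++ b).
    move: U; rewrite (perm_uniq (_ : perm_eq _ (c ++ (m ++ a ++ b)))).
      by rewrite cat_uniq => /and3P[].
    by apply/permP => x; rewrite !count_cat; lia.
  have Uc : uniq (m ++ a ++ c).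
    move: U; rewrite (perm_uniq (_ : perm_eq _ (b ++ (m ++ a ++ c)))).
      by rewrite cat_uniq => /and3P[].
    by apply/permP => x; rewrite !count_cat; lia.
  by rewrite !setU3 !perm_enum_set.
rewrite -[X in X <= _]mulr1 -mulr_natr exprMn ler_wpM2l ?sqr_ge0 //.
by rewrite -natrX ler1n expn_gt0 fact_gt0.
Qed.

End SetTuple.

End TupleSums.

(** * Gram kernels and Cauchy-Schwarz for contractions *)

Section Gram.
Variables (R : realFieldType) (A : finType) (W : A -> R).
Hypothesis W0 : forall a, 0 <= W a.

Lemma tsumM l l' (phi psi : seq A -> R) :
  tsum W l phi * tsum W l' psi = tsum W l (fun m => tsum W l' (fun m' => phi m * psi m')).
Proof.
rewrite mulrC -tsumZ; apply: eq_tsum => s _.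
by rewrite mulrC -tsumZ.
Qed.

(** The square is a double sum over m and m'; exchanging the sums leaves the scalar product of the
    Gram kernels of F and of G. *)
Lemma gram_swap l u v (F G : seq A -> seq A -> R) :
  tsum W u (fun b => tsum W v (fun c => tsum W l (fun m => F m b * G m c) ^+ 2))
  = tsum W l (fun m => tsum W l (fun m' =>
      tsum W u (fun b => F m b * F m' b) * tsum W v (fun c => G m c * G m' c))).
Proof.
transitivity (tsum W u (fun b => tsum W v (fun c => tsum W l (fun m => tsum W l (fun m' =>
    (F m b * F m' b) * (G m c * G m' c)))))).
  apply: eq_tsum => b _; apply: eq_tsum => c _; rewrite expr2 tsumM.
  by apply: eq_tsum => m _; apply: eq_tsum => m' _; rewrite mulrACA.
transitivity (tsum W u (fun b => tsum W l (fun m => tsum W l (fun m' => tsum W v (fun c =>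
    (F m b * F m' b) * (G m c * G m' c)))))).
  apply: eq_tsum => b _; rewrite exchange_tsum; apply: eq_tsum => m _.
  by rewrite exchange_tsum.
rewrite exchange_tsum; apply: eq_tsum => m _.
rewrite exchange_tsum; apply: eq_tsum => m' _.
by rewrite tsumM; apply: eq_tsum => b _.
Qed.

(** By [gram_swap] all three terms are integrals over (m, m') of products of the Gram kernels x and
    y, and 2 x y <= x^2 + y^2. *)
Lemma gram_cauchy l u v (F G : seq A -> seq A -> R) :
  2 * tsum W u (fun b => tsum W v (fun c => tsum W l (fun m => F m b * G m c) ^+ 2))
  <= tsum W u (fun b => tsum W u (fun c => tsum W l (fun m => F m b * F m c) ^+ 2))
   + tsum W v (fun b => tsum W v (fun c => tsum W l (fun m => G m b * G m c) ^+ 2)).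
Proof.
rewrite (gram_swap l u v F G) (gram_swap l u u F F) (gram_swap l v v G G).
rewrite -tsumZ -tsumD; apply: ler_tsum => // m _.
rewrite -tsumZ -tsumD; apply: ler_tsum => // m' _.
set x := tsum W u _; set y := tsum W v _.
by have := sqr_ge0 (x - y); rewrite -!expr2; lra.
Qed.

(* For v = u, the discrete [||f star_(l+g)^l f||^2] with f symmetric. *)
Definition gram4 (f : seq A -> R) l g u v : R :=
  tsum W g (fun a => tsum W u (fun b => tsum W v (fun c =>
    tsum W l (fun m => f (m ++ a ++ b) * f (m ++ a ++ c)) ^+ 2))).

Lemma gram4_cauchy f l g u v :
  2 * gram4 f l g u v <= gram4 f l g u u + gram4 f l g v v.
Proof.
rewrite /gram4 -tsumZ -tsumD; apply: ler_tsum => // a _.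
exact: (gram_cauchy l u v (fun m b => f (m ++ a ++ b)) (fun m b => f (m ++ a ++ b))).
Qed.

Lemma gram4_sym f l g u v : gram4 f l g u v = gram4 f l g v u.
Proof.
apply: eq_tsum => a _; rewrite exchange_tsum.
apply: eq_tsum => c _; apply: eq_tsum => b _; congr (_ ^+ 2).
by apply: eq_tsum => m _; rewrite mulrC.
Qed.

(** This is ||f star_g^0 f|| = ||f star_(u+g)^u f||, both being the L^2 norm of the integral of f^2
    over u variables. Contractions without integration are traded for contractions that integrate u
    variables, which for u > 0 are those listed in [max1]. *)
Lemma gram4_swap f g u : (forall s s', perm_eq s s' -> f s = f s') ->
  gram4 f 0 g u u = gram4 f u g 0 0.
Proof.
move=> fp; apply: eq_tsum => a _.
rewrite (gram_swap 0 u u (fun m b => f (m ++ a ++ b)) (fun m b => f (m ++ a ++ b))) /=.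
rewrite -expr2; congr (_ ^+ 2); apply: eq_tsum => m _; rewrite !cats0.
by congr (_ * _); apply: fp; rewrite perm_catC.
Qed.

End Gram.

(** * Kernels constant on coarse cells, evaluated on fine atoms *)

Section TwoScales.
Variables (R : realFieldType) (C : finType) (N : nat) (w : C * 'I_N -> R) (n : nat).
Variables (f : seq C -> R) (K eps Tot : R).
Let W c := \sum_b w (c, b).
Hypothesis w0 : forall a, 0 <= w a.
Hypothesis eps0 : 0 <= eps.
Hypothesis w_eps : forall a, w a <= eps.
Hypothesis w_tot : \sum_a w a <= Tot.
Hypothesis Tot1 : 1 <= Tot.
Hypothesis K0 : 0 <= K.
Hypothesis fK : forall s, `|f s| <= K.
Hypothesis f_perm : forall s s', perm_eq s s' -> f s = f s'.
Hypothesis f_size : forall s, f s != 0 -> (size s <= n)%N.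

Definition lift_kernel (S : {set C * 'I_N}) : R := f (map fst (enum S)).
Local Notation h := lift_kernel.

Let W0 c : 0 <= W c. Proof. by apply: sumr_ge0. Qed.

Lemma lift_kernel_neq0 S : h S != 0 -> (#|S| <= n)%N.
Proof. by move=> /f_size; rewrite size_map -cardE. Qed.

(* The price for replacing sums over distinct atoms by sums over all tuples. *)
Definition scale_error : R :=
  (K ^+ 2 * eps * (n * (n + n + n + n))%:R * Tot ^+ n) ^+ 2 * Tot ^+ (n + n + n).

Lemma scale_error_ge0 : 0 <= scale_error.
Proof. by rewrite mulr_ge0 ?sqr_ge0 // exprn_ge0 // (le_trans ler01). Qed.

(** The factors 2 come from s^2 <= 2 T^2 + 2 (T - s)^2, where s sums over distinct atoms and T over
    all tuples. The main term lives on the coarse scale by [tsum_fst]; only [scale_error] sees the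
    mesh eps. *)
Lemma shaped_le_gram4 l g u v : (l <= n)%N -> (g <= n)%N -> (u <= n)%N -> (v <= n)%N ->
  \sum_(p | shaped g u v p) setprod w (p.1 :|: p.2) * layer w h l p.1 p.2 ^+ 2
  <= 2 * gram4 W f l g u v + 2 * scale_error.
Proof.
move=> ln gn un vn; pose f' (s : seq (C * 'I_N)) := f (map fst s).
have f'_perm s s' : perm_eq s s' -> f' s = f' s'.
  by move=> ss'; apply: f_perm; apply: perm_map.
have T0 : 0 <= Tot by rewrite (le_trans ler01).
apply: le_trans (shaped_le_gsum w0 f'_perm l g u v) _.
pose e := K ^+ 2 * eps * (n * (n + n + n + n))%:R * Tot ^+ n.
pose T a b c := tsum w l (fun m => f' (m ++ a ++ b) * f' (m ++ a ++ c)).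
have near a b c : size a = g -> size b = u -> size c = v ->
    gsum w l (c ++ b ++ a) (fun m => f' (m ++ a ++ b) * f' (m ++ a ++ c)) ^+ 2
    <= 2 * T a b c ^+ 2 + 2 * e ^+ 2.
  move=> sa sb sc.
  have phiK m : size m = l -> `|f' (m ++ a ++ b) * f' (m ++ a ++ c)| <= K ^+ 2.
    by move=> _; rewrite normrM expr2 ler_pM // fK.
  have := gsum_near w0 eps0 w_eps w_tot Tot1 (sqr_ge0 K) (c ++ b ++ a) phiK.
  rewrite -/(T a b c); set s := gsum _ _ _ _ => near.
  have {}near : `|T a b c - s| <= e.
    apply: le_trans near _; rewrite /e !size_cat sa sb sc.
    rewrite ler_pM ?exprn_ge0 ?mulr_ge0 ?sqr_ge0 ?ler0n //.
      rewrite ler_wpM2l ?mulr_ge0 ?sqr_ge0 // ler_nat leq_mul //.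
      by rewrite -!addnA !leq_add.
    by rewrite ler_weXn2l.
  have e0 : 0 <= e by apply: le_trans near.
  have : (T a b c - s) ^+ 2 <= e ^+ 2.
    by rewrite -[X in X <= _]ger0_norm ?sqr_ge0 // normrX ler_pXn2r ?nnegrE.
  have := sqr_ge0 (2 * T a b c - s); nra.
apply: (@le_trans _ _ (gsum w g [::] (fun a => gsum w u a (fun b => gsum w v (b ++ a)
    (fun c => 2 * T a b c ^+ 2 + 2 * e ^+ 2))))).
  by do 3![apply: ler_gsum => // ? ? _ _]; exact: near.
have pos a b c : 0 <= 2 * T a b c ^+ 2 + 2 * e ^+ 2.
  by rewrite addr_ge0 // mulr_ge0 ?sqr_ge0.
apply: (@le_trans _ _ (tsum w g (fun a => tsum w u (fun b => tsum w v
    (fun c => 2 * T a b c ^+ 2 + 2 * e ^+ 2))))).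
  apply: le_trans (ler_gsum w0 _) (gsum_le_tsum w0 _ _); last first.
    by move=> a _; do 2![apply: tsum_ge0 => // ? _].
  move=> a _ _ _; apply: le_trans (ler_gsum w0 _) (gsum_le_tsum w0 _ _); last first.
    by move=> b _; apply: tsum_ge0.
  by move=> b _ _ _; apply: gsum_le_tsum.
have -> : tsum w g (fun a => tsum w u (fun b => tsum w v
    (fun c => 2 * T a b c ^+ 2 + 2 * e ^+ 2)))
  = 2 * gram4 W f l g u v + 2 * e ^+ 2 * (\sum_a w a) ^+ (g + (u + v)).
  rewrite -(tsum_cst w) tsum_cat -tsumZ.
  transitivity (tsum w g (fun a => 2 * tsum W u (fun b => tsum W v (fun c =>
      tsum W l (fun m => f (m ++ map fst a ++ b) * f (m ++ map fst a ++ c)) ^+ 2))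
    + tsum w (u + v) (fun=> 2 * e ^+ 2))); last first.
    rewrite tsumD; congr (_ + _).
    by rewrite (tsum_fst w g (fun a => 2 * tsum W u (fun b => tsum W v (fun c =>
      tsum W l (fun m => f (m ++ a ++ b) * f (m ++ a ++ c)) ^+ 2)))).
  apply: eq_tsum => a _; rewrite tsum_cat -tsumZ.
  rewrite -(tsum_fst w u (fun b => 2 * tsum W v (fun c =>
      tsum W l (fun m => f (m ++ map fst a ++ b) * f (m ++ map fst a ++ c)) ^+ 2))).
  rewrite -tsumD; apply: eq_tsum => b _; rewrite -tsumZ.
  rewrite -(tsum_fst w v (fun c => 2 *
      tsum W l (fun m => f (m ++ map fst a ++ map fst b) * f (m ++ map fst a ++ c)) ^+ 2)).
  rewrite -tsumD; apply: eq_tsum => c _; congr (2 * _ ^+ 2 + _).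
  rewrite -(tsum_fst w l (fun m => f (m ++ map fst a ++ map fst b) * f (m ++ map fst a ++ map fst c))).
  by apply: eq_tsum => m _; rewrite /f' !map_cat.
rewrite lerD2l -mulrA ler_wpM2l // /scale_error -/e ler_wpM2l ?sqr_ge0 //.
apply: (@le_trans _ _ (Tot ^+ (g + (u + v)))).
  by apply: lerXn2r; rewrite ?nnegrE // sumr_ge0.
by rewrite ler_weXn2l // addnA !leq_add.
Qed.

Variables (kap : C * 'I_N -> R) (M : R).
Hypothesis kap2 : forall a, `|kap a| <= 2.
Hypothesis M0 : 0 <= M.
Hypothesis gramM : forall l g u, (0 < l)%N -> (0 < g + u)%N -> (l + g + u <= n)%N ->
  gram4 W f l g u u <= M.

(** There are at most (n + 1)^3 shapes (g, u, v), each bounded by [shaped_le_gram4]. A shape with l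
    + g + u or l + g + v above n contributes nothing, since the kernel vanishes on lists longer than
    n. *)
Let layer_sum_le l (pr : nat -> nat -> nat -> bool) : (l <= n)%N ->
  (forall g u v, pr g u v -> (l + g + u <= n)%N -> (l + g + v <= n)%N ->
     gram4 W f l g u v <= M) ->
  \sum_S \sum_T (if pr #|S :&: T| #|S :\: T| #|T :\: S|
    then setprod w (S :|: T) * layer w h l S T ^+ 2 else 0)
  <= (n.+1 ^ 3)%:R * (2 * M + 2 * scale_error).
Proof.
move=> ln prM; pose F S T := setprod w (S :|: T) * layer w h l S T ^+ 2.
have pos : 0 <= 2 * M + 2 * scale_error.
  by rewrite addr_ge0 // mulr_ge0 ?scale_error_ge0.
have Fn (S T : {set C * 'I_N}) : F S T != 0 -> (l + #|S| <= n)%N /\ (l + #|T| <= n)%N.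
  move=> F0; apply: (@layer_neq0 _ _ w n h lift_kernel_neq0); apply: contraNneq F0 => e.
  by rewrite /F e expr0n mulr0.
rewrite (@sum_by_shape _ _ n F pr); last first.
  by move=> S T /Fn[nS nT]; split; [apply: leq_trans nS | apply: leq_trans nT]; rewrite leq_addl.
have cst3 (x : R) : (n.+1 ^ 3)%:R * x = \sum_(g < n.+1) \sum_(u < n.+1) \sum_(v < n.+1) x.
  by rewrite !sumr_const !card_ord -!mulrnA mulr_natl; congr (_ *+ _); rewrite !expnS; lia.
rewrite cst3; apply: ler_sum => g _; apply: ler_sum => u _; apply: ler_sum => v _.
case: ifPn => // prguv.
have [/andP[lu lv]|no] := boolP ((l + g + u <= n)%N && (l + g + v <= n)%N).
  apply: le_trans (shaped_le_gram4 ln (leq_ord g) (leq_ord u) (leq_ord v)) _.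
  by rewrite lerD2r ler_wpM2l // prM.
rewrite big1 // => p /and3P[/eqP pg /eqP pu /eqP pv].
apply/eqP; rewrite -/(F _ _); apply: contraNT no => /Fn.
by rewrite -(cardsID p.2 p.1) -(cardsID p.1 p.2) [p.2 :&: _]setIC pg pu pv !addnA => -[-> ->].
Qed.

Hypothesis thetaM : forall l v, (0 < l)%N -> (0 < v)%N -> (l + v <= n)%N ->
  gram4 W f l 0 0 v <= M.

(** [gram4_cauchy] reduces to u = v unless g and one of u, v vanish: it would then bring in
    [gram4 W f l 0 0 0], the fourth power of an L^2 norm. In this case [thetaM] takes over. *)
Lemma gram4M l g u v : (0 < l)%N -> (0 < g + u + v)%N -> (l + g + u <= n)%N ->
  (l + g + v <= n)%N -> gram4 W f l g u v <= M.
Proof.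
move=> l0 guv lu lv; have [gu|] := ltnP 0 (g + u); last first.
  rewrite leqn0 addn_eq0 => /andP[/eqP g0 /eqP u0].
  by rewrite g0 u0; apply: thetaM; lia.
have [gv|] := ltnP 0 (g + v); last first.
  rewrite leqn0 addn_eq0 => /andP[/eqP g0 /eqP v0].
  by rewrite g0 v0 gram4_sym; apply: thetaM; lia.
have := gram4_cauchy W0 f l g u v.
by have := gramM l0 gu lu; have := gramM l0 gv lv; lra.
Qed.

(** Kernels of F and of - L^-1 F: dividing m! by m gives (m - 1)!. At m = 0 the truncated
    predecessor gives 0! = 1. *)
Let a (S : {set C * 'I_N}) := #|S|`!%:R * h S.
Let a' (S : {set C * 'I_N}) := #|S|.-1`!%:R * h S.
Let Q (S T : {set C * 'I_N}) := if S :|: T != set0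
  then \sum_b w b * set_contract w (dkern a b) (dkern a' b) S T else 0.

(** The power of 64 comes from [collect_energy], and n * n! * n! bounds the coefficients in
    [layers_sqr_le] with e l = l. The single n + 1 is its Cauchy-Schwarz factor, (n + 1) * (n + 1)^3
    counts the layers and shapes summed at the end, and 2 is that of [shaped_le_gram4]. *)
Definition fluctuation_const : R :=
  (64 ^ n)%:R * (n.+1%:R * ((n * n`! * n`!)%:R) ^+ 2) * (n.+1 * n.+1 ^ 3)%:R * 2.

(** The weight #|M| of [sum_contract_dkern] kills the layer l = 0, so every remaining contraction
    integrates at least one variable; leaving out the pair of empty sets removes the mean. What is
    left are the shapes covered by [gram4M]. *)
Lemma fluctuation_energy :
  energy w (collect kap Q) <= fluctuation_const * (M + scale_error).
Proof.
pose Q1 (S T : {set C * 'I_N}) := \sum_b w b * set_contract w (dkern a b) (dkern a' b) S T.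
pose B : R := (n * n`! * n`!)%:R.
have Q1E (S T : {set C * 'I_N}) : Q1 S T = \sum_(M : {set C * 'I_N} | [disjoint M & S :|: T])
     #|M|%:R * (setprod w M * (#|M :|: S|`!%:R * h (M :|: S)) *
               (#|M :|: T|.-1`!%:R * h (M :|: T))).
  by rewrite /Q1 sum_contract_dkern; apply: eq_bigr => X _; rewrite -mulr_natl.
have eB (l s t : nat) : (l + s <= n)%N -> (l + t <= n)%N ->
    `|l%:R * (l + s)`!%:R * (l + t).-1`!%:R| <= B :> R.
  move=> ls lt; rewrite -!natrM normr_nat ler_nat !leq_mul //.
  - exact: leq_trans (leq_addr _ _) ls.
  - by rewrite leq_fact.
  - by rewrite leq_fact // (leq_trans (leq_pred _)).
have := @contract_energy _ _ w kap n w0 kap2 h lift_kernel_neq0 B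
  (fun l => l%:R) (fun m => m`!%:R) (fun m => m.-1`!%:R) (ler0n _ _) eB Q1 Q1E
  (fun S T => S :|: T != set0).
move/le_trans; apply.
rewrite /fluctuation_const -/B -!mulrA; do 4!rewrite ler_wpM2l ?ler0n //.
rewrite natrM -mulrA.
have -> : n.+1%:R * ((n.+1 ^ 3)%:R * (2 * (M + scale_error)))
   = \sum_(l < n.+1) (n.+1 ^ 3)%:R * (2 * M + 2 * scale_error).
  by rewrite sumr_const card_ord -(mulrDr 2 M) mulr_natl.
have pos : 0 <= (n.+1 ^ 3)%:R * (2 * M + 2 * scale_error).
  by rewrite mulr_ge0 ?ler0n // addr_ge0 // mulr_ge0 ?scale_error_ge0.
rewrite big_mkcond; apply: ler_sum => l _; case: ifPn => // l0.
have {}l0 : (0 < l)%N by rewrite lt0n; apply: contraNneq l0 => ->.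
have := @layer_sum_le l (fun g u v => (0 < g + u + v)%N) _ _.
rewrite (_ : \sum_S _ = \sum_(S : {set C * 'I_N}) \sum_(T : {set C * 'I_N})
   (if S :|: T != set0 then setprod w (S :|: T) * layer w h l S T ^+ 2 else 0)).
  apply; first by rewrite -ltnS ltn_ord.
  by move=> g u v; apply: gram4M.
apply: eq_bigr => S _; apply: eq_bigr => T _; congr (if _ then _ else _).
rewrite -card_gt0 (_ : #|S :|: T| = (#|S :&: T| + #|S :\: T| + #|T :\: S|)%N) //.
have := cardsUI S T; have := cardsID T S; have := cardsID S T.
by rewrite [T :&: S]setIC; lia.
Qed.

Hypothesis gram0M : forall g, (0 < g <= n)%N -> gram4 W f 0 g 0 0 <= M.

Definition fourth_const : R :=
  (64 ^ n)%:R * (n.+1%:R * (n`!%:R * n`!%:R) ^+ 2) * n%:R * (n.+1 * n.+1 ^ 3)%:R * 2.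

(** Here l = 0 does occur, but with g > 0. For l = 0, [gram4_swap] makes the free variables
    integrated ones; only the shape (0, g, 0, 0), a discrete integral of f^4, is out of its reach
    and is left to [gram0M]. *)
Lemma derivative_fourth (c : nat -> R) (k : {set C * 'I_N} -> R) : (forall m, (m <= n)%N -> `|c m| <= n`!%:R) ->
  (forall S, k S = c #|S| * h S) ->
  \sum_b w b * energy w (collect kap (set_contract w (dkern k b) (dkern k b)))
  <= fourth_const * (M + scale_error).
Proof.
move=> cB kE.
apply: le_trans (@derivative_energy _ _ w kap n w0 kap2 h lift_kernel_neq0 _ c k (ler0n _ _) cB kE) _.
rewrite /fourth_const -!mulrA; do 4!rewrite ler_wpM2l ?ler0n //.
do 3!rewrite ler_wpM2l ?ler0n //.
rewrite natrM -mulrA.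
have -> : n.+1%:R * ((n.+1 ^ 3)%:R * (2 * (M + scale_error)))
   = \sum_(l < n.+1) (n.+1 ^ 3)%:R * (2 * M + 2 * scale_error).
  by rewrite sumr_const card_ord -(mulrDr 2 M) mulr_natl.
apply: ler_sum => l _.
have := @layer_sum_le l (fun g u v => (0 < g)%N) _ _.
rewrite (_ : \sum_S _ = \sum_(S : {set C * 'I_N}) \sum_(T : {set C * 'I_N})
   (if S :&: T != set0 then setprod w (S :|: T) * layer w h l S T ^+ 2 else 0)).
  apply; first by rewrite -ltnS ltn_ord.
  move=> g u v g0 lu lv.
  have diag x : (l + g + x <= n)%N -> gram4 W f l g x x <= M.
    have [l0|] := ltnP 0 l; first by move=> gx; apply: gramM => //; rewrite addn_gt0 g0.
    rewrite leqn0 => /eqP -> gx; rewrite gram4_swap //.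
    case: x gx => [|x] gx; last by apply: gramM => //; rewrite ?addn0 // addnC.
    by apply: gram0M; rewrite g0 -(add0n g) -[X in (X <= _)%N]addn0.
  by have := gram4_cauchy W0 f l g u v; have := diag _ lu; have := diag _ lv; lra.
apply: eq_bigr => S _; apply: eq_bigr => T _; congr (if _ then _ else _).
by rewrite card_gt0.
Qed.

End TwoScales.

(** * From symmetric functions on tuples to polynomials indexed by sets *)

Section SymmetricKernels.
Variables (R : realFieldType) (A : finType).
Implicit Types (w x : A -> R) (f : seq A -> R).

Lemma tsum_gsum w n X f :
  (forall s, size s = n -> ~~ (uniq s && ~~ has [in X] s) -> f s = 0) ->
  tsum w n f = gsum w n X f.
Proof.
elim: n X f => [//|n IH] X f f0 /=; rewrite [RHS]big_mkcond; apply: eq_bigr => a _.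
case: ifPn => [aX|/negbNE aX].
  congr (_ * _); apply: IH => s sn hs; apply: f0; rewrite /= ?sn //.
  apply: contra hs => /andP[/andP[as_ us]]; rewrite negb_or => /andP[_ hX]; rewrite us /=.
  apply/hasPn => c cs; rewrite inE negb_or; apply/andP; split.
    by apply: contraNneq as_ => <-.
  by move/hasPn: hX => /(_ c cs).
rewrite (@eq_tsum _ _ w n _ (fun=> 0)) => [|s sn]; last first.
  by apply: f0; rewrite /= ?sn // negb_and negbK aX orbT.
have -> : tsum w n (fun=> 0 : R) = 0.
  by elim: (n) => [//|k IHk] /=; rewrite big1 // => b _; rewrite IHk mulr0.
by rewrite mulr0.
Qed.

(** Membership in a product rectangle with sides r, false when the lengths differ. The relation m is
    a parameter so that the same rectangle can be tested on points, on coarse cells and on atoms. *)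
Fixpoint rect (I C : Type) (m : I -> C -> bool) (r : seq I) (s : seq C) : bool :=
  match r, s with
  | [::], [::] => true
  | i :: r', c :: s' => m i c && rect m r' s'
  | _, _ => false
  end.

Lemma rect_size (I C : Type) (m : I -> C -> bool) r s : rect m r s -> size r = size s.
Proof. by elim: r s => [|i r IH] [|c s] //= /andP[_ /IH ->]. Qed.

Lemma rect_map (I C D : Type) (m : I -> C -> bool) (h : D -> C) r s :
  rect m r (map h s) = rect (fun i => m i \o h) r s.
Proof. by elim: r s => [|i r IH] [|c s] //=; rewrite IH. Qed.

Lemma tsum_rect (I : Type) x (m : I -> A -> bool) r :
  tsum x (size r) (fun s => (rect m r s)%:R) = \prod_(i <- r) \sum_a x a * (m i a)%:R.
Proof.
elim: r => [|i r IH] /=; first by rewrite big_nil.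
rewrite big_cons -IH mulr_suml; apply: eq_bigr => a _.
by rewrite -mulrA; congr (_ * _); rewrite -tsumZ; apply: eq_tsum => s _; rewrite -natrM mulnb.
Qed.

Section OneKernel.
Variables (f : seq A -> R) (n : nat).
Hypothesis f_perm : forall s s', perm_eq s s' -> f s = f s'.
Hypothesis f_size : forall s, f s != 0 -> (size s <= n)%N.

(** The factorial counts the orderings of S: a sum over tuples with distinct entries visits each set
    #|S|! times. *)
Definition sym_kernel (S : {set A}) : R := #|S|`!%:R * f (enum S).

Lemma sym_kernel_neq0 S : sym_kernel S != 0 -> (#|S| <= n)%N.
Proof.
by rewrite /sym_kernel mulf_eq0 negb_or => /andP[_ /f_size]; rewrite -cardE.
Qed.

Lemma sum_by_card (F : {set A} -> R) : (forall S, F S != 0 -> (#|S| <= n)%N) ->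
  \sum_S F S = \sum_(m < n.+1) \sum_(S : {set A} | #|S| == m) F S.
Proof.
move=> Fn; under [RHS]eq_bigr => m _ do rewrite big_mkcond /=.
rewrite exchange_big /=; apply: eq_bigr => S _.
have [->|/Fn Sn] := eqVneq (F S) 0; first by rewrite big1 // => m _; case: ifP.
rewrite (bigD1 (Ordinal (Sn : #|S| < n.+1)%N)) //= eqxx big1 ?addr0 // => m mS.
by case: eqP => // Sm; move/eqP: mS; case; apply: val_inj.
Qed.

Lemma chaos_sym_kernel x : chaos x sym_kernel = \sum_(m < n.+1) gsum x m [::] f.
Proof.
rewrite /chaos sum_by_card; last first.
  by move=> S; rewrite mulf_eq0 negb_or => /andP[/sym_kernel_neq0].
apply: eq_bigr => m _.
rewrite (_ : gsum x m [::] f = gsum x m [::] (fun s => f (enum [set a in s]))); last first.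
  by apply: eq_gsum => s _ us _; rewrite perm_enum_set.
rewrite -(gsum_set x m [::] (fun S => f (enum S))) -sumrMnl; apply: eq_big => S.
  by rewrite [X in _ && X](_ : _ = true) ?andbT // disjoint_subset; apply/subsetP.
by move=> /eqP Sm; rewrite /sym_kernel Sm -[RHS]mulr_natl; ring.
Qed.

Lemma energy_sym_kernel w :
  energy w sym_kernel = \sum_(m < n.+1) m`!%:R * gsum w m [::] (fun s => f s ^+ 2).
Proof.
rewrite /energy sum_by_card; last first.
  by move=> S; rewrite mulf_eq0 negb_or => /andP[_]; rewrite expf_eq0 => /sym_kernel_neq0.
apply: eq_bigr => m _.
rewrite (_ : gsum w m [::] _ = gsum w m [::] (fun s => f (enum [set a in s]) ^+ 2)); last first.
  by apply: eq_gsum => s _ us _; rewrite perm_enum_set.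
rewrite -(gsum_set w m [::] (fun S => f (enum S) ^+ 2)) -[X in _ * X]mulr_natl mulr_sumr mulr_sumr.
apply: eq_big => S.
  by rewrite [X in _ && X](_ : _ = true) ?andbT // disjoint_subset; apply/subsetP.
by move=> /eqP Sm; rewrite /sym_kernel Sm; ring.
Qed.

(** Discrete form of D I_m(f) = m I_(m-1)(f(b, .)), the remaining variables avoiding b. The term m =
    0, where m.-1 is truncated, vanishes by its coefficient. *)
Lemma chaos_dkern_sym_kernel x b : chaos x (dkern sym_kernel b)
  = \sum_(m < n.+1) m%:R * gsum x m.-1 [:: b] (fun s => f (b :: s)).
Proof.
rewrite /chaos sum_by_card; last first.
  move=> S; rewrite mulf_eq0 negb_or /dkern => /andP[+ _].
  case: ifPn => [_|bS /sym_kernel_neq0]; first by rewrite eqxx.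
  by rewrite cardsU1 bS add1n => /ltnW.
rewrite [RHS]big_ord_recl mul0r add0r [LHS]big_ord_recr /= [X in _ + X]big1 ?addr0; last first.
  move=> S /eqP Sn; rewrite /dkern; case: ifPn => [_|bS]; first by rewrite mul0r.
  have [->|/sym_kernel_neq0] := eqVneq (sym_kernel (b |: S)) 0; first by rewrite mul0r.
  by rewrite cardsU1 bS add1n Sn ltnn.
apply: eq_bigr => m _; rewrite /= /bump /= add1n.
rewrite (_ : gsum x m _ _ = gsum x m [:: b] (fun s => f (b :: enum [set a in s]))); last first.
  apply: eq_gsum => s _ us _; apply: f_perm; rewrite perm_cons perm_sym.
  apply: uniq_perm => //; first exact: enum_uniq.
  by move=> a; rewrite mem_enum inE.
rewrite -(gsum_set x m [:: b] (fun S => f (b :: enum S))) -[X in _ * X]mulr_natl mulr_sumr mulr_sumr.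
have dE (S : {set A}) : [disjoint S & [:: b]] = (b \notin S).
  by rewrite disjoint_sym disjoint_cons disjoint_has /= andbT.
rewrite [RHS]big_mkcond [LHS]big_mkcond; apply: eq_bigr => S _ /=.
rewrite dE; case: eqP => //= Sm; rewrite /dkern; case: ifPn => [_|bS] /=; first by rewrite mul0r.
rewrite /sym_kernel cardsU1 bS add1n Sm factS natrM.
rewrite (@f_perm (enum (b |: S)) (b :: enum S)); first by ring.
apply: uniq_perm; rewrite /= ?enum_uniq ?mem_enum ?bS //.
by move=> a; rewrite mem_enum !inE mem_enum.
Qed.

Lemma sum_energy_dkern w k :
  \sum_b w b * energy w (dkern k b) = \sum_M (setprod w M * k M ^+ 2) *+ #|M|.
Proof.
transitivity (\sum_(M : {set A} | [disjoint M & set0 :|: set0])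
    (setprod w M * k (M :|: set0) * k (M :|: set0)) *+ #|M|).
  rewrite -sum_contract_dkern; apply: eq_bigr => b _; congr (_ * _); rewrite /energy /set_contract.
  apply: eq_big => L; first by rewrite setU0 -setI_eq0 setI0 eqxx.
  by move=> _; rewrite !setU0 expr2 mulrA.
apply: eq_big => M; first by rewrite setU0 -setI_eq0 setI0 eqxx.
by move=> _; rewrite !setU0 -mulrA -expr2.
Qed.

Lemma sum_energy_dkern_le w : (forall a, 0 <= w a) ->
  \sum_b w b * energy w (dkern sym_kernel b) <= n%:R * energy w sym_kernel.
Proof.
move=> w0; rewrite sum_energy_dkern /energy mulr_sumr; apply: ler_sum => M _.
have [->|/sym_kernel_neq0 Mn] := eqVneq (sym_kernel M) 0.
  by rewrite expr0n mulr0 mul0rn mulr0.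
rewrite -[X in X <= _]mulr_natl ler_wpM2r ?ler_nat // mulr_ge0 ?sqr_ge0 //.
exact: setprod_ge0.
Qed.

End OneKernel.
End SymmetricKernels.

Section DerivativePairing.
Variables (R : comNzRingType) (A : finType) (w kap x : A -> R).
Hypothesis xx : forall a, x a ^+ 2 = w a + kap a * x a.
Implicit Types (S T : {set A}) (k : {set A} -> R).

Definition derivative_product k k' S T : R :=
  if S :|: T != set0 then \sum_b w b * set_contract w (dkern k b) (dkern k' b) S T else 0.

(** The pair of empty sets gives the constant term, the mean when the monomials are centred, and
    [derivative_product] collects the fluctuation. If k' S is k S divided by #|S|, the constant is
    the energy of k, that is the variance. *)
Lemma sum_derivative_product k k' :
  \sum_b w b * (chaos x (dkern k b) * chaos x (dkern k' b))
  = \sum_S (setprod w S * k S * k' S) *+ #|S| + chaos x (collect kap (derivative_product k k')).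
Proof.
pose Q S T := \sum_b w b * set_contract w (dkern k b) (dkern k' b) S T.
transitivity (\sum_S \sum_T setprod kap (S :&: T) * Q S T * setprod x (S :|: T)).
  under eq_bigr => b _ do rewrite (chaos_mul xx) chaos_collect mulr_sumr.
  rewrite exchange_big /=; apply: eq_bigr => S _.
  under eq_bigr => b _ do rewrite mulr_sumr.
  rewrite exchange_big /=; apply: eq_bigr => T _.
  rewrite /Q mulr_sumr mulr_suml; apply: eq_bigr => b _; ring.
have -> : \sum_S (setprod w S * k S * k' S) *+ #|S| = Q set0 set0.
  rewrite /Q sum_contract_dkern; apply: eq_big => [M|M _]; last by rewrite !setU0.
  by rewrite setU0 -setI_eq0 setI0 eqxx.
rewrite chaos_collect !pair_bigA /= (bigD1 (set0, set0)) //=.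
rewrite [in RHS](bigD1 (set0, set0)) //= /derivative_product setU0 setI0 !setprod0 eqxx /=.
rewrite mulr0 mul0r add0r mul1r mulr1; congr (_ + _); apply: eq_bigr => -[S T] ST /=.
rewrite ifT //; apply: contra ST; rewrite setU_eq0 => /andP[/eqP -> /eqP ->]; exact: eqxx.
Qed.

End DerivativePairing.

From HB Require Import structures.
From mathcomp Require Import all_boot all_order all_algebra all_fingroup.
From mathcomp Require Import all_classical all_reals all_analysis.
From mathcomp Require Import measurable_realfun.
From mathcomp Require Import ring lra zify.


Import Order.TTheory GRing.Theory Num.Theory.
Import numFieldNormedType.Exports.

Local Open Scope classical_set_scope.
Local Open Scope ring_scope.
Local Open Scope ereal_scope.



(** * Integration over powers of a measure *)

Section SeqMeasurable.
Context d (Z : measurableType d).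

(** Kernels are handled as functions on lists of any length, measurable on each length separately;
    concatenating and rearranging arguments then needs no casts between tuple types. *)
Definition seq_measurable d' (T : measurableType d') (phi : seq Z -> T) : Prop :=
  forall n, measurable_fun [set: n.-tuple Z] (fun t => phi t).

Lemma measurable_cat_tuple m n :
  measurable_fun [set: m.-tuple Z * n.-tuple Z] (fun p => [tuple of p.1 ++ p.2]).
Proof.
apply/measurable_fun_tnthP => i.
case: (splitP i) => j ij.
  rewrite (_ : _ \o _ = (fun p => tnth p.1 j)); last first.
    apply/funext => p /=; rewrite -(tnth_lshift p.1 p.2); congr tnth.
    exact: val_inj.
  exact: (@measurableT_comp _ _ _ _ _ _ (fun t => tnth t j) _ fst (measurable_tnth j) measurable_fst).
rewrite (_ : _ \o _ = (fun p => tnth p.2 j)); last first.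
  apply/funext => p /=; rewrite -(tnth_rshift p.1 p.2); congr tnth.
  exact: val_inj.
exact: (@measurableT_comp _ _ _ _ _ _ (fun t => tnth t j) _ snd (measurable_tnth j) measurable_snd).
Qed.

Variables (d' : measure_display) (T : measurableType d').
Implicit Type phi : seq Z -> T.

Lemma seq_measurable_cat phi m n : seq_measurable phi ->
  measurable_fun [set: m.-tuple Z * n.-tuple Z] (fun p => phi (p.1 ++ p.2)).
Proof.
move=> mphi.
exact: (measurableT_comp (mphi (m + n)%N) (@measurable_cat_tuple m n)).
Qed.

Lemma seq_measurable_cons phi n : seq_measurable phi ->
  measurable_fun [set: Z * n.-tuple Z] (fun p => phi (p.1 :: p.2)).
Proof.
move=> mphi; exact: (measurableT_comp (mphi n.+1) (@measurable_pair_cons _ Z n)).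
Qed.

Lemma seq_measurable_catl phi (s : seq Z) : seq_measurable phi ->
  seq_measurable (fun t => phi (s ++ t)).
Proof.
move=> mphi n.
have h1 := @seq_measurable_cat phi (size s) n mphi.
have h2 := @pair1_measurable _ _ ((size s).-tuple Z) (n.-tuple Z) (in_tuple s).
have h3 := measurableT_comp h1 h2.
exact h3.
Qed.

Lemma measurable_map_tnth phi n (idx : seq 'I_n) : seq_measurable phi ->
  measurable_fun [set: n.-tuple Z] (fun t => phi (map (tnth t) idx)).
Proof.
move=> mphi; pose g (t : n.-tuple Z) := [tuple of map (tnth t) (in_tuple idx)].
apply: (measurableT_comp (mphi (size idx)) (_ : measurable_fun setT g)).
apply/measurable_fun_tnthP => i.
rewrite (_ : _ \o _ = (fun t => tnth t (tnth (in_tuple idx) i))).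
  exact: measurable_tnth.
by apply/funext => t /=; rewrite tnth_map.
Qed.

End SeqMeasurable.

Section PowerIntegral.
Context d (Z : measurableType d) (R : realType).
Variable mu : {sigma_finite_measure set Z -> \bar R}.
Implicit Types (phi : seq Z -> \bar R).

Lemma integral_mpow0 phi : seq_measurable phi -> \int[mpow mu 0]_t phi t = phi [::].
Proof.
by move=> mphi; rewrite integral_dirac // ?diracT ?mul1e //; exact: mphi.
Qed.

Lemma ge0_integral_mpow_cons n phi : seq_measurable phi -> (forall s, 0 <= phi s) ->
  \int[mpow mu n.+1]_t phi t = \int[mu]_z \int[mpow mu n]_t phi (z :: t).
Proof.
move=> mphi phi0.
rewrite -(fubini_tonelli1 (fun p : Z * n.-tuple Z => phi (p.1 :: p.2))) //; last first.
  exact: seq_measurable_cons.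
have := @ge0_integral_pushforward _ _ _ _ _ _ (@measurable_pair_cons _ Z n)
  (mu \x mpow mu n) setT (fun t => phi t) measurableT (mphi n.+1) (fun t _ => phi0 t).
rewrite preimage_setT => <-.
reflexivity.
Qed.

Lemma ge0_integral_mpow_cat m n phi : seq_measurable phi -> (forall s, 0 <= phi s) ->
  \int[mpow mu (m + n)]_t phi t = \int[mpow mu m]_a \int[mpow mu n]_b phi (a ++ b).
Proof.
move=> mphi phi0; elim: m phi mphi phi0 => [|m IH] phi mphi phi0.
  rewrite integral_dirac // ?diracT ?mul1e //.
  exact: (@measurable_fun_fubini_tonelli_F _ _ (0.-tuple Z) (n.-tuple Z) R (mpow mu n)
    (fun p => phi (p.1 ++ p.2)) (@seq_measurable_cat _ _ _ _ phi 0 n mphi) (fun p => phi0 _)).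
rewrite addSn (ge0_integral_mpow_cons _ mphi phi0).
have mcat : seq_measurable (fun s => \int[mpow mu n]_b phi (s ++ b)).
  move=> k.
  exact: (@measurable_fun_fubini_tonelli_F _ _ (k.-tuple Z) (n.-tuple Z) R (mpow mu n)
    (fun p => phi (p.1 ++ p.2)) (@seq_measurable_cat _ _ _ _ phi k n mphi) (fun p => phi0 _)).
rewrite (ge0_integral_mpow_cons _ mcat) //; last by move=> s; exact: integral_ge0.
apply: eq_integral => z _; rewrite (IH (fun s => phi (z :: s))) //.
exact: (seq_measurable_catl [:: z] mphi).
Qed.

Lemma ge0_integral_mpow_prod m n phi : seq_measurable phi -> (forall s, 0 <= phi s) ->
  \int[mpow mu (m + n)]_t phi t = \int[mpow mu m \x mpow mu n]_p phi (p.1 ++ p.2).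
Proof.
move=> mphi phi0; rewrite ge0_integral_mpow_cat //.
rewrite (fubini_tonelli1 (fun p : m.-tuple Z * n.-tuple Z => phi (p.1 ++ p.2))) //.
exact: seq_measurable_cat.
Qed.

Lemma seq_measurable_funepos phi : seq_measurable phi -> seq_measurable phi^\+.
Proof. by move=> mphi n; have := measurable_funepos (mphi n); rewrite unlock. Qed.

Lemma seq_measurable_funeneg phi : seq_measurable phi -> seq_measurable phi^\-.
Proof. by move=> mphi n; have := measurable_funeneg (mphi n); rewrite unlock. Qed.

Lemma integral_mpow_prod m n phi : seq_measurable phi ->
  \int[mpow mu (m + n)]_t phi t = \int[mpow mu m \x mpow mu n]_p phi (p.1 ++ p.2).
Proof.
move=> mphi; rewrite integralE [RHS]integralE; congr (_ - _).
- have := ge0_integral_mpow_prod m n (seq_measurable_funepos mphi) (funepos_ge0 phi).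
  by rewrite unlock.
- have := ge0_integral_mpow_prod m n (seq_measurable_funeneg mphi) (funeneg_ge0 phi).
  by rewrite unlock.
Qed.

(** Exchange of two adjacent initial blocks. Such exchanges generate all permutations, in the form
    of the induction principle [catCA_perm_ind], and for each of them the invariance of the integral
    is Fubini. *)
Definition block_swap (T : Type) a b (s : seq T) :=
  take b (drop a s) ++ take a s ++ drop (a + b) s.

Lemma map_block_swap (T U : Type) (g : T -> U) a b s :
  map g (block_swap a b s) = block_swap a b (map g s).
Proof. by rewrite /block_swap !map_cat !map_take !map_drop. Qed.

Lemma block_swap_cat (T : Type) (s1 s2 s3 : seq T) a b : size s1 = a -> size s2 = b ->
  block_swap a b (s1 ++ s2 ++ s3) = s2 ++ s1 ++ s3.
Proof.
move=> <- <-; rewrite /block_swap drop_size_cat // take_size_cat // take_size_cat //.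
by rewrite [in drop _ _]catA drop_size_cat ?size_cat.
Qed.

Lemma seq_measurable_block_swap a b phi : seq_measurable phi ->
  seq_measurable (fun s => phi (block_swap a b s)).
Proof.
move=> mphi n.
have := measurable_map_tnth (block_swap a b (enum 'I_n)) mphi.
by under eq_fun do rewrite map_block_swap map_tnth_enum.
Qed.

Lemma integral_block_swap a b c phi : seq_measurable phi -> (forall s, 0 <= phi s) ->
  \int[mpow mu (a + (b + c))]_t phi (block_swap a b t) = \int[mpow mu (a + (b + c))]_t phi t.
Proof.
move=> mphi phi0.
have msw := seq_measurable_block_swap a b mphi.
rewrite (ge0_integral_mpow_cat _ _ msw) //.
transitivity (\int[mpow mu a]_x \int[mpow mu b]_y \int[mpow mu c]_z phi (y ++ x ++ z)).
  apply: eq_integral => x _.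
  rewrite (@ge0_integral_mpow_cat _ _ (fun s => phi (block_swap a b (x ++ s)))) //.
    apply: eq_integral => y _; apply: eq_integral => z _.
    by rewrite block_swap_cat ?size_tuple.
  exact: (seq_measurable_catl x msw).
have mF : measurable_fun [set: a.-tuple Z * b.-tuple Z]
    (fun p => \int[mpow mu c]_z phi (p.2 ++ p.1 ++ z)).
  have := @measurable_fun_fubini_tonelli_F _ _ ((a + b)%N.-tuple Z) (c.-tuple Z) R (mpow mu c)
    (fun p => phi (block_swap a b (p.1 ++ p.2)))
    (@seq_measurable_cat _ _ _ _ (fun s => phi (block_swap a b s)) (a + b)%N c msw) (fun p => phi0 _).
  move=> h; have := measurableT_comp h (@measurable_cat_tuple _ Z a b).
  rewrite /fubini_F /=; congr measurable_fun; apply/funext => p /=.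
  by apply: eq_integral => z _ /=; rewrite -catA block_swap_cat ?size_tuple.
rewrite (@sfinite_Fubini _ _ _ _ _ (mpow mu a) (mpow mu b)
  (fun p => \int[mpow mu c]_z phi (p.2 ++ p.1 ++ z))) //; last first.
  by move=> p; exact: integral_ge0.
rewrite (_ : (a + (b + c))%N = (b + (a + c))%N); last by rewrite addnCA.
rewrite (ge0_integral_mpow_cat _ _ mphi) //; apply: eq_integral => y _.
rewrite (@ge0_integral_mpow_cat _ _ (fun s => phi (y ++ s))) //.
exact: seq_measurable_catl.
Qed.

Lemma ge0_integral_mpow_perm n (idx : seq 'I_n) phi : perm_eq (enum 'I_n) idx ->
  seq_measurable phi -> (forall s, 0 <= phi s) ->
  \int[mpow mu n]_t phi (map (tnth t) idx) = \int[mpow mu n]_t phi t.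
Proof.
move=> pidx mphi phi0.
have : size (enum 'I_n) = n -> forall phi, seq_measurable phi -> (forall s, 0 <= phi s) ->
  \int[mpow mu n]_t phi (map (tnth t) (enum 'I_n)) = \int[mpow mu n]_t phi t.
  by move=> _ psi _ _; apply: eq_integral => t _; rewrite map_tnth_enum.
move: (perm_size pidx) => ps.
have sidx : size idx = n by rewrite -ps size_enum_ord.
pose Pidx (s : seq 'I_n) : Prop := size s = n -> forall phi, seq_measurable phi ->
  (forall s, 0 <= phi s) -> \int[mpow mu n]_t phi (map (tnth t) s) = \int[mpow mu n]_t phi t.
move=> h0; suff /(_ sidx) : Pidx idx by exact.
apply: (catCA_perm_ind _ pidx h0) => s1 s2 s3 IH s213 psi mpsi psi0.
have s123 : size (s1 ++ s2 ++ s3) = n by rewrite -[RHS]s213 !size_cat addnCA.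
have := IH s123 _ (seq_measurable_block_swap (size s1) (size s2) mpsi) (fun=> psi0 _).
under eq_integral => t _ do rewrite -map_block_swap block_swap_cat //.
move=> ->; have en : n = (size s1 + (size s2 + size s3))%N by rewrite -[LHS]s123 !size_cat.
move: (size s1) (size s2) (size s3) en => a b c; clear -mpsi psi0.
by move=> ->; exact: integral_block_swap.
Qed.

Lemma integral_mpow_perm n (s : 'S_n) phi : seq_measurable phi ->
  \int[mpow mu n]_t phi [tuple tnth t (s i) | i < n] = \int[mpow mu n]_t phi t.
Proof.
move=> mphi.
have pidx : perm_eq (enum 'I_n) (map s (enum 'I_n)).
  apply: uniq_perm; rewrite ?enum_uniq //.
    by rewrite map_inj_uniq ?enum_uniq //; exact: perm_inj.
  move=> i; rewrite mem_enum inE; apply/esym/mapP; exists ((s^-1)%g i).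
    by rewrite mem_enum.
  by rewrite permKV.
have key (psi : seq Z -> \bar R) : seq_measurable psi -> (forall s, 0 <= psi s) ->
    \int[mpow mu n]_t psi [tuple tnth t (s i) | i < n] = \int[mpow mu n]_t psi t.
  move=> mpsi psi0; rewrite -(ge0_integral_mpow_perm pidx mpsi psi0).
  by apply: eq_integral => t _; rewrite -map_comp.
rewrite integralE [RHS]integralE; congr (_ - _).
- by have := key _ (seq_measurable_funepos mphi) (funepos_ge0 phi); rewrite unlock.
- by have := key _ (seq_measurable_funeneg mphi) (funeneg_ge0 phi); rewrite unlock.
Qed.

End PowerIntegral.

(** * Fubini with a weight, and rank-one test functions *)

Section FubiniTools.
Context dX dY (X : measurableType dX) (Y : measurableType dY) (R : realType).
Variables (mX : {sigma_finite_measure set X -> \bar R})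
  (mY : {sigma_finite_measure set Y -> \bar R}).

Lemma measurable_integral_r (f : X -> Y -> \bar R) :
  measurable_fun setT (fun p : X * Y => f p.1 p.2) ->
  measurable_fun setT (fun x => \int[mY]_y f x y).
Proof.
move=> mf; pose g (p : X * Y) := f p.1 p.2.
under eq_fun do rewrite integralE.
apply: emeasurable_funB.
  have := @measurable_fun_fubini_tonelli_F _ _ _ _ R mY g^\+ (measurable_funepos mf) (funepos_ge0 g).
  by rewrite /fubini_F unlock.
have := @measurable_fun_fubini_tonelli_F _ _ _ _ R mY g^\- (measurable_funeneg mf) (funeneg_ge0 g).
by rewrite /fubini_F unlock.
Qed.

Lemma ge0_integral_prod (f : X -> Y -> \bar R) :
  measurable_fun setT (fun p : X * Y => f p.1 p.2) -> (forall x y, 0 <= f x y) ->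
  \int[mX \x mY]_p f p.1 p.2 = \int[mX]_x \int[mY]_y f x y.
Proof. by move=> mf f0; rewrite (fubini_tonelli1 (fun p : X * Y => f p.1 p.2)). Qed.

Lemma ge0_integral_exchange (f : X -> Y -> \bar R) :
  measurable_fun setT (fun p : X * Y => f p.1 p.2) -> (forall x y, 0 <= f x y) ->
  \int[mX]_x \int[mY]_y f x y = \int[mY]_y \int[mX]_x f x y.
Proof.
move=> mf f0.
by rewrite (@sfinite_Fubini _ _ _ _ _ mX mY (fun p => f p.1 p.2)).
Qed.

Section Weight.
Variables (c : X -> R) (h : X -> Y -> R).
Hypothesis mc : measurable_fun setT c.
Hypothesis mh : measurable_fun setT (fun p : X * Y => h p.1 p.2).
Let H (p : X * Y) : \bar R := (c p.1 * h p.1 p.2)%:E.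
Hypothesis iH : (mX \x mY).-integrable setT H.

Let cK x : \bar R := (c x)%:E * \int[mY]_y (h x y)%:E.

Let mcK : measurable_fun setT cK.
Proof.
apply: emeasurable_funM; first exact/measurable_EFinP.
apply: (@measurable_integral_r (fun x y => (h x y)%:E)); exact/measurable_EFinP.
Qed.

Let weight_ae : ae_eq mX setT (fubini_F mY H) cK.
Proof.
have := ae_integrable1 iH.
apply: filterS => x ix _; rewrite /fubini_F /H /cK /=; have [c0|c0] := eqVneq (c x) 0%R.
  by rewrite c0 mul0e; under eq_integral do rewrite mul0r; rewrite integral0.
have ih : mY.-integrable setT (fun y => (h x y)%:E).
  have := integrableZl measurableT (c x)^-1 ix.
  apply: eq_integrable => // y _ /=.
  by rewrite -EFinM /= mulKf.
by rewrite -integralZl.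
Qed.

Lemma fubini_weight_integrable : mX.-integrable setT cK.
Proof.
have i := integrable_fubini_F iH.
apply/integrableP; split => //.
have /integrableP[mF] := i; apply: le_lt_trans.
rewrite le_eqVlt; apply/orP; left; apply/eqP.
apply: ge0_ae_eq_integral => //; [exact: measurableT_comp | exact: measurableT_comp | ].
by apply: filterS weight_ae => x /(_ I) ->.
Qed.

(** Joint integrability is available for the product c * h only. For almost every x with c x != 0
    the section of h is integrable; where c x = 0 both sides vanish, even if the integral of the
    section is infinite. *)
Lemma fubini_weight : \int[mX]_x ((c x)%:E * \int[mY]_y (h x y)%:E)
  = \int[mY]_y \int[mX]_x (c x * h x y)%:E.
Proof.
transitivity (\int[mX]_x fubini_F mY H x).
  apply: ae_eq_integral => //.
    by have /integrableP[] := integrable_fubini_F iH.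
  exact: ae_eq_sym.
by rewrite (integral12_prod_meas1 iH) -(integral21_prod_meas1 iH).
Qed.

End Weight.
End FubiniTools.

Section RankOne.
Context dX d1 d3 (X : measurableType dX) (T1 : measurableType d1) (T3 : measurableType d3)
  (R : realType).
Variables (mX : {sigma_finite_measure set X -> \bar R})
  (m1 : {sigma_finite_measure set T1 -> \bar R})
  (m3 : {sigma_finite_measure set T3 -> \bar R}).
(* X stands for T3 * T3, with projections p1 and p2. *)
Variables (p1 p2 : X -> T3).
Hypothesis mp1 : measurable_fun setT p1.
Hypothesis mp2 : measurable_fun setT p2.
Hypothesis ge0_integralX : forall f : T3 -> T3 -> \bar R,
  measurable_fun setT (fun p : T3 * T3 => f p.1 p.2) -> (forall t s, 0 <= f t s) ->
  \int[mX]_x f (p1 x) (p2 x) = \int[m3]_t \int[m3]_s f t s.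
Hypothesis integralX : forall f : T3 -> T3 -> \bar R,
  measurable_fun setT (fun p : T3 * T3 => f p.1 p.2) ->
  mX.-integrable setT (fun x => f (p1 x) (p2 x)) ->
  \int[mX]_x f (p1 x) (p2 x) = \int[m3]_t \int[m3]_s f t s.
Variable G : T1 -> T3 -> R.
Hypothesis mG : measurable_fun setT (fun p : T1 * T3 => G p.1 p.2).
Hypothesis G2 : \int[m1]_z \int[m3]_t (G z t ^+ 2)%:E < +oo.

Let mGz z : measurable_fun setT (G z).
Proof. exact: (measurableT_comp mG (pair1_measurable z)). Qed.

Let mGt t : measurable_fun setT (G^~ t).
Proof. exact: (measurableT_comp mG (pair2_measurable t)). Qed.

Let msqr dT (T : measurableType dT) (g : T -> R) :
  measurable_fun setT g -> measurable_fun setT (fun x => (g x ^+ 2)%:E : \bar R).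
Proof. by move=> mg; apply/measurable_EFinP; apply: measurable_funX. Qed.

Let sqr0 dT (T : measurableType dT) (g : T -> R) x : 0 <= ((g x ^+ 2)%:E : \bar R).
Proof. by rewrite lee_fin sqr_ge0. Qed.

Variable psi : T3 -> R.
Hypothesis mpsi : measurable_fun setT psi.
Hypothesis psi2 : \int[m3]_t (psi t ^+ 2)%:E < +oo.

Let gF t : \bar R := \int[m1]_z (G z t ^+ 2)%:E.

Let mgF : measurable_fun setT gF.
Proof.
apply: (@measurable_integral_r _ _ T3 T1 R m1 (fun t z => (G z t ^+ 2)%:E)).
apply: (@msqr _ (T3 * T1)%type (fun p => G p.2 p.1)).
exact: (measurableT_comp mG (measurable_fun_pair measurable_snd measurable_fst)).
Qed.

Let gF0 t : 0 <= gF t.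
Proof. by apply: integral_ge0. Qed.

Let gF_fin : \int[m3]_t gF t < +oo.
Proof.
rewrite /gF -(@ge0_integral_exchange _ _ T1 T3 R m1 m3 (fun z t => (G z t ^+ 2)%:E)) //.
exact: (msqr mG).
Qed.

Let Gp1 : measurable_fun setT (fun q : X * T1 => G q.2 (p1 q.1)).
Proof.
apply: (measurableT_comp mG (_ : measurable_fun setT (fun q : X * T1 => (q.2, p1 q.1)))).
by apply: measurable_fun_pair => //; exact: measurableT_comp.
Qed.

Let Gp2 : measurable_fun setT (fun q : X * T1 => G q.2 (p2 q.1)).
Proof.
apply: (measurableT_comp mG (_ : measurable_fun setT (fun q : X * T1 => (q.2, p2 q.1)))).
by apply: measurable_fun_pair => //; exact: measurableT_comp.
Qed.

Let psi1 : measurable_fun setT (psi \o p1). Proof. exact: measurableT_comp. Qed.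
Let psi2' : measurable_fun setT (psi \o p2). Proof. exact: measurableT_comp. Qed.

Let D_fin (u v : X -> T3) : measurable_fun setT (psi \o u) ->
  measurable_fun setT (fun q : X * T1 => G q.2 (v q.1)) ->
  (forall f : T3 -> T3 -> \bar R, measurable_fun setT (fun p : T3 * T3 => f p.1 p.2) ->
     (forall t s, 0 <= f t s) ->
     \int[mX]_x f (u x) (v x) = \int[m3]_t \int[m3]_s f t s) ->
  \int[mX \x m1]_q (psi (u q.1) ^+ 2 * G q.2 (v q.1) ^+ 2)%:E < +oo.
Proof.
move=> mu mv uvE.
rewrite (@ge0_integral_prod _ _ X T1 R mX m1
  (fun x z => (psi (u x) ^+ 2 * G z (v x) ^+ 2)%:E)); first last.
- by move=> x z; rewrite lee_fin mulr_ge0 ?sqr_ge0.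
- apply/measurable_EFinP; apply: measurable_funM; apply: measurable_funX => //.
  exact: (measurableT_comp mu).
rewrite (_ : (fun x => _) = (fun x => (psi (u x) ^+ 2)%:E * gF (v x))); last first.
  apply/funext => x; rewrite /gF -ge0_integralZl_EFin ?sqr_ge0 //.
  exact: msqr.
rewrite (uvE (fun t s => (psi t ^+ 2)%:E * gF s)); first last.
- by move=> t s; rewrite mule_ge0.
- apply: emeasurable_funM.
    exact: (measurableT_comp (msqr mpsi) measurable_fst).
  exact: (measurableT_comp mgF measurable_snd).
rewrite (_ : (fun t => _) = (fun t => (psi t ^+ 2)%:E * \int[m3]_s gF s)); last first.
  by apply/funext => t; rewrite ge0_integralZl_EFin ?sqr_ge0.
rewrite ge0_integralZr ?integral_ge0 //; last exact: msqr.
rewrite lte_mul_pinfty ?integral_ge0 // ge0_fin_numE // integral_ge0 //.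
Qed.

Let h x z := (G z (p1 x) * G z (p2 x))%R.

Let mh : measurable_fun setT (fun q : X * T1 => h q.1 q.2).
Proof. exact: measurable_funM. Qed.

Let c x := (psi (p1 x) * psi (p2 x))%R.
Let mc : measurable_fun setT c. Proof. exact: measurable_funM. Qed.

(** The four factors are paired crosswise, psi at p2 with G at p1 and psi at p1 with G at p2: the
    integrals of the squares then factor into those of psi^2 and of G^2, which pairing equal
    arguments would not allow. *)
Let iH : (mX \x m1).-integrable setT (fun q => (c q.1 * h q.1 q.2)%:E).
Proof.
have mH : measurable_fun setT (fun q : X * T1 => (c q.1 * h q.1 q.2)%R).
  by apply: measurable_funM => //; exact: (measurableT_comp mc).
pose D1 (q : X * T1) : \bar R := (psi (p2 q.1) ^+ 2 * G q.2 (p1 q.1) ^+ 2)%:E.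
pose D2 (q : X * T1) : \bar R := (psi (p1 q.1) ^+ 2 * G q.2 (p2 q.1) ^+ 2)%:E.
have mD1 : measurable_fun setT D1.
  apply/measurable_EFinP; apply: measurable_funM; apply: measurable_funX => //.
  exact: (measurableT_comp psi2').
have mD2 : measurable_fun setT D2.
  apply/measurable_EFinP; apply: measurable_funM; apply: measurable_funX => //.
  exact: (measurableT_comp psi1).
have D10 x : 0 <= D1 x by rewrite lee_fin mulr_ge0 // sqr_ge0.
have D20 x : 0 <= D2 x by rewrite lee_fin mulr_ge0 // sqr_ge0.
have I1 : \int[mX \x m1]_q D1 q < +oo.
  apply: D_fin => // f mf f0.
  rewrite (ge0_integralX (f := fun t s => f s t)) //.
    by rewrite ge0_integral_exchange //; exact: (measurableT_comp mf
      (measurable_fun_pair measurable_snd measurable_fst)).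
  exact: (measurableT_comp mf (measurable_fun_pair measurable_snd measurable_fst)).
have I2 : \int[mX \x m1]_q D2 q < +oo by apply: D_fin.
apply/integrableP; split; first exact/measurable_EFinP.
apply: (@le_lt_trans _ _ (\int[mX \x m1]_x (D1 x + D2 x))).
  apply: ge0_le_integral => //.
  - by apply: measurableT_comp => //; exact/measurable_EFinP.
  - exact: emeasurable_funD.
  move=> x _; rewrite /h /c /D1 /D2 /= -EFinD lee_fin.
  set a := psi _; set b := psi _; set u := G _ _; set v := G _ _.
  have := sqr_ge0 (b * u - a * v); have := sqr_ge0 (b * u + a * v).
  have := sqr_ge0 (b * u); have := sqr_ge0 (a * v).
  by rewrite ler_norml => *; apply/andP; split; nra.
by rewrite ge0_integralD //; apply: lte_add_pinfty.
Qed.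

Lemma rank_one_integrable : mX.-integrable setT
  (fun x => (psi (p1 x) * psi (p2 x))%:E * \int[m1]_z (G z (p1 x) * G z (p2 x))%:E).
Proof. exact: (fubini_weight_integrable mc mh iH). Qed.

Lemma ae_section_sqr : {ae m1, forall z, \int[m3]_t (G z t ^+ 2)%:E < +oo}.
Proof.
have i : m1.-integrable setT (fun z => \int[m3]_t (G z t ^+ 2)%:E).
  apply/integrableP; split.
    exact: (@measurable_integral_r _ _ T1 T3 R m3 (fun z t => (G z t ^+ 2)%:E) (msqr mG)).
  by under eq_integral => z _ do rewrite gee0_abs ?integral_ge0 //.
have := integrable_ae measurableT i; apply: filterS => z /(_ I).
by rewrite ge0_fin_numE ?integral_ge0.
Qed.

Lemma section_integrable z : \int[m3]_t (G z t ^+ 2)%:E < +oo ->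
  m3.-integrable setT (fun t => (psi t * G z t)%:E).
Proof.
move=> Gz.
apply/integrableP; split; first by apply/measurable_EFinP; apply: measurable_funM.
apply: (@le_lt_trans _ _ (\int[m3]_t ((psi t ^+ 2)%:E + (G z t ^+ 2)%:E))).
  apply: ge0_le_integral => //.
  - by apply: measurableT_comp => //; apply/measurable_EFinP; apply: measurable_funM.
  - by apply: emeasurable_funD; apply: msqr.
  move=> t _ /=; rewrite -EFinD lee_fin.
  set a := psi t; set b := G _ _; have := sqr_ge0 (a - b); have := sqr_ge0 (a + b).
  by have := sqr_ge0 a; have := sqr_ge0 b; rewrite ler_norml => *; apply/andP; split; nra.
by rewrite ge0_integralD //; [exact: lte_add_pinfty | exact: msqr | exact: msqr].
Qed.

(** Integrating G(z, t) G(z, s) over z gives the kernel of a positive operator, and this is its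
    quadratic form at psi. *)
Lemma rank_one_integral :
  \int[mX]_x ((psi (p1 x) * psi (p2 x))%:E * \int[m1]_z (G z (p1 x) * G z (p2 x))%:E)
  = \int[m1]_z (\int[m3]_t (psi t * G z t)%:E) ^+ 2.
Proof.
rewrite (fubini_weight mc mh iH).
have mpG : measurable_fun setT (fun p : T1 * T3 => (psi p.2 * G p.1 p.2)%:E : \bar R).
  apply/measurable_EFinP; apply: measurable_funM => //.
  exact: (measurableT_comp mpsi measurable_snd).
apply: ae_eq_integral => //.
- exact: (measurable_fubini_G iH).
- apply: (@measurableT_comp _ _ _ _ _ _ (fun y : \bar R => y ^+ 2)) => //; last first.
    exact: (@measurable_integral_r _ _ T1 T3 R m3 (fun z t => (psi t * G z t)%:E) mpG).
  by under eq_fun do rewrite expe2; apply: emeasurable_funM.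
have := ae_integrable2 iH; have := ae_section_sqr.
apply: filterS2 => z Gz iz _.
have ig := section_integrable Gz.
have fin : \int[m3]_t (psi t * G z t)%:E \is a fin_num by exact: integrable_fin_num.
have cE : (fun x => (c x * h x z)%:E) =
   (fun x => ((psi (p1 x) * G z (p1 x)) * (psi (p2 x) * G z (p2 x)))%:E : \bar R).
  by apply/funext => x; rewrite /c /h; congr EFin; ring.
rewrite cE in iz *.
rewrite (integralX (f := fun t s => ((psi t * G z t) * (psi s * G z s))%:E)) //; last first.
  apply/measurable_EFinP; apply: measurable_funM; apply: measurable_funM.
  - exact: (measurableT_comp mpsi measurable_fst).
  - exact: (measurableT_comp (mGz z) measurable_fst).
  - exact: (measurableT_comp mpsi measurable_snd).
  - exact: (measurableT_comp (mGz z) measurable_snd).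
rewrite (_ : (fun t => _) = (fun t => (psi t * G z t)%:E * \int[m3]_s (psi s * G z s)%:E)).
  by rewrite -{1}(fineK fin) integralZr // fineK // expe2.
by apply/funext => t; under eq_integral do rewrite EFinM; rewrite integralZl.
Qed.

End RankOne.

(** * Averaging does not increase contraction norms *)

Section SigmaFiniteProduct.
Context d1 d2 (T1 : measurableType d1) (T2 : measurableType d2) (R : realType).
Variables (m1 : {sigma_finite_measure set T1 -> \bar R})
  (m2 : {sigma_finite_measure set T2 -> \bar R}).

(* An alias: on product_measure1 itself the canonical sigma-finite structure is
   the one of products of subprobabilities. *)
Definition sigma_finite_prod : set (T1 * T2) -> \bar R := (m1 \x m2)%E.

HB.instance Definition _ := Measure.copy sigma_finite_prod (m1 \x m2)%E.

Let sigma_finite_prodT : sigma_finite [set: T1 * T2] sigma_finite_prod.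
Proof.
have /sigma_finiteP[F [TF ndF Foo]] := sigma_finiteT m1.
have /sigma_finiteP[G [TG ndG Goo]] := sigma_finiteT m2.
exists (fun n => F n `*` G n).
  rewrite -setXTT TF TG predeqE => -[x y]; split.
    move=> [/= [n _ Fnx] [k _ Gky]]; exists (maxn n k) => //; split.
    - by move: x Fnx; exact/subsetPset/ndF/leq_maxl.
    - by move: y Gky; exact/subsetPset/ndG/leq_maxr.
  by move=> [n _ []/= ? ?]; split; exists n.
move=> k; have [? ?] := Foo k; have [? ?] := Goo k.
split; first exact: measurableX.
by rewrite /sigma_finite_prod product_measure1E// lte_mul_pinfty// ge0_fin_numE.
Qed.

HB.instance Definition _ := Measure_isSigmaFinite.Build _ _ _ sigma_finite_prod
  sigma_finite_prodT.

End SigmaFiniteProduct.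

Section SquareIntegrable.
Context d (T : measurableType d) (R : realType) (m : {measure set T -> \bar R}).
Implicit Types f g : T -> R.

Lemma measurable_sqr f : measurable_fun setT f -> measurable_fun setT (fun x => (f x ^+ 2)%:E : \bar R).
Proof. by move=> mf; apply/measurable_EFinP; apply: measurable_funX. Qed.

Lemma sqr_mul_integrable f g : measurable_fun setT f -> measurable_fun setT g ->
  \int[m]_x (f x ^+ 2)%:E < +oo -> \int[m]_x (g x ^+ 2)%:E < +oo ->
  m.-integrable setT (fun x => (f x * g x)%:E).
Proof.
move=> mf mg f2 g2.
apply/integrableP; split; first by apply/measurable_EFinP; apply: measurable_funM.
apply: (@le_lt_trans _ _ (\int[m]_t ((f t ^+ 2)%:E + (g t ^+ 2)%:E))).
  apply: ge0_le_integral => //.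
  - by apply: measurableT_comp => //; apply/measurable_EFinP; apply: measurable_funM.
  - by apply: emeasurable_funD; apply: measurable_sqr.
  move=> t _ /=; rewrite -EFinD lee_fin.
  set a := f t; set b := g t; have := sqr_ge0 (a - b); have := sqr_ge0 (a + b).
  by have := sqr_ge0 a; have := sqr_ge0 b; rewrite ler_norml => *; apply/andP; split; nra.
rewrite ge0_integralD //; first exact: lte_add_pinfty.
- by move=> t _; rewrite lee_fin sqr_ge0.
- exact: measurable_sqr.
- by move=> t _; rewrite lee_fin sqr_ge0.
- exact: measurable_sqr.
Qed.

Lemma integral_sqr_ge0 f : 0 <= \int[m]_x (f x ^+ 2)%:E.
Proof. by apply: integral_ge0 => x _; rewrite lee_fin sqr_ge0. Qed.

(** f has no sign and may fail to be integrable; it is replaced by its positive part, which g still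
    dominates. *)
Lemma integral_le_ge0_ae (f g : T -> \bar R) : measurable_fun setT f -> measurable_fun setT g ->
  (forall x, 0 <= g x) -> {ae m, forall x, f x <= g x} -> \int[m]_x f x <= \int[m]_x g x.
Proof.
move=> mf mg g0 fg; rewrite integralE.
apply: (@le_trans _ _ (\int[m]_x f^\+ x)).
  by rewrite -[leRHS]sube0 leeB // integral_ge0.
apply: ae_ge0_le_integral => //; first exact: measurable_funepos.
by apply: filterS fg => x fg _; rewrite unlock ge_max fg g0.
Qed.

End SquareIntegrable.

Section StepFunctions.
Context d (T : measurableType d) (R : realType) (m : {measure set T -> \bar R}).
Variables (I : finType) (e : I -> set T) (w : I -> R).
Hypothesis me : forall i, measurable (e i).
Hypothesis ew : forall i, m (e i) = (w i)%:E.
Hypothesis de : forall i j, i != j -> e i `&` e j = set0.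

Lemma cell_indicM i j t : (\1_(e i) t * \1_(e j) t = (i == j)%:R * \1_(e i) t :> R)%R.
Proof.
have [->|ij] := eqVneq i j; first by rewrite mul1r !indicE; case: (_ \in _); rewrite ?mulr1 ?mulr0.
rewrite mul0r !indicE; have [ti|] := boolP (t \in e i); last by rewrite mul0r.
have [tj|] := boolP (t \in e j); last by rewrite mulr0.
by have /seteqP[/(_ t) h _] := de ij; case: h; split; exact: set_mem.
Qed.

Definition step (a : I -> R) t : R := (\sum_i a i * \1_(e i) t)%R.

Lemma measurable_step a : measurable_fun setT (step a).
Proof. by apply: measurable_sum => i; apply: measurable_funM. Qed.

Lemma stepM a b t : (step a t * step b t = step (fun i => a i * b i) t)%R.
Proof.
rewrite /step big_distrlr /=; apply: eq_bigr => i _.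
rewrite (bigD1 i) //= big1 ?addr0 => [|j ji].
  by rewrite mulrACA cell_indicM eqxx mul1r.
by rewrite mulrACA cell_indicM eq_sym (negbTE ji) mul0r mulr0.
Qed.

Lemma step_cell a i t : e i t -> step a t = a i.
Proof.
move=> eit; rewrite /step (bigD1 i) //= big1 ?addr0 => [|j ji].
  by rewrite indicE mem_set // mulr1.
by rewrite indicE memNset ?mulr0 // => ejt; have := de ji; move/seteqP => [/(_ t)] + _; exact.
Qed.

Lemma integral_step a : (forall i, 0 <= a i)%R ->
  \int[m]_t (step a t)%:E = (\sum_i a i * w i)%:E.
Proof.
move=> a0; under eq_integral => t _ do rewrite /step -sumEFin.
rewrite ge0_integral_sum //.
- rewrite -sumEFin; apply: eq_bigr => i _.
  under eq_integral => t _ do rewrite EFinM.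
  rewrite ge0_integralZl_EFin //; last exact/measurable_EFinP.
  by rewrite (_ : \int[m]_t (\1_(e i) t)%:E = m (e i)) ?ew // integral_indic ?setIT.
- by move=> i; apply/measurable_EFinP; apply: measurable_funM.
- by move=> i t _; rewrite lee_fin mulr_ge0.
Qed.

Lemma integral_step_sqr a : \int[m]_t (step a t ^+ 2)%:E = (\sum_i a i ^+ 2 * w i)%:E.
Proof.
rewrite -(@integral_step (fun i => a i ^+ 2)%R) => [|i]; last exact: sqr_ge0.
by apply: eq_integral => t _; rewrite expr2 stepM.
Qed.

End StepFunctions.

(** * Jensen's inequality for squared contraction norms *)

Section TwoVariables.
Context d1 d3 (T1 : measurableType d1) (T3 : measurableType d3) (R : realType).
Variables (m1 : {sigma_finite_measure set T1 -> \bar R})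
  (m3 : {sigma_finite_measure set T3 -> \bar R}).
Variable G : T1 -> T3 -> R.
Hypothesis mG : measurable_fun setT (fun p : T1 * T3 => G p.1 p.2).
Hypothesis G2 : \int[m1]_z \int[m3]_t (G z t ^+ 2)%:E < +oo.

Let K t s : \bar R := \int[m1]_z (G z t * G z s)%:E.

Let integralX (f : T3 -> T3 -> \bar R) :
  measurable_fun setT (fun p : T3 * T3 => f p.1 p.2) ->
  (m3 \x m3).-integrable setT (fun x => f x.1 x.2) ->
  \int[m3 \x m3]_x f x.1 x.2 = \int[m3]_t \int[m3]_s f t s.
Proof. by move=> mf fi; rewrite -(integral12_prod_meas1 fi). Qed.

Lemma measurable_cross_kernel : measurable_fun setT (fun x : T3 * T3 => K x.1 x.2).
Proof.
apply: (@measurable_integral_r _ _ (T3 * T3)%type T1 R m1 (fun x z => (G z x.1 * G z x.2)%:E)).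
apply/measurable_EFinP; apply: measurable_funM.
  apply: (measurableT_comp mG (_ : measurable_fun setT
    (fun q : (T3 * T3) * T1 => (q.2, q.1.1)))).
  by apply: measurable_fun_pair => //; exact: measurableT_comp.
apply: (measurableT_comp mG (_ : measurable_fun setT
  (fun q : (T3 * T3) * T1 => (q.2, q.1.2)))).
by apply: measurable_fun_pair => //; exact: measurableT_comp.
Qed.

Variables (I : finType) (w : I -> R) (psi : I -> T3 -> R) (rho : I -> T1 -> R).
Hypothesis w0 : forall i, (0 <= w i)%R.
Hypothesis mpsi : forall i, measurable_fun setT (psi i).
Hypothesis psi2 : forall i, \int[m3]_t (psi i t ^+ 2)%:E < +oo.
Hypothesis mrho : forall i, measurable_fun setT (rho i).
Hypothesis rho2 : forall i, \int[m1]_z (rho i z ^+ 2)%:E < +oo.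

Let h i z : \bar R := \int[m3]_t (psi i t * G z t)%:E.

Let mpG i : measurable_fun setT (fun p : T1 * T3 => (psi i p.2 * G p.1 p.2)%:E : \bar R).
Proof.
apply/measurable_EFinP; apply: measurable_funM => //.
exact: (measurableT_comp (mpsi i) measurable_snd).
Qed.

Let mh i : measurable_fun setT (h i).
Proof. exact: (@measurable_integral_r _ _ T1 T3 R m3 (fun z t => (psi i t * G z t)%:E) (mpG i)). Qed.

Let kap (x : T3 * T3) : R := (\sum_i w i * (psi i x.1 * psi i x.2))%R.

Let mkap : measurable_fun setT kap.
Proof.
apply: measurable_sum => i; apply: measurable_funM => //; apply: measurable_funM.
  exact: (measurableT_comp (mpsi i) measurable_fst).
exact: (measurableT_comp (mpsi i) measurable_snd).
Qed.

Let msqre dT (T : measurableType dT) (f : T -> \bar R) :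
  measurable_fun setT f -> measurable_fun setT (fun x => f x ^+ 2).
Proof. by move=> mf; under eq_fun do rewrite expe2; apply: emeasurable_funM. Qed.

Lemma sqre_ge0 (x : \bar R) : 0 <= x ^+ 2.
Proof.
by rewrite expe2; case: x => [r| |]; rewrite ?mulyy ?mulNyNy // -EFinM lee_fin -expr2 sqr_ge0.
Qed.

Lemma mul2e_le_sqr (a : R) (x : \bar R) : (2 * a)%:E * x <= x ^+ 2 + (a ^+ 2)%:E.
Proof.
case: x => [x| |]; rewrite expe2; last 2 first.
- by rewrite mulyy /= addye // leey.
- by rewrite mulNyNy /= addye // leey.
by rewrite -!EFinM -EFinD lee_fin; have := sqr_ge0 (x - a); nra.
Qed.

(** The left side is twice the integral of K * kap, because each psi i contributes its quadratic
    form at K by [rank_one_integral]. Pointwise, 2 a x <= x^2 + a^2. *)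
Lemma sum_section_sqr_le :
  2%:E * \sum_i (w i)%:E * \int[m1]_z h i z ^+ 2
  <= \int[m3]_t \int[m3]_s K t s ^+ 2 + \int[m3]_t \int[m3]_s (kap (t, s) ^+ 2)%:E.
Proof.
pose mX := [the {sigma_finite_measure set (T3 * T3)%type -> \bar R} of sigma_finite_prod m3 m3].
have mK2 : measurable_fun setT (fun x : T3 * T3 => K x.1 x.2 ^+ 2).
  exact: msqre measurable_cross_kernel.
have mk2 : measurable_fun setT (fun x : T3 * T3 => (kap (x.1, x.2) ^+ 2)%:E : \bar R).
  under eq_fun do rewrite -surjective_pairing.
  exact: measurable_sqr.
rewrite -(@ge0_integral_prod _ _ T3 T3 R m3 m3 (fun t s => K t s ^+ 2)) //; last first.
  by move=> *; exact: sqre_ge0.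
rewrite -(@ge0_integral_prod _ _ T3 T3 R m3 m3 (fun t s => (kap (t, s) ^+ 2)%:E)) //; last first.
  by move=> *; rewrite lee_fin sqr_ge0.
have ri i := @rank_one_integrable _ _ _ (T3 * T3)%type T1 T3 R mX m1 m3 fst snd
  measurable_fst measurable_snd
  (fun f mf f0 => @ge0_integral_prod _ _ T3 T3 R m3 m3 f mf f0) G mG G2 (psi i) (mpsi i) (psi2 i).
have rI i := @rank_one_integral _ _ _ (T3 * T3)%type T1 T3 R mX m1 m3 fst snd
  measurable_fst measurable_snd
  (fun f mf f0 => @ge0_integral_prod _ _ T3 T3 R m3 m3 f mf f0) integralX G mG G2 (psi i) (mpsi i) (psi2 i).
rewrite -ge0_integralD //; last 2 first.
- by move=> x _; exact: sqre_ge0.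
- by move=> x _; rewrite lee_fin sqr_ge0.
have -> : 2%:E * \sum_i (w i)%:E * \int[m1]_z h i z ^+ 2
   = \int[m3 \x m3]_x (\sum_i (2 * w i)%:E * ((psi i x.1 * psi i x.2)%:E * K x.1 x.2)).
  rewrite integral_sum //; last by move=> i; exact: integrableZl.
  rewrite ge0_sume_distrr; last first.
    by move=> i _; rewrite mule_ge0 ?lee_fin // integral_ge0 // => z _; exact: sqre_ge0.
  by apply: eq_bigr => i _; rewrite integralZl // rI muleA -EFinM.
apply: integral_le_ge0_ae.
- apply: emeasurable_sum => i; apply: emeasurable_funM => //.
  by have /integrableP[] := ri i.
- exact: emeasurable_funD.
- by move=> x; rewrite adde_ge0 ?sqre_ge0 // lee_fin sqr_ge0.
apply: aeW => x; rewrite -surjective_pairing.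
case: (K x.1 x.2) => [r| |]; last 2 first.
- by rewrite expe2 mulyy addye // leey.
- by rewrite expe2 mulNyNy addye // leey.
apply: le_trans (mul2e_le_sqr (kap x) r%:E).
rewrite -EFinM /kap mulr_sumr mulr_suml -sumEFin le_eqVlt; apply/orP; left; apply/eqP.
by apply: eq_bigr => i _; rewrite -!EFinM; congr EFin; ring.
Qed.

Lemma section_weight_le i :
  2%:E * \int[m1 \x m3]_p (rho i p.1 * (psi i p.2 * G p.1 p.2))%:E
  <= \int[m1]_z h i z ^+ 2 + \int[m1]_z (rho i z ^+ 2)%:E.
Proof.
have mrp : measurable_fun setT (fun p : T1 * T3 => (rho i p.1 * psi i p.2)%R).
  apply: measurable_funM; first exact: (measurableT_comp (mrho i) measurable_fst).
  exact: (measurableT_comp (mpsi i) measurable_snd).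
have sq0 (x : R) : 0 <= ((x ^+ 2)%:E : \bar R) by rewrite lee_fin sqr_ge0.
have rp2 : \int[m1 \x m3]_p ((rho i p.1 * psi i p.2) ^+ 2)%:E < +oo.
  rewrite (@ge0_integral_prod _ _ T1 T3 R m1 m3 (fun z t => ((rho i z * psi i t) ^+ 2)%:E)) //.
    rewrite (_ : (fun z => _) = (fun z => (rho i z ^+ 2)%:E * \int[m3]_t (psi i t ^+ 2)%:E)).
      rewrite ge0_integralZr ?integral_sqr_ge0 //; last exact: measurable_sqr.
      by rewrite lte_mul_pinfty ?integral_sqr_ge0 // ge0_fin_numE ?integral_sqr_ge0.
    apply/funext => z; rewrite -ge0_integralZl_EFin ?sqr_ge0 //; last exact: measurable_sqr.
    by apply: eq_integral => t _; rewrite exprMn EFinM.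
  exact: measurable_sqr.
have GG2 : \int[m1 \x m3]_p (G p.1 p.2 ^+ 2)%:E < +oo.
  rewrite (@ge0_integral_prod _ _ T1 T3 R m1 m3 (fun z t => (G z t ^+ 2)%:E)) //.
  exact: measurable_sqr.
have iH : (m1 \x m3).-integrable setT (fun p => (rho i p.1 * (psi i p.2 * G p.1 p.2))%:E).
  by under eq_fun do rewrite mulrA; exact: sqr_mul_integrable.
have mpG' : measurable_fun setT (fun p : T1 * T3 => psi i p.2 * G p.1 p.2)%R.
  by apply/measurable_EFinP; exact: mpG.
have iw := @fubini_weight_integrable _ _ T1 T3 R m1 m3 (rho i) (fun z t => psi i t * G z t)%R
  (mrho i) mpG' iH.
have -> : \int[m1 \x m3]_p (rho i p.1 * (psi i p.2 * G p.1 p.2))%:E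
   = \int[m1]_z ((rho i z)%:E * h i z).
  rewrite -(integral21_prod_meas1 iH) -(@fubini_weight _ _ T1 T3 R m1 m3 (rho i)
    (fun z t => psi i t * G z t)%R (mrho i) mpG' iH) //.
rewrite -integralZl // -ge0_integralD //; first last.
- exact: measurable_sqr.
- exact: msqre.
- by move=> z _; exact: sqre_ge0.
apply: integral_le_ge0_ae.
- apply: emeasurable_funM => //; apply: emeasurable_funM => //.
  exact/measurable_EFinP.
- by apply: emeasurable_funD; [exact: msqre | exact: measurable_sqr].
- by move=> z; rewrite adde_ge0 ?sqre_ge0.
by apply: aeW => z; rewrite muleA -EFinM; exact: mul2e_le_sqr.
Qed.

End TwoVariables.

(** The identity tr((A A^T)^2) = tr((A^T A)^2), with weights. *)
Lemma gram_sum_swap (R : comNzRingType) (I K : finType) (w : I -> R) (v : K -> R) (a : I -> K -> R) :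
  (\sum_k \sum_k' v k * v k' * (\sum_i w i * a i k * a i k') ^+ 2
  = \sum_i \sum_i' w i * w i' * (\sum_k v k * a i k * a i' k) ^+ 2)%R.
Proof.
transitivity (\sum_k \sum_k' \sum_i \sum_i'
    (v k * v k' * (w i * w i' * (a i k * a i k' * (a i' k * a i' k')))))%R.
  apply: eq_bigr => k _; apply: eq_bigr => k' _; rewrite expr2 big_distrlr /= mulr_sumr.
  apply: eq_bigr => i _; rewrite mulr_sumr; apply: eq_bigr => i' _; ring.
under eq_bigr => k _ do rewrite exchange_big /=.
rewrite exchange_big /=; apply: eq_bigr => i _.
under eq_bigr => k _ do rewrite exchange_big /=.
rewrite exchange_big /=; apply: eq_bigr => i' _.
rewrite expr2 big_distrlr /= mulr_sumr; apply: eq_bigr => k _.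
rewrite mulr_sumr; apply: eq_bigr => k' _; ring.
Qed.

Lemma measurable_indic_comp d d' (T : measurableType d) (T' : measurableType d')
    (R : realType) (e : set T') (u : T -> T') :
  measurable e -> measurable_fun setT u -> measurable_fun setT (fun x => \1_e (u x) : R).
Proof.
move=> me mu; have mi : measurable_fun setT (\1_e : T' -> R) by [].
exact: (measurableT_comp mi mu).
Qed.

Section Box.
Context d1 d2 d3 (T1 : measurableType d1) (T2 : measurableType d2) (T3 : measurableType d3).
Variable R : realType.
Variables (m1 : {sigma_finite_measure set T1 -> \bar R})
  (m2 : {sigma_finite_measure set T2 -> \bar R})
  (m3 : {sigma_finite_measure set T3 -> \bar R}).
Let m13 := [the {sigma_finite_measure set (T1 * T3)%type -> \bar R} of sigma_finite_prod m1 m3].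
Variable F : T1 -> T2 -> T3 -> R.
Hypothesis mF : measurable_fun setT (fun p : T2 * (T1 * T3) => F p.2.1 p.1 p.2.2).
Hypothesis F2 : \int[m2 \x m13]_p (F p.2.1 p.1 p.2.2 ^+ 2)%:E < +oo.
Variables (I1 I2 I3 : finType) (e1 : I1 -> set T1) (e2 : I2 -> set T2) (e3 : I3 -> set T3).
Variables (w1 : I1 -> R) (w2 : I2 -> R) (w3 : I3 -> R) (A : I1 -> I2 -> I3 -> R).
Hypothesis me1 : forall i, measurable (e1 i).
Hypothesis me2 : forall i, measurable (e2 i).
Hypothesis me3 : forall i, measurable (e3 i).
Hypothesis ew1 : forall i, m1 (e1 i) = (w1 i)%:E.
Hypothesis ew2 : forall i, m2 (e2 i) = (w2 i)%:E.
Hypothesis ew3 : forall i, m3 (e3 i) = (w3 i)%:E.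
Hypothesis de1 : forall i j, i != j -> e1 i `&` e1 j = set0.
Hypothesis de2 : forall i j, i != j -> e2 i `&` e2 j = set0.
Hypothesis de3 : forall i j, i != j -> e3 i `&` e3 j = set0.
Hypothesis avg : forall i j k, \int[m2 \x m13]_p
  (\1_(e2 j) p.1 * (\1_(e1 i) p.2.1 * \1_(e3 k) p.2.2) * F p.2.1 p.1 p.2.2)%:E
  = (A i j k * (w1 i * w2 j * w3 k))%:E.

Let w10 i : (0 <= w1 i)%R. Proof. by rewrite -lee_fin -ew1. Qed.
Let w30 i : (0 <= w3 i)%R. Proof. by rewrite -lee_fin -ew3. Qed.

(** z is integrated, g is shared, t and s are free: the integral over g is the squared norm of a
    contraction of F with itself. *)
Definition contraction_sqr (g : T2) : \bar R :=
  \int[m3]_t \int[m3]_s (\int[m1]_z (F z g t * F z g s)%:E) ^+ 2.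

Lemma contraction_sqr_ge0 g : 0 <= contraction_sqr g.
Proof. by do 2![apply: integral_ge0 => ? _]; exact: sqre_ge0. Qed.

Lemma measurable_contraction_sqr : measurable_fun setT contraction_sqr.
Proof.
apply: (@measurable_integral_r _ _ T2 T3 R m3 (fun g t =>
  \int[m3]_s (\int[m1]_z (F z g t * F z g s)%:E) ^+ 2)).
apply: (@measurable_integral_r _ _ (T2 * T3)%type T3 R m3 (fun p s =>
  (\int[m1]_z (F z p.1 p.2 * F z p.1 s)%:E) ^+ 2)).
under eq_fun do rewrite expe2.
have mK : measurable_fun [set: (T2 * T3) * T3]
    (fun q => \int[m1]_z (F z q.1.1 q.1.2 * F z q.1.1 q.2)%:E).
  apply: (@measurable_integral_r _ _ ((T2 * T3) * T3)%type T1 R m1 (fun q z =>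
    (F z q.1.1 q.1.2 * F z q.1.1 q.2)%:E)).
  have m11 : measurable_fun [set: ((T2 * T3) * T3) * T1] (fun r => r.1.1.1).
    by do 2![apply: measurableT_comp => //].
  have m12 : measurable_fun [set: ((T2 * T3) * T3) * T1] (fun r => r.1.1.2).
    by do 2![apply: measurableT_comp => //].
  have m2' : measurable_fun [set: ((T2 * T3) * T3) * T1] (fun r => r.1.2).
    by apply: measurableT_comp.
  have mm (u : ((T2 * T3) * T3) * T1 -> T3) : measurable_fun setT u ->
      measurable_fun setT (fun r : ((T2 * T3) * T3) * T1 => F r.2 r.1.1.1 (u r)).
    move=> mu; apply: (measurableT_comp mF (_ : measurable_fun setT
      (fun r : ((T2 * T3) * T3) * T1 => (r.1.1.1, (r.2, u r))))).
    by apply: measurable_fun_pair => //; apply: measurable_fun_pair.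
  apply/measurable_EFinP; apply: measurable_funM; exact: mm.
by apply: emeasurable_funM.
Qed.

Section OneCell.
Variable j : I2.
Let a i k := A i j k.
Let c i i' := (\sum_k w3 k * a i k * a i' k)%R.
Let S := (\sum_i \sum_i' w1 i * w1 i' * c i i' ^+ 2)%R.
Let psi i := step e3 (a i).
Let rho i := step e1 (c i).
(** For the fixed cell j, a is the matrix of averages, c = a a^T with weights and S = ||c||^2. theta
    is the step function of the matrix c a, which up to the factor 4 is the gradient of ||a a^T||^2
    at a. *)
Let theta (y : T1 * T3) : R := (\sum_i w1 i * (rho i y.1 * psi i y.2))%R.

Let mpsi i : measurable_fun setT (psi i). Proof. exact: measurable_step. Qed.
Let mrho i : measurable_fun setT (rho i). Proof. exact: measurable_step. Qed.
Let psi2 i : \int[m3]_t (psi i t ^+ 2)%:E < +oo.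
Proof. by rewrite (integral_step_sqr me3 ew3 de3) ltry. Qed.
Let rho2 i : \int[m1]_z (rho i z ^+ 2)%:E < +oo.
Proof. by rewrite (integral_step_sqr me1 ew1 de1) ltry. Qed.

Let FS g := \int[m13]_y (F y.1 g y.2 ^+ 2)%:E.

Let mFg g : measurable_fun setT (fun y : T1 * T3 => F y.1 g y.2).
Proof. exact: (measurableT_comp mF (pair1_measurable g)). Qed.

Let rho_psi_integrable g i : FS g < +oo ->
  m13.-integrable setT (fun y => (rho i y.1 * psi i y.2 * F y.1 g y.2)%:E).
Proof.
move=> Fg; apply: sqr_mul_integrable => //.
  apply: measurable_funM; first exact: (measurableT_comp (mrho i) measurable_fst).
  exact: (measurableT_comp (mpsi i) measurable_snd).
rewrite (@ge0_integral_prod _ _ T1 T3 R m1 m3 (fun z t => ((rho i z * psi i t) ^+ 2)%:E)).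
- rewrite (_ : (fun z => _) = (fun z => (rho i z ^+ 2)%:E * \int[m3]_t (psi i t ^+ 2)%:E)).
    rewrite ge0_integralZr ?integral_sqr_ge0 //.
    + by rewrite lte_mul_pinfty ?integral_sqr_ge0 // ge0_fin_numE ?integral_sqr_ge0.
    + exact: measurable_sqr.
    + by move=> z _; rewrite lee_fin sqr_ge0.
  apply/funext => z; rewrite -ge0_integralZl_EFin ?sqr_ge0 //.
  + by apply: eq_integral => t _; rewrite exprMn EFinM.
  + by move=> t _; rewrite lee_fin sqr_ge0.
  + exact: measurable_sqr.
- apply: measurable_sqr.
  apply: measurable_funM; first exact: (measurableT_comp (mrho i) measurable_fst).
  exact: (measurableT_comp (mpsi i) measurable_snd).
- by move=> z t; rewrite lee_fin sqr_ge0.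
Qed.

Let kernel_step : \int[m3]_t \int[m3]_s ((\sum_i w1 i * (psi i t * psi i s)) ^+ 2)%:E = S%:E.
Proof.
pose b k k' := (\sum_i w1 i * a i k * a i k')%R.
have E t s : ((\sum_i w1 i * (psi i t * psi i s)) = step e3 (fun k' => step e3 (b^~ k') t) s)%R.
  rewrite /step.
  under [RHS]eq_bigr => k' _ do rewrite mulr_suml.
  rewrite [RHS]exchange_big /=.
  under eq_bigr => i _ do rewrite /psi /step big_distrlr mulr_sumr /=.
  rewrite exchange_big /=; apply: eq_bigr => k _.
  under eq_bigr => i _ do rewrite mulr_sumr.
  rewrite exchange_big /=; apply: eq_bigr => k' _.
  rewrite /b mulr_suml mulr_suml; apply: eq_bigr => i _; ring.
under eq_integral => t _.
  under eq_integral => s _ do rewrite E.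
  rewrite (integral_step_sqr me3 ew3 de3); over.
under eq_integral => t _ do rewrite -sumEFin.
rewrite ge0_integral_sum //.
- rewrite /S -(gram_sum_swap w1 w3 a) exchange_big -sumEFin.
  apply: eq_bigr => k' _.
  under eq_integral => t _ do rewrite EFinM.
  rewrite ge0_integralZr ?lee_fin //.
  + rewrite (integral_step_sqr me3 ew3 de3) -EFinM mulr_suml; congr EFin.
    by apply: eq_bigr => k _; rewrite /b; ring.
  + by apply: measurable_sqr; exact: measurable_step.
  + by move=> t _; rewrite lee_fin sqr_ge0.
- move=> k'; apply/measurable_EFinP; apply: measurable_funM => //.
  by apply: measurable_funX; exact: measurable_step.
- by move=> k' t _; rewrite lee_fin mulr_ge0 ?sqr_ge0.
Qed.

(** Tangent inequality at the averages for the convex form sending F to ||F F^T||^2, with equality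
    when F is the step function of a. It combines 2 int(theta F) <= H + S with 2 H <=
    [contraction_sqr g] + S, where H is the weighted sum of the integrals of the squared sections.
    Its left side is linear in F, so it can be integrated over the cell. *)
Let cell_pointwise g : FS g < +oo ->
  4%:E * \int[m13]_y (theta y * F y.1 g y.2)%:E <= contraction_sqr g + (3 * S)%:E.
Proof.
move=> Fg.
have G2 : \int[m1]_z \int[m3]_t (F z g t ^+ 2)%:E < +oo.
  rewrite -(@ge0_integral_prod _ _ T1 T3 R m1 m3 (fun z t => (F z g t ^+ 2)%:E)) //.
    exact: measurable_sqr.
  by move=> z t; rewrite lee_fin sqr_ge0.
have Ha := @sum_section_sqr_le _ _ T1 T3 R m1 m3 (fun z t => F z g t) (mFg g) G2 I1 w1 psi
  w10 mpsi psi2.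
have Hb i := @section_weight_le _ _ T1 T3 R m1 m3 (fun z t => F z g t) (mFg g) G2 I1 psi rho
  mpsi psi2 mrho rho2 i.
have th : \int[m13]_y (theta y * F y.1 g y.2)%:E = \sum_i (w1 i)%:E *
    \int[m13]_y (rho i y.1 * (psi i y.2 * F y.1 g y.2))%:E.
  have ii i : m13.-integrable setT (fun y => (rho i y.1 * (psi i y.2 * F y.1 g y.2))%:E).
    by have := rho_psi_integrable i Fg; under eq_fun do rewrite -mulrA.
  under [RHS]eq_bigr => i _ do rewrite -integralZl //.
  rewrite -integral_sum //; last by move=> i; exact: integrableZl.
  apply: eq_integral => y _; rewrite /theta mulr_suml -sumEFin.
  by apply: eq_bigr => i _; rewrite -EFinM; congr EFin; ring.
have ir i : \int[m1]_z (rho i z ^+ 2)%:E = (\sum_i' c i i' ^+ 2 * w1 i')%:E.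
  by rewrite (integral_step_sqr me1 ew1 de1).
have Ssum : (\sum_i w1 i * \sum_i' c i i' ^+ 2 * w1 i' = S)%R.
  apply: eq_bigr => i _; rewrite mulr_sumr; apply: eq_bigr => i' _; ring.
move: Ha; rewrite kernel_step -/(contraction_sqr g); set H := \sum_i _ => Ha.
have H0 : 0 <= H.
  apply: sume_ge0 => i _; rewrite mule_ge0 ?lee_fin //.
  by apply: integral_ge0 => z _; exact: sqre_ge0.
have Hc : 2%:E * \int[m13]_y (theta y * F y.1 g y.2)%:E <= H + S%:E.
  have ii i : m13.-integrable setT (fun y => (rho i y.1 * (psi i y.2 * F y.1 g y.2))%:E).
    by have := rho_psi_integrable i Fg; under eq_fun do rewrite -mulrA.
  have fr i := fineK (integrable_fin_num measurableT (ii i)).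
  rewrite th /H -Ssum -sumEFin -big_split /=.
  rewrite (_ : 2%:E * _ = \sum_i (w1 i)%:E * (2%:E *
    \int[m13]_y (rho i y.1 * (psi i y.2 * F y.1 g y.2))%:E)); last first.
    under eq_bigr => i _ do rewrite -fr -EFinM.
    under [RHS]eq_bigr => i _ do rewrite -fr -!EFinM.
    rewrite !sumEFin -EFinM mulr_sumr; congr EFin.
    by apply: eq_bigr => i _; rewrite mulrCA.
  apply: lee_sum => i _; rewrite EFinM -ge0_muleDr.
  - by apply: lee_wpmul2l; [rewrite lee_fin | rewrite -ir].
  - by apply: integral_ge0 => z _; exact: sqre_ge0.
  - by rewrite lee_fin sumr_ge0 // => i' _; rewrite mulr_ge0 ?sqr_ge0.
have S0 : (0 <= S)%R.
  apply: sumr_ge0 => i _; apply: sumr_ge0 => i' _.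
  by apply: mulr_ge0; [exact: mulr_ge0 | exact: sqr_ge0].
rewrite (_ : 4%:E = 2%:E * 2%:E); last by rewrite -EFinM; congr EFin; ring.
rewrite -muleA; apply: (@le_trans _ _ (2%:E * (H + S%:E))).
  by apply: lee_wpmul2l; rewrite ?lee_fin.
rewrite ge0_muleDr ?lee_fin // (_ : (3 * S)%:E = S%:E + 2%:E * S%:E).
  by rewrite addeA leeD2r.
by rewrite -EFinM -EFinD; congr EFin; ring.
Qed.

(** Integrating [cell_pointwise] over the cell j: since theta is a step function and A are the
    averages of F, the left side becomes 4 w S, and 3 w S is subtracted. *)
Let one_cell_le : (w2 j * S)%:E <= \int[m2]_g ((\1_(e2 j) g)%:E * contraction_sqr g).
Proof.
have S0 : (0 <= S)%R.
  apply: sumr_ge0 => i _; apply: sumr_ge0 => i' _.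
  by apply: mulr_ge0; [exact: mulr_ge0 | exact: sqr_ge0].
have mFF : measurable_fun setT (fun p : T2 * (T1 * T3) => F p.2.1 p.1 p.2.2) by exact: mF.
have m21 : measurable_fun [set: T2 * (T1 * T3)] (fun p => p.2.1) by exact: measurableT_comp.
have m22 : measurable_fun [set: T2 * (T1 * T3)] (fun p => p.2.2) by exact: measurableT_comp.
pose q (p : I1 * (I1 * I3)) := (w1 p.1 * c p.1 p.2.1 * a p.1 p.2.2)%R.
pose E (p : I1 * (I1 * I3)) (x : T2 * (T1 * T3)) : R :=
  (\1_(e2 j) x.1 * (\1_(e1 p.2.1) x.2.1 * \1_(e3 p.2.2) x.2.2) * F x.2.1 x.1 x.2.2)%R.
have mind (p : I1 * (I1 * I3)) : measurable_fun [set: T2 * (T1 * T3)]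
    (fun x => \1_(e2 j) x.1 * (\1_(e1 p.2.1) x.2.1 * \1_(e3 p.2.2) x.2.2) : R)%R.
  apply: measurable_funM; first exact: measurable_indic_comp.
  by apply: measurable_funM; apply: measurable_indic_comp.
have iE p : (m2 \x m13).-integrable setT (EFin \o E p).
  apply: sqr_mul_integrable => //.
  rewrite (_ : (fun x => _) = (fun x => (\1_(e2 j `*` (e1 p.2.1 `*` e3 p.2.2)) x)%:E)).
    rewrite integral_indic ?setIT //; last by do 2!apply: measurableX => //.
    have E1 : (m1 \x m3)%E (e1 p.2.1 `*` e3 p.2.2) = (w1 p.2.1)%:E * (w3 p.2.2)%:E.
      by rewrite product_measure1E // -ew1 -ew3.
    have E2 : (m2 \x m13)%E (e2 j `*` (e1 p.2.1 `*` e3 p.2.2))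
        = (w2 j)%:E * ((w1 p.2.1)%:E * (w3 p.2.2)%:E).
      rewrite product_measure1E //; last exact: measurableX.
      by congr (_ * _); [exact: ew2 | exact: E1].
    rewrite -[X in X < _]/((m2 \x m13)%E (e2 j `*` (e1 p.2.1 `*` e3 p.2.2))) E2.
    by rewrite -!EFinM ltry.
  apply/funext => x; rewrite !indicE !in_setX.
  by case: (_ \in _); case: (_ \in _); case: (_ \in _); rewrite /= ?mulr1 ?mulr0 ?mul0r ?expr1n ?expr0n.
have thE (x : T2 * (T1 * T3)) : (\1_(e2 j) x.1 * (theta x.2 * F x.2.1 x.1 x.2.2) = \sum_p q p * E p x)%R.
  rewrite -(pair_bigA _ (fun i r => q (i, r) * E (i, r) x)%R) /= /theta mulr_suml mulr_sumr.
  apply: eq_bigr => i _; rewrite -(pair_bigA _ (fun i' k => q (i, (i', k)) * E (i, (i', k)) x)%R) /=.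
  rewrite /rho /psi /step big_distrlr /= mulr_sumr mulr_suml mulr_sumr; apply: eq_bigr => i' _.
  rewrite mulr_sumr mulr_suml mulr_sumr; apply: eq_bigr => k _; rewrite /q /E /=; ring.
have iqE p : (m2 \x m13).-integrable setT (fun x => (q p * E p x)%:E).
  exact: (integrableZl measurableT (q p) (iE p)).
have iN : (m2 \x m13).-integrable setT
    (fun x => (\1_(e2 j) x.1 * (theta x.2 * F x.2.1 x.1 x.2.2))%:E).
  under eq_fun do rewrite thE -sumEFin.
  by apply: integrable_sum => // p _; exact: iqE.
have mth : measurable_fun setT (fun x : T2 * (T1 * T3) => theta x.2 * F x.2.1 x.1 x.2.2)%R.
  apply: measurable_funM => //; apply: measurable_sum => i; apply: measurable_funM => //.
  apply: measurable_funM; first exact: (measurableT_comp (mrho i) m21).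
  exact: (measurableT_comp (mpsi i) m22).
have mi2 : measurable_fun setT (\1_(e2 j) : T2 -> R) by [].
have iw := @fubini_weight_integrable _ _ T2 (T1 * T3)%type R m2 m13 (\1_(e2 j))
  (fun g y => theta y * F y.1 g y.2)%R mi2 mth iN.
have vE : \int[m2]_g ((\1_(e2 j) g)%:E * \int[m13]_y (theta y * F y.1 g y.2)%:E) = (w2 j * S)%:E.
  rewrite (@fubini_weight _ _ T2 (T1 * T3)%type R m2 m13 (\1_(e2 j))
    (fun g y => theta y * F y.1 g y.2)%R mi2 mth iN).
  transitivity (\int[m2 \x m13]_x (\1_(e2 j) x.1 * (theta x.2 * F x.2.1 x.1 x.2.2))%:E).
    by rewrite -(integral21_prod_meas1 iN).
  under eq_integral => x _ do rewrite thE -sumEFin.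
  rewrite (integral_sum measurableT iqE).
  rewrite (_ : (w2 j * S)%R = (\sum_p q p * (A p.2.1 j p.2.2 * (w1 p.2.1 * w2 j * w3 p.2.2)))%R).
    rewrite -sumEFin; apply: eq_bigr => p _.
    under eq_integral => x _ do rewrite EFinM.
    rewrite (integralZl measurableT (iE p)) (_ : \int[_]_(x in _) _ = (A p.2.1 j p.2.2 * (w1 p.2.1 * w2 j * w3 p.2.2))%:E) //.
    exact: avg.
  rewrite -(pair_bigA _ (fun i p => q (i, p) * (A p.1 j p.2 * (w1 p.1 * w2 j * w3 p.2)))%R) /=.
  rewrite /S mulr_sumr; apply: eq_bigr => i _.
  rewrite -(pair_bigA _ (fun i' k => q (i, (i', k)) * (A i' j k * (w1 i' * w2 j * w3 k)))%R) /=.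
  rewrite mulr_sumr; apply: eq_bigr => i' _.
  rewrite /q /= (_ : (c i i' ^+ 2 = c i i' * \sum_k w3 k * a i k * a i' k)%R) ?expr2 //.
  transitivity (\sum_k w2 j * (w1 i * w1 i' * (c i i' * (w3 k * a i k * a i' k))))%R.
    by rewrite -!mulr_sumr.
  by apply: eq_bigr => k _; rewrite /a; ring.
have mPhi := measurable_contraction_sqr.
have ineq : 4%:E * (w2 j * S)%:E <=
    \int[m2]_g ((\1_(e2 j) g)%:E * contraction_sqr g + (3 * S * \1_(e2 j) g)%:E).
  rewrite -vE -integralZl //; apply: integral_le_ge0_ae.
  - apply: emeasurable_funM => //; by have /integrableP[] := iw.
  - apply: emeasurable_funD; first by apply: emeasurable_funM => //; exact/measurable_EFinP.
    by apply/measurable_EFinP; apply: measurable_funM.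
  - by move=> g; rewrite adde_ge0 ?mule_ge0 ?contraction_sqr_ge0 ?lee_fin ?mulr_ge0.
  have iF : (m2 \x m13).-integrable setT (fun p => (F p.2.1 p.1 p.2.2 ^+ 2)%:E).
    apply/integrableP; split; first exact: measurable_sqr.
    by under eq_integral => p _ do rewrite gee0_abs ?lee_fin ?sqr_ge0 //.
  have := ae_integrable1 iF; apply: filterS => g /integrableP[_].
  under eq_integral => p _ do rewrite gee0_abs ?lee_fin ?sqr_ge0 //.
  move=> Fg; rewrite indicE; case: (g \in e2 j); rewrite ?mul1e ?mulr1; last first.
    by rewrite !mul0e mule0 mulr0 add0e.
  exact: cell_pointwise.
move: ineq; rewrite ge0_integralD //; first last.
- by apply/measurable_EFinP; apply: measurable_funM.
- by move=> g _; rewrite lee_fin !mulr_ge0.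
- by apply: emeasurable_funM => //; exact/measurable_EFinP.
- by move=> g _; rewrite mule_ge0 ?contraction_sqr_ge0 ?lee_fin.
have -> : \int[m2]_g (3 * S * \1_(e2 j) g)%:E = (3 * (w2 j * S))%:E.
  under eq_integral => g _ do rewrite EFinM.
  rewrite ge0_integralZl_EFin ?mulr_ge0 //; last exact/measurable_EFinP.
  rewrite (_ : \int[m2]_g (\1_(e2 j) g)%:E = (w2 j)%:E); last first.
    by rewrite integral_indic ?setIT //; exact: ew2.
  by rewrite -EFinM; congr EFin; ring.
rewrite -EFinM -leeBlDr // -EFinB.
by rewrite (_ : 4 * _ - _ = w2 j * S)%R //; ring.
Qed.

Lemma cell_gram_le :
  (w2 j * (\sum_k \sum_k' w3 k * w3 k' * (\sum_i w1 i * A i j k * A i j k') ^+ 2))%:E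
  <= \int[m2]_g ((\1_(e2 j) g)%:E * contraction_sqr g).
Proof. by rewrite (gram_sum_swap w1 w3 (fun i k => A i j k)); exact: one_cell_le. Qed.

End OneCell.

Lemma box_le_contraction :
  (\sum_j w2 j * (\sum_k \sum_k' w3 k * w3 k' * (\sum_i w1 i * A i j k * A i j k') ^+ 2))%:E
  <= \int[m2]_g contraction_sqr g.
Proof.
have mPhi := measurable_contraction_sqr.
have mi j : measurable_fun setT (fun g => (\1_(e2 j) g)%:E * contraction_sqr g).
  by apply: emeasurable_funM => //; exact/measurable_EFinP.
have i0 j g : 0 <= (\1_(e2 j) g)%:E * contraction_sqr g.
  by rewrite mule_ge0 ?contraction_sqr_ge0 ?lee_fin.
apply: (@le_trans _ _ (\int[m2]_g (\sum_j (\1_(e2 j) g)%:E * contraction_sqr g))).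
  by rewrite ge0_integral_sum // -sumEFin; apply: lee_sum => j _; exact: cell_gram_le.
apply: ge0_le_integral => //.
- by move=> g _; rewrite sume_ge0.
- exact: emeasurable_sum.
move=> g _; have [[j ej]|no] := pselect (exists j, e2 j g).
  rewrite (bigD1 j) //= big1 ?adde0 => [|k kj].
    by rewrite indicE mem_set // mul1e.
  rewrite indicE memNset ?mul0e // => ek; have := de2 kj; move/seteqP => [/(_ g)] + _.
  by apply; split.
rewrite big1 ?contraction_sqr_ge0 // => j _.
by rewrite indicE memNset ?mul0e // => ej; apply: no; exists j.
Qed.

End Box.

Lemma integral_indicT d (T : measurableType d) (R : realType) (m : {measure set T -> \bar R})
  (e : set T) : measurable e -> \int[m]_t (\1_e t)%:E = m e.
Proof. by move=> me; rewrite integral_indic // setIT. Qed.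

Section StepDistance.
Context d (T : measurableType d) (R : realType) (m : {measure set T -> \bar R}).
Variables (I : finType) (e : I -> set T) (w : I -> R).
Hypothesis me : forall i, measurable (e i).
Hypothesis ew : forall i, m (e i) = (w i)%:E.
Hypothesis de : forall i j, i != j -> e i `&` e j = set0.
Variables (f : T -> R) (A : I -> R).
Hypothesis mf : measurable_fun setT f.
Hypothesis f2 : \int[m]_t (f t ^+ 2)%:E < +oo.
Hypothesis avg : forall i, \int[m]_t (\1_(e i) t * f t)%:E = (A i * w i)%:E.

Lemma cell_integrable i : m.-integrable setT (fun t => (\1_(e i) t * f t)%:E).
Proof.
apply: sqr_mul_integrable => //.
rewrite (_ : \int[_]_(_ in _) _ = m (e i)); last first.
  rewrite -(integral_indicT m (me i)).
  by apply: eq_integral => x _; rewrite indicE; case: (_ \in _); rewrite ?expr1n ?expr0n.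
by rewrite ew ltry.
Qed.

(** The square is expanded; tested against a step function, f enters only through its cell averages
    A. *)
Lemma step_distance G : \int[m]_t ((f t - step e G t) ^+ 2)%:E
  = (fine (\int[m]_t (f t ^+ 2)%:E) + \sum_i w i * (G i ^+ 2 - 2 * (G i * A i)))%:E.
Proof.
have iF : m.-integrable setT (fun t => (f t ^+ 2)%:E).
  apply/integrableP; split; first exact: measurable_sqr.
  by under eq_integral => p _ do rewrite gee0_abs ?lee_fin ?sqr_ge0 //.
have iS : m.-integrable setT (fun t => (step e G t ^+ 2)%:E).
  apply/integrableP; split; first by apply: measurable_sqr; exact: measurable_step.
  under eq_integral => p _ do rewrite gee0_abs ?lee_fin ?sqr_ge0 //.
  by rewrite (integral_step_sqr me ew de) ltry.
have ic i : m.-integrable setT (fun t => ((- 2 * G i) * (\1_(e i) t * f t))%:E).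
  exact: (integrableZl measurableT (- 2 * G i)%R (cell_integrable i)).
have iC : m.-integrable setT (fun t => (\sum_i (- 2 * G i) * (\1_(e i) t * f t))%:E).
  rewrite (_ : (fun t => _) = fun t => \sum_i ((- 2 * G i) * (\1_(e i) t * f t))%:E).
    exact: integrable_sum.
  by apply/funext => t; rewrite sumEFin.
have -> : (fun t => ((f t - step e G t) ^+ 2)%:E) = (fun t => (f t ^+ 2)%:E +
    ((\sum_i (- 2 * G i) * (\1_(e i) t * f t))%:E + (step e G t ^+ 2)%:E)).
  apply/funext => t; rewrite -!EFinD; congr EFin.
  have -> : (\sum_i (- 2 * G i) * (\1_(e i) t * f t) = - 2 * (step e G t * f t))%R.
    by rewrite /step mulr_suml mulr_sumr; apply: eq_bigr => i _; ring.
  ring.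
rewrite integralD //; last exact: integrableD.
rewrite integralD // (integral_step_sqr me ew de).
under [X in _ + (X + _)]eq_integral => t _ do rewrite -sumEFin.
rewrite integral_sum //.
under [X in _ + (X + _)]eq_bigr => i _.
  rewrite (_ : \int[m]_t _ = (- 2 * G i)%:E * (A i * w i)%:E); last first.
    by rewrite -avg -(integralZl measurableT (cell_integrable i)).
  rewrite -EFinM.
  over.
rewrite sumEFin -[X in X + _](fineK (integrable_fin_num measurableT iF)) -!EFinD.
congr EFin; congr (_ + _)%R; rewrite -big_split /=; apply: eq_bigr => i _; ring.
Qed.

Lemma step_average_le : (\sum_i w i * A i ^+ 2)%:E <= \int[m]_t (f t ^+ 2)%:E.
Proof.
have iF : m.-integrable setT (fun t => (f t ^+ 2)%:E).
  apply/integrableP; split; first exact: measurable_sqr.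
  by under eq_integral => p _ do rewrite gee0_abs ?lee_fin ?sqr_ge0 //.
have := integral_sqr_ge0 m (fun t => f t - step e A t)%R; rewrite step_distance.
rewrite -[X in _ -> _ <= X](fineK (integrable_fin_num measurableT iF)) !lee_fin.
rewrite -[in X in _ -> X]subr_ge0 -sumrN; congr (0 <= _)%R; congr (_ + _)%R.
by apply: eq_bigr => i _; ring.
Qed.

(* The averages are the L^2 projection of f on the step functions. *)
Lemma step_average_near G : (\sum_i w i * (G i - A i) ^+ 2)%:E
  <= \int[m]_t ((f t - step e G t) ^+ 2)%:E.
Proof.
have iF : m.-integrable setT (fun t => (f t ^+ 2)%:E).
  apply/integrableP; split; first exact: measurable_sqr.
  by under eq_integral => p _ do rewrite gee0_abs ?lee_fin ?sqr_ge0 //.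
rewrite step_distance; have := step_average_le.
rewrite -[X in _ <= X -> _](fineK (integrable_fin_num measurableT iF)) !lee_fin -subr_ge0.
move=> h; rewrite -subr_ge0; apply: le_trans h _; rewrite le_eqVlt; apply/orP; left.
apply/eqP; rewrite -addrA; congr (_ + _)%R; rewrite -!sumrN -big_split /=.
by apply: eq_bigr => i _; ring.
Qed.

Lemma average_dist_le G : \int[m]_t ((f t - step e A t) ^+ 2)%:E
  <= \int[m]_t ((f t - step e G t) ^+ 2)%:E.
Proof.
rewrite !step_distance lee_fin lerD2l; apply: ler_sum => i _.
have w0 : (0 <= w i)%R by rewrite -lee_fin -ew.
apply: ler_wpM2l => //; rewrite -subr_ge0.
rewrite (_ : _ - _ = (G i - A i) ^+ 2)%R ?sqr_ge0 //; ring.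
Qed.

End StepDistance.

(** * Averages over products of cells *)

Section Boxes.
Context d (Z : measurableType d) (R : realType).
Variable mu : {sigma_finite_measure set Z -> \bar R}.
Variables (C : finType) (cell : C -> set Z) (W : C -> R).
Hypothesis mcell : forall c, measurable (cell c).
Hypothesis cellW : forall c, mu (cell c) = (W c)%:E.
Hypothesis dcell : forall c c', c != c' -> cell c `&` cell c' = set0.

Fixpoint box (s : seq C) : set (seq Z) := fun t =>
  match s, t with
  | [::], [::] => True
  | c :: s', z :: t' => cell c z /\ box s' t'
  | _, _ => False
  end.

Definition tbox n (s : seq C) : set (n.-tuple Z) := [set t | box s t].
Definition weight (s : seq C) : R := (\prod_(c <- s) W c)%R.

Lemma tboxE n s (t : n.-tuple Z) : \1_(tbox s) t = \1_(box s) t :> R.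
Proof. by rewrite !indicE; congr (nat_of_bool _)%:R; apply/idP/idP; rewrite !in_setE. Qed.

Lemma box_size s t : box s t -> size s = size t.
Proof. by elim: s t => [|c s IH] [|z t] //= [_ /IH ->]. Qed.

Lemma box_cons c s z t : \1_(box (c :: s)) (z :: t) = (\1_(cell c) z * \1_(box s) t)%R :> R.
Proof.
rewrite !indicE -natrM mulnb; congr (nat_of_bool _)%:R.
by apply/idP/andP; rewrite !in_setE.
Qed.

Lemma box_nil : \1_(box [::]) [::] = 1%R :> R.
Proof. by rewrite indicE mem_set. Qed.

Lemma box_cat s s' t t' : size s = size t ->
  \1_(box (s ++ s')) (t ++ t') = (\1_(box s) t * \1_(box s') t')%R :> R.
Proof.
elim: s t => [|c s IH] [|z t] //=; first by rewrite box_nil mul1r.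
by move=> [] /IH e; rewrite !box_cons e mulrA.
Qed.

Lemma seq_measurable_box s : seq_measurable (\1_(box s) : seq Z -> R).
Proof.
elim: s => [|c s IH] n.
  case: n => [|n].
    rewrite (_ : (fun t : 0.-tuple Z => _) = cst 1%R); first exact: measurable_cst.
    by apply/funext => t; rewrite tuple0 /= box_nil.
  rewrite (_ : (fun t : n.+1.-tuple Z => _) = cst 0%R); first exact: measurable_cst.
  by apply/funext => t; rewrite indicE memNset // => /box_size /esym; rewrite size_tuple.
case: n => [|n].
  rewrite (_ : (fun t : 0.-tuple Z => _) = cst 0%R); first exact: measurable_cst.
  by apply/funext => t; rewrite indicE memNset // => /box_size; rewrite size_tuple.
rewrite (_ : (fun t : n.+1.-tuple Z => _) = (fun t : n.+1.-tuple Z =>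
   \1_(cell c) (thead t) * \1_(box s) [tuple of behead t])%R); last first.
  by apply/funext => t; case/tupleP: t => z t; rewrite box_cons theadE.
apply: measurable_funM.
  apply: (measurable_indic_comp (mcell c)); exact: measurable_tnth.
have mb := @measurable_behead _ Z n.
exact: (measurableT_comp (IH n) mb).
Qed.

Lemma measurable_tbox n (s : seq C) : measurable (@tbox n s).
Proof.
rewrite (_ : tbox s = (fun t : n.-tuple Z => \1_(box s) t) @^-1` [set 1%R : R]).
  by rewrite -[X in measurable X]setTI; exact: seq_measurable_box.
apply/seteqP; split => t /=; first by move=> st; rewrite indicE mem_set.
by rewrite indicE; case: (boolP (_ \in _)); rewrite ?in_setE // => _ /eqP; rewrite eq_sym oner_eq0.
Qed.

Lemma integral_box s : \int[mpow mu (size s)]_t (\1_(box s) t)%:E = (weight s)%:E.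
Proof.
elim: s => [|c s IH].
  rewrite (@integral_mpow0 _ _ _ mu (fun t => (\1_(box [::]) t)%:E)).
    by rewrite box_nil /weight big_nil.
  by move=> n; apply/measurable_EFinP; exact: seq_measurable_box.
rewrite (@ge0_integral_mpow_cons _ _ _ mu _ (fun t => (\1_(box (c :: s)) t)%:E)).
- under eq_integral => z _.
    under eq_integral => t _ do rewrite box_cons EFinM.
    rewrite ge0_integralZl_EFin //; last by apply/measurable_EFinP; exact: seq_measurable_box.
    rewrite IH -EFinM mulrC EFinM.
    over.
  rewrite ge0_integralZl_EFin //.
  + rewrite (_ : \int[mu]_x (\1_(cell c) x)%:E = (W c)%:E); last first.
      by rewrite integral_indicT //; exact: cellW.
    by rewrite -EFinM mulrC /weight big_cons.
  + exact/measurable_EFinP.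
  + by apply: prodr_ge0 => a _; rewrite -lee_fin -cellW.
- by move=> n; apply/measurable_EFinP; exact: seq_measurable_box.
- by move=> t; rewrite lee_fin.
Qed.

Lemma tbox_weight n (s : n.-tuple C) : mpow mu n (tbox s) = (weight s)%:E.
Proof.
have := integral_box s; rewrite size_tuple => <-.
rewrite -(integral_indicT (mpow mu n) (@measurable_tbox n s)).
by apply: eq_integral => t _; rewrite tboxE.
Qed.

Lemma box_disjoint s s' t : box s t -> box s' t -> s = s'.
Proof.
elim: s s' t => [|c s IH] [|c' s'] [|z t] //= [cz st] [cz' st'].
have -> := IH _ _ st st'; congr (_ :: _); apply/eqP; apply/negPn/negP => /dcell.
by move/seteqP => [/(_ z)] + _; apply.
Qed.

Lemma tbox_disjoint n (s s' : n.-tuple C) : s != s' -> @tbox n s `&` tbox s' = set0.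
Proof.
move=> ss'; apply/seteqP; split => // t [st st'].
by move/eqP: ss'; apply; apply: val_inj; exact: box_disjoint st st'.
Qed.

Section Average.
Variable K : seq Z -> R.
Hypothesis mK : seq_measurable K.
Hypothesis K2 : forall n, \int[mpow mu n]_t (K t ^+ 2)%:E < +oo.

(** On a box of weight zero the quotient is 0, which is consistent with [averageP] since the
    integral over a null box vanishes. *)
Definition average (s : seq C) : R :=
  (fine (\int[mpow mu (size s)]_t (\1_(box s) t * K t)%:E) / weight s)%R.

Lemma box_integrable n (s : n.-tuple C) :
  (mpow mu n).-integrable setT (fun t => (\1_(box s) t * K t)%:E).
Proof.
have := cell_integrable (fun s : n.-tuple C => measurable_tbox s) (@tbox_weight n) (@mK n) (K2 n) s.
by apply: eq_integrable => // t _; rewrite tboxE.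
Qed.

Lemma averageP n (s : n.-tuple C) :
  \int[mpow mu n]_t (\1_(box s) t * K t)%:E = (average s * weight s)%:E.
Proof.
have Es := size_tuple s.
rewrite /average Es; have [w0|w0] := eqVneq (weight s) 0%R; last first.
  by rewrite divfK // fineK // (integrable_fin_num measurableT (box_integrable s)).
rewrite w0 invr0 !mulr0.
transitivity (\int[mpow mu n]_(t in tbox s) (K t)%:E); last rewrite null_set_integral //.
- rewrite [RHS]integral_mkcond; apply: eq_integral => t _.
  rewrite patchE indicE; case: ifPn.
    by rewrite in_setE => st; rewrite mem_set // mul1r.
  by move=> st; rewrite memNset ?mul0r // => st'; move/negP: st; apply; rewrite in_setE.
- exact: measurable_tbox.
- by apply: measurable_funTS; apply/measurable_EFinP; exact: mK.
- by rewrite -[RHS]/(0%:E) -w0; exact: tbox_weight.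
Qed.

End Average.
End Boxes.

Section BlockSplit.
Context d (Z : measurableType d) (R : realType).
Variable mu : {sigma_finite_measure set Z -> \bar R}.
Variables (l g u : nat).
Let mlu := [the {sigma_finite_measure set (l.-tuple Z * u.-tuple Z)%type -> \bar R}
  of sigma_finite_prod (mpow mu l) (mpow mu u)].

Lemma measurable_cat3 : measurable_fun [set: g.-tuple Z * (l.-tuple Z * u.-tuple Z)]
  (fun p => [tuple of p.2.1 ++ [tuple of p.1 ++ p.2.2]]).
Proof.
have m21 : measurable_fun [set: g.-tuple Z * (l.-tuple Z * u.-tuple Z)] (fun p => p.2.1).
  exact: measurableT_comp.
have m22 : measurable_fun [set: g.-tuple Z * (l.-tuple Z * u.-tuple Z)] (fun p => p.2.2).
  exact: measurableT_comp.
have mgu : measurable_fun [set: g.-tuple Z * (l.-tuple Z * u.-tuple Z)]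
    (fun p => [tuple of p.1 ++ p.2.2]).
  exact: (measurableT_comp (@measurable_cat_tuple _ Z g u) (measurable_fun_pair measurable_fst m22)).
exact: (measurableT_comp (@measurable_cat_tuple _ Z l (g + u)) (measurable_fun_pair m21 mgu)).
Qed.

Lemma seq_measurable_cat3 d' (T : measurableType d') (phi : seq Z -> T) : seq_measurable phi ->
  measurable_fun [set: g.-tuple Z * (l.-tuple Z * u.-tuple Z)]
    (fun p => phi (p.2.1 ++ p.1 ++ p.2.2)).
Proof.
by move=> mphi; exact: (measurableT_comp (@mphi (l + (g + u))%N) measurable_cat3).
Qed.

(** Fubini with the middle block outermost: the shared variables come first, and the integrated and
    free ones form a pair, the arrangement in which [box_le_contraction] is stated. *)
Lemma ge0_integral_mpow_split (phi : seq Z -> \bar R) :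
  seq_measurable phi -> (forall s, 0 <= phi s) ->
  \int[mpow mu (l + (g + u))]_t phi t
  = \int[mpow mu g \x mlu]_p phi (p.2.1 ++ p.1 ++ p.2.2).
Proof.
move=> mphi phi0; rewrite ge0_integral_mpow_cat //.
pose h (x : l.-tuple Z) (y : g.-tuple Z) := \int[mpow mu u]_z phi (x ++ y ++ z).
transitivity (\int[mpow mu l]_x \int[mpow mu g]_y h x y).
  apply: eq_integral => x _; rewrite (@ge0_integral_mpow_cat _ _ _ mu g u (fun s => phi (x ++ s))) //.
  exact: seq_measurable_catl.
have mh : measurable_fun setT (fun p : l.-tuple Z * g.-tuple Z => h p.1 p.2).
  rewrite /h; under eq_fun do under eq_integral => z _ do rewrite catA.
  pose k (s : (l + g).-tuple Z) := \int[mpow mu u]_z phi (s ++ z).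
  have mk : measurable_fun setT k.
    apply: (@measurable_integral_r _ _ _ _ _ (mpow mu u)
      (fun (s : (l + g).-tuple Z) (z : u.-tuple Z) => phi (s ++ z))).
    exact: seq_measurable_cat.
  exact: (measurableT_comp mk (@measurable_cat_tuple _ Z l g)).
rewrite (@ge0_integral_exchange _ _ _ _ _ (mpow mu l) (mpow mu g) h) //; last first.
  by move=> x y; exact: integral_ge0.
have m3 := seq_measurable_cat3 mphi.
rewrite (@ge0_integral_prod _ _ _ _ _ (mpow mu g) mlu (fun y p => phi (p.1 ++ y ++ p.2))) //.
apply: eq_integral => y _; symmetry.
apply: (@ge0_integral_prod _ _ _ _ _ (mpow mu l) (mpow mu u) (fun x z => phi (x ++ y ++ z))) => //.
exact: (measurableT_comp m3 (@pair1_measurable _ _ (g.-tuple Z) (l.-tuple Z * u.-tuple Z)%type y)).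
Qed.

Lemma integral_mpow_split (phi : seq Z -> \bar R) : seq_measurable phi ->
  \int[mpow mu (l + (g + u))]_t phi t
  = \int[mpow mu g \x mlu]_p phi (p.2.1 ++ p.1 ++ p.2.2).
Proof.
move=> mphi; rewrite integralE [RHS]integralE; congr (_ - _).
- have := ge0_integral_mpow_split (seq_measurable_funepos mphi) (funepos_ge0 phi).
  by rewrite unlock.
- have := ge0_integral_mpow_split (seq_measurable_funeneg mphi) (funeneg_ge0 phi).
  by rewrite unlock.
Qed.

End BlockSplit.

Section AverageBounds.
Context d (Z : measurableType d) (R : realType).
Variable mu : {sigma_finite_measure set Z -> \bar R}.
Variables (C : finType) (cell : C -> set Z) (W : C -> R).
Hypothesis mcell : forall c, measurable (cell c).
Hypothesis cellW : forall c, mu (cell c) = (W c)%:E.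
Hypothesis dcell : forall c c', c != c' -> cell c `&` cell c' = set0.
Variable K : seq Z -> R.
Hypothesis mK : seq_measurable K.
Hypothesis K2 : forall n, \int[mpow mu n]_t (K t ^+ 2)%:E < +oo.
Let fb := average mu cell W K.

Let wE n : forall s : n.-tuple C, mpow mu n (tbox cell s) = (weight W s)%:E.
Proof. by move=> s; exact: tbox_weight. Qed.

Lemma weight_cat s t : weight W (s ++ t) = (weight W s * weight W t)%R.
Proof. by rewrite /weight big_cat. Qed.

Lemma gram4_le_contraction l g u : (gram4 W fb l g u u)%:E
  <= \int[mpow mu g]_x \int[mpow mu u]_t \int[mpow mu u]_s
       (\int[mpow mu l]_z (K (z ++ x ++ t) * K (z ++ x ++ s))%:E) ^+ 2.
Proof.
pose F (z : l.-tuple Z) (x : g.-tuple Z) (t : u.-tuple Z) := K (z ++ x ++ t).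
pose A (i : l.-tuple C) (j : g.-tuple C) (k : u.-tuple C) := fb (i ++ j ++ k).
pose e n (i : n.-tuple C) : set (n.-tuple Z) := tbox cell i.
have me n i : measurable (@e n i) by exact: measurable_tbox.
have de n (i j : n.-tuple C) : i != j -> e n i `&` e n j = set0 by exact: tbox_disjoint.
have := @box_le_contraction _ _ _ _ _ _ R (mpow mu l) (mpow mu g) (mpow mu u) F
  (@seq_measurable_cat3 _ Z l g u _ _ _ mK) _ _ _ _ (@e l) (@e g) (@e u) _ _ _ A
  (@me l) (@me g) (@me u) (@wE l) (@wE g) (@wE u) (@de l) (@de g) (@de u).
rewrite (_ : (\sum_j _)%R = gram4 W fb l g u u).
  apply.
    rewrite -(@ge0_integral_mpow_split _ _ _ mu l g u (fun t => (K t ^+ 2)%:E)) //.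
      by move=> n; apply: measurable_sqr; exact: mK.
    by move=> s; rewrite lee_fin sqr_ge0.
  move=> i j k.
  have := averageP mcell cellW mK K2 [tuple of i ++ [tuple of j ++ k]].
  rewrite (@integral_mpow_split _ _ _ mu l g u (fun t => (\1_(box cell (i ++ j ++ k)) t * K t)%:E)).
    rewrite /A /= !weight_cat => E.
    transitivity (fb (i ++ j ++ k) * (weight W i * (weight W j * weight W k)))%:E; last first.
      by congr EFin; ring.
    rewrite -E; apply: eq_integral => p _; congr EFin.
    by rewrite !box_cat ?size_tuple // !tboxE /F; ring.
  move=> n; apply/measurable_EFinP; apply: measurable_funM; last exact: mK.
  exact: seq_measurable_box.
rewrite /gram4 tsum_tuple; apply: eq_bigr => j _; rewrite /weight; congr (_ * _)%R.
rewrite tsum_tuple; apply: eq_bigr => k _.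
rewrite tsum_tuple mulr_sumr; apply: eq_bigr => k' _; rewrite mulrA; congr (_ * _ ^+ 2)%R.
rewrite tsum_tuple; apply: eq_bigr => i _; rewrite /A; ring.
Qed.

End AverageBounds.

Lemma integral_prod_swap dX dY (X : measurableType dX) (Y : measurableType dY) (R : realType)
    (mX : {sigma_finite_measure set X -> \bar R}) (mY : {sigma_finite_measure set Y -> \bar R})
    (f : X -> Y -> \bar R) : measurable_fun setT (fun p : X * Y => f p.1 p.2) ->
  \int[mX \x mY]_p f p.1 p.2 = \int[mY \x mX]_p f p.2 p.1.
Proof.
have ge0_swap (g : X -> Y -> \bar R) : measurable_fun setT (fun p : X * Y => g p.1 p.2) ->
    (forall x y, 0 <= g x y) ->
    \int[mX \x mY]_p g p.1 p.2 = \int[mY \x mX]_p g p.2 p.1.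
  move=> mg g0.
  rewrite (@ge0_integral_prod _ _ _ _ _ mX mY g) //.
  rewrite (@ge0_integral_prod _ _ _ _ _ mY mX (fun y x => g x y)) //; last first.
    exact: (measurableT_comp mg (measurable_fun_pair measurable_snd measurable_fst)).
  exact: ge0_integral_exchange.
move=> mf; rewrite integralE [RHS]integralE; congr (_ - _).
- have mp : measurable_fun setT (fun p : X * Y => maxe (f p.1 p.2) 0).
    by have := measurable_funepos mf; rewrite unlock.
  have p0 x y : 0 <= maxe (f x y) 0 by rewrite le_max lexx orbT.
  by rewrite unlock; exact: (ge0_swap _ mp p0).
- have mp : measurable_fun setT (fun p : X * Y => maxe (- f p.1 p.2) 0).
    by have := measurable_funeneg mf; rewrite unlock.
  have p0 x y : 0 <= maxe (- f x y) 0 by rewrite le_max lexx orbT.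
  by rewrite unlock; exact: (ge0_swap _ mp p0).
Qed.

Lemma integral_mpow_nil d (Z : measurableType d) (R : realType)
    (mu : {sigma_finite_measure set Z -> \bar R}) (phi : seq Z -> \bar R) :
  \int[mpow mu 0]_t phi t = phi [::].
Proof.
rewrite -[RHS](@integral_mpow0 _ _ _ mu (fun=> phi [::])); last by move=> n; exact: measurable_cst.
by apply: eq_integral => t _; rewrite tuple0.
Qed.

Lemma discriminant_le (R : realFieldType) (a b c : R) : (0 <= a)%R ->
  (forall t, 0 <= t ^+ 2 * a + 2 * t * b + c)%R -> (b ^+ 2 <= a * c)%R.
Proof.
move=> a0 h; have [a00|an] := eqVneq a 0%R.
  have [->|b0] := eqVneq b 0%R; first by rewrite a00 mul0r expr0n.
  (* For a = 0 and b != 0 the polynomial is affine and takes the value -1 at this point. *)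
  have := h (- (c + 1) / (2 * b))%R; rewrite a00 mulr0 add0r.
  rewrite (_ : 2 * _ * b + c = - 1)%R ?oppr_ge0 ?ler10 //.
  field.
  exact: b0.
have ap : (0 < a)%R by rewrite lt_neqAle eq_sym an.
have := h (- b / a)%R.
rewrite (_ : (- b / a) ^+ 2 * a + 2 * (- b / a) * b + c = (a * c - b ^+ 2) / a)%R; last by field.
by rewrite pmulr_lge0 ?invr_gt0 // subr_ge0.
Qed.

Section SquareNorms.
Context d (T : measurableType d) (R : realType) (m : {measure set T -> \bar R}).
Implicit Types f g : T -> R.

Definition sqnorm f : R := fine (\int[m]_x (f x ^+ 2)%:E).

Lemma sqr_integrable f : measurable_fun setT f -> \int[m]_x (f x ^+ 2)%:E < +oo ->
  m.-integrable setT (fun x => (f x ^+ 2)%:E).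
Proof.
move=> mf f2; apply/integrableP; split; first exact: measurable_sqr.
by under eq_integral => p _ do rewrite gee0_abs ?lee_fin ?sqr_ge0 //.
Qed.

Lemma sqnormE f : \int[m]_x (f x ^+ 2)%:E < +oo ->
  \int[m]_x (f x ^+ 2)%:E = (sqnorm f)%:E.
Proof. by move=> f2; rewrite fineK // ge0_fin_numE ?integral_sqr_ge0. Qed.

Lemma sqnorm_ge0 f : (0 <= sqnorm f)%R.
Proof. by rewrite fine_ge0 // integral_sqr_ge0. Qed.

Lemma integral_lin_sqr f g (t : R) : measurable_fun setT f -> measurable_fun setT g ->
  \int[m]_x (f x ^+ 2)%:E < +oo -> \int[m]_x (g x ^+ 2)%:E < +oo ->
  \int[m]_x ((t * f x + g x) ^+ 2)%:E
  = (t ^+ 2 * sqnorm f + 2 * t * fine (\int[m]_x (f x * g x)%:E) + sqnorm g)%:E.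
Proof.
move=> mf mg f2 g2.
have iF := sqr_integrable mf f2; have iG := sqr_integrable mg g2.
have iFG := sqr_mul_integrable mf mg f2 g2.
have E : (fun x => ((t * f x + g x) ^+ 2)%:E) =
   (fun x => ((t ^+ 2)%:E * (f x ^+ 2)%:E + (2 * t)%:E * (f x * g x)%:E) + (g x ^+ 2)%:E).
  apply/funext => x; rewrite -!EFinM -!EFinD; congr EFin; ring.
rewrite E integralD //; last by apply: integrableD => //; exact: integrableZl.
rewrite integralD //; try exact: integrableZl.
rewrite !integralZl // -[in X in X + _ + _](fineK (integrable_fin_num measurableT iF)).
rewrite -[X in _ + _ * X + _](fineK (integrable_fin_num measurableT iFG)).
rewrite -[X in _ + X](fineK (integrable_fin_num measurableT iG)) -!EFinM -!EFinD.
by [].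
Qed.

Lemma integral_cauchy_schwarz f g : measurable_fun setT f -> measurable_fun setT g ->
  \int[m]_x (f x ^+ 2)%:E < +oo -> \int[m]_x (g x ^+ 2)%:E < +oo ->
  (fine (\int[m]_x (f x * g x)%:E) ^+ 2 <= sqnorm f * sqnorm g)%R.
Proof.
move=> mf mg f2 g2; apply: discriminant_le; first exact: sqnorm_ge0.
move=> t; rewrite -lee_fin -integral_lin_sqr //; exact: integral_sqr_ge0.
Qed.

End SquareNorms.

(** * Averaging when one kernel is contracted completely into another *)

Section StepSection.
Context dX dY (X : measurableType dX) (Y : measurableType dY) (R : realType).
Variables (mX : {sigma_finite_measure set X -> \bar R})
  (mY : {sigma_finite_measure set Y -> \bar R}).
Variable G : X -> Y -> R.
Hypothesis mG : measurable_fun setT (fun p : X * Y => G p.1 p.2).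
Hypothesis G2 : \int[mX]_s \int[mY]_z (G s z ^+ 2)%:E < +oo.
Variables (IX IY : finType) (eX : IX -> set X) (eY : IY -> set Y).
Variables (wX : IX -> R) (wY : IY -> R) (A : IY -> IX -> R).
Hypothesis meX : forall i, measurable (eX i).
Hypothesis meY : forall i, measurable (eY i).
Hypothesis ewX : forall i, mX (eX i) = (wX i)%:E.
Hypothesis ewY : forall i, mY (eY i) = (wY i)%:E.
Hypothesis deX : forall i j, i != j -> eX i `&` eX j = set0.
Hypothesis deY : forall i j, i != j -> eY i `&` eY j = set0.
Hypothesis avg : forall i k, \int[mX \x mY]_p (\1_(eX k) p.1 * \1_(eY i) p.2 * G p.1 p.2)%:E
  = (A i k * (wX k * wY i))%:E.
Variables (f : Y -> R) (a : IY -> R).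
Hypothesis mf : measurable_fun setT f.
Hypothesis f2 : \int[mY]_z (f z ^+ 2)%:E < +oo.

Let al k : R := (\sum_i wY i * a i * A i k)%R.
Let theta : R := (\sum_k wX k * al k ^+ 2)%R.
Let phi := step eY a.
Let rho := step eX al.
Let mphi : measurable_fun setT phi. Proof. exact: measurable_step. Qed.
Let phi2 : \int[mY]_z (phi z ^+ 2)%:E < +oo.
Proof. by rewrite (integral_step_sqr meY ewY deY) ltry. Qed.
Let mrho : measurable_fun setT rho. Proof. exact: measurable_step. Qed.
Let rho2E : \int[mX]_s (rho s ^+ 2)%:E = theta%:E.
Proof.
rewrite (integral_step_sqr meX ewX deX); congr EFin.
by apply: eq_bigr => k _; rewrite mulrC.
Qed.

Let mind k i : measurable_fun setT (fun p : X * Y => \1_(eX k) p.1 * \1_(eY i) p.2 : R)%R.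
Proof.
apply: measurable_funM; first exact: (measurable_indic_comp (meX k) measurable_fst).
exact: (measurable_indic_comp (meY i) measurable_snd).
Qed.

Let iG : \int[mX \x mY]_p (G p.1 p.2 ^+ 2)%:E < +oo.
Proof.
rewrite (@ge0_integral_prod _ _ _ _ _ mX mY (fun s z => (G s z ^+ 2)%:E)) //.
  exact: measurable_sqr.
by move=> s z; rewrite lee_fin sqr_ge0.
Qed.

Let E (x : IX * IY) (p : X * Y) : R := (\1_(eX x.1) p.1 * \1_(eY x.2) p.2 * G p.1 p.2)%R.

Let iE x : (mX \x mY).-integrable setT (fun p => (E x p)%:E).
Proof.
apply: sqr_mul_integrable => //.
rewrite (_ : (fun p => _) = (fun p => (\1_(eX x.1 `*` eY x.2) p)%:E)).
  rewrite integral_indicT; last by apply: measurableX.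
  rewrite -[X in X < _]/((mX \x mY)%E (eX x.1 `*` eY x.2)).
  rewrite product_measure1E // -[X in X < _]/(mX (eX x.1) * mY (eY x.2)).
  have -> : mX (eX x.1) * mY (eY x.2) = (wX x.1 * wY x.2)%:E by rewrite EFinM -ewX -ewY.
  exact: ltry.
apply/funext => p; rewrite !indicE !in_setX.
by case: (_ \in _); case: (_ \in _); rewrite /= ?mulr1 ?mulr0 ?mul0r ?expr1n ?expr0n.
Qed.

Let rho_integral : \int[mX \x mY]_p (rho p.1 * (phi p.2 * G p.1 p.2))%:E = theta%:E.
Proof.
pose q (x : IX * IY) := (al x.1 * a x.2)%R.
have iqE x : (mX \x mY).-integrable setT (fun p => (q x * E x p)%:E).
  exact: (integrableZl measurableT (q x) (iE x)).
transitivity (\int[mX \x mY]_p (\sum_x (q x * E x p)%:E)).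
  apply: eq_integral => p _; rewrite sumEFin; congr EFin.
  rewrite -(pair_bigA _ (fun k i => q (k, i) * E (k, i) p)%R) /=.
  rewrite /rho /phi /step mulr_suml; apply: eq_bigr => k _.
  rewrite mulr_suml mulr_sumr; apply: eq_bigr => i _; rewrite /q /E /=; ring.
rewrite (integral_sum measurableT iqE).
rewrite (eq_bigr (fun x => (q x * (A x.2 x.1 * (wX x.1 * wY x.2)))%:E)); last first.
  move=> x _; rewrite (integralZl measurableT (iE x)) [RHS]EFinM -avg.
  by [].
rewrite sumEFin; congr EFin.
rewrite -(pair_bigA _ (fun k i => q (k, i) * (A i k * (wX k * wY i)))%R) /=.
apply: eq_bigr => k _; transitivity (wX k * (al k * \sum_i wY i * a i * A i k))%R; last first.
  by rewrite expr2.
by rewrite !mulr_sumr; apply: eq_bigr => i _; rewrite /q /=; ring.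
Qed.

Let h s := \int[mY]_z (phi z * G s z)%:E.
Let h' s := \int[mY]_z (f z * G s z)%:E.

(** Projecting h on step functions does not increase its norm: tested against rho this reads 2 theta
    <= int h^2 + theta, and theta is finite. *)
Let theta_le : theta%:E <= \int[mX]_s h s ^+ 2.
Proof.
have := @section_weight_le _ _ X Y R mX mY G mG G2 unit (fun=> phi) (fun=> rho)
  (fun=> mphi) (fun=> phi2) (fun=> mrho) _ tt.
rewrite rho_integral rho2E => /(_ (fun=> _)).
rewrite -EFinM (_ : 2 * theta = theta + theta)%R ?EFinD; last ring.
by rewrite leeD2rE //; apply; rewrite ltry.
Qed.

(** Averaging G alone is harmless by [theta_le]. But G is contracted with the step function of a
    instead of f, and the difference is bounded by Cauchy-Schwarz in z; hence the additional term,
    small only if f is close to that step function. *)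
Lemma step_section_le : (\sum_k wX k * (\sum_i wY i * a i * A i k) ^+ 2)%:E
  <= 2%:E * \int[mX]_s (\int[mY]_z (f z * G s z)%:E) ^+ 2
   + 2%:E * (\int[mY]_z ((f z - step eY a z) ^+ 2)%:E * \int[mX]_s \int[mY]_z (G s z ^+ 2)%:E).
Proof.
apply: le_trans theta_le _.
have mfphi : measurable_fun setT (fun z => f z - phi z)%R by exact: measurable_funB.
have mh0 (u : Y -> R) : measurable_fun setT u ->
    measurable_fun setT (fun s => \int[mY]_z (u z * G s z)%:E).
  move=> mu; apply: (@measurable_integral_r _ _ _ _ _ mY (fun s z => (u z * G s z)%:E)).
  apply/measurable_EFinP; apply: measurable_funM => //.
  exact: (measurableT_comp mu measurable_snd).
have msq (u : X -> \bar R) : measurable_fun setT u -> measurable_fun setT (fun x => u x ^+ 2).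
  by move=> mu; under eq_fun do rewrite expe2; exact: emeasurable_funM.
have mGs s : measurable_fun setT (G s).
  exact: (measurableT_comp mG (@pair1_measurable _ _ X Y s)).
have mGG : measurable_fun setT (fun s => \int[mY]_z (G s z ^+ 2)%:E).
  apply: (@measurable_integral_r _ _ _ _ _ mY (fun s z => (G s z ^+ 2)%:E)).
  exact: measurable_sqr.
have fphi2 : \int[mY]_z ((f z - phi z) ^+ 2)%:E < +oo.
  have := @integral_lin_sqr _ _ _ mY phi f (-1) mphi mf phi2 f2.
  under eq_integral => z _ do rewrite mulN1r addrC.
  by move=> ->; rewrite ltry.
pose D := \int[mY]_z ((f z - phi z) ^+ 2)%:E.
have D0 : 0 <= D by exact: integral_sqr_ge0.
have GG0 s : 0 <= \int[mY]_z (G s z ^+ 2)%:E by exact: integral_sqr_ge0.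
rewrite -!ge0_integralZl_EFin //; first last.
- exact: msq (mh0 _ mf).
- by move=> s _; exact: sqre_ge0.
rewrite -(ge0_integralZl _ measurableT) // -ge0_integralZl_EFin //; first last.
- exact: measurable_funeM.
- by move=> s _; exact: mule_ge0.
rewrite -ge0_integralD //; first last.
- by do 2!apply: measurable_funeM.
- by move=> s _; rewrite !mule_ge0.
- by apply: measurable_funeM; exact: msq (mh0 _ mf).
- by move=> s _; rewrite mule_ge0 // sqre_ge0.
apply: integral_le_ge0_ae.
- exact: msq (mh0 _ mphi).
- apply: emeasurable_funD; first by apply: measurable_funeM; exact: msq (mh0 _ mf).
  by do 2!apply: measurable_funeM.
- by move=> s; rewrite adde_ge0 // mule_ge0 ?sqre_ge0 // mule_ge0.
have iGG : mX.-integrable setT (fun s => \int[mY]_z (G s z ^+ 2)%:E).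
  apply/integrableP; split=> //.
  by under eq_integral => s _ do rewrite gee0_abs //.
have := integrable_ae measurableT iGG; apply: filterS => s /(_ I).
rewrite ge0_fin_numE // => Gs.
have i1 := sqr_mul_integrable mf (mGs s) f2 Gs.
have i2 := sqr_mul_integrable mfphi (mGs s) fphi2 Gs.
have CS := integral_cauchy_schwarz mfphi (mGs s) fphi2 Gs.
have hE : h s = h' s - \int[mY]_z ((f z - phi z) * G s z)%:E.
  rewrite -integralB //; apply: eq_integral => z _; rewrite -EFinB; congr EFin; ring.
rewrite -/(h s) hE /h' -(fineK (integrable_fin_num measurableT i1)).
rewrite -(fineK (integrable_fin_num measurableT i2)) -/D (sqnormE Gs) /D (sqnormE fphi2).
set x := fine _; set y := fine _ in CS *.
rewrite -EFinB -!EFin_expe -!EFinM -EFinD lee_fin.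
have := sqr_ge0 (x + y); nra.
Qed.

End StepSection.

Section AverageBounds.
Context d (Z : measurableType d) (R : realType).
Variable mu : {sigma_finite_measure set Z -> \bar R}.
Variables (C : finType) (cell : C -> set Z) (W : C -> R).
Hypothesis mcell : forall c, measurable (cell c).
Hypothesis cellW : forall c, mu (cell c) = (W c)%:E.
Hypothesis dcell : forall c c', c != c' -> cell c `&` cell c' = set0.
Variable K : seq Z -> R.
Hypothesis mK : seq_measurable K.
Hypothesis K2 : forall n, \int[mpow mu n]_t (K t ^+ 2)%:E < +oo.
Let fb := average mu cell W K.
Let e n (i : n.-tuple C) : set (n.-tuple Z) := tbox cell i.
Let me n i : measurable (@e n i). Proof. exact: measurable_tbox. Qed.
Let de n (i j : n.-tuple C) : i != j -> e i `&` e j = set0.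
Proof. exact: tbox_disjoint. Qed.
Let wE n : forall s : n.-tuple C, mpow mu n (e s) = (weight W s)%:E.
Proof. by move=> s; exact: tbox_weight. Qed.

(** With l = u = 0 the contraction is f star_g^0 f = f^2, and its squared norm is the integral of
    f^4. *)
Lemma gram4_average_fourth g :
  (gram4 W fb 0 g 0 0)%:E <= \int[mpow mu g]_x (K x ^+ 4)%:E.
Proof.
apply: le_trans (gram4_le_contraction mcell cellW dcell mK K2 0 g 0) _.
rewrite le_eqVlt; apply/orP; left; apply/eqP; apply: eq_integral => x _.
pose k (t s z : seq Z) : \bar R := (K (z ++ x ++ t) * K (z ++ x ++ s))%:E.
rewrite (integral_mpow_nil mu (fun t => \int[mpow mu 0]_s (\int[mpow mu 0]_z k t s z) ^+ 2)).
rewrite (integral_mpow_nil mu (fun s => (\int[mpow mu 0]_z k [::] s z) ^+ 2)).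
rewrite (integral_mpow_nil mu (fun z => k [::] [::] z)) /k.
by rewrite expe2 /= cats0 -EFinM; congr EFin; ring.
Qed.

Lemma gram4_theta_le l v :
  (gram4 W fb l 0 0 v)%:E
  <= 2%:E * \int[mpow mu v]_s (\int[mpow mu l]_z (K z * K (z ++ s))%:E) ^+ 2
   + 2%:E * (\int[mpow mu l]_z ((K z - step (@e l) (fun i : l.-tuple C => fb i) z) ^+ 2)%:E *
             \int[mpow mu (l + v)]_t (K t ^+ 2)%:E).
Proof.
pose G (s : v.-tuple Z) (z : l.-tuple Z) : R := K (z ++ s).
have mG : measurable_fun setT (fun p : v.-tuple Z * l.-tuple Z => G p.1 p.2).
  exact: (measurableT_comp (@seq_measurable_cat _ _ _ _ K l v mK)
    (measurable_fun_pair measurable_snd measurable_fst)).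
have G2E : \int[mpow mu v]_s \int[mpow mu l]_z (G s z ^+ 2)%:E
    = \int[mpow mu (l + v)]_t (K t ^+ 2)%:E.
  rewrite (@ge0_integral_mpow_cat _ _ _ mu l v (fun t => (K t ^+ 2)%:E)) //; first last.
  - by move=> s; rewrite lee_fin sqr_ge0.
  - by move=> n; apply: measurable_sqr; exact: mK.
  apply: (@ge0_integral_exchange _ _ _ _ _ (mpow mu v) (mpow mu l) (fun s z => (G s z ^+ 2)%:E)).
    exact: measurable_sqr.
  by move=> s z; rewrite lee_fin sqr_ge0.
have avg (i : l.-tuple C) (k : v.-tuple C) :
    \int[mpow mu v \x mpow mu l]_p (\1_(e k) p.1 * \1_(e i) p.2 * G p.1 p.2)%:E
    = (fb (i ++ k) * (weight W k * weight W i))%:E.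
  have := averageP mcell cellW mK K2 [tuple of i ++ k].
  rewrite (@integral_mpow_prod _ _ _ mu l v (fun t => (\1_(box cell (i ++ k)) t * K t)%:E)).
    rewrite /= weight_cat mulrC [(weight W i * _)%R]mulrC mulrC => <-.
    rewrite (@integral_prod_swap _ _ _ _ _ (mpow mu v) (mpow mu l)
      (fun s z => (\1_(e k) s * \1_(e i) z * G s z)%:E)).
      apply: eq_integral => p _; congr EFin.
      by rewrite box_cat ?size_tuple // !tboxE /G; ring.
    apply/measurable_EFinP; apply: measurable_funM => //.
    apply: measurable_funM; first exact: (measurable_indic_comp (me k) measurable_fst).
    exact: (measurable_indic_comp (me i) measurable_snd).
  move=> n; apply/measurable_EFinP; apply: measurable_funM; last exact: mK.
  exact: seq_measurable_box.
have := @step_section_le _ _ _ _ R (mpow mu v) (mpow mu l) G mG _ _ _ (@e v) (@e l)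
  _ _ (fun i k => fb (i ++ k)) (@me v) (@me l) (@wE v) (@wE l) (@de v) (@de l) avg
  (fun z => K z) (fun i => fb i) (@mK l) (@K2 l).
rewrite G2E => /(_ (@K2 (l + v))); congr (_%:E <= _).
rewrite /gram4 /= tsum_tuple; apply: eq_bigr => k _; congr (_ * _ ^+ 2)%R.
by rewrite tsum_tuple; apply: eq_bigr => i _; rewrite cats0 /= mulrA.
Qed.

Lemma box_map n (s : n.-tuple C) (t : n.-tuple Z) (p : 'S_n) :
  box cell [tuple tnth s (p i) | i < n] [tuple tnth t (p i) | i < n] = box cell s t.
Proof.
have boxP (s' : n.-tuple C) (t' : n.-tuple Z) :
    box cell s' t' <-> forall i, cell (tnth s' i) (tnth t' i).
  elim: (n) s' t' => [|m IH] s' t'; first by rewrite (tuple0 s') (tuple0 t'); split=> // _ [].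
  case/tupleP: s' => c s'; case/tupleP: t' => z t' /=; split.
    move=> [cz /IH h] i; case: (unliftP ord0 i) => [j ->|->]; last by rewrite !tnth0.
    by rewrite !tnthS.
  move=> h; split; first by have := h ord0; rewrite !tnth0.
  by apply/IH => i; have := h (lift ord0 i); rewrite !tnthS.
apply/propext; rewrite !boxP; split => h i.
  by have := h (p^-1%g i); rewrite !tnth_mktuple permKV.
by rewrite !tnth_mktuple.
Qed.

(** The kernel is symmetric almost everywhere only, but averages do not see null sets, and permuting
    box and variables together preserves the integral. The discrete kernels are therefore symmetric
    without exception, as evaluation on sets requires. *)
Lemma average_perm :
  (forall n, {ae mpow mu n, forall t, forall s : 'S_n, K [tuple tnth t (s i) | i < n] = K t}) ->
  forall s s', perm_eq s s' -> fb s = fb s'.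
Proof.
move=> Ks s s' ss'; rewrite perm_sym in ss'.
have [p Ep] := tuple_permP (ss' : perm_eq s' (in_tuple s)).
rewrite /fb /average; congr (fine _ / _)%R; last by apply/esym/perm_big.
rewrite (perm_size ss'); set n := size s in p Ep *.
have mb q : seq_measurable (fun t => (\1_(box cell q) t * K t)%:E : \bar R).
  move=> k; apply/measurable_EFinP; apply: measurable_funM; last exact: mK.
  exact: seq_measurable_box.
rewrite -[RHS](@integral_mpow_perm _ _ _ mu n p (fun t => (\1_(box cell s') t * K t)%:E)) //.
apply: ae_eq_integral => //.
- exact: mb.
- have := @measurable_map_tnth _ Z _ _ _ n (map p (enum 'I_n)) (mb s').
  by apply: eq_measurable_fun => t _; rewrite -map_comp.
- move: (Ks n); apply: filterS => t Kt _; rewrite Kt; congr (_ * _)%:E.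
  rewrite !indicE; congr (nat_of_bool _)%:R.
  by rewrite Ep; apply/idP/idP; rewrite !in_setE (@box_map n (in_tuple s) t p).
Qed.

End AverageBounds.

(** * Norms of contractions as iterated integrals *)

Section NaturalPowers.
Context d (T : measurableType d) (R : realType) (m : {measure set T -> \bar R}).

Lemma poweR_nat (x : \bar R) n : 0 <= x -> x `^ n.+1%:R = x ^+ n.+1.
Proof.
case: x => [r||] //; last first.
  rewrite poweRyr ?pnatr_eq0 // => _; elim: n => [|n IH]; first by rewrite /= .
  by rewrite expeS -IH mulyy.
by rewrite lee_fin => r0; rewrite poweR_EFin powR_mulrn // EFin_expe.
Qed.

Lemma Lnorm_nat n (h : T -> \bar R) : 'N[m]_(n.+1%:R)%:E[h] ^+ n.+1 = \int[m]_x `|h x| ^+ n.+1.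
Proof.
rewrite -poweR_nat ?Lnorm_ge0 // poweR_Lnorm ?pnatr_eq0 //.
by apply: eq_integral => x _; rewrite poweR_nat.
Qed.

Lemma Lnorm2_sqr (h : T -> \bar R) : 'N[m]_2%:E[h] ^+ 2 = \int[m]_x h x ^+ 2.
Proof.
rewrite (Lnorm_nat 1); apply: eq_integral => x _.
by rewrite !expe2 -abseM gee0_abs // -expe2 sqre_ge0.
Qed.

End NaturalPowers.

Section Contractions.
Context d (Z : measurableType d) (R : realType).
Variable mu : {sigma_finite_measure set Z -> \bar R}.

(** A selection that commutes with [map] is determined by its action on the list of positions, hence
    is a fixed choice of coordinates on each length. *)
Lemma seq_measurable_select d' (T : measurableType d') (sel : forall U, seq U -> seq U)
    (phi : seq Z -> T) :
  (forall U V (h : U -> V) x, map h (sel U x) = sel V (map h x)) ->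
  seq_measurable phi -> seq_measurable (fun s => phi (sel Z s)).
Proof.
move=> nat_sel mphi n.
have := measurable_map_tnth (sel _ (enum 'I_n)) mphi.
by under eq_fun do rewrite nat_sel map_tnth_enum.
Qed.

Lemma seq_measurable_app n (f : n.-tuple Z -> R) : measurable_fun setT f ->
  seq_measurable (app_seq f).
Proof.
move=> mf k; have [->|kn] := eqVneq k n.
  rewrite (_ : (fun t => _) = f) //; apply/funext => t.
  by rewrite /app_seq valK.
rewrite (_ : (fun t => _) = cst 0%R); first exact: measurable_cst.
by apply/funext => t; rewrite /app_seq insubF // size_tuple; apply/negbTE.
Qed.

Lemma contraction_norm_sqr l g u v p q (f : p.-tuple Z -> R) (f' : q.-tuple Z -> R) :
  p = (l + (g + u))%N -> q = (l + (g + v))%N ->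
  measurable_fun setT f -> measurable_fun setT f' ->
  contraction_norm mu (l + g) l f f' ^+ 2
  = \int[mpow mu g]_x \int[mpow mu u]_t \int[mpow mu v]_s
      (\int[mpow mu l]_z (app_seq f (z ++ x ++ t) * app_seq f' (z ++ x ++ s))%:E) ^+ 2.
Proof.
move=> ep eq mf mf'; rewrite /contraction_norm Lnorm2_sqr.
set N := (p + q - _ - _)%N.
have NE : N = (g + (u + v))%N by rewrite /N; lia.
(* The arguments of the two factors, written as selections from z ++ x that are natural in the type
   of the entries, so that [seq_measurable_select] applies. *)
pose s1 U (x : seq U) := take l x ++ take (l + g - l) (drop l x) ++
  take (p - (l + g)) (drop (l + g - l) (drop l x)).
pose s2 U (x : seq U) := take l x ++ take (l + g - l) (drop l x) ++ drop (p - l) (drop l x).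
pose k (x : seq Z) := (app_seq f (s1 Z x) * app_seq f' (s2 Z x))%R.
pose phi (x : seq Z) : \bar R := (\int[mpow mu l]_z (k (z ++ x))%:E) ^+ 2.
have mk : seq_measurable k.
  move=> n; apply: measurable_funM.
    apply: (seq_measurable_select (sel := s1)); last exact: seq_measurable_app.
    by move=> U V h x; rewrite /s1 !map_cat !map_take !map_drop.
  apply: (seq_measurable_select (sel := s2)); last exact: seq_measurable_app.
  by move=> U V h x; rewrite /s2 !map_cat !map_take !map_drop.
have mphi : seq_measurable phi.
  move=> n; rewrite /phi; under eq_fun do rewrite expe2.
  have mi : measurable_fun setT (fun t : n.-tuple Z => \int[mpow mu l]_z (k (z ++ t))%:E).
    apply: (@measurable_integral_r _ _ _ _ _ (mpow mu l)
      (fun (t : n.-tuple Z) (z : l.-tuple Z) => (k (z ++ t))%:E)).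
    apply/measurable_EFinP.
    exact: (measurableT_comp (@seq_measurable_cat _ _ _ _ k l n mk)
      (measurable_fun_pair measurable_snd measurable_fst)).
  exact: emeasurable_funM.
have phi0 s : 0 <= phi s by exact: sqre_ge0.
transitivity (\int[mpow mu N]_x phi x).
  apply: eq_integral => x _; congr (_ ^+ 2); apply: eq_integral => z _.
  by rewrite /k /s1 /s2 take_size_cat ?drop_size_cat ?size_tuple.
clearbody N; rewrite {}NE ge0_integral_mpow_cat //.
apply: eq_integral => x _.
transitivity (\int[mpow mu u]_t \int[mpow mu v]_s phi (x ++ t ++ s)).
  exact: (@ge0_integral_mpow_cat _ _ _ mu u v (fun y => phi (x ++ y))
    (seq_measurable_catl (tval x) mphi) (fun s => phi0 _)).
apply: eq_integral => t _; apply: eq_integral => s _; congr (_ ^+ 2).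
apply: eq_integral => z _; rewrite /k /s1 /s2 !(take_size_cat _ (size_tuple z)).
rewrite !(drop_size_cat _ (size_tuple z)) addKn !(take_size_cat _ (size_tuple x)).
rewrite (drop_size_cat _ (size_tuple x)) (_ : p - (l + g) = u)%N; last by rewrite ep; lia.
rewrite (take_size_cat _ (size_tuple t)) (_ : p - l = g + u)%N; last by rewrite ep; lia.
by rewrite (catA (tval x) (tval t) (tval s)) drop_size_cat // size_cat !size_tuple.
Qed.

End Contractions.

Lemma maxe_sup (R : realType) (I : eqType) (r : seq I) (P : pred I) (F : I -> \bar R) i x :
  i \in r -> P i -> x <= F i -> x <= \big[maxe/0]_(j <- r | P j) F j.
Proof.
move=> + Pi xF; elim: r => // j r IH; rewrite inE big_cons => /orP[/eqP <-|/IH h].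
  by rewrite Pi le_max xF.
by case: ifP => // _; rewrite le_max h orbT.
Qed.

Section KernelFamily.
Context d (Z : measurableType d) (R : realType).
Variable mu : {sigma_finite_measure set Z -> \bar R}.
Variables (k : nat) (q : 'I_k -> nat).
Hypothesis q_incr : forall i j : 'I_k, (i < j)%N -> (q i < q j)%N.
Variable f : forall i : 'I_k, (q i).-tuple Z -> R.
Arguments f : clear implicits.
Hypothesis fL2 : forall i, L2_sym mu (f i).
Variable pr : pred 'I_k.

(** The orders are distinct, so the length of the list selects at most one f_i. The predicate [pr]
    allows the kernel of order one to be left out. *)
Definition chaos_kernel (s : seq Z) : R := (\sum_(i | pr i) app_seq (f i) s)%R.

Lemma L2_measurable n (g : n.-tuple Z -> R) : g \in Lfun (mpow mu n) 2%:E -> measurable_fun setT g.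
Proof. by move=> /sub_Lfun_mfun; rewrite inE. Qed.

Let mf i : measurable_fun setT (f i).
Proof. by have [/L2_measurable] := fL2 i. Qed.

Let f2 i : \int[mpow mu (q i)]_t (f i t ^+ 2)%:E < +oo.
Proof.
have [/Lfun2_integrable_sqr/integrableP[_]] := fL2 i.
by under eq_integral => t _ do rewrite gee0_abs ?lee_fin ?sqr_ge0 //.
Qed.

Lemma q_inj : injective q.
Proof.
move=> i j qij; apply/val_inj/eqP; rewrite eqn_leq; apply/andP; split; rewrite leqNgt;
  by apply/negP => /q_incr; rewrite qij ltnn.
Qed.

Lemma seq_measurable_kernel : seq_measurable chaos_kernel.
Proof. move=> n; rewrite /chaos_kernel; under eq_fun do rewrite big_mkcond /=.
apply: (@measurable_sum _ _ _ _ _ _ (fun i (t : n.-tuple Z) =>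
  if pr i then app_seq (f i) t else 0%R)) => i.
by case: (pr i); [exact: seq_measurable_app | exact: measurable_cst]. Qed.

Lemma kernel_size i s : size s = q i -> chaos_kernel s = (if pr i then app_seq (f i) s else 0)%R.
Proof.
move=> ss; have app0 j : j != i -> app_seq (f j) s = 0%R.
  by move=> ji; rewrite /app_seq insubF // ss; apply/negbTE; rewrite (inj_eq q_inj) eq_sym.
case: ifPn => pi; last by rewrite /chaos_kernel big1 // => j pj; apply: app0; apply: contraNneq pi => <-.
by rewrite /chaos_kernel (bigD1 i) //= big1 ?addr0 // => j /andP[_ /app0].
Qed.

Lemma kernel0 s : (forall i, pr i -> size s != q i) -> chaos_kernel s = 0%R.
Proof.
move=> h; rewrite /chaos_kernel big1 // => i pi; rewrite /app_seq insubF //.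
exact/negbTE/h.
Qed.

Lemma kernel_cases n : (exists2 i, pr i & n = q i) \/ (forall s, size s = n -> chaos_kernel s = 0%R).
Proof.
have [/existsP[i /andP[pi /eqP ->]]|/existsPn h] := boolP [exists i, pr i && (n == q i)].
  by left; exists i.
right=> s sn; apply: kernel0 => i pi; apply/negP => /eqP e.
by have := h i; rewrite pi -sn e eqxx.
Qed.

Lemma kernel_sym n :
  {ae mpow mu n, forall t, forall s : 'S_n, chaos_kernel [tuple tnth t (s i) | i < n] = chaos_kernel t}.
Proof.
have [[i pi ->]|k0] := kernel_cases n; last first.
  by apply: aeW => t s; rewrite !k0 // size_tuple.
have [_] := fL2 i; apply: filterS => t ft s.
by rewrite !(@kernel_size i) ?size_tuple // pi /app_seq !valK ft.
Qed.

Lemma kernel_tuple i (t : (q i).-tuple Z) : pr i -> chaos_kernel t = f i t.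
Proof. by move=> pi; rewrite (@kernel_size i) ?size_tuple // pi /app_seq valK. Qed.

Lemma kernel_sqr n : \int[mpow mu n]_t (chaos_kernel t ^+ 2)%:E < +oo.
Proof.
have [[i pi ->]|k0] := kernel_cases n.
  by under eq_integral => t _ do rewrite kernel_tuple //.
under eq_integral => t _ do rewrite k0 ?size_tuple // expr0n.
by rewrite integral0 ltry.
Qed.

Variable m : R.
Hypothesis m0 : (0 <= m)%R.
Hypothesis m1 : max1 mu f <= m%:E.
Hypothesis m2 : max2 mu f <= m%:E.

Let sqr_le (x : \bar R) : 0 <= x -> x <= m%:E -> x ^+ 2 <= (m ^+ 2)%:E.
Proof.
by move=> x0 xm; rewrite EFin_expe !expe2; apply: lee_pmul.
Qed.

(** If lists of length l + g + u carry a kernel f_i, this is the squared norm of f_i star_(l+g)^l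
    f_i; as g + u > 0 one has l <= q_i - 1, so it occurs in [max1]. Otherwise the integrand is 0. *)
Lemma kernel_gram l g u : (0 < l)%N -> (0 < g + u)%N ->
  \int[mpow mu g]_x \int[mpow mu u]_t \int[mpow mu u]_s
    (\int[mpow mu l]_z (chaos_kernel (z ++ x ++ t) * chaos_kernel (z ++ x ++ s))%:E) ^+ 2
  <= (m ^+ 2)%:E.
Proof.
move=> l0 gu0; have [[i pi e]|k0] := kernel_cases (l + (g + u)).
  have -> : \int[mpow mu g]_x \int[mpow mu u]_t \int[mpow mu u]_s
    (\int[mpow mu l]_z (chaos_kernel (z ++ x ++ t) * chaos_kernel (z ++ x ++ s))%:E) ^+ 2
    = contraction_norm mu (l + g) l (f i) (f i) ^+ 2.
    rewrite (@contraction_norm_sqr _ _ _ mu l g u u _ _ _ _ (esym e) (esym e) (@mf i) (@mf i)).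
    apply: eq_integral => x _; apply: eq_integral => t _; apply: eq_integral => s _.
    congr (_ ^+ 2); apply: eq_integral => z _; congr EFin.
    by rewrite !(@kernel_size i) ?pi // !size_cat !size_tuple.
  apply: sqr_le; first exact: Lnorm_ge0.
  apply: le_trans m1; rewrite /max1.
  apply: (@maxe_sup _ _ _ _ _ i) => //; first by rewrite mem_index_enum.
    by rewrite -e; lia.
  apply: (@maxe_sup _ _ _ _ _ (l + g)%N) => //; first by rewrite mem_index_iota -e; lia.
  apply: (@maxe_sup _ _ _ _ _ l) => //.
  by rewrite mem_index_iota -e; lia.
rewrite integral0_eq ?lee_fin ?sqr_ge0 // => x _.
rewrite integral0_eq // => t _; rewrite integral0_eq // => s _.
rewrite integral0_eq ?expe2 ?mul0e // => z _.
by rewrite k0 ?mul0r // !size_cat !size_tuple.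
Qed.

(** The contraction of two different kernels that is really used: f_i of order l is integrated
    completely against l variables of f_j of order l + v, the case r = l = q_i of [max2]. *)
Lemma kernel_theta l v : (0 < l)%N -> (0 < v)%N ->
  \int[mpow mu v]_s (\int[mpow mu l]_z (chaos_kernel z * chaos_kernel (z ++ s))%:E) ^+ 2 <= (m ^+ 2)%:E.
Proof.
move=> l0 v0; have [[i pi ei]|k0] := kernel_cases l; last first.
  rewrite integral0_eq ?lee_fin ?sqr_ge0 // => s _.
  by rewrite integral0_eq ?expe2 ?mul0e // => z _; rewrite k0 ?mul0r // size_tuple.
have [[j pj ej]|k0] := kernel_cases (l + v); last first.
  rewrite integral0_eq ?lee_fin ?sqr_ge0 // => s _.
  rewrite integral0_eq ?expe2 ?mul0e // => z _.
  by rewrite (k0 (z ++ s)) ?mulr0 // size_cat !size_tuple.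
have ij : (i < j)%N.
  rewrite ltnNge; apply/negP; rewrite leq_eqVlt => /orP[/eqP/val_inj ji|/q_incr]; last by lia.
  by move: ej; rewrite ji -ei; lia.
have ei' : q i = (l + (0 + 0))%N by rewrite -ei; lia.
have -> : \int[mpow mu v]_s (\int[mpow mu l]_z (chaos_kernel z * chaos_kernel (z ++ s))%:E) ^+ 2
    = contraction_norm mu (l + 0) l (f i) (f j) ^+ 2.
  rewrite (@contraction_norm_sqr _ _ _ mu l 0 0 v _ _ (f i) (f j) ei' (esym ej)) //.
  pose h (x t : seq Z) := \int[mpow mu v]_s (\int[mpow mu l]_z
    (app_seq (f i) (z ++ x ++ t) * app_seq (f j) (z ++ x ++ s))%:E) ^+ 2.
  rewrite (integral_mpow_nil mu (fun x => \int[mpow mu 0]_t h x t)).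
  rewrite (integral_mpow_nil mu (h [::])).
  apply: eq_integral => s _; congr (_ ^+ 2); apply: eq_integral => z _; congr EFin.
  rewrite (@kernel_size i) ?size_tuple // pi (@kernel_size j) ?size_cat ?size_tuple //.
  by rewrite pj /= cats0.
apply: sqr_le; first exact: Lnorm_ge0.
apply: le_trans m2; rewrite /max2.
apply: (@maxe_sup _ _ _ _ _ i) => //; first by rewrite mem_index_enum.
apply: (@maxe_sup _ _ _ _ _ j) => //; first by rewrite mem_index_enum.
apply: (@maxe_sup _ _ _ _ _ (l + 0)%N) => //; first by rewrite mem_index_iota -ei; lia.
apply: (@maxe_sup _ _ _ _ _ l) => //.
by rewrite mem_index_iota; lia.
Qed.

Hypothesis m4 : forall i, pr i -> normf mu f 4 i ^+ 2 <= m%:E.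

Lemma kernel_fourth g : \int[mpow mu g]_x (chaos_kernel x ^+ 4)%:E <= (m ^+ 2)%:E.
Proof.
have [[i pi ->]|k0] := kernel_cases g; last first.
  rewrite integral0_eq ?lee_fin ?sqr_ge0 // => x _.
  by rewrite k0 ?size_tuple // expr0n.
have -> : \int[mpow mu (q i)]_x (chaos_kernel x ^+ 4)%:E = (normf mu f 4 i ^+ 2) ^+ 2.
  transitivity (normf mu f 4 i ^+ 4); last by rewrite !expeS !expe0 !mule1 !muleA.
  rewrite /normf (Lnorm_nat _ 3); apply: eq_integral => t _.
  rewrite kernel_tuple // -[RHS]EFin_expe; congr EFin.
  by rewrite -normrX ger0_norm // (exprM _ 2 2) sqr_ge0.
by apply: sqr_le; [exact: expe_ge0 (Lnorm_ge0 _ _ _) | exact: m4].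
Qed.

End KernelFamily.

(** A fibre of an injective map has at most one point, hence no nonempty proper subset, whereas
    positive mass would provide one. *)
Lemma non_atomic_fiber d (Z : measurableType d) (R : realType) (mu : {measure set Z -> \bar R})
    (phi : Z -> R) (c : R) : non_atomic mu -> measurable_fun setT phi -> injective phi ->
  mu (phi @^-1` [set c]) = 0.
Proof.
move=> na mphi inj; apply/eqP; rewrite eq_le measure_ge0 andbT leNgt; apply/negP => h.
have [|B [mB BA /andP[B0 BlA]]] := na _ _ h.
  by rewrite -[X in measurable X]setTI; exact: mphi.
have [B00|/set0P[z Bz]] := eqVneq B set0; first by move: B0; rewrite B00 measure0 ltxx.
suff AB : phi @^-1` [set c] `<=` B.
  by move: BlA; rewrite (_ : B = phi @^-1` [set c]) ?ltxx //; exact/seteqP.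
move=> x /= xc; have := BA _ Bz => /= zc.
by have -> : x = z by apply: inj; rewrite xc zc.
Qed.

Lemma disjoint_subcover (T : Type) (N : nat) (A : 'I_N -> set T) :
  let D (i : 'I_N) := A i `\` \big[setU/set0]_(j < N | (j < i)%N) A j in
  (forall i j, i != j -> D i `&` D j = set0) /\
  (forall x, (exists i, A i x) -> exists i, D i x).
Proof.
move=> D; split.
  have key (i j : 'I_N) : (i < j)%N -> D i `&` D j = set0.
    move=> ij; apply/seteqP; split => // x [[Ai _] [_ nA]]; apply: nA.
    by rewrite -bigcup_seq_cond; exists i => //=; rewrite mem_index_enum.
  move=> i j; rewrite -val_eqE neq_ltn => /orP[]; first exact: key.
  by rewrite setIC; exact: key.
move=> x [i Ai]; pose P (m : nat) := [exists j : 'I_N, (val j == m) && `[< A j x >]].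
have exP : exists m, P m.
  by exists i; apply/existsP; exists i; rewrite eqxx; apply/asboolP.
case: (ex_minnP exP) => m /existsP[j /andP[/eqP jm /asboolP Aj]] min.
exists j; split => //; rewrite -bigcup_seq_cond => -[l /= /andP[_ lj] Al].
have : (m <= l)%N by apply: min; apply/existsP; exists l; rewrite eqxx; apply/asboolP.
by rewrite -jm leqNgt lj.
Qed.

(* Continuity from above makes small balls around every point of [0, 1] light;
   finitely many of them cover [0, 1] by compactness. *)
Lemma small_cover d (Z : measurableType d) (R : realType)
    (mu : {measure set Z -> \bar R}) (U : set Z) (eps : R) :
  borel_space Z R -> non_atomic mu -> measurable U -> mu U < +oo -> (0 < eps)%R ->
  exists (N : nat) (D : 'I_N -> set Z),
    [/\ forall i, measurable (D i), forall i j, i != j -> D i `&` D j = set0,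
        forall z, exists i, D i z & forall i, mu (U `&` D i) <= eps%:E].
Proof.
move=> [phi [mphi inj rng _]] na mU Uoo eps0.
pose B (c : R) (r : R) := phi @^-1` ball c r.
have mB c r : measurable (B c r).
  by rewrite -[X in measurable X]setTI; apply: mphi => //; exact: measurable_ball.
have small c : exists m : nat, mu (U `&` B c (m.+1%:R^-1)%R) < eps%:E.
  pose F (m : nat) := U `&` B c (m.+1%:R^-1)%R.
  have mF m : measurable (F m) by exact: measurableI.
  have capF : \bigcap_m F m `<=` phi @^-1` [set c].
    move=> z Fz; apply/eqP; rewrite eq_sym -subr_eq0 -normr_le0 leNgt; apply/negP => h.
    have [m _ /(_ m (leqnn m))] := near_infty_natSinv_lt (PosNum h).
    rewrite /= => hm; have [_] := Fz m I; rewrite /B /= => bz.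
    have := lt_trans bz hm; by rewrite ltxx.
  have cap0 : mu (\bigcap_m F m) = 0.
    apply/eqP; rewrite eq_le measure_ge0 andbT -(non_atomic_fiber c na mphi inj).
    apply: le_measure; rewrite ?inE //; first exact: bigcap_measurable.
    by rewrite -[X in measurable X]setTI; exact: mphi.
  have cvgF : mu \o F @ \oo --> 0.
    rewrite -cap0; apply: nonincreasing_cvg_mu => //.
    - by apply: le_lt_trans Uoo; apply: le_measure; rewrite ?inE //; exact: subIsetl.
    - exact: bigcap_measurable.
    - move=> m n mn; apply/subsetPset => z [Uz Bz]; split => //.
      by apply: lt_le_trans Bz _; rewrite lef_pV2 ?posrE ?ltr0n // ler_nat.
  have : nbhs (0 : \bar R) [set x | x < eps%:E].
    by apply: open_ereal_lt'; rewrite lte_fin.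
  by move=> /cvgF [m _ /(_ m (leqnn m))] h; exists m.
have [M rP] := choice small; pose r c : R := ((M c).+1%:R^-1)%R.
have r0 c : (0 < r c)%R by rewrite invr_gt0 ltr0n.
have := @segment_compact R 0%R 1%R; rewrite compact_cover => /(_ R setT (fun c => ball c (r c))) [].
- by move=> c _; exact: ball_open.
- by move=> x _; exists x => //; exact: ballxx.
move=> Dc _ cov.
pose s : seq R := finmap.enum_fset Dc; pose A (i : 'I_(size s)) := B (tnth (in_tuple s) i) (r (tnth (in_tuple s) i)).
have [dA cA] := disjoint_subcover A.
exists (size s), (fun i => A i `\` \big[setU/set0]_(j < size s | (j < i)%N) A j); split => //.
- move=> i; apply: measurableD; first exact: mB.
  by apply: bigsetU_measurable => j _; exact: mB.
- move=> z; apply: cA; have [|c /= cs bc] := cov (phi z); first by rewrite /= in_itv /=.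
  have ci : (index c s < size s)%N by rewrite index_mem.
  by exists (Ordinal ci); rewrite /A (tnth_nth 0%R) /= nth_index.
- move=> i; apply: le_trans (ltW (rP (tnth (in_tuple s) i))).
  apply: le_measure; rewrite ?inE; [apply: measurableI => //|exact: measurableI|].
    apply: measurableD; first exact: mB.
    by apply: bigsetU_measurable => j _; exact: mB.
  by move=> z [Uz [Az _]].
Qed.

(** * Void indicators of a Poisson measure *)

Lemma nneseries_exp (R : realType) (x : R) : (0 <= x)%R ->
  \sum_(0 <= n <oo) (x ^+ n / n`!%:R)%:E = (expR x)%:E.
Proof.
move=> x0; rewrite expRE -EFin_lim; last first.
  rewrite /pseries/=; under eq_fun do rewrite mulrC.
  exact: is_cvg_series_exp_coeff.
apply/congr_lim/funext => n/=; rewrite /pseries/= /series/= -sumEFin//.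
by under eq_bigr do rewrite mulrC.
Qed.

(** Lets the exponential moment of a Poisson count bound all its polynomial moments. *)
Lemma pow_le_exp (R : realType) (x : R) n : (0 <= x)%R -> (x ^+ n <= n`!%:R * expR x)%R.
Proof.
move=> x0; case: n => [|n].
  by rewrite expr0 fact0 mul1r (le_trans _ (expR_ge1Dx _)) // lerDl.
rewrite mulrC -ler_pdivrMr ?ltr0n ?fact_gt0 //.
by apply: le_trans (expR_ge1Dxn n x0); rewrite lerDr.
Qed.

Section VoidScale.
Variable R : realType.

(* The normalisation giving the centred void indicator of a set of mass w the
   variance w; the value at w = 0 is arbitrary up to the bounds below. *)
Definition void_scale (w : R) : R :=
  (if w == 0 then 1 else Num.sqrt (w / (expR (- w) * (1 - expR (- w)))))%R.

Variable w : R.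
Hypothesis w0 : (0 <= w)%R.
Hypothesis w2 : (2 * w <= 1)%R.
Let e := expR (- w).
Let s := void_scale w.

Let e_le1 : (e <= 1)%R. Proof. by rewrite /e expR_le1 oppr_le0. Qed.
Let e_ge : (1 - w <= e)%R. Proof. exact: expR_ge1Dx. Qed.
Let e_inv : (e * (1 + w) <= 1)%R.
Proof. by rewrite /e expRN mulrC ler_pdivrMr ?expR_gt0 // mul1r expR_ge1Dx. Qed.
Let e_gt0 : (0 < e)%R. Proof. exact: expR_gt0. Qed.

Lemma void_scale_ge0 : (0 <= s)%R.
Proof. by rewrite /s /void_scale; case: eqVneq => // _; exact: sqrtr_ge0. Qed.

Lemma void_scale_sqr : (s ^+ 2 * (e * (1 - e)) = w)%R.
Proof.
rewrite /s /void_scale /e; case: eqVneq => [->|wn].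
  by rewrite oppr0 expR0 subrr !mulr0.
have wp : (0 < w)%R by rewrite lt_neqAle eq_sym wn.
have D0 : (0 < expR (- w) * (1 - expR (- w)))%R.
  by rewrite mulr_gt0 ?expR_gt0 // subr_gt0 expR_lt1 oppr_lt0.
by rewrite sqr_sqrtr ?divfK ?gt_eqF // divr_ge0 // ltW.
Qed.

Lemma void_scale_ge1 : (1 <= s)%R.
Proof.
rewrite -(@ler_pXn2r _ 2) ?nnegrE ?ler01 ?void_scale_ge0 // expr1n.
have [E|wn] := eqVneq w 0%R; first by rewrite /s /void_scale E eqxx expr1n.
have wp : (0 < w)%R by rewrite lt_neqAle eq_sym wn.
have e1 : (e < 1)%R by rewrite /e expR_lt1 oppr_lt0.
have D0 : (0 < e * (1 - e))%R by rewrite mulr_gt0 // subr_gt0.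
rewrite -(ler_pM2r D0) void_scale_sqr; have := e_ge; have := e_gt0; nra.
Qed.

Lemma void_scale_le : (s <= 1 + 2 * w)%R.
Proof.
have q0 : (0 <= 1 + 2 * w)%R by rewrite addr_ge0 // mulr_ge0.
have [E|wn] := eqVneq w 0%R; first by rewrite /s /void_scale E eqxx mulr0 addr0.
rewrite -(@ler_pXn2r _ 2) ?nnegrE ?void_scale_ge0 //.
have wp : (0 < w)%R by rewrite lt_neqAle eq_sym wn.
have e1 : (e < 1)%R by rewrite /e expR_lt1 oppr_lt0.
have D0 : (0 < e * (1 - e))%R by rewrite mulr_gt0 // subr_gt0.
rewrite -(ler_pM2r D0) void_scale_sqr.
have h : (w <= (1 + w) * (1 - e))%R by have := e_inv; lra.
(* Together with the previous bound and 1 - w <= e this gives s^2 <= (1 + 2 w)^2; the smallness of w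
   makes the factor 1 - 2 w^2 nonnegative. *)
have h2 : (1 + w <= (1 + 2 * w) ^+ 2 * (1 - w))%R.
  rewrite -subr_ge0 (_ : _ - _ = 2 * w * (1 - 2 * w ^+ 2))%R; last by ring.
  by apply: mulr_ge0; [exact: mulr_ge0 | have := w0; have := w2; nra].
have e1' : (0 <= 1 - e)%R by rewrite subr_ge0 ltW.
apply: le_trans h _; rewrite mulrA; apply: ler_wpM2r => //.
by apply: le_trans h2 _; apply: ler_wpM2l; rewrite ?sqr_ge0.
Qed.

Lemma void_scale_comp : (`|s * (1 - e) - w| <= 2 * w ^+ 2)%R.
Proof.
have h : (w <= (1 + w) * (1 - e))%R by have := e_inv; lra.
have := void_scale_ge1; have := void_scale_le; have := e_ge; have := e_le1.
rewrite ler_norml => *; apply/andP; split; nra.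
Qed.

Lemma void_scale_coef : (`|s * (2 * e - 1)| <= 2)%R.
Proof.
have h1 := void_scale_ge1; have h2 := void_scale_le.
rewrite normrM ger0_norm ?void_scale_ge0 // -[leRHS]mulr1; apply: ler_pM => //.
- exact: void_scale_ge0.
- by apply: le_trans h2 _; have := w2; lra.
- by rewrite ler_norml; apply/andP; split; have := e_gt0; have := e_le1; lra.
Qed.

(** An indicator satisfies b^2 = b, so the square of s (e - b) is affine in it; the constant term is
    s^2 e (1 - e), equal to w by the choice of s. *)
Lemma void_scale_relation (b : bool) :
  ((s * (e - b%:R)) ^+ 2 = w + s * (2 * e - 1) * (s * (e - b%:R)))%R.
Proof.
transitivity (s ^+ 2 * (e * (1 - e)) + s * (2 * e - 1) * (s * (e - b%:R)))%R; last first.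
  by rewrite void_scale_sqr.
by case: b => /=; ring.
Qed.

(** A void indicator only tells whether there is a point. For at most one point it therefore
    determines the count, and the normalisation agrees with the centred count up to second order by
    [void_scale_comp]. *)
Lemma void_scale_count (n : nat) : (n <= 1)%N ->
  (`|(n%:R - w) - s * (e - (n == 0%N)%:R)| <= 2 * w * (n%:R + w))%R.
Proof.
have hc := void_scale_comp; have h1 := void_scale_ge1; have hl := void_scale_le.
move: hc; rewrite ler_norml => /andP[hc1 hc2].
by case: n => [|[|//]] _; rewrite /= ler_norml; apply/andP; split; nra.
Qed.

Lemma void_scale_bound (n : nat) : (`|s * (e - (n == 0%N)%:R)| <= 2 * (n%:R + w))%R.
Proof.
have h1 := void_scale_ge1; have h2 := void_scale_le.
case: n => [|n]; rewrite /= ler_norml.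
  by apply/andP; split; have := e_ge; have := e_le1; have := w2; have := w0; nra.
have : (1 <= n.+1%:R :> R)%R by rewrite ler1n.
by rewrite subr0 => *; apply/andP; split; have := e_gt0; have := e_le1; have := w0; have := w2; nra.
Qed.

End VoidScale.

Lemma bounded_integrable d (T : measurableType d) (R : realType) (P : probability T R)
    (X : T -> R) (M : R) : measurable_fun setT X -> (forall w, `|X w| <= M)%R ->
  P.-integrable setT (EFin \o X).
Proof.
move=> mX XM; apply: (@le_integrable _ _ _ P _ measurableT _ (cst M%:E)).
- exact/measurable_EFinP.
- by move=> w _ /=; rewrite lee_fin; apply: le_trans (XM w) (ler_norm _).
- apply/integrableP; split; first exact: measurable_cst.
  by rewrite integral_cst //= probability_setT mule1 ltry.
Qed.

Section PoissonCounts.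
Context d d' (Z : measurableType d) (Omega : measurableType d') (R : realType).
Variables (P : probability Omega R) (mu : {sigma_finite_measure set Z -> \bar R}).
Variable eta : R.-ker Omega ~> Z.
Hypothesis eta_poisson : poisson_measure P mu eta.

Definition no_point (B : set Z) : set Omega := [set w | eta w B = 0].

Let level B (n : nat) : set Omega := [set w | eta w B = n%:R%:E].

Let measurable_level B n : measurable B -> measurable (level B n).
Proof.
move=> mB; have := @measurable_kernel _ _ _ _ _ eta B mB measurableT _ (emeasurable_set1 n%:R%:E).
by rewrite setTI.
Qed.

Lemma measurable_no_point B : measurable B -> measurable (no_point B).
Proof. exact: (@measurable_level B 0). Qed.

Let level_prob B n : measurable B -> mu B < +oo -> P (level B n) =
  (fine (mu B) ^+ n / n`!%:R * expR (- fine (mu B)))%R%:E.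
Proof. by move=> mB Boo; have [+ _] := eta_poisson; apply. Qed.

Lemma void_prob B : measurable B -> mu B < +oo -> P (no_point B) = (expR (- fine (mu B)))%:E.
Proof.
by move=> mB Boo; rewrite -[no_point B]/(level B 0) level_prob // expr0 fact0 divr1 mul1r.
Qed.

Let level_disjoint B : trivIset setT (level B).
Proof.
apply/trivIsetP => i j _ _ ij; apply/seteqP; split => // w [].
by rewrite /level /= => -> [] /eqP; rewrite eqr_nat (negbTE ij).
Qed.

(** The values of eta are extended reals; the Poisson probabilities of the natural numbers sum to 1,
    which leaves probability zero for all other values. *)
Lemma count_nat B : measurable B -> mu B < +oo ->
  {ae P, forall w, exists n : nat, eta w B = n%:R%:E}.
Proof.
move=> mB Boo; have mL : measurable (\bigcup_n level B n).
  by apply: bigcup_measurable => n _; exact: measurable_level.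
have PL : P (\bigcup_n level B n) = 1.
  rewrite measure_bigcup //; last by move=> n _; exact: measurable_level.
  transitivity (\sum_(0 <= n <oo | n \in [set: nat])
      (expR (- fine (mu B)))%:E * (fine (mu B) ^+ n / n`!%:R)%:E).
    by apply: eq_eseriesr => n _; rewrite -EFinM mulrC; exact: level_prob.
  rewrite nneseriesZl; last by move=> n _; rewrite lee_fin divr_ge0 ?exprn_ge0 ?fine_ge0.
  rewrite (eq_eseriesl (Q := predT)); last by move=> n; rewrite /= in_setT.
  by rewrite nneseries_exp ?fine_ge0 // -EFinM expRN mulVf ?gt_eqF ?expR_gt0.
exists (~` \bigcup_n level B n); split; first exact: measurableC.
  by have := probability_setC P mL; rewrite PL subee.
move=> w /= h [n _ Ln]; apply: h; by exists n.
Qed.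

Lemma count_exp_moment B : measurable B -> mu B < +oo ->
  \int[P]_w (expR (fine (eta w B)))%:E < +oo.
Proof.
move=> mB Boo; have mL : measurable (\bigcup_n level B n).
  by apply: bigcup_measurable => n _; exact: measurable_level.
have mf : measurable_fun setT (fun w => (expR (fine (eta w B)))%:E).
  apply/measurable_EFinP; apply: measurableT_comp => //.
  exact: (measurableT_comp (fine_measurable measurableT) (measurable_kernel eta _ mB)).
have f0 w : 0 <= (expR (fine (eta w B)))%:E :> \bar R by rewrite lee_fin expR_ge0.
rewrite (_ : \int[P]_w _ = \int[P]_(w in \bigcup_n level B n) (expR (fine (eta w B)))%:E); last first.
  rewrite [RHS]integral_mkcond; apply: ae_eq_integral => //.
    by apply/(measurable_restrict _ mL measurableT); rewrite setTI; exact: measurable_funTS.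
  move: (count_nat mB Boo); apply: filterS => w [n Ln] _.
  by rewrite patchE mem_set //; exists n.
rewrite (@ge0_integral_bigcup _ _ _ P _ _ (fun n => @measurable_level B n mB)
  (measurable_funTS mf) (fun w _ => f0 w) (@level_disjoint B)).
under eq_eseriesr => n _.
  rewrite (_ : \int[P]_(w in _) _ = (expR (- fine (mu B)))%:E *
     ((expR 1 * fine (mu B)) ^+ n / n`!%:R)%:E); last first.
    rewrite (eq_integral (fun=> (expR n%:R)%:E)); last by move=> w; rewrite inE => /= ->.
    rewrite integral_cst; last exact: measurable_level.
    transitivity ((expR n%:R)%:E * (fine (mu B) ^+ n / n`!%:R * expR (- fine (mu B)))%:E).
      by congr (_ * _); exact: level_prob.
    by rewrite -!EFinM exprMn -expRM_natl mulr1; congr EFin; ring.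
  over.
rewrite nneseriesZl; last first.
  by move=> n _; rewrite lee_fin divr_ge0 // exprn_ge0 // mulr_ge0 ?expR_ge0 ?fine_ge0.
by rewrite nneseries_exp ?mulr_ge0 ?expR_ge0 ?fine_ge0 // -EFinM ltry.
Qed.

(** From exp(- w) >= 1 - w: 1 - exp(- w) (1 + w) <= 1 - (1 - w) (1 + w) = w^2. *)
Lemma count_ge2 B (w : R) : measurable B -> mu B = w%:E -> (0 <= w)%R ->
  P (~` (level B 0 `|` level B 1)) <= (w ^+ 2)%:E.
Proof.
move=> mB Bw w0; have Boo : mu B < +oo by rewrite Bw ltry.
have mU : measurable (level B 0 `|` level B 1) by apply: measurableU; exact: measurable_level.
have := probability_setC P mU; rewrite measureU //; try exact: measurable_level; last first.
  by move/trivIsetP : (@level_disjoint B) => /(_ 0%N 1%N I I); apply.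
have := level_prob 0 mB Boo; have := level_prob 1 mB Boo; rewrite Bw /=.
set e := expR (- w); move=> E1 E0 ->; have -> : 1 - (P (level B 0) + P (level B 1))%R
    = (1 - (w ^+ 0 / 0`!%:R * e + w ^+ 1 / 1`!%:R * e))%:E.
  by rewrite EFinB EFinD -E0 -E1.
rewrite lee_fin /e {e E0 E1}.
rewrite expr0 fact0 expr1 factS fact0 mul1n !divr1 mul1r.
have := expR_ge1Dx (- w); have := expR_gt0 (- w); nra.
Qed.

End PoissonCounts.

(** * Orthogonality of the void polynomials *)

Section PoissonChaos.
Context d d' (Z : measurableType d) (Omega : measurableType d') (R : realType).
Variables (P : probability Omega R) (mu : {sigma_finite_measure set Z -> \bar R}).
Variable eta : R.-ker Omega ~> Z.
Hypothesis eta_poisson : poisson_measure P mu eta.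
Variables (A : finType) (E : A -> set Z) (w : A -> R).
Hypothesis mE : forall a, measurable (E a).
Hypothesis Ew : forall a, mu (E a) = (w a)%:E.
Hypothesis dE : forall a b, a != b -> E a `&` E b = set0.
Hypothesis w2 : forall a, (2 * w a <= 1)%R.

Lemma atom_weight_ge0 a : (0 <= w a)%R.
Proof. by rewrite -lee_fin -Ew. Qed.

Lemma measurable_atoms (s : seq A) : measurable (\big[setU/set0]_(a <- s) E a).
Proof. by apply: bigsetU_measurable => a _. Qed.

Lemma measure_atoms (m : {measure set Z -> \bar R}) (s : seq A) : uniq s ->
  m (\big[setU/set0]_(a <- s) E a) = \sum_(a <- s) m (E a).
Proof.
elim: s => [|a s IH] /=; first by rewrite !big_nil measure0.
move=> /andP[as_ us]; rewrite !big_cons -IH //; apply: measureU => //.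
  exact: measurable_atoms.
apply/seteqP; split => // z [az]; rewrite -bigcup_seq => -[b /= bs bz].
have ab : a != b by apply: contraNneq as_ => ->.
by move/seteqP: (dE ab) => [/(_ z)] + _; apply.
Qed.

Definition void_ind (a : A) (om : Omega) : R := \1_(no_point eta (E a)) om.

Definition void_var (om : Omega) (a : A) : R :=
  (void_scale (w a) * (expR (- w a) - void_ind a om))%R.

Definition void_coef (a : A) : R := (void_scale (w a) * (2 * expR (- w a) - 1))%R.

Lemma measurable_void_ind a : measurable_fun setT (void_ind a).
Proof. apply: measurable_indic; exact: measurable_no_point. Qed.

Lemma measurable_void_var a : measurable_fun setT (void_var^~ a).
Proof.
apply: measurable_funM => //; apply: measurable_funB => //; exact: measurable_void_ind.
Qed.

Lemma void_var_sqr om a : (void_var om a ^+ 2 = w a + void_coef a * void_var om a)%R.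
Proof.
rewrite /void_var /void_ind indicE (void_scale_relation (atom_weight_ge0 a)).
by [].
Qed.

Lemma void_coef_le a : (`|void_coef a| <= 2)%R.
Proof. exact: void_scale_coef (atom_weight_ge0 a) (w2 a). Qed.

(** Absence of points in every atom is absence of points in their union, so the joint law of the
    void indicators is read off from the void probability of a single set, for which the weights add
    up. *)
Lemma void_prob_atoms (s : seq A) : uniq s ->
  P [set om | forall a, a \in s -> no_point eta (E a) om] = (\prod_(a <- s) expR (- w a))%:E.
Proof.
move=> us; have muU : mu (\big[setU/set0]_(a <- s) E a) = (\sum_(a <- s) w a)%:E.
  by rewrite measure_atoms // -sumEFin; apply: eq_bigr => a _; exact: Ew.
have -> : [set om | forall a, a \in s -> no_point eta (E a) om]
    = no_point eta (\big[setU/set0]_(a <- s) E a).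
  apply/seteqP; split => om /=; rewrite /no_point /= measure_atoms //.
    by move=> h; rewrite big1_seq // => a /andP[_ /h].
  move=> h a as_; apply/eqP; rewrite eq_le measure_ge0 andbT -h (big_rem a) //=.
  by rewrite leeDl // sume_ge0.
have Uoo : mu (\big[setU/set0]_(a <- s) E a) < +oo by rewrite muU ltry.
have := void_prob eta_poisson (measurable_atoms s) Uoo.
by rewrite muU /= -sumrN expR_sum.
Qed.

Let mixed (s t : seq A) (om : Omega) : R :=
  ((\prod_(a <- s) (expR (- w a) - void_ind a om)) * \prod_(b <- t) void_ind b om)%R.

Let ind01 a om : (0 <= void_ind a om <= 1)%R.
Proof. by rewrite /void_ind indicE; case: (_ \in _); rewrite ?lexx ?ler01. Qed.

Let measurable_mixed s t : measurable_fun setT (mixed s t).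
Proof.
apply: measurable_funM; apply: measurable_prod => a _; last exact: measurable_void_ind.
apply: measurable_funB => //; exact: measurable_void_ind.
Qed.

Let mixed_le1 s t om : (`|mixed s t om| <= 1)%R.
Proof.
rewrite normrM -[leRHS]mulr1; apply: ler_pM => //; rewrite normr_prod.
  apply: prodr_ile1 => a _; rewrite normr_ge0 ler_norml.
  have := expR_gt0 (- w a); have /andP[] := ind01 a om.
  have : (expR (- w a) <= 1)%R by rewrite expR_le1 oppr_le0 atom_weight_ge0.
  by move=> *; apply/andP; split; lra.
apply: prodr_ile1 => a _; have /andP[i0 i1] := ind01 a om.
by rewrite ger0_norm // i0 i1.
Qed.

Let mixed_integrable s t : P.-integrable setT (EFin \o mixed s t).
Proof. exact: bounded_integrable (@measurable_mixed s t) (@mixed_le1 s t). Qed.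

(** Induction on the centred factors. Splitting the factor of a gives exp(- w a) times the mean
    without a, minus the mean in which the indicator of a has joined t; either both are exp(- w a)
    times the same product or both are 0. *)
Let mixed_mean s t : uniq (s ++ t) ->
  \int[P]_om (mixed s t om)%:E
  = (if s is [::] then \prod_(b <- t) expR (- w b) else 0)%R%:E.
Proof.
elim: s t => [|a s IH] t ust.
  rewrite -void_prob_atoms // -(integral_indicT P); last first.
    rewrite (_ : [set _ | _] = \bigcap_(a in [set` t]) no_point eta (E a)) //.
    apply: fin_bigcap_measurable => // a _; exact: measurable_no_point.
  apply: eq_integral => om _; rewrite /mixed big_nil mul1r; congr EFin.
  rewrite indicE; elim: (t) => [|b t' IHt].
    by rewrite big_nil mem_set.
  rewrite big_cons IHt /void_ind indicE -natrM mulnb; congr (nat_of_bool _)%:R.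
  apply/andP/idP; rewrite !in_setE /=.
    by move=> [h1 h2] c; rewrite inE => /orP[/eqP ->|/h2].
  move=> h; split; first by apply: h; rewrite inE eqxx.
  by move=> c ct; apply: h; rewrite inE ct orbT.
have ust2 : uniq (s ++ a :: t).
  by rewrite -(perm_uniq (_ : perm_eq ((a :: s) ++ t) _)) //= perm_sym perm_catC /= perm_cons perm_catC.
have ust1 : uniq (s ++ t) by move: ust => /= /andP[].
have -> : \int[P]_om (mixed (a :: s) t om)%:E
    = \int[P]_om ((expR (- w a))%:E * (mixed s t om)%:E - (mixed s (a :: t) om)%:E).
  apply: eq_integral => om _; rewrite -EFinM -EFinB; congr EFin.
  by rewrite /mixed !big_cons; ring.
rewrite integralB //; [|exact: (integrableZl measurableT _ (mixed_integrable s t))|exact: mixed_integrable].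
rewrite (integralZl measurableT (mixed_integrable s t)) !IH // -EFinM -EFinB; congr EFin.
by case: (s) => [|b s']; rewrite ?big_cons ?mulr0 subrr.
Qed.

Lemma measurable_setprod_void S : measurable_fun setT (fun om => setprod (void_var om) S).
Proof.
rewrite /setprod; under eq_fun do rewrite -big_enum /=.
by apply: measurable_prod => a _; exact: measurable_void_var.
Qed.

Lemma void_var_le om a : (`|void_var om a| <= 2)%R.
Proof.
rewrite /void_var normrM ger0_norm ?void_scale_ge0 ?atom_weight_ge0 // -[leRHS]mulr1.
apply: ler_pM => //; first exact: void_scale_ge0.
  apply: le_trans (void_scale_le (atom_weight_ge0 a) (w2 a)) _; have := w2 a; lra.
have := expR_gt0 (- w a); have /andP[] := ind01 a om.
have : (expR (- w a) <= 1)%R by rewrite expR_le1 oppr_le0 atom_weight_ge0.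
by rewrite ler_norml => *; apply/andP; split; lra.
Qed.

Lemma setprod_void_le om S : (`|setprod (void_var om) S| <= 2 ^+ #|S|)%R.
Proof.
rewrite /setprod normr_prod -prodr_const; apply: ler_prod => a _.
by rewrite normr_ge0 void_var_le.
Qed.

Lemma setprod_void_integrable S : P.-integrable setT (fun om => (setprod (void_var om) S)%:E).
Proof. exact: bounded_integrable (@measurable_setprod_void S) (fun om => setprod_void_le om S). Qed.

Lemma setprod_void_mean S : \int[P]_om (setprod (void_var om) S)%:E = (S == finset.set0)%:R%:E.
Proof.
have E1 om : (setprod (void_var om) S
    = (\prod_(a <- enum S) void_scale (w a)) * mixed (enum S) [::] om)%R.
  by rewrite /setprod /mixed big_nil mulr1 -big_split /= big_enum.
under eq_integral => om _ do rewrite E1 EFinM.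
rewrite (integralZl measurableT (mixed_integrable (enum S) [::])) mixed_mean ?cats0 ?enum_uniq // -EFinM.
have [->|/set0Pn[a aS]] := eqVneq S finset.set0; first by rewrite enum_set0 !big_nil mulr1.
have : a \in enum S by rewrite mem_enum.
by case: (enum S) => // b s _; rewrite mulr0.
Qed.

Lemma measurable_chaos_void k : measurable_fun setT (fun om => chaos (void_var om) k).
Proof.
apply: measurable_sum => S; apply: measurable_funM => //; exact: measurable_setprod_void.
Qed.

Lemma chaos_void_mean k : \int[P]_om (chaos (void_var om) k)%:E = (k finset.set0)%:E.
Proof.
have ik S : P.-integrable setT (fun om => (k S * setprod (void_var om) S)%:E).
  exact: (integrableZl measurableT (k S) (setprod_void_integrable S)).
under eq_integral => om _ do rewrite /chaos -sumEFin.
rewrite (integral_sum measurableT ik) (eq_bigr (fun S => (k S * (S == finset.set0)%:R)%:E)); last first.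
  by move=> S _; rewrite (integralZl measurableT (setprod_void_integrable S)) setprod_void_mean.
rewrite sumEFin (bigD1 finset.set0) //= eqxx mulr1 big1 ?addr0 // => S /negbTE ->.
by rewrite mulr0.
Qed.

Lemma chaos_void_sqr om k : (chaos (void_var om) k ^+ 2
  = chaos (void_var om) (collect void_coef (set_contract w k k)))%R.
Proof. rewrite expr2; apply: chaos_mul => a; exact: void_var_sqr. Qed.

Lemma collect_set0 (kap : A -> R) Q : collect kap Q finset.set0 = Q finset.set0 finset.set0 :> R.
Proof.
rewrite /collect (big_pred1 (finset.set0, finset.set0)) /= ?finset.setI0 ?setprod0 ?mul1r //.
move=> [S T] /=; rewrite finset.setU_eq0; apply/andP/eqP => [[/eqP -> /eqP ->] //|[-> ->]].
by rewrite !eqxx.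
Qed.

(** The product formula writes the square as a chaos, whose mean is its coefficient at the empty
    set; only the completely contracted terms contribute to it. *)
Lemma chaos_void_energy k :
  \int[P]_om ((chaos (void_var om) k) ^+ 2)%:E = (energy w k)%:E.
Proof.
under eq_integral => om _ do rewrite chaos_void_sqr.
rewrite chaos_void_mean collect_set0 /set_contract /energy; congr EFin.
apply: eq_big => L; first by rewrite finset.setU0 -finset.setI_eq0 finset.setI0 eqxx.
by move=> _; rewrite !finset.setU0 expr2 mulrA.
Qed.

End PoissonChaos.

Lemma prod_diff_le (R : realFieldType) n (u v : 'I_n -> R) (M e : R) : (0 <= M)%R -> (0 <= e)%R ->
  (forall j, `|u j| <= M)%R -> (forall j, `|v j| <= M)%R ->
  (forall j, `|u j - v j| <= e * M)%R ->
  (`|\prod_j u j - \prod_j v j| <= n%:R * e * M ^+ n)%R.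
Proof.
move=> M0 e0; elim: n u v => [|n IH] u v uM vM uv.
  by rewrite !big_ord0 subrr normr0 !mul0r.
rewrite !big_ord_recl.
have prodM (x : 'I_n.+1 -> R) : (forall j, `|x j| <= M)%R ->
    (`|\prod_(i < n) x (lift ord0 i)| <= M ^+ n)%R.
  move=> xM; rewrite normr_prod -[n in (M ^+ n)%R]card_ord -prodr_const.
  by apply: ler_prod => i _; rewrite normr_ge0 xM.
have h := IH (fun i => u (lift ord0 i)) (fun i => v (lift ord0 i))
  (fun i => uM _) (fun i => vM _) (fun i => uv _).
set p := (\prod_(i < n) u (lift ord0 i))%R in h *.
set r := (\prod_(i < n) v (lift ord0 i))%R in h *.
rewrite (_ : u ord0 * p - v ord0 * r = (u ord0 - v ord0) * p + v ord0 * (p - r))%R; last by ring.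
apply: le_trans (ler_normD _ _) _; rewrite !normrM.
apply: le_trans (_ : (e * M) * M ^+ n + M * (n%:R * e * M ^+ n) <= _)%R.
  apply: lerD; apply: ler_pM => //; first by apply: prodM => i; exact: uM.
rewrite -natr1 exprS le_eqVlt; apply/orP; left; apply/eqP; ring.
Qed.

(** * Void polynomials approximate products of compensated masses *)

Section Closeness.
Context d d' (Z : measurableType d) (Omega : measurableType d') (R : realType).
Variables (P : probability Omega R) (mu : {sigma_finite_measure set Z -> \bar R}).
Variable eta : R.-ker Omega ~> Z.
Hypothesis eta_poisson : poisson_measure P mu eta.
Variables (n : nat) (U : set Z).
Hypothesis mU : measurable U.
Hypothesis Uoo : mu U < +oo.

(** Twice this variable bounds almost surely all compensated masses and void sums of blocks of
    atoms, uniformly in the grid; its moments are finite by the exponential moment of the count of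
    U. *)
Let H (om : Omega) : R := (fine (eta om U) + fine (mu U) + 1)%R.

Let H_ge1 om : (1 <= H om)%R.
Proof. by rewrite /H lerDr addr_ge0 // fine_ge0. Qed.

Let mcount B : measurable B -> measurable_fun setT (fun om => fine (eta om B)).
Proof. by move=> mB; exact: (measurableT_comp (fine_measurable measurableT) (measurable_kernel eta _ mB)). Qed.

Let mH : measurable_fun setT H.
Proof. by apply: measurable_funD => //; apply: measurable_funD => //; exact: mcount. Qed.

Let H_moment k : \int[P]_om (H om ^+ k)%:E < +oo.
Proof.
have mE : measurable_fun setT (fun om => (expR (fine (eta om U)))%:E).
  by apply/measurable_EFinP; apply: measurableT_comp => //; exact: mcount.
apply: (@le_lt_trans _ _ (\int[P]_om ((k`!%:R * expR (fine (mu U) + 1))%:E *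
    (expR (fine (eta om U)))%:E))).
  apply: ge0_le_integral => //.
  - by move=> om _; rewrite lee_fin exprn_ge0 // (le_trans ler01).
  - by apply/measurable_EFinP; apply: measurable_funX.
  - exact: measurable_funeM.
  - move=> om _; rewrite -EFinM lee_fin -mulrA -expRD.
    have := pow_le_exp k (le_trans ler01 (H_ge1 om)).
    by rewrite /H [(_ + fine (eta om U))%R]addrC addrA.
rewrite ge0_integralZl_EFin ?mulr_ge0 ?expR_ge0 //.
apply: lte_mul_pinfty; rewrite ?lee_fin ?mulr_ge0 ?expR_ge0 //.
exact: (count_exp_moment eta_poisson).
Qed.

Section Grid.
Variables (A : finType) (E : A -> set Z) (w : A -> R) (eps : R).
Hypothesis mE : forall a, measurable (E a).
Hypothesis Ew : forall a, mu (E a) = (w a)%:E.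
Hypothesis dE : forall a b, a != b -> E a `&` E b = set0.
Hypothesis EU : U = \big[setU/set0]_(a <- enum A) E a.
Hypothesis w_eps : forall a, (w a <= eps)%R.
Hypothesis eps0 : (0 <= eps)%R.
Hypothesis eps2 : (2 * eps <= 1)%R.

Let w0 a : (0 <= w a)%R. Proof. exact: atom_weight_ge0 Ew a. Qed.
Let w2 a : (2 * w a <= 1)%R.
Proof. by apply: le_trans eps2; rewrite ler_pM2l. Qed.
Let x := void_var eta E w.

Let sum_w : fine (mu U) = (\sum_a w a)%R.
Proof.
rewrite EU (measure_atoms mE dE) ?enum_uniq // (eq_bigr (fun a => (w a)%:E)) => [|a _]; last exact: Ew.
by rewrite sumEFin big_enum.
Qed.

(** The count of the atom a is neither 0 nor 1, and the void indicator loses information. The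
    probability is at most (w a)^2, so all these events together weigh at most eps times the mass of
    U. *)
Let bad1 a : set Omega := ~` ([set om | eta om (E a) = 0%:R%:E] `|` [set om | eta om (E a) = 1%:R%:E]).
Let bad : set Omega := \big[setU/set0]_(a <- enum A) bad1 a.

Let mlevel a (k : nat) : measurable [set om | eta om (E a) = k%:R%:E].
Proof.
have := @measurable_kernel _ _ _ _ _ eta _ (mE a) measurableT _ (emeasurable_set1 k%:R%:E).
by rewrite setTI.
Qed.

Let mbad1 a : measurable (bad1 a).
Proof. by apply: measurableC; apply: measurableU; exact: mlevel. Qed.

Let mbad : measurable bad.
Proof. by apply: bigsetU_measurable => a _. Qed.

Let Pbad : P bad <= (eps * fine (mu U))%:E.
Proof.
apply: (@le_trans _ _ (\sum_(a <- enum A) P (bad1 a))).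
  rewrite /bad; elim: (enum A) => [|a s IH]; first by rewrite !big_nil measure0.
  rewrite !big_cons; apply: le_trans (measureU2 _ _ _) _ => //.
    by apply: bigsetU_measurable => b _.
  exact: leeD2l.
apply: (@le_trans _ _ (\sum_(a <- enum A) (eps * w a)%:E)).
  apply: lee_sum => a _; apply: le_trans (count_ge2 eta_poisson (mE a) (Ew a) (w0 a)) _.
  by rewrite lee_fin expr2 ler_wpM2r.
by rewrite sumEFin big_enum /= -mulr_sumr sum_w.
Qed.

Let counts_nat : {ae P, forall om, exists c : A -> nat, forall a, eta om (E a) = (c a)%:R%:E}.
Proof.
have : {ae P, forall om, forall a, exists m : nat, eta om (E a) = m%:R%:E}.
  apply: filter_forall => a; apply: (count_nat eta_poisson (mE a)).
  by rewrite Ew ltry.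
by apply: filterS => om /= h; have [c hc] := choice h; exists c.
Qed.

Variable B : 'I_n -> {set A}.
Let comp j om := compensated mu eta (\big[setU/set0]_(a <- enum (B j)) E a) om.
Let xi j om : R := (\sum_(a in B j) x om a)%R.

Let compE om (c : A -> nat) j : (forall a, eta om (E a) = (c a)%:R%:E) ->
  comp j om = (\sum_(a in B j) ((c a)%:R - w a))%R.
Proof.
move=> ec; rewrite /comp /compensated !(measure_atoms mE dE) ?enum_uniq //.
have -> : (\sum_(a <- enum (B j)) eta om (E a))%R = (\sum_(a <- enum (B j)) (c a)%:R)%:E.
  by rewrite -sumEFin; apply: eq_bigr => a _; exact: ec.
have -> : (\sum_(a <- enum (B j)) mu (E a))%R = (\sum_(a <- enum (B j)) w a)%:E.
  by rewrite -sumEFin; apply: eq_bigr => a _; exact: Ew.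
by rewrite /= !big_enum sumrB.
Qed.

Let HE om (c : A -> nat) : (forall a, eta om (E a) = (c a)%:R%:E) ->
  H om = (\sum_a ((c a)%:R + w a) + 1)%R.
Proof.
move=> ec; rewrite /H sum_w big_split /=; congr (_ + _ + _)%R.
rewrite EU (measure_atoms mE dE) ?enum_uniq // (eq_bigr (fun a => ((c a)%:R)%:E)) => [|a _]; last exact: ec.
by rewrite sumEFin big_enum.
Qed.

Let xE om (c : A -> nat) a : (forall a, eta om (E a) = (c a)%:R%:E) ->
  x om a = (void_scale (w a) * (expR (- w a) - (c a == 0%N)%:R))%R.
Proof.
move=> ec; rewrite /x /void_var /void_ind indicE; congr (_ * (_ - (nat_of_bool _)%:R))%R.
apply/idP/eqP; rewrite in_setE /no_point /= ec.
  by move=> [] /eqP; rewrite pnatr_eq0 => /eqP.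
by move=> ->.
Qed.

Let sum_B_le (c : A -> nat) j (g : A -> R) (k : R) :
  (forall a, `|g a| <= k * ((c a)%:R + w a))%R -> (0 <= k)%R ->
  (`|\sum_(a in B j) g a| <= k * (\sum_a ((c a)%:R + w a) + 1))%R.
Proof.
move=> gk k0; apply: le_trans (ler_norm_sum _ _ _) _.
apply: (@le_trans _ _ (\sum_(a in B j) k * ((c a)%:R + w a))%R); first by apply: ler_sum.
rewrite -mulr_sumr ler_wpM2l // (le_trans _ (_ : \sum_a ((c a)%:R + w a) <= _)%R) //; last by rewrite lerDl.
rewrite [leRHS](bigID (mem (B j))) /= lerDl sumr_ge0 // => a _.
by rewrite addr_ge0.
Qed.

Let X om : R := ((2 * H om) ^+ (n + n))%R.

(** Off [bad] every factor is within eps * (2 H) of its void approximation and [prod_diff_le]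
    applies; on [bad] both products are merely bounded by (2 H)^n. The exponent n + n in X accounts
    for the square. *)
Let pointwise : {ae P, forall om,
  ((\prod_j comp j om - \prod_j xi j om) ^+ 2
   <= (n%:R ^+ 2 * eps) * X om + 4 * (\1_bad om * X om))%R}.
Proof.
move: counts_nat; apply: filterS => om [c ec].
have H1 := H_ge1 om; have H2 : (0 <= 2 * H om)%R by lra.
have cu j : (`|comp j om| <= 2 * H om)%R.
  apply: le_trans (_ : 1 * H om <= _)%R; last lra.
  rewrite (compE j ec) (HE ec); apply: sum_B_le => // a.
  by rewrite mul1r; apply: le_trans (ler_normB _ _) _; rewrite !ger0_norm.
have cv j : (`|xi j om| <= 2 * H om)%R.
  rewrite (HE ec); apply: sum_B_le => // a.
  by rewrite (xE a ec); exact: (void_scale_bound (w0 a) (w2 a)).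
have X0 : (0 <= X om)%R by exact: exprn_ge0.
have [bd|gd] := boolP (om \in bad).
  rewrite indicE bd mul1r.
  have : (`|\prod_j comp j om - \prod_j xi j om| <= 2 * (2 * H om) ^+ n)%R.
    apply: le_trans (ler_normB _ _) _; rewrite !normr_prod mulr_natl mulr2n.
    by apply: lerD; rewrite -[n in (_ ^+ n)%R]card_ord -prodr_const; apply: ler_prod => j _; rewrite normr_ge0 /=.
  rewrite -ler_sqr ?nnegrE ?mulr_ge0 ?exprn_ge0 // real_normK ?num_real // => h.
  apply: le_trans h _; rewrite exprMn /X exprD -expr2 (_ : 2 ^+ 2 = 4)%R; last by ring.
  by rewrite lerDr !mulr_ge0 ?sqr_ge0 ?exprn_ge0.
rewrite indicE (negbTE gd) mul0r mulr0 addr0.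
have cle a : (c a <= 1)%N.
  have : ~ bad1 a om.
    move=> ba; move/negP: gd; apply; rewrite in_setE /bad -bigcup_seq; exists a => //=.
    by rewrite mem_enum.
  rewrite /bad1 /= ec; case: (c a) => [|[|m]] // h; exfalso; apply: h => -[] [] /eqP;
  by rewrite eqr_nat.
have cd j : (`|comp j om - xi j om| <= eps * (2 * H om))%R.
  rewrite (compE j ec) /xi -sumrB (HE ec) mulrCA mulrA.
  apply: sum_B_le; last by rewrite mulr_ge0.
  move=> a; rewrite (xE a ec).
  apply: le_trans (void_scale_count (w0 a) (w2 a) (cle a)) _.
  by rewrite ler_wpM2r ?addr_ge0 // ler_pM2l.
have h := prod_diff_le H2 eps0 cu cv cd.
have : (`|\prod_j comp j om - \prod_j xi j om| ^+ 2 <= (n%:R * eps * (2 * H om) ^+ n) ^+ 2)%R.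
  by rewrite ler_sqr ?nnegrE ?mulr_ge0 ?exprn_ge0.
rewrite real_normK ?num_real // => h'; apply: le_trans h' _.
rewrite exprMn (_ : ((2 * H om) ^+ n) ^+ 2 = X om)%R; last by rewrite /X exprD expr2.
apply: ler_wpM2r => //; rewrite exprMn; apply: ler_wpM2l; first exact: sqr_ge0.
by rewrite expr2; apply: ler_piMl => //; have := eps2; have := eps0; lra.
Qed.

Let mX : measurable_fun setT X.
Proof. by apply: measurable_funX; apply: measurable_funM. Qed.

Let X0 om : (0 <= X om)%R.
Proof. by apply: exprn_ge0; apply: mulr_ge0 => //; exact: le_trans (H_ge1 om). Qed.

Lemma measurable_block (C : {set A}) :
  measurable_fun setT (compensated mu eta (\big[setU/set0]_(a <- enum C) E a)).
Proof. apply: measurable_funB => //; apply: mcount; exact: measurable_atoms. Qed.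

Lemma measurable_block_sum (C : {set A}) :
  measurable_fun setT (fun om => \sum_(a in C) void_var eta E w om a)%R.
Proof.
under eq_fun do rewrite -big_enum /=.
by apply: measurable_sum => a; exact: measurable_void_var.
Qed.

(** The indicator of [bad] is separated from the unbounded X by 2 X <= th * X^2 + th^-1: X has
    moments and [bad] has small probability. *)
Lemma product_close_grid (th : R) : (0 < th)%R ->
  \int[P]_om ((\prod_j comp j om - \prod_j xi j om) ^+ 2)%:E
  <= (n%:R ^+ 2 * eps)%:E * \int[P]_om ((2 * H om) ^+ (n + n))%:E
   + (4%:E * (th%:E * \int[P]_om ((2 * H om) ^+ (n + n + (n + n)))%:E)
   + (4 * th^-1 * (eps * fine (mu U)))%:E).
Proof.
move=> th0.
have mD : measurable_fun setT (fun om => \prod_j comp j om - \prod_j xi j om)%R.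
  apply: measurable_funB; apply: measurable_prod => j _.
    exact: measurable_block.
  exact: measurable_block_sum.
have mX2 : measurable_fun setT (fun om => ((2 * H om) ^+ (n + n + (n + n)))%:E).
  by apply/measurable_EFinP; apply: measurable_funX; apply: measurable_funM.
have X20 om : (0 <= (2 * H om) ^+ (n + n + (n + n)))%R.
  by rewrite exprD mulr_ge0 ?X0.
have c0 : (0 <= n%:R ^+ 2 * eps)%R by rewrite mulr_ge0 ?sqr_ge0.
have mXE : measurable_fun setT (fun om => (X om)%:E) by exact/measurable_EFinP.
have mb : measurable_fun setT (fun om => (\1_bad om)%:E : \bar R).
  by apply/measurable_EFinP; exact: measurable_indic.
have th1 : (0 <= 4 * th^-1)%R by rewrite mulr_ge0 // invr_ge0 ltW.
have th4 : (0 <= 4 * th)%R by rewrite mulr_ge0 // ltW.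
have g1 om : 0 <= (n%:R ^+ 2 * eps)%:E * (X om)%:E by rewrite -EFinM lee_fin mulr_ge0.
have g2 om : 0 <= (4 * th)%:E * ((2 * H om) ^+ (n + n + (n + n)))%:E.
  by rewrite -EFinM lee_fin mulr_ge0.
have g3 om : 0 <= (4 * th^-1)%:E * (\1_bad om)%:E by rewrite -EFinM lee_fin mulr_ge0.
apply: (@le_trans _ _ (\int[P]_om ((n%:R ^+ 2 * eps)%:E * (X om)%:E + ((4 * th)%:E *
   ((2 * H om) ^+ (n + n + (n + n)))%:E + (4 * th^-1)%:E * (\1_bad om)%:E)))).
  apply: integral_le_ge0_ae.
  - exact: measurable_sqr.
  - apply: emeasurable_funD; first exact: measurable_funeM.
    by apply: emeasurable_funD; exact: measurable_funeM.
  - by move=> om; rewrite !adde_ge0.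
  move: pointwise; apply: filterS => om h.
  rewrite -!EFinM -!EFinD lee_fin; apply: le_trans h _; rewrite lerD2l.
  rewrite -!mulrA -mulrDr ler_wpM2l // exprD -/(X om).
  rewrite indicE; case: (_ \in _); rewrite ?mul1r ?mul0r ?mulr1 ?mulr0 ?addr0; last first.
    by rewrite !mulr_ge0 // ltW.
  have : (0 <= th * (X om - th^-1) ^+ 2)%R by rewrite mulr_ge0 ?sqr_ge0 // ltW.
  rewrite (_ : th * _ = th * (X om * X om) + th^-1 - 2 * X om)%R; last first.
    by field; rewrite gt_eqF.
  by have := X0 om; lra.
rewrite ge0_integralD //; first last.
- by apply: emeasurable_funD; exact: measurable_funeM.
- by move=> om _; rewrite adde_ge0.
- exact: measurable_funeM.
rewrite (ge0_integralZl_EFin _ measurableT) //; last by move=> om _; rewrite lee_fin.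
apply: leeD2l; rewrite ge0_integralD //; first last.
- exact: measurable_funeM.
- exact: measurable_funeM.
rewrite (ge0_integralZl_EFin _ measurableT) //; last by move=> om _; rewrite lee_fin.
rewrite [(4 * th)%:E]EFinM -muleA; apply: leeD2l.
rewrite (ge0_integralZl_EFin _ measurableT) // integral_indicT //.
by rewrite [leRHS]EFinM; apply: lee_wpmul2l; rewrite ?lee_fin.
Qed.

End Grid.
Lemma product_close (delta : R) : (0 < delta)%R -> exists2 eps : R, (0 < eps)%R &
  forall (A : finType) (E : A -> set Z) (w : A -> R) (e : R),
  (forall a, measurable (E a)) -> (forall a, mu (E a) = (w a)%:E) ->
  (forall a b, a != b -> E a `&` E b = set0) -> U = \big[setU/set0]_(a <- enum A) E a ->
  (forall a, w a <= e)%R -> (0 <= e)%R -> (2 * e <= 1)%R -> (e <= eps)%R ->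
  forall B : 'I_n -> {set A},
  \int[P]_om ((\prod_j compensated mu eta (\big[setU/set0]_(a <- enum (B j)) E a) om
              - \prod_j \sum_(a in B j) void_var eta E w om a) ^+ 2)%:E <= delta%:E.
Proof.
move=> d0.
have H2_moment k : \int[P]_om ((2 * H om) ^+ k)%:E < +oo.
  under eq_integral => om _ do rewrite exprMn EFinM.
  rewrite ge0_integralZl_EFin //.
  - by apply: lte_mul_pinfty; rewrite ?lee_fin ?exprn_ge0.
  - by move=> om _; rewrite lee_fin exprn_ge0 // (le_trans ler01).
  - by apply/measurable_EFinP; apply: measurable_funX.
have H20 k : 0 <= \int[P]_om ((2 * H om) ^+ k)%:E.
  apply: integral_ge0 => om _; rewrite lee_fin exprn_ge0 // mulr_ge0 //.
  exact: le_trans (H_ge1 om).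
pose h k := fine (\int[P]_om ((2 * H om) ^+ k)%:E).
have hE k : \int[P]_om ((2 * H om) ^+ k)%:E = (h k)%:E by rewrite fineK // ge0_fin_numE.
have h0 k : (0 <= h k)%R by rewrite fine_ge0.
(* th is fixed so that the term with the high moment is at most delta / 2; eps is chosen afterwards
   and absorbs the factor th^-1. *)
pose th := (delta / (8 * (h (n + n + (n + n))%N + 1)))%R.
have th0 : (0 < th)%R by rewrite divr_gt0 // mulr_gt0 // ltr_wpDl.
pose S := (n%:R ^+ 2 * h (n + n)%N + 4 * th^-1 * fine (mu U) + 1)%R.
have S0 : (0 < S)%R.
  by rewrite ltr_wpDl // addr_ge0 // !mulr_ge0 ?invr_ge0 ?fine_ge0 ?sqr_ge0 // ltW.
exists (delta / (2 * S))%R; first by rewrite divr_gt0 // mulr_gt0.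
move=> A E w e mE Ew dE EU we e0 e2 eS B.
apply: le_trans (product_close_grid mE Ew dE EU we e0 e2 B th0) _.
rewrite !hE -!EFinM -!EFinD lee_fin.
rewrite (_ : _ + _ = e * (S - 1) + 4 * (th * h (n + n + (n + n))%N))%R; last by rewrite /S; ring.
rewrite [leRHS](_ : delta = delta / 2 + delta / 2)%R; last by field.
apply: lerD.
  apply: (@le_trans _ _ (e * S)%R); first by rewrite ler_wpM2l // lerBlDr lerDl.
  by apply: le_trans (ler_wpM2r (ltW S0) eS) _; rewrite le_eqVlt; apply/orP; left; apply/eqP; field; rewrite gt_eqF.
rewrite /th (_ : 4 * _ = delta / 2 * (h (n + n + (n + n))%N / (h (n + n + (n + n))%N + 1)))%R.
  rewrite ler_piMr ?divr_ge0 ?(ltW d0) // ler_pdivrMr ?ltr_wpDl // mul1r lerDl //.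
by field; rewrite gt_eqF // ltr_wpDl.
Qed.

End Closeness.

(** * Elementary integrals on a grid *)

Section CoarsePartition.
Context d (Z : measurableType d) (R : realType).
Variable mu : {sigma_finite_measure set Z -> \bar R}.
Variables (I : finType) (S : I -> set Z).

Definition pattern (z : Z) : {set I} := [set i | `[< S i z >]]%SET.

(** Atoms of the algebra generated by the sets S i. The empty pattern is left out since the
    complement of all the S i may have infinite mass, and only patterns that occur are kept so that
    each cell contains a point. *)
Definition coarse : finType :=
  {c : {set I} | (c != finset.set0) && `[< exists z, pattern z = c >]}.

Definition cell (c : coarse) : set Z := [set z | pattern z = val c].

Lemma in_pattern i z : (i \in pattern z) = `[< S i z >].
Proof. by rewrite inE. Qed.

Lemma in_cell c i z : cell c z -> (i \in val c) = `[< S i z >].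
Proof. by move=> <-; exact: in_pattern. Qed.

Lemma cell_ex (c : coarse) : exists z, cell c z.
Proof. by have /andP[_ /asboolP] := valP c. Qed.

Definition cell_point (c : coarse) : Z := projT1 (cid (cell_ex c)).

Lemma cell_pointP c : cell c (cell_point c).
Proof. exact: projT2 (cid (cell_ex c)). Qed.

Lemma cell_cover i z : S i z -> exists c, cell c z.
Proof.
move=> Siz; have h : (pattern z != finset.set0) && `[< exists z', pattern z' = pattern z >].
  apply/andP; split; last by apply/asboolP; exists z.
  by apply/set0Pn; exists i; rewrite in_pattern; apply/asboolP.
by exists (Sub (pattern z) h).
Qed.

Lemma cell_disjoint c c' : c != c' -> cell c `&` cell c' = set0.
Proof.
move=> cc'; apply/seteqP; split => // z [cz c'z]; move/eqP: cc'; apply.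
by apply: val_inj; rewrite -cz c'z.
Qed.

Hypothesis mS : forall i, measurable (S i).
Hypothesis Soo : forall i, mu (S i) < +oo.

Lemma measurable_cell c : measurable (cell c).
Proof.
rewrite (_ : cell c = \bigcap_(i in [set: I]) (if i \in val c then S i else ~` S i)).
  apply: fin_bigcap_measurable; first exact: finite_finset.
  by move=> i _; case: ifP => _; [exact: mS | exact: measurableC].
apply/seteqP; split => z /=.
  move=> cz i _; rewrite (in_cell i cz); case: ifP => [/asboolP //|/negP h].
  by move=> Siz; apply: h; apply/asboolP.
move=> h; apply/setP => i; rewrite in_pattern; have := h i Logic.I.
case: ifP => [_ Siz|_ nS]; first exact/asboolP.
by apply/negbTE/negP => /asboolP.
Qed.

Lemma cell_sub (c : coarse) i : i \in val c -> cell c `<=` S i.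
Proof. by move=> ic z cz; move: ic; rewrite (in_cell i cz) => /asboolP. Qed.

Lemma cell_finite c : mu (cell c) < +oo.
Proof.
have /andP[/set0Pn[i ic] _] := valP c.
apply: le_lt_trans (Soo i); apply: le_measure; rewrite ?inE //; first exact: measurable_cell.
exact: cell_sub.
Qed.

Definition cell_weight c : R := fine (mu (cell c)).

Lemma cell_weightE c : mu (cell c) = (cell_weight c)%:E.
Proof. by rewrite fineK // ge0_fin_numE // cell_finite. Qed.

Definition support_set : set Z := \bigcup_(i in [set: I]) S i.

Lemma measurable_support : measurable support_set.
Proof. by apply: fin_bigcup_measurable; [exact: finite_finset | move=> i _]. Qed.

Lemma support_finite : mu support_set < +oo.
Proof.
apply: (@le_lt_trans _ _ (\sum_(i <- enum I) mu (S i))).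
  rewrite /support_set (_ : \bigcup_(i in _) S i = \big[setU/set0]_(i <- enum I) S i); last first.
    by rewrite -bigcup_seq; apply: eq_bigcupl; split => i //= _; rewrite mem_enum.
  elim: (enum I) => [|i s IH]; first by rewrite !big_nil measure0.
  rewrite !big_cons; apply: le_trans (measureU2 _ _ _) _ => //.
    by apply: bigsetU_measurable.
  exact: leeD2l.
by rewrite big_enum; apply: lte_sum_pinfty => i _.
Qed.

Section Grid.
Variables (N : nat) (D : 'I_N -> set Z) (w : coarse * 'I_N -> R) (e : R).

Definition atom (a : coarse * 'I_N) : set Z := cell a.1 `&` D a.2.

(** One partition D of the whole space cuts all coarse cells, so that atoms are indexed by a product
    and summing over the second index recovers the weight of a cell. *)
Definition is_grid : Prop :=
  [/\ forall i, measurable (D i), forall i j, i != j -> D i `&` D j = set0,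
      forall z, exists i, D i z, forall a, mu (atom a) = (w a)%:E &
      forall a, (w a <= e)%R].

Hypothesis grid : is_grid.

Lemma measurable_atom a : measurable (atom a).
Proof. by have [mD _ _ _ _] := grid; apply: measurableI; [exact: measurable_cell | exact: mD]. Qed.

Lemma atom_mu a : mu (atom a) = (w a)%:E.
Proof. by have [_ _ _ + _] := grid; apply. Qed.

Lemma atom_le a : (w a <= e)%R.
Proof. by have [_ _ _ _] := grid; apply. Qed.

Lemma atom_ge0 a : (0 <= w a)%R.
Proof. by rewrite -lee_fin -atom_mu. Qed.

Lemma atom_disjoint a b : a != b -> atom a `&` atom b = set0.
Proof.
have [_ dD _ _ _] := grid; case: a b => [c i] [c' j]; rewrite xpair_eqE negb_and => /orP[h|h].
  by rewrite /atom setIACA (cell_disjoint h) set0I.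
by rewrite /atom setIACA (dD _ _ h) setI0.
Qed.

Lemma atom_cover z c : cell c z -> exists i, atom (c, i) z.
Proof. by have [_ _ cov _ _] := grid; move=> cz; have [i Di] := cov z; exists i. Qed.

Lemma sum_atom_weight c : (\sum_i w (c, i) = cell_weight c)%R.
Proof.
have h : mu (\big[setU/set0]_(a <- [seq (c, i) | i <- enum 'I_N]) atom a)
    = (\sum_(a <- [seq (c, i) | i <- enum 'I_N]) mu (atom a))%R.
  apply: (measure_atoms measurable_atom atom_disjoint).
  by rewrite map_inj_uniq ?enum_uniq // => i j [].
have E : \big[setU/set0]_(a <- [seq (c, i) | i <- enum 'I_N]) atom a = cell c.
  rewrite -bigcup_seq; apply/seteqP; split => z.
    by move=> [a /= /mapP[i _ ->]] [].
  move=> cz; have [i ci] := atom_cover cz; exists (c, i) => //=.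
  by apply: map_f; rewrite mem_enum.
move: h; rewrite E cell_weightE big_map big_enum /= => h.
by apply: EFin_inj; rewrite h -sumEFin; apply: eq_bigr => i _; rewrite atom_mu.
Qed.

Definition atoms_in (i : I) : {set coarse * 'I_N} := [set a : coarse * 'I_N | i \in val a.1]%SET.

Lemma atoms_inE i : S i = \big[setU/set0]_(a <- enum (atoms_in i)) atom a.
Proof.
rewrite -bigcup_seq; apply/seteqP; split => z.
  move=> Siz; have [c cz] := cell_cover Siz; have [j aj] := atom_cover cz.
  by exists (c, j) => //=; rewrite mem_enum inE /= (in_cell i cz); apply/asboolP.
by move=> [a /=]; rewrite mem_enum inE => ia [az _]; exact: cell_sub az.
Qed.

Lemma support_atoms : support_set = \big[setU/set0]_(a <- enum {: coarse * 'I_N}) atom a.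
Proof.
rewrite -bigcup_seq; apply/seteqP; split => z.
  move=> [i _ Siz]; have [c cz] := cell_cover Siz; have [j aj] := atom_cover cz.
  by exists (c, j) => //=; rewrite mem_enum.
move=> [a _ [az _]]; have /andP[/set0Pn[i ia] _] := valP a.1.
by exists i => //; exact: cell_sub az.
Qed.

End Grid.

Lemma grid_exists (e : R) : borel_space Z R -> non_atomic mu -> (0 < e)%R ->
  exists N (D : 'I_N -> set Z) w, is_grid D w e.
Proof.
move=> bZ na e0.
have [N [D [mD dD cov De]]] := small_cover bZ na measurable_support support_finite e0.
exists N, D, (fun a => fine (mu (atom D a))); split => //.
  move=> a; rewrite fineK // ge0_fin_numE //; apply: le_lt_trans (cell_finite a.1).
  apply: le_measure; rewrite ?inE //; [|exact: measurable_cell|exact: subIsetl].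
  by apply: measurableI => //; exact: measurable_cell.
move=> a; rewrite -lee_fin fineK; last first.
  rewrite ge0_fin_numE //; apply: le_lt_trans (cell_finite a.1).
  apply: le_measure; rewrite ?inE //; [|exact: measurable_cell|exact: subIsetl].
  by apply: measurableI => //; exact: measurable_cell.
apply: le_trans (De a.2); apply: le_measure; rewrite ?inE //.
- by apply: measurableI => //; exact: measurable_cell.
- by apply: measurableI => //; exact: measurable_support.
move=> z [az Dz]; split => //; have /andP[/set0Pn[i ia] _] := valP a.1.
by exists i => //; exact: cell_sub az.
Qed.

End CoarsePartition.

Section SquareIntegrals.
Context d (T : measurableType d) (R : realType) (m : {measure set T -> \bar R}).
Implicit Types X Y : T -> R.

Lemma integral_sqr_scale c X : measurable_fun setT X ->
  \int[m]_x ((c * X x) ^+ 2)%:E = (c ^+ 2)%:E * \int[m]_x (X x ^+ 2)%:E.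
Proof.
move=> mX; under eq_integral => x _ do rewrite exprMn EFinM.
rewrite ge0_integralZl_EFin ?sqr_ge0 //; first by move=> x _; rewrite lee_fin sqr_ge0.
exact: measurable_sqr.
Qed.

Lemma integral_sqr_add_le X Y : measurable_fun setT X -> measurable_fun setT Y ->
  \int[m]_x ((X x + Y x) ^+ 2)%:E
  <= 2%:E * \int[m]_x (X x ^+ 2)%:E + 2%:E * \int[m]_x (Y x ^+ 2)%:E.
Proof.
move=> mX mY; have mX2 := measurable_sqr mX; have mY2 := measurable_sqr mY.
have s0 (Z : T -> R) x : 0 <= 2%:E * (Z x ^+ 2)%:E by rewrite -EFinM lee_fin mulr_ge0 ?sqr_ge0.
rewrite -!(ge0_integralZl_EFin _ measurableT) //; try by move=> x _; rewrite lee_fin sqr_ge0.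
rewrite -ge0_integralD //; try exact: measurable_funeM.
apply: ge0_le_integral => //.
- by move=> x _; rewrite lee_fin sqr_ge0.
- by apply: measurable_sqr; exact: measurable_funD.
- by apply: emeasurable_funD; exact: measurable_funeM.
move=> x _; rewrite -!EFinM -EFinD lee_fin -subr_ge0.
rewrite (_ : _ - _ = (X x - Y x) ^+ 2)%R ?sqr_ge0 //; ring.
Qed.

End SquareIntegrals.

Section ElementaryData.
Context d (Z : measurableType d) (R : realType).
Variable mu : {sigma_finite_measure set Z -> \bar R}.
Variables (I : finType) (S : I -> set Z).

(* A list of pairs (c, r) stands for the sum of c times the product rectangle
   of the sets S i, i in r; rectangles of different orders may occur. *)
Implicit Type D : seq (R * seq I).

Definition at_point (i : I) (z : Z) : bool := `[< S i z >].
Definition at_cell (i : I) (c : coarse S) : bool := i \in val c.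
Definition at_atom N (i : I) (a : coarse S * 'I_N) : bool := at_cell i a.1.

Definition data_fun D (t : seq Z) : R := (\sum_(p <- D) p.1 * (rect at_point p.2 t)%:R)%R.
Definition data_kernel D (s : seq (coarse S)) : R :=
  (\sum_(p <- D) p.1 * (rect at_cell p.2 s)%:R)%R.
Definition data_sum N (x : coarse S * 'I_N -> R) D : R :=
  (\sum_(p <- D) p.1 * tsum x (size p.2) (fun s => (rect (@at_atom N) p.2 s)%:R))%R.
(** Derivative at a point lying in the sets S i with i in J and in no other. Only the first variable
    is tested and removed; for symmetric functions the factor [size p.2] accounts for the other
    variables. *)
Definition data_derivative D (J : {set I}) : seq (R * seq I) :=
  [seq ((size p.2)%:R * p.1 * (if p.2 is i :: _ then i \in J else false)%:R, behead p.2)%R | p <- D].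

Definition disjoint_data D := forall p, p \in D ->
  pairwise (fun i j => `[< S i `&` S j = set0 >]) p.2.

Definition sized_data n D := forall p, p \in D -> (size p.2 <= n)%N.

Lemma rect_box r (s : seq (coarse S)) (t : seq Z) : box (cell (S := S)) s t ->
  rect at_point r t = rect at_cell r s.
Proof.
elim: r s t => [|i r IH] [|c s] [|z t] //= [cz /IH ->].
by rewrite /at_point /at_cell (in_cell i cz).
Qed.

Lemma data_fun_box D s t : box (cell (S := S)) s t -> data_fun D t = data_kernel D s.
Proof. by move=> st; apply: eq_bigr => p _; rewrite (rect_box _ st). Qed.

Lemma box_points s : box (cell (S := S)) s (map (@cell_point d Z I S) s).
Proof. by elim: s => //= c s IH; split; [exact: cell_pointP|]. Qed.

Lemma data_kernelE D s : data_kernel D s = data_fun D (map (@cell_point d Z I S) s).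
Proof. by rewrite (data_fun_box D (box_points s)). Qed.

Lemma rect_in_box r t : rect at_point r t -> exists s, box (cell (S := S)) s t.
Proof.
elim: r t => [|i r IH] [|z t] //=; first by exists [::].
move=> /andP[/asboolP Siz /IH[s st]]; have [c cz] := cell_cover Siz.
by exists (c :: s).
Qed.

Lemma data_fun_step D n (t : n.-tuple Z) :
  data_fun D t = step (fun s : n.-tuple (coarse S) => tbox (cell (S := S)) s)
                      (fun s : n.-tuple (coarse S) => data_kernel D s) t.
Proof.
have [[s st]|no] := pselect (exists s, box (cell (S := S)) s t).
  have ns : size s == n by rewrite (box_size st) size_tuple.
  have st' : tbox (cell (S := S)) (Tuple ns) t by [].
  rewrite (step_cell _ _ st') ?(data_fun_box D st) //.
  by move=> i j ij; apply: tbox_disjoint ij; exact: cell_disjoint.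
rewrite /data_fun big1 => [|p _]; last first.
  case: (boolP (rect _ _ _)) => [/rect_in_box[s st]|_]; last by rewrite mulr0.
  by exfalso; apply: no; exists s.
rewrite /step big1 // => s _; rewrite indicE memNset ?mulr0 // => st.
by apply: no; exists s.
Qed.

(** Disjoint sides cannot share a cell, so these rectangles vanish on lists with a repeated cell.
    For elementary kernels sums over all tuples of atoms thus equal sums over distinct atoms without
    error, in contrast to averaged kernels. *)
Lemma rect_uniq r s : pairwise (fun i j => `[< S i `&` S j = set0 >]) r ->
  rect at_cell r s -> uniq s.
Proof.
elim: r s => [|i r IH] [|c s] //= /andP[ir pr] /andP[ic rs]; rewrite (IH _ pr rs) andbT.
apply/negP => cs.
have : exists2 j, j \in r & at_cell j c.
  elim: (r) (s) rs cs => [|j r' IHr] [|c' s'] //= /andP[jc' rs']; rewrite inE.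
  move=> /orP[/eqP ->|/(IHr _ rs')[k kr kc]]; first by exists j; rewrite // inE eqxx.
  by exists k; rewrite // inE kr orbT.
move=> [j jr jc]; have /allP/(_ j jr)/asboolP := ir.
move/seteqP => [/(_ (cell_point c))] + _; apply.
by split; [exact: cell_sub ic _ (cell_pointP c) | exact: cell_sub jc _ (cell_pointP c)].
Qed.

Lemma data_kernel_uniq D s : disjoint_data D -> ~~ uniq s -> data_kernel D s = 0%R.
Proof.
move=> dD us; rewrite /data_kernel big1_seq // => p /andP[_ pD].
case: (boolP (rect _ _ _)) => [|_]; last by rewrite mulr0.
by move/(rect_uniq (dD _ pD)); rewrite (negbTE us).
Qed.

Lemma data_kernel_size D n s : sized_data n D -> data_kernel D s != 0%R -> (size s <= n)%N.
Proof.
move=> sD; apply: contraNT; rewrite -ltnNge => ns; rewrite /data_kernel big1_seq // => p /andP[_ pD].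
case: (boolP (rect _ _ _)) => [/rect_size E|_]; last by rewrite mulr0.
by have := sD _ pD; rewrite E leqNgt ns.
Qed.

Section AtomSums.
Variables (N : nat) (x : coarse S * 'I_N -> R) (n : nat) (D : seq (R * seq I)).
Hypothesis dD : disjoint_data D.
Hypothesis sD : sized_data n D.
Hypothesis D_perm : forall s s', perm_eq s s' -> data_kernel D s = data_kernel D s'.

Definition atom_kernel (s : seq (coarse S * 'I_N)) : R := data_kernel D (map fst s).

Lemma atom_kernel_perm s s' : perm_eq s s' -> atom_kernel s = atom_kernel s'.
Proof. by move=> ss'; apply: D_perm; exact: perm_map. Qed.

Lemma atom_kernel_size s : atom_kernel s != 0%R -> (size s <= n)%N.
Proof. by move=> /(data_kernel_size sD); rewrite size_map. Qed.

Lemma atom_kernel_nuniq s : ~~ uniq s -> atom_kernel s = 0%R.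
Proof. by move=> us; apply: data_kernel_uniq => //; apply: contra us; exact: map_uniq. Qed.

Lemma data_sum_by_size (D' : seq (R * seq I)) m : sized_data m D' ->
  data_sum x D' = (\sum_(k < m.+1) tsum x k (fun s => data_kernel D' (map fst s)))%R.
Proof.
move=> sD'; rewrite /data_sum /data_kernel.
under [RHS]eq_bigr => k _ do rewrite tsum_sum.
rewrite exchange_big /=; apply: eq_big_seq => p pD.
rewrite (bigD1 (Ordinal (sD' p pD : (size p.2 < m.+1)%N))) //= [X in (_ + X)%R]big1 ?addr0.
  by rewrite -tsumZ; apply: eq_tsum => s _; rewrite rect_map.
move=> k kp; rewrite (@eq_tsum _ _ x k _ (fun=> 0 * 0)%R) => [|s sk]; last first.
  case: (boolP (rect _ _ _)) => [/rect_size|_]; last by rewrite !mulr0.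
  by rewrite size_map sk => E; case/eqP: kp; apply: val_inj.
by rewrite tsumZ mul0r.
Qed.

Lemma data_sum_chaos : data_sum x D = chaos x (sym_kernel atom_kernel).
Proof.
rewrite (data_sum_by_size sD) (chaos_sym_kernel atom_kernel_perm atom_kernel_size).
apply: eq_bigr => k _; apply: tsum_gsum => s _ h; apply: atom_kernel_nuniq.
by apply: contra h => ->; apply/hasPn.
Qed.

Lemma data_derivative_kernel (c : coarse S) s :
  data_kernel (data_derivative D (val c)) s = ((size s).+1%:R * data_kernel D (c :: s))%R.
Proof.
rewrite /data_kernel /data_derivative big_map mulr_sumr; apply: eq_bigr => -[a r] _ /=.
case: r => [|i r] /=; first by rewrite !mul0r !mulr0.
rewrite -/(at_cell i c) -mulnb natrM.
case: (boolP (rect _ _ _)) => [/rect_size ->|_]; last by rewrite !mulr0.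
by rewrite /= !mulr1; ring.
Qed.

Lemma sized_derivative J : sized_data n.-1 (data_derivative D J).
Proof.
move=> p /mapP[p' /sD p'D ->] /=; rewrite size_behead.
by case: (size _) p'D => [|k] //=; case: (n).
Qed.

Lemma data_derivative_chaos (b : coarse S * 'I_N) :
  data_sum x (data_derivative D (val b.1)) = chaos x (dkern (sym_kernel atom_kernel) b).
Proof.
rewrite (data_sum_by_size (@sized_derivative _)).
rewrite (chaos_dkern_sym_kernel atom_kernel_perm atom_kernel_size).
rewrite [RHS]big_ord_recl mul0r add0r.
(* For n = 0 the order n.-1 is again 0 by truncation, and the single term vanishes because lists of
   length one carry no kernel. *)
have [n0|n0] := posnP n.
  rewrite n0 big_ord0 /= big_ord_recl big_ord0 addr0 /= data_derivative_kernel /=.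
  rewrite mul1r; apply/eqP/negPn/negP => /(data_kernel_size sD).
  by rewrite n0.
rewrite prednK //; apply: eq_bigr => k _; rewrite /= /bump /= add1n.
rewrite -tsum_gsum; last first.
  move=> s _ h; apply: atom_kernel_nuniq; apply: contra h => /= /andP[bs ->].
  by apply/hasPn => a as_; rewrite inE; apply: contraNneq bs => <-.
rewrite -tsumZ; apply: eq_tsum => s sk.
by rewrite data_derivative_kernel size_map sk.
Qed.

End AtomSums.

Section Closeness.
Context d' (Omega : measurableType d').
Variables (P : probability Omega R) (eta : R.-ker Omega ~> Z).
Hypothesis eta_poisson : poisson_measure P mu eta.
Hypothesis mS : forall i, measurable (S i).
Hypothesis Soo : forall i, mu (S i) < +oo.

Definition data_int D (om : Omega) : R :=
  (\sum_(p <- D) p.1 * \prod_(i <- p.2) compensated mu eta (S i) om)%R.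

(** Uniform over all grids of mesh at most eps: the cells are fixed by S, while the grid can be
    chosen later and shared by several data. *)
Definition close_on (X : Omega -> R)
    (Y : forall N, ('I_N -> set Z) -> (coarse S * 'I_N -> R) -> Omega -> R) (eps delta : R) :=
  forall N (G : 'I_N -> set Z) w e, is_grid mu G w e -> (0 <= e)%R -> (2 * e <= 1)%R ->
    (e <= eps)%R -> \int[P]_om ((X om - Y N G w om) ^+ 2)%:E <= delta%:E.

Lemma measurable_compensated B : measurable B -> measurable_fun setT (compensated mu eta B).
Proof.
move=> mB; apply: measurable_funB => //.
exact: (measurableT_comp (fine_measurable measurableT) (measurable_kernel eta _ mB)).
Qed.

Lemma measurable_data_int D : measurable_fun setT (data_int D).
Proof.
apply: measurable_sum => p; apply: measurable_funM => //.
by apply: measurable_prod => i _; exact: measurable_compensated.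
Qed.

Lemma tsum_atomE N (x : coarse S * 'I_N -> R) r : tsum x (size r) (fun s => (rect (@at_atom N) r s)%:R)
  = (\prod_(i <- r) \sum_(a in atoms_in S N i) x a)%R.
Proof.
rewrite tsum_rect; apply: eq_bigr => i _; rewrite [RHS]big_mkcond /=.
by apply: eq_bigr => a _; rewrite inE /at_atom /at_cell; case: (_ \in _); rewrite ?mulr1 ?mulr0.
Qed.

Lemma rect_close r delta : (0 < delta)%R -> exists2 eps : R, (0 < eps)%R &
  close_on (fun om => \prod_(i <- r) compensated mu eta (S i) om)%R
    (fun N G w om => tsum (void_var eta (atom G) w om) (size r)
      (fun s => (rect (@at_atom N) r s)%:R)) eps delta.
Proof.
move=> d0; have [eps e0 H] := product_close eta_poisson (size r) (measurable_support mS)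
  (support_finite mS Soo) d0.
exists eps => // N G w e grid e1 e2 eeps.
have := H _ _ _ e (measurable_atom mS grid) (atom_mu grid) (atom_disjoint grid)
  (support_atoms grid) (atom_le grid) e1 e2 eeps (fun j => atoms_in S N (tnth (in_tuple r) j)).
congr (_ <= _); apply: eq_integral => om _; rewrite tsum_atomE.
rewrite (big_tnth _ _ r) [in RHS](big_tnth _ _ r (fun=> true) (fun i => \sum_(a in atoms_in S N i) _)%R).
congr ((_ - _) ^+ 2)%:E; apply: eq_bigr => j _.
by rewrite -(atoms_inE grid).
Qed.

Lemma measurable_data_sum N (D' : 'I_N -> set Z) w e D : is_grid mu D' w e ->
  measurable_fun setT (fun om => data_sum (void_var eta (atom D') w om) D).
Proof.
move=> grid; apply: measurable_sum => p; apply: measurable_funM => //.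
under eq_fun do rewrite tsum_atomE.
apply: measurable_prod => i _; under eq_fun do rewrite -big_enum /=.
by apply: measurable_sum => a; apply: measurable_void_var; exact: measurable_atom grid.
Qed.

Lemma data_close D delta : (0 < delta)%R -> exists2 eps : R, (0 < eps)%R &
  close_on (data_int D) (fun N G w om => data_sum (void_var eta (atom G) w om) D) eps delta.
Proof.
elim: D delta => [|[c r] D IH] delta d0.
  exists 1%R => // N D' w e _ _ _ _.
  rewrite integral0_eq ?lee_fin ?ltW // => om _.
  by rewrite /data_int /data_sum !big_nil subrr expr0n.
(* The new rectangle enters with c squared and a factor 2 from the square of a sum; the added 1
   avoids a division by zero. *)
have d1 : (0 < delta / (4 * (c ^+ 2 + 1)))%R.
  by rewrite divr_gt0 // mulr_gt0 // ltr_wpDl // sqr_ge0.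
have d2 : (0 < delta / 4)%R by rewrite divr_gt0.
have [e1 e10 H1] := rect_close r d1; have [e2 e20 H2] := IH _ d2.
exists (Num.min e1 e2); first by rewrite lt_min e10.
move=> N D' w e grid e0 ee; rewrite le_min => /andP[ee1 ee2].
have := H1 N D' w e grid e0 ee ee1; have := H2 N D' w e grid e0 ee ee2.
set X2 := \int[P]_om _; set X1 := \int[P]_om _ => h2 h1.
have mr : measurable_fun setT (fun om => \prod_(i <- r) compensated mu eta (S i) om -
    tsum (void_var eta (atom D') w om) (size r) (fun s => (rect (@at_atom N) r s)%:R))%R.
  apply: measurable_funB; first by apply: measurable_prod => i _; exact: measurable_compensated.
  under eq_fun do rewrite tsum_atomE.
  apply: measurable_prod => i _; under eq_fun do rewrite -big_enum /=.
  by apply: measurable_sum => a; apply: measurable_void_var; exact: measurable_atom grid.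
have mD : measurable_fun setT (fun om => data_int D om -
    data_sum (void_var eta (atom D') w om) D)%R.
  by apply: measurable_funB; [exact: measurable_data_int | exact: measurable_data_sum grid].
apply: (@le_trans _ _ (2%:E * ((c ^+ 2)%:E * X1) + 2%:E * X2)).
  rewrite -(integral_sqr_scale P c mr); apply: le_trans (integral_sqr_add_le P _ mD); last first.
    exact: measurable_funM.
  rewrite le_eqVlt; apply/orP; left; apply/eqP; apply: eq_integral => om _.
  by rewrite /data_int /data_sum !big_cons /=; congr EFin; ring.
apply: (@le_trans _ _ (2%:E * ((c ^+ 2)%:E * (delta / (4 * (c ^+ 2 + 1)))%:E) + 2%:E * (delta / 4)%:E)).
  by apply: leeD; do ?[apply: lee_wpmul2l; rewrite ?lee_fin ?sqr_ge0 //].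
rewrite -!EFinM -EFinD lee_fin.
have c1 : (0 < c ^+ 2 + 1)%R by rewrite ltr_wpDl // sqr_ge0.
rewrite (_ : _ + _ = delta / 2 * (c ^+ 2 / (c ^+ 2 + 1)) + delta / 2)%R; last first.
  by field; rewrite gt_eqF.
rewrite [leRHS](_ : delta = delta / 2 + delta / 2)%R; last by field.
rewrite lerD2r ler_piMr ?divr_ge0 ?(ltW d0) // ler_pdivrMr // mul1r lerDl //.
Qed.

End Closeness.
End ElementaryData.

(** * Isometry and uniqueness of chaos expansions *)

Section RealSquareNorm.
Context d (T : measurableType d) (R : realType) (m : {measure set T -> \bar R}).
Implicit Types f g : T -> R.

Definition isL2 f := measurable_fun setT f /\ \int[m]_x (f x ^+ 2)%:E < +oo.

Definition nrm f : R := Num.sqrt (sqnorm m f).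

Lemma nrm_ge0 f : (0 <= nrm f)%R. Proof. exact: sqrtr_ge0. Qed.

Lemma nrm_sqr f : (nrm f ^+ 2 = sqnorm m f)%R.
Proof. by rewrite sqr_sqrtr // sqnorm_ge0. Qed.

Lemma isL2_sqr f : isL2 f -> \int[m]_x (f x ^+ 2)%:E = (nrm f ^+ 2)%:E.
Proof. by move=> [_ f2]; rewrite nrm_sqr sqnormE. Qed.

Lemma nrm_le f (c : R) : (0 <= c)%R -> \int[m]_x (f x ^+ 2)%:E <= (c ^+ 2)%:E -> (nrm f <= c)%R.
Proof.
move=> c0 h; rewrite -(@ler_pXn2r _ 2) ?nnegrE ?nrm_ge0 // nrm_sqr -lee_fin -sqnormE //.
by apply: le_lt_trans h _; rewrite ltry.
Qed.

Lemma isL2_le f (c : R) : measurable_fun setT f -> \int[m]_x (f x ^+ 2)%:E <= c%:E -> isL2 f.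
Proof. by move=> mf h; split => //; apply: le_lt_trans h _; rewrite ltry. Qed.

Lemma isL2D f g : isL2 f -> isL2 g -> isL2 (f \+ g)%R.
Proof.
move=> [mf f2] [mg g2]; split; first exact: measurable_funD.
by apply: le_lt_trans (integral_sqr_add_le m mf mg) _; rewrite lte_add_pinfty // lte_mul_pinfty.
Qed.

Lemma isL2Z c f : isL2 f -> isL2 (fun x => c * f x)%R.
Proof.
move=> [mf f2]; split; first exact: measurable_funM.
by rewrite integral_sqr_scale // lte_mul_pinfty ?lee_fin ?sqr_ge0.
Qed.

Lemma isL2B f g : isL2 f -> isL2 g -> isL2 (fun x => f x - g x)%R.
Proof.
move=> f2 g2; rewrite (_ : (fun x => _) = f \+ (fun x => - 1 * g x))%R.
  by apply: isL2D => //; exact: isL2Z.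
by apply/funext => x /=; rewrite mulN1r.
Qed.

Lemma isL2_0 : isL2 (fun=> 0%R).
Proof.
split; first exact: measurable_cst.
by under eq_integral => x _ do rewrite expr0n; rewrite integral0 ltry.
Qed.

Lemma isL2_sum (J : Type) (r : seq J) (P : pred J) (F : J -> T -> R) :
  (forall j, P j -> isL2 (F j)) -> isL2 (fun x => \sum_(j <- r | P j) F j x)%R.
Proof.
move=> h; elim: r => [|j r IH].
  by under eq_fun do rewrite big_nil; exact: isL2_0.
under eq_fun do rewrite big_cons; case Pj: (P j) => //.
exact: (isL2D (h j Pj) IH).
Qed.

Lemma nrm0 : nrm (fun=> 0%R) = 0%R.
Proof.
rewrite /nrm /sqnorm; under eq_integral => x _ do rewrite expr0n.
by rewrite integral0 sqrtr0.
Qed.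

Lemma nrmZ c f : isL2 f -> nrm (fun x => c * f x)%R = (`|c| * nrm f)%R.
Proof.
move=> [mf f2]; rewrite /nrm {1}/sqnorm integral_sqr_scale // sqnormE // -EFinM /=.
by rewrite sqrtrM ?sqr_ge0 // sqrtr_sqr.
Qed.

Lemma nrmD f g : isL2 f -> isL2 g -> (nrm (fun x => f x + g x) <= nrm f + nrm g)%R.
Proof.
move=> [mf f2] [mg g2].
rewrite -(@ler_pXn2r _ 2) ?nnegrE ?addr_ge0 ?nrm_ge0 // sqrrD !nrm_sqr {1}/sqnorm.
have := integral_lin_sqr 1 mf mg f2 g2; under eq_integral => x _ do rewrite mul1r.
move=> -> /=; rewrite expr1n mul1r mulr1 lerD2r lerD2l -[X in (_ <= X)%R]mulr_natl.
rewrite ler_pM2l // ; have := integral_cauchy_schwarz mf mg f2 g2; set b := fine _ => h.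
apply: le_trans (ler_norm b) _; rewrite -(@ler_pXn2r _ 2) ?nnegrE ?mulr_ge0 ?nrm_ge0 //.
by rewrite exprMn !nrm_sqr real_normK ?num_real.
Qed.

Lemma nrm_sum (J : Type) (r : seq J) (F : J -> T -> R) : (forall j, isL2 (F j)) ->
  (nrm (fun x => \sum_(j <- r) F j x) <= \sum_(j <- r) nrm (F j))%R.
Proof.
move=> h; elim: r => [|j r IH].
  by rewrite big_nil; under eq_fun do rewrite big_nil; rewrite nrm0.
rewrite big_cons; under eq_fun do rewrite big_cons.
by apply: le_trans (nrmD (h j) (isL2_sum _ (fun j _ => h j))) _; rewrite lerD2l.
Qed.

Lemma nrmN f : nrm (fun x => - f x)%R = nrm f.
Proof.
by rewrite /nrm /sqnorm; congr (Num.sqrt (fine _)); apply: eq_integral => x _; rewrite sqrrN.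
Qed.

Lemma nrmBC f g : nrm (fun x => f x - g x)%R = nrm (fun x => g x - f x)%R.
Proof. by rewrite -nrmN; congr nrm; apply/funext => x; rewrite opprB. Qed.

Lemma nrmB_dist f g : isL2 f -> isL2 g -> (`|nrm f - nrm g| <= nrm (fun x => f x - g x))%R.
Proof.
have key u v : isL2 u -> isL2 v -> (nrm u - nrm v <= nrm (fun x => u x - v x))%R.
  move=> u2 v2; rewrite lerBlDr; apply: le_trans (nrmD (isL2B u2 v2) v2).
  rewrite le_eqVlt; apply/orP; left; apply/eqP; congr nrm.
  by apply/funext => x; rewrite subrK.
move=> f2 g2; rewrite ler_norml; apply/andP; split; last exact: key.
by rewrite lerNl opprB nrmBC; exact: key.
Qed.

Lemma nrm_ae f g : isL2 f -> isL2 g -> {ae m, forall x, f x = g x} -> nrm f = nrm g.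
Proof.
move=> [mf _] [mg _] fg; rewrite /nrm /sqnorm; congr (Num.sqrt (fine _)).
apply: ae_eq_integral => //; try exact: measurable_sqr.
by move: fg; apply: filterS => x ->.
Qed.

Lemma sqr_nrm_lt f (c : R) : isL2 f -> (nrm f <= c)%R -> \int[m]_x (f x ^+ 2)%:E <= (c ^+ 2)%:E.
Proof.
move=> f2 h; rewrite isL2_sqr // lee_fin ler_pXn2r ?nnegrE ?nrm_ge0 //.
exact: le_trans (nrm_ge0 _) h.
Qed.

Lemma Lfun_isL2 f : (f \in Lfun m 2%:E) <-> isL2 f.
Proof.
have E : 'N[m]_2%:E[EFin \o f] ^+ 2 = \int[m]_x (f x ^+ 2)%:E by exact: Lnorm2_sqr.
split.
  move=> fL; split; first by move: (sub_Lfun_mfun fL); rewrite inE.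
  by have /integrableP[_] := Lfun2_integrable_sqr fL; under eq_integral => x _ do rewrite gee0_abs ?lee_fin ?sqr_ge0 //.
move=> [mf f2]; rewrite inE; apply/andP; split; rewrite inE //=.
rewrite /finite_norm ltNge leye_eq; apply/negP => /eqP Ny.
by move: f2; rewrite -E Ny expe2 mulyy.
Qed.

Lemma cvg_L2_near (F_ : nat -> T -> R) F (eps : R) : (forall n, measurable_fun setT (F_ n)) ->
  cvg_L2 m F_ F -> (0 < eps)%R ->
  exists n0, forall n, (n0 <= n)%N -> isL2 (F_ n) /\ (nrm (fun x => F x - F_ n x) <= eps)%R.
Proof.
move=> mF [/Lfun_isL2 FL2 cv] e0.
have /cv [n0 _ h] : nbhs (0 : \bar R) [set x | x < eps%:E].
  by apply: open_ereal_lt'; rewrite lte_fin.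
exists n0 => n n0n; have /= hn := h n n0n.
have D : isL2 (fun x => F_ n x - F x)%R.
  apply: (@isL2_le _ (eps ^+ 2)); first by apply: measurable_funB => //; case: FL2.
  rewrite (_ : \int[m]_x _ = 'N[m]_2%:E[EFin \o (F_ n \- F)%R] ^+ 2); last by rewrite Lnorm2_sqr.
  rewrite EFin_expe !expe2; apply: lee_pmul; rewrite ?Lnorm_ge0 //; exact: ltW.
split.
  rewrite (_ : F_ n = (fun x => (F_ n x - F x)) \+ F)%R; first exact: isL2D.
  by apply/funext => x /=; rewrite subrK.
rewrite nrmBC; apply: nrm_le; first exact: ltW.
rewrite (_ : \int[m]_x _ = 'N[m]_2%:E[EFin \o (F_ n \- F)%R] ^+ 2); last by rewrite Lnorm2_sqr.
by rewrite EFin_expe !expe2; apply: lee_pmul; rewrite ?Lnorm_ge0 //; exact: ltW.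
Qed.

End RealSquareNorm.

Lemma eq_of_small (R : realFieldType) (a b C : R) :
  (forall e, 0 < e -> e <= 1 -> `|a - b| <= C * e)%R -> a = b.
Proof.
move=> h; apply/eqP; rewrite -subr_eq0 -normr_le0 leNgt; apply/negP => p.
have C0 : (0 < C)%R by rewrite -[C]mulr1; apply: lt_le_trans p _; apply: h.
pose e := Num.min 1%R (`|a - b| / (2 * C))%R.
have e0 : (0 < e)%R by rewrite lt_min ltr01 divr_gt0 // mulr_gt0.
have := h e e0; rewrite ge_min lexx => /(_ isT); apply/negP; rewrite -ltNge.
apply: (@le_lt_trans _ _ (C * (`|a - b| / (2 * C)))%R).
  by rewrite ler_pM2l // ge_min lexx orbT.
rewrite (_ : C * _ = `|a - b| / 2)%R; last by field; rewrite gt_eqF.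
by rewrite ltr_pdivrMr // ltr_pMr // ltr1n.
Qed.

Lemma sqr_dist_le (R : realFieldType) (x y e : R) : (0 <= x)%R -> (0 <= y)%R -> (e <= 1)%R ->
  (`|x - y| <= e)%R -> (`|x ^+ 2 - y ^+ 2| <= (2 * x + 1) * e)%R.
Proof.
move=> x0 y0 e1 h; rewrite subr_sqr normrM mulrC; apply: ler_pM => //.
rewrite ger0_norm ?addr_ge0 //; move: h; rewrite ler_norml => /andP[h _]; lra.
Qed.

(** * Symmetrisation of elementary kernels *)

Section Elementary.
Context d (Z : measurableType d) (R : realType).
Variable mu : {sigma_finite_measure set Z -> \bar R}.
Context d' (Omega : measurableType d').
Variables (P : probability Omega R) (eta : R.-ker Omega ~> Z).

Lemma elementaryP n (J : finType) (c : J -> R) (A : J -> 'I_n -> set Z) :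
  (forall j i, measurable (A j i) /\ mu (A j i) < +oo) ->
  (forall j, trivIset [set: 'I_n] (A j)) ->
  elementary_integral mu eta
    (fun t => \sum_j c j * \prod_(i < n) \1_(A j i) (tnth t i))%R
    (fun w => \sum_j c j * \prod_(i < n) compensated mu eta (A j i) w)%R.
Proof.
move=> mA tA; exists #|J|, (c \o enum_val), (A \o enum_val); split => //.
- by move=> j i; exact: mA.
- by move=> j; exact: tA.
- by apply/funext => t; rewrite (reindex (fun j : 'I_#|J| => enum_val j)) //; exact/onW_bij/enum_val_bij.
- by apply/funext => t; rewrite (reindex (fun j : 'I_#|J| => enum_val j)) //; exact/onW_bij/enum_val_bij.
Qed.

Definition permute n (T : Type) (s : 'S_n) (t : n.-tuple T) : n.-tuple T :=
  [tuple tnth t (s i) | i < n].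

Definition symmetrize n (g : n.-tuple Z -> R) (t : n.-tuple Z) : R :=
  (n`!%:R^-1 * \sum_(s : 'S_n) g (permute s t))%R.

Lemma permuteM n (T : Type) (s p : 'S_n) (t : n.-tuple T) :
  permute s (permute p t) = permute (s * p)%g t.
Proof. by apply: eq_from_tnth => i; rewrite !tnth_mktuple permM. Qed.

Lemma symmetrize_perm n (g : n.-tuple Z -> R) p t : symmetrize g (permute p t) = symmetrize g t.
Proof.
rewrite /symmetrize; congr (_ * _)%R.
rewrite [RHS](reindex_inj (mulIg p)); apply: eq_bigr => s _; by rewrite permuteM.
Qed.

(** Permuting the sides of a rectangle permutes the factors of the product of compensated masses, so
    the random variable does not change. *)
Lemma elementary_symmetrize n (g : n.-tuple Z -> R) X :
  elementary_integral mu eta g X -> elementary_integral mu eta (symmetrize g) X.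
Proof.
move=> [N [c [A [mA tA -> ->]]]].
have nf : (n`!%:R != 0 :> R)%R by rewrite pnatr_eq0 -lt0n fact_gt0.
have := @elementaryP n ('I_N * 'S_n)%type (fun p => n`!%:R^-1 * c p.1)%R
  (fun p i => A p.1 (p.2 i)) _ _.
set g' := (fun t => _); set X' := (fun w => _).
have -> : g' = symmetrize (fun t => \sum_(j < N) c j * \prod_(i < n) \1_(A j i) (tnth t i))%R.
  apply/funext => t; rewrite /g' /symmetrize exchange_big /= mulr_sumr.
  rewrite -(pair_bigA _ (fun j (s : 'S_n) => n`!%:R^-1 * c j *
    \prod_(i < n) \1_(A j (s i)) (tnth t i))%R) /=.
  apply: eq_bigr => j _; rewrite mulr_sumr (reindex_inj invg_inj) /=.
  apply: eq_bigr => s _; rewrite -mulrA; congr (_ * (_ * _))%R.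
  rewrite (reindex_inj (@perm_inj _ s)) /=; apply: eq_bigr => i _.
  by rewrite permK tnth_mktuple.
have -> : X' = (fun w => \sum_(j < N) c j * \prod_(i < n) compensated mu eta (A j i) w)%R.
  apply/funext => w; rewrite /X'.
  rewrite -(pair_bigA _ (fun j (s : 'S_n) => n`!%:R^-1 * c j *
    \prod_(i < n) compensated mu eta (A j (s i)) w)%R) /=.
  apply: eq_bigr => j _; rewrite (eq_bigr (fun=> n`!%:R^-1 * (c j *
    \prod_(i < n) compensated mu eta (A j i) w)))%R => [|s _]; last first.
    by rewrite -mulrA; congr (_ * (_ * _))%R; rewrite [RHS](reindex_inj (@perm_inj _ s)).
  by rewrite sumr_const card_Sn -[X in X = _]mulr_natl mulrA divff // mul1r.
apply.
- by move=> [j s] i; exact: mA.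
- move=> [j s] /=; apply/trivIsetP => i i' _ _ ii'; move/trivIsetP: (tA j); apply => //.
  by rewrite (inj_eq (@perm_inj _ s)).
Qed.

Lemma measurable_elementary n (g : n.-tuple Z -> R) X : elementary_integral mu eta g X ->
  measurable_fun setT g /\ measurable_fun setT X.
Proof.
move=> [N [c [A [mA tA -> ->]]]]; split; apply: measurable_sum => j;
  apply: measurable_funM => //; apply: measurable_prod => i _; have [mAji _] := mA j i.
  apply: (measurable_indic_comp mAji); exact: measurable_tnth.
exact: measurable_compensated.
Qed.

(** As f is symmetric almost everywhere, f - symmetrize g is the mean over all permutations of the
    permuted f - g; convexity of the square and invariance of the product measure conclude. *)
Lemma symmetrize_dist n (f g : n.-tuple Z -> R) : measurable_fun setT f ->
  {ae mpow mu n, forall t, forall s : 'S_n, f (permute s t) = f t} -> measurable_fun setT g ->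
  \int[mpow mu n]_t ((f t - symmetrize g t) ^+ 2)%:E
  <= \int[mpow mu n]_t ((f t - g t) ^+ 2)%:E.
Proof.
move=> mf fs mg.
have nf : (0 < n`!%:R :> R)%R by rewrite ltr0n fact_gt0.
pose h (t : n.-tuple Z) := (f t - g t)%R.
have mh : measurable_fun setT h by exact: measurable_funB.
have mperm (u : n.-tuple Z -> R) (s : 'S_n) : measurable_fun setT u ->
    measurable_fun setT (fun t => u (permute s t)).
  move=> mu'; apply: (measurableT_comp mu' _); apply/measurable_fun_tnthP => i.
  rewrite (_ : _ \o _ = (fun t => tnth t (s i))); first exact: measurable_tnth.
  by apply/funext => t /=; rewrite tnth_mktuple.
have msym : measurable_fun setT (symmetrize g).
  apply: measurable_funM => //; apply: measurable_sum => s; exact: mperm.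
apply: (@le_trans _ _ (\int[mpow mu n]_t ((n`!%:R^-1)%:E * (\sum_(s : 'S_n) (h (permute s t) ^+ 2)%:E)))).
  apply: integral_le_ge0_ae.
  - by apply: measurable_sqr; exact: measurable_funB.
  - apply: measurable_funeM; apply: emeasurable_sum => s; apply: measurable_sqr.
    exact: mperm.
  - by move=> t; rewrite mule_ge0 ?lee_fin ?invr_ge0 ?(ltW nf) // sume_ge0 // => s _; rewrite lee_fin sqr_ge0.
  move: fs; apply: filterS => t ft; rewrite sumEFin -EFinM lee_fin.
  have -> : (f t - symmetrize g t = n`!%:R^-1 * \sum_(s : 'S_n) h (permute s t))%R.
    rewrite /h sumrB (eq_bigr (fun=> f t)) => [|s _]; last exact: ft.
    rewrite sumr_const card_Sn mulrBr -[X in (_ * X - _)%R]mulr_natl mulrA mulVf ?gt_eqF //.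
    by rewrite mul1r.
  rewrite exprMn expr2 -mulrA ler_pM2l ?invr_gt0 // mulrC ler_pdivrMr // mulrC.
  by have := sqr_sum_le predT (fun s : 'S_n => h (permute s t)); rewrite card_Sn.
rewrite ge0_integralZl_EFin ?invr_ge0 ?(ltW nf) //; first last.
- apply: emeasurable_sum => s; apply: measurable_sqr; exact: mperm.
- by move=> t _; rewrite sume_ge0 // => s _; rewrite lee_fin sqr_ge0.
rewrite ge0_integral_sum //; first last.
- by move=> s t _; rewrite lee_fin sqr_ge0.
- by move=> s; apply: measurable_sqr; exact: mperm.
have E (s : 'S_n) : \int[mpow mu n]_t (h (permute s t) ^+ 2)%:E = \int[mpow mu n]_t (h t ^+ 2)%:E.
  have mphi : seq_measurable (fun x => (app_seq h x ^+ 2)%:E : \bar R).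
    by move=> k; apply: measurable_sqr; exact: seq_measurable_app.
  have := @integral_mpow_perm _ _ _ mu n s (fun x => (app_seq h x ^+ 2)%:E) mphi.
  by rewrite /app_seq; under eq_integral => t _ do rewrite valK;
     under [in X in _ = X -> _]eq_integral => t _ do rewrite valK.
under eq_bigr => s _ do rewrite E.
have [hoo|hoo] := eqVneq (\int[mpow mu n]_t (h t ^+ 2)%:E) +oo.
  by rewrite -/(h _) hoo leey.
have hfin : \int[mpow mu n]_t (h t ^+ 2)%:E = (fine (\int[mpow mu n]_t (h t ^+ 2)%:E))%:E.
  by rewrite fineK // ge0_fin_numE ?integral_sqr_ge0 // ltey.
rewrite -/(h _) hfin sumEFin -EFinM lee_fin sumr_const card_Sn -[X in (_ * X <= _)%R]mulr_natl.
by rewrite mulrA mulVf ?gt_eqF // mul1r.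
Qed.

End Elementary.

Section Isometry.
Context d (Z : measurableType d) (R : realType).
Variable mu : {sigma_finite_measure set Z -> \bar R}.
Context d' (Omega : measurableType d').
Variables (P : probability Omega R) (eta : R.-ker Omega ~> Z).

Lemma wiener_ito_approx n (f : n.-tuple Z -> R) X (eps : R) :
  wiener_ito P mu eta f X -> (0 < eps)%R ->
  exists (g : n.-tuple Z -> R) (Y : Omega -> R),
    [/\ elementary_integral mu eta g Y, forall s t, g (permute s t) = g t,
        isL2 (mpow mu n) g /\ isL2 P Y,
        (nrm (mpow mu n) (fun t => f t - g t) <= eps)%R &
        (nrm P (fun w => X w - Y w) <= eps)%R].
Proof.
move=> [[fL fs] [g_ [X_ [el cg cX]]]] e0.
have mg N := (measurable_elementary (el N)).1; have mX N := (measurable_elementary (el N)).2.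
have [n1 h1] := cvg_L2_near mg cg e0; have [n2 h2] := cvg_L2_near mX cX e0.
pose N := maxn n1 n2.
have [gL gf] := h1 N (leq_maxl _ _); have [XL XX] := h2 N (leq_maxr _ _).
have /Lfun_isL2[mf f2] := fL.
have mN : measurable_fun setT (symmetrize (g_ N)).
  exact: (measurable_elementary (elementary_symmetrize (el N))).1.
have dist : \int[mpow mu n]_t ((f t - symmetrize (g_ N) t) ^+ 2)%:E <= (eps ^+ 2)%:E.
  apply: le_trans (symmetrize_dist mf fs (mg N)) _.
  by apply: sqr_nrm_lt => //; apply: isL2B.
exists (symmetrize (g_ N)), (X_ N); split => //.
- exact: elementary_symmetrize.
- by move=> s t; exact: symmetrize_perm.
- split => //; have D : isL2 (mpow mu n) (fun t => f t - symmetrize (g_ N) t)%R.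
    by apply: isL2_le dist; exact: measurable_funB.
  rewrite (_ : symmetrize _ = (fun t => f t - (f t - symmetrize (g_ N) t))%R); first exact: isL2B.
  by apply/funext => t; rewrite subKr.
- by apply: nrm_le => //; exact: ltW.
Qed.

Lemma rect_map2 (A I C : Type) (m : I -> C -> bool) (h : A -> I) (k : A -> C) s :
  rect m (map h s) (map k s) = all (fun a => m (h a) (k a)) s.
Proof. by elim: s => //= a s ->. Qed.

Lemma all_prodr (A : Type) (p : pred A) s : ((all p s)%:R = \prod_(x <- s) (p x)%:R :> R)%R.
Proof. by elim: s => [|a s IH]; rewrite ?big_nil // big_cons -IH /= -natrM mulnb. Qed.

(** Finitely many elementary integrals are described over one family of sets, all sides of all
    rectangles, indexed by a dependent sum. A common family provides common cells and common
    grids. *)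
Lemma elementary_data (K : finType) (q : K -> nat) (g : forall k, (q k).-tuple Z -> R)
    (Y : K -> Omega -> R) : (forall k, elementary_integral mu eta (g k) (Y k)) ->
  exists (I : finType) (S : I -> set Z) (D : K -> seq (R * seq I)),
  [/\ forall i, measurable (S i) /\ mu (S i) < +oo,
      forall k, disjoint_data S (D k),
      forall k p, p \in D k -> size p.2 = q k,
      forall k (t : (q k).-tuple Z), g k t = data_fun S (D k) t &
      forall k, Y k = data_int mu S eta (D k)].
Proof.
move=> el.
have [N [c [A hA]]] : exists (N : K -> nat) (c : forall k, 'I_(N k) -> R)
    (A : forall k, 'I_(N k) -> 'I_(q k) -> set Z), forall k,
    [/\ forall j i, measurable (A k j i) /\ mu (A k j i) < +oo,
        forall j, trivIset [set: 'I_(q k)] (A k j),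
        g k = (fun t => \sum_(j < N k) c k j * \prod_(i < q k) \1_(A k j i) (tnth t i))%R &
        Y k = (fun w => \sum_(j < N k) c k j * \prod_(i < q k) compensated mu eta (A k j i) w)%R].
  have h1 k := svalP (cid (el k)); have h2 k := svalP (cid (h1 k)).
  by exists (fun k => sval (cid (el k))), (fun k => sval (cid (h1 k))),
    (fun k => sval (cid (h2 k))) => k; exact: svalP (cid (h2 k)).
pose T k : finType := ('I_(N k) * 'I_(q k))%type.
pose I : finType := {k : K & T k}.
pose S (i : I) : set Z := A (tag i) (tagged i).1 (tagged i).2.
pose h k j (l : 'I_(q k)) : I := Tagged T (j, l).
pose D k := [seq (c k j, map (h k j) (enum 'I_(q k))) | j <- enum 'I_(N k)].
exists I, S, D; split.
- by move=> [k [j i]]; have [mA _ _ _] := hA k; exact: mA.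
- move=> k p /mapP[j _ ->] /=; have [_ tA _ _] := hA k.
  have := enum_uniq 'I_(q k); rewrite pairwise_map uniq_pairwise; apply: sub_pairwise => i i' /= ii'.
  by apply/asboolP; move/trivIsetP: (tA j); apply.
- by move=> k p /mapP[j _ ->] /=; rewrite size_map size_enum_ord.
- move=> k t; have [_ _ -> _] := hA k.
  rewrite /data_fun /D big_map big_enum /=; apply: eq_bigr => j _; congr (_ * _)%R.
  rewrite -[in RHS](map_tnth_enum t) rect_map2.
  by rewrite all_prodr big_enum.
- move=> k; have [_ _ _ ->] := hA k; apply/funext => w.
  rewrite /data_int /D big_map big_enum /=; apply: eq_bigr => j _; congr (_ * _)%R.
  by rewrite big_map big_enum.
Qed.

Hypothesis eta_poisson : poisson_measure P mu eta.
Hypothesis Zborel : borel_space Z R.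
Hypothesis mu_na : non_atomic mu.

Section Data.
Variables (I : finType) (S : I -> set Z) (D : seq (R * seq I)) (n : nat).
Hypothesis mS : forall i, measurable (S i).
Hypothesis Soo : forall i, mu (S i) < +oo.
Hypothesis dD : disjoint_data S D.
Hypothesis sD : sized_data n D.
Hypothesis D_perm : forall s s', perm_eq s s' -> data_kernel (S := S) D s = data_kernel D s'.

Lemma tsum_kernel_sqr m : (tsum (cell_weight mu (S:=S)) m (fun s : seq (coarse S) => data_kernel D s ^+ 2)%R)%:E
  = \int[mpow mu m]_t (data_fun S D t ^+ 2)%:E.
Proof.
have mb (s : m.-tuple (coarse S)) : measurable (@tbox _ Z _ (@cell _ Z I S) m s).
  by apply: (measurable_tbox R) => c; exact: measurable_cell.
have wb (s : m.-tuple (coarse S)) : mpow mu m (tbox (@cell _ Z I S) s)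
    = (weight (cell_weight mu (S:=S)) s)%:E.
  by apply: tbox_weight => c; [exact: measurable_cell | exact: cell_weightE].
have db (s s' : m.-tuple (coarse S)) : s != s' ->
    @tbox _ Z _ (@cell _ Z I S) m s `&` tbox (@cell _ Z I S) s' = set0.
  by apply: tbox_disjoint; exact: cell_disjoint.
under eq_integral => t _ do rewrite data_fun_step.
rewrite (integral_step_sqr mb wb db) tsum_tuple; congr EFin; apply: eq_bigr => s _.
by rewrite mulrC.
Qed.

Lemma data_fun_isL2 m : isL2 (mpow mu m) (fun t => data_fun S D t).
Proof.
split; last by rewrite -tsum_kernel_sqr ltry.
under eq_fun do rewrite data_fun_step.
have mb (s : m.-tuple (coarse S)) : measurable (@tbox _ Z _ (@cell _ Z I S) m s).
  by apply: (measurable_tbox R) => c; exact: measurable_cell.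
exact: (@measurable_step _ _ _ _ _ mb).
Qed.

(** Exact on every grid: the kernels vanish on repeated cells and depend on cells only, so neither
    diagonals nor mesh intervene. *)
Lemma data_chaos_energy N (G : 'I_N -> set Z) (w : coarse S * 'I_N -> R) e : is_grid mu G w e -> (2 * e <= 1)%R ->
  \int[P]_om (data_sum (void_var eta (atom G) w om) D ^+ 2)%:E
  = (\sum_(m < n.+1) m`!%:R * nrm (mpow mu m) (fun t => data_fun S D t) ^+ 2)%R%:E.
Proof.
move=> grid e2; under eq_integral => om _ do rewrite (data_sum_chaos _ dD sD D_perm).
rewrite (chaos_void_energy eta_poisson (measurable_atom mS grid) (atom_mu grid) (atom_disjoint grid)).
  rewrite (energy_sym_kernel (@atom_kernel_perm _ _ _ _ _ N _ D_perm) (atom_kernel_size (N := N) sD)).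
  congr EFin; apply: eq_bigr => m _; congr (_ * _)%R.
  apply: EFin_inj; rewrite -isL2_sqr; last exact: data_fun_isL2.
  rewrite -tsum_kernel_sqr; congr EFin.
  rewrite -tsum_gsum; last first.
    move=> s _ h; rewrite (atom_kernel_nuniq dD) ?expr0n //; apply: contra h => ->.
    by apply/hasPn.
  rewrite /atom_kernel (tsum_fst w m (fun s : seq (coarse S) => data_kernel D s ^+ 2)%R).
  by congr tsum; apply/funext => c; exact: (sum_atom_weight mS Soo grid).
by move=> a; apply: le_trans e2; rewrite ler_pM2l //; exact: (atom_le grid).
Qed.

(** The elementary integral is approximated in L^2 by void polynomials whose second moment is the
    right side on every grid; a small mesh yields both the square integrability and the value of the
    norm. *)
Lemma data_isometry : isL2 P (data_int mu S eta D) /\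
  (nrm P (data_int mu S eta D) ^+ 2
   = \sum_(m < n.+1) m`!%:R * nrm (mpow mu m) (fun t => data_fun S D t) ^+ 2)%R.
Proof.
set V := (\sum_(m < n.+1) _)%R.
have V0 : (0 <= V)%R by apply: sumr_ge0 => m _; rewrite mulr_ge0 ?sqr_ge0.
pose X := data_int mu S eta D.
have mX : measurable_fun setT X by exact: measurable_data_int.
have near (e : R) : (0 < e)%R -> exists2 Y, isL2 P Y /\ (nrm P Y = Num.sqrt V)%R &
    \int[P]_om ((X om - Y om) ^+ 2)%:E <= (e ^+ 2)%:E.
  move=> e0; have [eps eps0 H] := data_close eta_poisson mS Soo D (exprn_gt0 2 e0).
  pose e' := Num.min eps 2^-1%R.
  have e'0 : (0 < e')%R by rewrite lt_min eps0 invr_gt0 ltr0n.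
  have e'2 : (2 * e' <= 1)%R.
    have : (e' <= 2^-1)%R by rewrite ge_min lexx orbT.
    by move=> h; rewrite mulrC -ler_pdivlMr // mul1r.
  have [N [G [w grid]]] := grid_exists mS Soo Zborel mu_na e'0.
  exists (fun om => data_sum (void_var eta (atom G) w om) D); last first.
    by apply: H grid _ _ _ => //; [exact: ltW | rewrite ge_min lexx].
  have E := data_chaos_energy grid e'2.
  split; first by split; [exact: measurable_data_sum grid | rewrite E ltry].
  by rewrite /nrm /sqnorm E.
have XL : isL2 P X.
  have [Y [YL _] h] := near 1%R ltr01.
  rewrite (_ : X = (fun w => X w - Y w) \+ Y)%R; last by apply/funext => w /=; rewrite subrK.
  apply: isL2D => //; apply: isL2_le h; apply: measurable_funB => //; by case: YL.
split => //; rewrite -/X -[RHS]sqr_sqrtr //; congr (_ ^+ 2)%R.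
apply: (@eq_of_small _ _ _ 1) => e e0 _; rewrite mul1r.
have [Y [YL YV] h] := near e e0; rewrite -YV; apply: le_trans (nrmB_dist XL YL) _.
by apply: nrm_le => //; exact: ltW.
Qed.

End Data.
End Isometry.

(** * Elementary integrals of several orders at once *)

Section DataFamily.
Context d (Z : measurableType d) (R : realType).
Variable mu : {sigma_finite_measure set Z -> \bar R}.
Context d' (Omega : measurableType d').
Variables (eta : R.-ker Omega ~> Z) (I : finType) (S : I -> set Z).
Variables (K : finType) (q : K -> nat) (D : K -> seq (R * seq I)).
Hypothesis disj : forall k, disjoint_data S (D k).
Hypothesis exact_size : forall k p, p \in D k -> size p.2 = q k.

Definition all_data := flatten [seq D k | k <- enum K].

Lemma data_fun_size k (t : seq Z) : size t != q k -> data_fun S (D k) t = 0%R.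
Proof.
move=> tq; rewrite /data_fun big1_seq // => p /andP[_ pD].
case: (boolP (rect _ _ _)) => [/rect_size E|_]; last by rewrite mulr0.
by case/eqP: tq; rewrite -(exact_size pD) E.
Qed.

Lemma all_dataP p : p \in all_data -> exists k, p \in D k.
Proof. by move=> /flattenP[_ /mapP[k _ ->] pD]; exists k. Qed.

Lemma disjoint_all_data : disjoint_data S all_data.
Proof. by move=> p /all_dataP[k]; exact: disj. Qed.

Lemma sized_all_data n : (forall k, (q k <= n)%N) -> sized_data n all_data.
Proof. by move=> qn p /all_dataP[k /exact_size ->]. Qed.

Lemma data_fun_all t : data_fun S all_data t = (\sum_k data_fun S (D k) t)%R.
Proof. by rewrite /data_fun /all_data big_flatten big_map big_enum. Qed.

Lemma data_int_all om : data_int mu S eta all_data om = (\sum_k data_int mu S eta (D k) om)%R.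
Proof. by rewrite /data_int /all_data big_flatten big_map big_enum. Qed.

Lemma data_fun_all_order k (t : (q k).-tuple Z) : injective q ->
  data_fun S all_data t = data_fun S (D k) t.
Proof.
move=> q_inj; rewrite data_fun_all (bigD1 k) //= big1 ?addr0 // => j jk.
by apply: data_fun_size; rewrite size_tuple; apply: contraNneq jk => /q_inj ->.
Qed.

Hypothesis sym : forall k (s : 'S_(q k)) (t : (q k).-tuple Z),
  data_fun S (D k) (permute s t) = data_fun S (D k) t.

Lemma all_data_perm s s' : perm_eq s s' ->
  data_kernel (S := S) all_data s = data_kernel all_data s'.
Proof.
move=> ss'; rewrite !data_kernelE !data_fun_all; apply: eq_bigr => k _.
have [sq|sq] := eqVneq (size s) (q k); last first.
  by rewrite !data_fun_size ?size_map // -(perm_size ss').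
have sq' : size s' == q k by rewrite -(perm_size ss') sq.
have /tuple_permP[p E] : perm_eq s (Tuple sq') by [].
pose u : (q k).-tuple Z := [tuple of map (@cell_point d Z I S) (Tuple sq')].
have -> : map (@cell_point d Z I S) s = permute p u.
  rewrite E /= -map_comp; apply: eq_map => i /=; by rewrite tnth_map.
exact: sym.
Qed.

End DataFamily.

Section MultipleIntegral.
Context d (Z : measurableType d) (R : realType).
Variable mu : {sigma_finite_measure set Z -> \bar R}.
Context d' (Omega : measurableType d').
Variables (P : probability Omega R) (eta : R.-ker Omega ~> Z).

(* The sequence-free form of wiener_ito: f is square integrable and is
   approximated together with X by everywhere symmetric elementary kernels. *)
Definition multiple_integral n (f : n.-tuple Z -> R) (X : Omega -> R) :=
  [/\ isL2 (mpow mu n) f, isL2 P X & forall eps : R, (0 < eps)%R ->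
    exists (g : n.-tuple Z -> R) (Y : Omega -> R),
    [/\ elementary_integral mu eta g Y, forall s t, g (permute s t) = g t,
        isL2 (mpow mu n) g /\ isL2 P Y,
        (nrm (mpow mu n) (fun t => f t - g t) <= eps)%R &
        (nrm P (fun w => X w - Y w) <= eps)%R]].

Lemma wiener_ito_multiple n (f : n.-tuple Z -> R) X :
  wiener_ito P mu eta f X -> multiple_integral f X.
Proof.
move=> W; split; last by move=> eps; exact: wiener_ito_approx.
  by case: W => [[fL _] _]; apply/Lfun_isL2.
by case: W => [_ [_ [_ [_ _ [XL _]]]]]; apply/Lfun_isL2.
Qed.

Lemma elementaryD n (g h : n.-tuple Z -> R) X Y a : elementary_integral mu eta g X ->
  elementary_integral mu eta h Y ->
  elementary_integral mu eta (fun t => a * g t + h t)%R (fun w => a * X w + Y w)%R.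
Proof.
move=> [N [c [A [mA tA -> ->]]]] [N' [c' [A' [mA' tA' -> ->]]]].
pose cc (j : 'I_N + 'I_N') : R := match j with inl j => (a * c j)%R | inr j => c' j end.
pose AA (j : 'I_N + 'I_N') := match j with inl j => A j | inr j => A' j end.
have := @elementaryP _ _ _ mu _ _ eta n _ cc AA _ _.
set g1 := (fun t => _); set X1 := (fun w => _).
have -> : g1 = (fun t => a * (\sum_(j < N) c j * \prod_(i < n) \1_(A j i) (tnth t i)) +
    \sum_(j < N') c' j * \prod_(i < n) \1_(A' j i) (tnth t i))%R.
  apply/funext => t; rewrite /g1 big_sumType /=; congr (_ + _)%R.
  by rewrite mulr_sumr; apply: eq_bigr => j _; rewrite mulrA.
have -> : X1 = (fun w => a * (\sum_(j < N) c j * \prod_(i < n) compensated mu eta (A j i) w) +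
    \sum_(j < N') c' j * \prod_(i < n) compensated mu eta (A' j i) w)%R.
  apply/funext => t; rewrite /X1 big_sumType /=; congr (_ + _)%R.
  by rewrite mulr_sumr; apply: eq_bigr => j _; rewrite mulrA.
apply.
  by case=> j i; [exact: mA | exact: mA'].
by case=> j; [exact: tA | exact: tA'].
Qed.

Lemma elementary0 n : elementary_integral mu eta (fun _ : n.-tuple Z => 0%R) (fun=> 0%R).
Proof.
exists 0%N, (fun=> 0%R), (fun _ _ => set0); split.
- by case.
- by case.
- by apply/funext => t; rewrite big_ord0.
- by apply/funext => t; rewrite big_ord0.
Qed.

Lemma elementary_of_data (I : finType) (S : I -> set Z) n (D : seq (R * seq I)) :
  (forall i, measurable (S i) /\ mu (S i) < +oo) -> disjoint_data S D ->
  (forall p, p \in D -> size p.2 = n) ->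
  elementary_integral mu eta (fun t : n.-tuple Z => data_fun S D t) (data_int mu S eta D).
Proof.
move=> mS; elim: D => [|[c r] D IH] dD sD.
  rewrite (_ : data_int _ _ _ _ = fun=> 0%R).
    rewrite (_ : (fun t => _) = fun=> 0%R); first exact: elementary0.
    by apply/funext => t; rewrite /data_fun big_nil.
  by apply/funext => t; rewrite /data_int big_nil.
have {}IH : elementary_integral mu eta (fun t : n.-tuple Z => data_fun S D t) (data_int mu S eta D).
  by apply: IH => p pD; [apply: dD | apply: sD]; rewrite inE pD orbT.
have rn : size r == n by apply/eqP; apply: (sD (c, r)); rewrite inE eqxx.
have dr := dD (c, r) (mem_head _ _); rewrite /= in dr.
have [r' E] : exists r' : n.-tuple I, r = r' by exists (Tuple rn).
subst r; clear rn.
have tA : trivIset [set: 'I_n] (fun i => S (tnth r' i)).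
  apply/trivIsetP => i j _ _ ij; wlog lij : i j ij / (i < j)%N.
    move=> H; have [l|l|/val_inj E] := ltngtP i j; first exact: H.
      by rewrite setIC; apply: H; rewrite // eq_sym.
    by rewrite E eqxx in ij.
  move/(pairwiseP (tnth r' i)) : dr => /(_ i j).
  rewrite !inE size_tuple !ltn_ord => /(_ isT isT lij) h.
  have E (u : 'I_n) : nth (tnth r' i) r' u = tnth r' u by rewrite -tnth_nth.
  by rewrite (E i) (E j) in h; exact: h.
have El := @elementaryP _ _ _ mu _ _ eta n unit (fun=> 1%R) (fun _ i => S (tnth r' i))
  (fun _ i => mS _) (fun=> tA).
have := elementaryD c El IH.
have -> : (fun t : n.-tuple Z => c * (\sum_(j : unit) 1 * \prod_(i < n) \1_(S (tnth r' i)) (tnth t i)) +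
    data_fun S D t)%R = (fun t => data_fun S ((c, tval r') :: D) t).
  apply/funext => t; rewrite /data_fun big_cons; congr (_ * _ + _)%R.
  rewrite (big_pred1 tt) => [|[] //]; rewrite mul1r /= -[X in rect _ X _](map_tnth_enum r').
  by rewrite -[X in rect _ _ X](map_tnth_enum t) rect_map2 all_prodr big_enum.
congr elementary_integral; apply/funext => w; rewrite /data_int big_cons; congr (_ * _ + _)%R.
by rewrite (big_pred1 tt) => [|[] //]; rewrite mul1r /= (big_tuple _ _ r').
Qed.

Lemma multiple_integral_lin n (f g : n.-tuple Z -> R) X Y a :
  multiple_integral f X -> multiple_integral g Y ->
  multiple_integral (fun t => a * f t + g t)%R (fun w => a * X w + Y w)%R.
Proof.
move=> [f2 X2 hf] [g2 Y2 hg]; split.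
- exact: isL2D (isL2Z a f2) g2.
- exact: isL2D (isL2Z a X2) Y2.
move=> eps e0; have c0 : (0 < `|a| + 1)%R by rewrite ltr_wpDl.
(* The first term is multiplied by a; the tolerance is divided by |a| + 1 so that a = 0 is covered
   too. *)
have e1 : (0 < eps / (2 * (`|a| + 1)))%R by rewrite divr_gt0 // mulr_gt0.
have e2 : (0 < eps / 2)%R by rewrite divr_gt0.
have [f' [X' [ef sf [f'2 X'2] df dX]]] := hf _ e1.
have [g' [Y' [eg sg [g'2 Y'2] dg dY]]] := hg _ e2.
exists (fun t => a * f' t + g' t)%R, (fun w => a * X' w + Y' w)%R; split.
- exact: elementaryD.
- by move=> s t; rewrite sf sg.
- by split; [exact: isL2D (isL2Z a f'2) g'2 | exact: isL2D (isL2Z a X'2) Y'2].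
all: have key dT (T : measurableType dT) (m : {measure set T -> \bar R}) (u u' v v' : T -> R) :
    isL2 m u -> isL2 m u' -> isL2 m v -> isL2 m v' ->
    (nrm m (fun x => u x - u' x) <= eps / (2 * (`|a| + 1)))%R ->
    (nrm m (fun x => v x - v' x) <= eps / 2)%R ->
    (nrm m (fun x => (a * u x + v x) - (a * u' x + v' x)) <= eps)%R.
  1,3: move=> u2 u'2 v2 v'2 hu hv.
  1,2: rewrite (_ : (fun x => _) = (fun x => a * (u x - u' x) + (v x - v' x)))%R; last first.
  1,3: by apply/funext => x; ring.
  1,2: apply: le_trans (nrmD (isL2Z a (isL2B u2 u'2)) (isL2B v2 v'2)) _.
  1,2: rewrite nrmZ; last exact: isL2B.
  1,2: rewrite [leRHS](_ : eps = eps / 2 + eps / 2)%R; last by field.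
  1,2: apply: lerD => //; apply: (@le_trans _ _ ((`|a| + 1) * (eps / (2 * (`|a| + 1)))))%R.
  1,3: by apply: ler_pM => //; rewrite ?nrm_ge0 ?lerDl.
  1,2: by rewrite le_eqVlt; apply/orP; left; apply/eqP; field; rewrite gt_eqF.
all: exact: key.
Qed.

Lemma multiple_integral_ae n (f f' : n.-tuple Z -> R) X : multiple_integral f X ->
  isL2 (mpow mu n) f' -> nrm (mpow mu n) (fun t => f' t - f t)%R = 0%R -> multiple_integral f' X.
Proof.
move=> [f2 X2 hf] f'2 E; split => // eps e0.
have [g [Y [eg sg [g2 Y2] df dX]]] := hf _ e0.
exists g, Y; split => //; apply: le_trans df.
rewrite (_ : (fun t => _) = (fun t => (f' t - f t) + (f t - g t)))%R; last first.
  by apply/funext => t; ring.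
apply: le_trans (nrmD (isL2B f'2 f2) (isL2B f2 g2)) _; by rewrite E add0r.
Qed.

(** Order zero is included so that the constant of an expansion is one of its terms; the empty
    product makes a single rectangle without sides represent it. *)
Lemma multiple_integral_cst (c : R) :
  multiple_integral (fun _ : 0.-tuple Z => c) (fun=> c).
Proof.
have cst dT (T : measurableType dT) (m : {finite_measure set T -> \bar R}) : isL2 m (fun=> c).
  split => //; rewrite integral_cst // lte_mul_pinfty ?lee_fin ?sqr_ge0 //.
  exact: fin_num_fun_lty.
have f2 : isL2 (mpow mu 0) (fun _ : 0.-tuple Z => c).
  by split => //; rewrite (@integral_mpow_nil _ _ _ mu (fun=> (c ^+ 2)%:E)) ltry.
split=> //; first exact: (cst _ _ P).
move=> eps e0; exists (fun=> c), (fun=> c); split => //.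
- exists 1%N, (fun=> c), (fun _ _ => set0); split.
  + by move=> j [].
  + by move=> j; apply/trivIsetP => [[]].
  + by apply/funext => t; rewrite big_ord1 big_ord0 mulr1.
  + by apply/funext => t; rewrite big_ord1 big_ord0 mulr1.
- by split => //; exact: (cst _ _ P).
- by under eq_fun do rewrite subrr; rewrite nrm0 ltW.
- by under eq_fun do rewrite subrr; rewrite nrm0 ltW.
Qed.

Hypothesis eta_poisson : poisson_measure P mu eta.
Hypothesis Zborel : borel_space Z R.
Hypothesis mu_na : non_atomic mu.

(** Concatenating the data of all orders gives one function on lists, and its chaos energy separates
    the orders. Orthogonality of different orders is thus part of the isometry. *)
Lemma elementary_isometry (K : finType) (q : K -> nat) (g : forall k, (q k).-tuple Z -> R)
    (Y : K -> Omega -> R) : injective q ->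
  (forall k, elementary_integral mu eta (g k) (Y k)) ->
  (forall k s t, g k (permute s t) = g k t) ->
  (nrm P (fun w => \sum_k Y k w) ^+ 2 =
   \sum_k (q k)`!%:R * nrm (mpow mu (q k)) (g k) ^+ 2)%R.
Proof.
move=> q_inj el sg; have [I [S [D [mS dD sD gD YD]]]] := elementary_data el.
pose n := (\max_k q k)%N; have qn k : (q k <= n)%N by exact: leq_bigmax.
have symD k (s : 'S_(q k)) (t : (q k).-tuple Z) :
    data_fun S (D k) (permute s t) = data_fun S (D k) t by rewrite -!gD.
have [_] := @data_isometry _ _ _ mu _ _ P eta eta_poisson Zborel mu_na I S (all_data D) n
  (fun i => (mS i).1) (fun i => (mS i).2) (disjoint_all_data dD)
  (sized_all_data sD qn) (@all_data_perm _ _ _ _ _ _ _ _ sD symD).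
rewrite (_ : data_int _ _ _ _ = (fun w => \sum_k Y k w)%R); last first.
  by apply/funext => w; rewrite data_int_all; apply: eq_bigr => k _; rewrite YD.
move=> ->; pose H k := ((q k)`!%:R * nrm (mpow mu (q k)) (g k) ^+ 2)%R.
rewrite (eq_bigr (fun m : 'I_n.+1 => \sum_(k | q k == m) H k)%R) => [|m _]; last first.
  have [k /eqP E|no] := pickP (fun k => q k == m).
    rewrite (big_pred1 k) => [|j]; last by rewrite -E; apply/eqP/eqP => [/q_inj|->].
    rewrite /H -E; congr (_ * nrm _ _ ^+ 2)%R; apply/funext => t.
    by rewrite (data_fun_all_order S sD _ q_inj) // gD.
  rewrite big_pred0 //; under [X in nrm _ X]eq_fun => t.
    rewrite data_fun_all big1 => [|k _]; last by apply: (data_fun_size S sD); rewrite size_tuple eq_sym no.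
    over.
  by rewrite nrm0 expr0n mulr0.
rewrite (exchange_big_dep predT) //=; apply: eq_bigr => k _.
by rewrite (big_pred1 (Ordinal (qn k : (q k < n.+1)%N))) // => m; rewrite -val_eqE eq_sym.
Qed.

Lemma multiple_integral_isometry (K : finType) (q : K -> nat)
    (f : forall k, (q k).-tuple Z -> R) (X : K -> Omega -> R) : injective q ->
  (forall k, multiple_integral (f k) (X k)) ->
  (nrm P (fun w => \sum_k X k w) ^+ 2 =
   \sum_k (q k)`!%:R * nrm (mpow mu (q k)) (f k) ^+ 2)%R.
Proof.
move=> q_inj W; set N := nrm P _; pose c := (#|K|%:R + 1 : R)%R.
have c0 : (0 < c)%R by rewrite ltr_wpDl.
apply: (@eq_of_small _ _ _ ((2 * N + 1) +
  \sum_k (q k)`!%:R * (2 * nrm (mpow mu (q k)) (f k) + 1))%R) => e e0 e1.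
have ec : (0 < e / c)%R by rewrite divr_gt0.
have ec1 : (e / c <= e)%R by rewrite ler_pdivrMr // ler_peMr ?(ltW e0) // lerDr.
have X2 k : isL2 P (X k) by case: (W k).
have f2 k : isL2 (mpow mu (q k)) (f k) by case: (W k).
have /choice[Y hY] k : exists Y, exists g, 
    [/\ elementary_integral mu eta g Y, forall s t, g (permute s t) = g t,
        isL2 (mpow mu (q k)) g /\ isL2 P Y,
        (nrm (mpow mu (q k)) (fun t => f k t - g t) <= e / c)%R &
        (nrm P (fun w => X k w - Y w) <= e / c)%R].
  by case: (W k) => _ _ /(_ _ ec)[g [Y h]]; exists Y, g.
pose g k := sval (cid (hY k)); have hg k := svalP (cid (hY k)).
have {hg} hg k : [/\ elementary_integral mu eta (g k) (Y k), forall s t, g k (permute s t) = g k t,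
        isL2 (mpow mu (q k)) (g k) /\ isL2 P (Y k),
        (nrm (mpow mu (q k)) (fun t => f k t - g k t) <= e / c)%R &
        (nrm P (fun w => X k w - Y k w) <= e / c)%R] by exact: hg.
move: g hg => g hg.
have Y2 k : isL2 P (Y k) by have [_ _ []] := hg k.
have g2 k : isL2 (mpow mu (q k)) (g k) by have [_ _ []] := hg k.
pose M := nrm P (fun w => \sum_k Y k w)%R.
have NM : (`|N - M| <= e)%R.
  apply: le_trans (nrmB_dist (isL2_sum _ (fun k _ => X2 k)) (isL2_sum _ (fun k _ => Y2 k))) _.
  under [X in nrm _ X]eq_fun do rewrite -sumrB.
  apply: le_trans (nrm_sum _ (fun k => isL2B (X2 k) (Y2 k))) _.
  apply: (@le_trans _ _ (\sum_(k : K) e / c)%R).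
    by apply: ler_sum => k _; have [] := hg k.
  rewrite sumr_const -mulr_natl mulrA ler_pdivrMr // mulrC ler_pM2l // lerDl //.
rewrite mulrDl -[X in `|X - _|%R](subrK (M ^+ 2)%R) -addrA; apply: le_trans (ler_normD _ _) _.
apply: lerD; first by apply: sqr_dist_le => //; exact: nrm_ge0.
rewrite (elementary_isometry q_inj (fun k => let: And5 a _ _ _ _ := hg k in a)
   (fun k => let: And5 _ a _ _ _ := hg k in a)) -sumrB.
apply: le_trans (ler_norm_sum _ _ _) _; rewrite mulr_suml; apply: ler_sum => k _.
rewrite -mulrBr normrM ger0_norm // -mulrA ler_wpM2l // distrC.
apply: sqr_dist_le => //; rewrite ?nrm_ge0 //; apply: le_trans (nrmB_dist (f2 k) (g2 k)) _.
by have [_ _ _ h _] := hg k; exact: le_trans h ec1.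
Qed.

Lemma multiple_integral_norm n (f : n.-tuple Z -> R) X : multiple_integral f X ->
  (nrm P X ^+ 2 = n`!%:R * nrm (mpow mu n) f ^+ 2)%R.
Proof.
move=> fX; have := @multiple_integral_isometry unit (fun=> n) (fun=> f) (fun=> X).
rewrite (big_pred1 tt) => [|[] //]; move=> <- //; last by move=> [] [].
by congr (nrm _ _ ^+ 2)%R; apply/funext => w; rewrite (big_pred1 tt) // => -[].
Qed.

(** By the isometry each term of a partial sum is bounded by the norm of the whole sum, and m! >=
    1. *)
Lemma chaos_kernels_eq0 (h : forall m, m.-tuple Z -> R) (X : nat -> Omega -> R) :
  (forall m, multiple_integral (h m) (X m)) ->
  (forall eps, (0 < eps)%R -> exists n0, forall n, (n0 <= n)%N ->
     (nrm P (fun w => \sum_(m < n.+1) X m w) <= eps)%R) ->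
  forall m, nrm (mpow mu m) (h m) = 0%R.
Proof.
move=> W cv m; apply: (@eq_of_small _ _ _ 1) => e e0 _; rewrite subr0 mul1r ger0_norm ?nrm_ge0 //.
have [n0 hn0] := cv e e0; pose n := maxn n0 m.
have mn : (m < n.+1)%N by rewrite ltnS leq_maxr.
have : (nrm P (fun w => \sum_(m < n.+1) X m w) ^+ 2 <= e ^+ 2)%R.
  by rewrite ler_pXn2r ?nnegrE ?nrm_ge0 ?(ltW e0) // hn0 // leq_maxl.
rewrite (@multiple_integral_isometry 'I_n.+1 val (fun k => h k) (fun k => X k)) //.
move=> le_e; rewrite -(@ler_pXn2r _ 2) ?nnegrE ?nrm_ge0 ?(ltW e0) //; apply: le_trans le_e.
have p0 (k : nat) : (0 <= k`!%:R * nrm (mpow mu k) (h k) ^+ 2)%R by rewrite mulr_ge0 ?sqr_ge0.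
rewrite (bigD1 (Ordinal mn)) //= ler_wpDr ?sumr_ge0 // ler_peMl ?sqr_ge0 //.
by rewrite ler1n fact_gt0.
Qed.

End MultipleIntegral.

Section ChaosExpansion.
Context d (Z : measurableType d) (R : realType).
Variable mu : {sigma_finite_measure set Z -> \bar R}.
Context d' (Omega : measurableType d').
Variables (P : probability Omega R) (eta : R.-ker Omega ~> Z).
Hypothesis eta_poisson : poisson_measure P mu eta.
Hypothesis Zborel : borel_space Z R.
Hypothesis mu_na : non_atomic mu.
Local Notation multiple_integral := (multiple_integral mu P eta).

Definition expansion (c : R) (h : forall m, m.-tuple Z -> R) (X : nat -> Omega -> R)
    (F : Omega -> R) := [/\ isL2 P F,
  forall m, (0 < m)%N -> multiple_integral (h m) (X m) &
  forall eps, (0 < eps)%R -> exists n0, forall n, (n0 <= n)%N ->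
    (nrm P (fun w => F w - (c + \sum_(1 <= m < n.+1) X m w)) <= eps)%R].

Lemma isL2_cst (c : R) : isL2 P (fun=> c).
Proof. by case: (multiple_integral_cst mu P eta c). Qed.

Lemma multiple_integral0 n : multiple_integral (fun _ : n.-tuple Z => 0%R) (fun=> 0%R).
Proof.
split; [exact: isL2_0 | exact: isL2_0|] => eps e0.
exists (fun=> 0%R), (fun=> 0%R); split => //; first exact: elementary0.
- by split; exact: isL2_0.
- by under eq_fun do rewrite subrr; rewrite nrm0 ltW.
- by under eq_fun do rewrite subrr; rewrite nrm0 ltW.
Qed.

Lemma multiple_integral_scale n a (f : n.-tuple Z -> R) X : multiple_integral f X ->
  multiple_integral (fun t => a * f t)%R (fun w => a * X w)%R.
Proof.
move=> h; have := multiple_integral_lin a h (multiple_integral0 n).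
by under eq_fun do rewrite addr0; under [X in multiple_integral _ X]eq_fun do rewrite addr0.
Qed.

Lemma sum_from1 (x : nat -> R) n : (\sum_(1 <= m < n.+1) x m = \sum_(m < n) x m.+1)%R.
Proof. by rewrite big_add1 big_mkord. Qed.

Lemma isL2_partial c X n : (forall m, (0 < m)%N -> isL2 P (X m)) ->
  isL2 P (fun w => c + \sum_(1 <= m < n.+1) X m w)%R.
Proof.
move=> X2; apply: isL2D; first exact: isL2_cst.
under eq_fun do rewrite sum_from1.
by apply: (isL2_sum _ (F := fun (m : 'I_n) w => X m.+1 w)) => m _; exact: X2.
Qed.

(** The difference of the two expansions is an expansion of 0 whose term of order zero is c - c', so
    constants are treated like any other kernel. *)
Lemma expansion_unique c h X c' h' X' F : expansion c h X F -> expansion c' h' X' F ->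
  forall m, (0 < m)%N -> nrm (mpow mu m) (fun t => h m t - h' m t)%R = 0%R.
Proof.
move=> [F2 W cv] [_ W' cv'].
pose H m : m.-tuple Z -> R := if m is 0%N then (fun=> c - c')%R else fun t => (- 1 * h' m t + h m t)%R.
pose Y m : Omega -> R := if m is 0%N then (fun=> c - c')%R else fun w => (- 1 * X' m w + X m w)%R.
have HY m : multiple_integral (H m) (Y m).
  case: m => [|m]; first exact: multiple_integral_cst.
  by apply: multiple_integral_lin; [exact: W' | exact: W].
have z := @chaos_kernels_eq0 _ _ _ _ _ _ _ _ eta_poisson Zborel mu_na H Y HY _.
move=> [//|m] _; rewrite -[RHS](z _ m.+1); last first.
  move=> eps e0; have e2 : (0 < eps / 2)%R by rewrite divr_gt0.
  have [n1 h1] := cv _ e2; have [n2 h2] := cv' _ e2; exists (maxn n1 n2) => n.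
  rewrite geq_max => /andP[/h1 {}h1 /h2 {}h2].
  have S2 := @isL2_partial c X n (fun m m0 => let: And3 _ a _ := W m m0 in a).
  have S2' := @isL2_partial c' X' n (fun m m0 => let: And3 _ a _ := W' m m0 in a).
  rewrite (_ : (fun w => _) = (fun w => (F w - (c' + \sum_(1 <= m < n.+1) X' m w)) -
     (F w - (c + \sum_(1 <= m < n.+1) X m w)))%R); last first.
    apply/funext => w; rewrite !sum_from1 big_ord_recl /=.
    under eq_bigr => i _ do rewrite mulN1r.
    rewrite big_split /= sumrN; ring.
  apply: le_trans (nrmD (isL2B F2 S2') _) _.
    have := isL2Z (- 1) (isL2B F2 S2); congr isL2; by apply/funext => w; rewrite mulN1r.
  by rewrite nrmN [leRHS](_ : eps = eps / 2 + eps / 2)%R ?lerD //; field.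
by congr nrm; apply/funext => t /=; rewrite mulN1r addrC.
Qed.

Lemma cvg_L2_expansion c h X F : (forall m, (0 < m)%N -> multiple_integral (h m) (X m)) ->
  cvg_L2 P (fun n w => c + \sum_(1 <= m < n.+1) X m w)%R F -> expansion c h X F.
Proof.
move=> W cv; split => //; first by case: cv => /Lfun_isL2.
move=> eps e0; have [|n0 hn0] := cvg_L2_near _ cv e0.
  by move=> n; case: (@isL2_partial c X n (fun m m0 => let: And3 _ a _ := W m m0 in a)).
by exists n0 => n /hn0[].
Qed.

Lemma chaos_expansionP F h : chaos_expansion P mu eta F h -> exists X, expansion (fine 'E_P[F]) h X F.
Proof.
move=> [X [W cv]]; exists X; apply: cvg_L2_expansion => // m m0.
exact/wiener_ito_multiple/W.
Qed.

Lemma nrm_eq0_integral dT (T : measurableType dT) (m : {measure set T -> \bar R}) (u : T -> R) :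
  isL2 m u -> nrm m u = 0%R -> \int[m]_x (u x ^+ 2)%:E = 0.
Proof. by move=> u2 E; rewrite isL2_sqr // E expr0n. Qed.

Lemma nrm_integral0 dT (T : measurableType dT) (m : {measure set T -> \bar R}) (u : T -> R) :
  \int[m]_x (u x ^+ 2)%:E = 0 -> nrm m u = 0%R.
Proof. by move=> E; rewrite /nrm /sqnorm E sqrtr0. Qed.

Lemma ae_section0 m (u : seq Z -> R) : seq_measurable u ->
  \int[mpow mu m.+1]_t (u t ^+ 2)%:E = 0 ->
  {ae mu, forall z, \int[mpow mu m]_t (u (z :: t) ^+ 2)%:E = 0}.
Proof.
move=> mU; have mU2 : seq_measurable (fun s => (u s ^+ 2)%:E : \bar R).
  by move=> n; apply: measurable_sqr; exact: mU.
rewrite (@ge0_integral_mpow_cons _ _ _ mu m _ mU2) => [E|s]; last by rewrite lee_fin sqr_ge0.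
have mG : measurable_fun setT (fun z => \int[mpow mu m]_t (u (z :: t) ^+ 2)%:E).
  apply: (@measurable_integral_r _ _ _ _ _ _ (fun z (t : m.-tuple Z) => (u (z :: t) ^+ 2)%:E)) => //.
  exact: (@seq_measurable_cons _ _ _ _ _ m mU2).
have /(ae_eq_integral_abs mu measurableT mG) : \int[mu]_z `|\int[mpow mu m]_t (u (z :: t) ^+ 2)%:E| = 0.
  by rewrite -[RHS]E; apply: eq_integral => z _; rewrite gee0_abs // integral_sqr_ge0.
by apply: filterS => z /(_ Logic.I).
Qed.

Section Derivative.
Variables (k : nat) (q : 'I_k -> nat).
Hypothesis q_gt0 : forall i, (0 < q i)%N.
Hypothesis q_incr : forall i j : 'I_k, (i < j)%N -> (q i < q j)%N.
Variable f : forall i : 'I_k, (q i).-tuple Z -> R.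
Arguments f : clear implicits.
Hypothesis fL2 : forall i, L2_sym mu (f i).

Let K := chaos_kernel f predT.

Let mK : seq_measurable K.
Proof. exact: seq_measurable_kernel fL2 _. Qed.

Let qinj : injective q := q_inj q_incr.

Lemma order_cases m : (exists i, m = q i) \/ forall s, size s = m -> K s = 0%R.
Proof. by case: (kernel_cases f predT m) => [[i _ ->]|]; [left; exists i | right]. Qed.

(* U z is the derivative at z of the sum of the c (q i) * I_(q i) (f i). *)
Definition derivative_of (c : nat -> R) (U : Z -> Omega -> R) :=
  measurable_fun setT (fun x : Z * Omega => U x.1 x.2) /\
  {ae mu, forall z, isL2 P (U z) /\ exists J : 'I_k -> Omega -> R,
    (forall i, multiple_integral (fun t : (q i).-1.-tuple Z => K (z :: t)) (J i)) /\
    nrm P (fun w => U z w - \sum_i (c (q i) * (q i)%:R) * J i w)%R = 0%R}.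

Lemma sum_orders (x : 'I_k -> R) n : (forall i, q i <= n)%N ->
  (\sum_(m < n) \sum_(i | q i == m.+1) x i = \sum_i x i)%R.
Proof.
move=> qn; rewrite (exchange_big_dep predT) //=; apply: eq_bigr => i _.
have qi : ((q i).-1 < n)%N by rewrite prednK // qn.
rewrite (big_pred1 (Ordinal qi)) // => m.
by rewrite /= -val_eqE /= -[in RHS]eqSS prednK // eq_sym.
Qed.

(** The coefficient 1 is kept in the kernel to match the shape a m * K t expected by
    [derivative_ofP]. *)
Lemma finite_expansion (X : 'I_k -> Omega -> R) c F : isL2 P F ->
  (forall i, multiple_integral (f i) (X i)) ->
  {ae P, forall w, F w = (c + \sum_i X i w)%R} ->
  expansion c (fun m t => 1 * K t)%R (fun m w => \sum_(i | q i == m) X i w)%R F.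
Proof.
move=> F2 W FE; split => // [m _|eps e0].
  rewrite (_ : (fun t : m.-tuple Z => 1 * K t)%R = (fun t => K t)); last first.
    by apply/funext => t; rewrite mul1r.
  have [[i ->]|k0] := order_cases m.
    rewrite (_ : (fun w => \sum_(j | q j == q i) X j w)%R = X i); last first.
      by apply/funext => w; rewrite (big_pred1 i) // => j; rewrite (inj_eq qinj).
    rewrite (_ : (fun t : (q i).-tuple Z => K t) = f i) //.
    by apply/funext => t; rewrite /K kernel_tuple.
  have [i /eqP qi|no] := pickP (fun i => q i == m).
    subst m; rewrite (_ : (fun w => \sum_(j | q j == q i) X j w)%R = X i); last first.
      by apply/funext => w; rewrite (big_pred1 i) // => j; rewrite (inj_eq qinj).
    rewrite (_ : (fun t : (q i).-tuple Z => K t) = f i) //.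
    by apply/funext => t; rewrite /K kernel_tuple.
  rewrite (_ : (fun w => \sum_(i | q i == m) X i w)%R = fun=> 0%R); last first.
    by apply/funext => w; rewrite big_pred0.
  rewrite (_ : (fun t : m.-tuple Z => K t) = fun=> 0%R); first exact: multiple_integral0.
  by apply/funext => t; rewrite k0 ?size_tuple.
exists (\max_i q i)%N => n qn.
have E w : (\sum_(1 <= m < n.+1) \sum_(i | q i == m) X i w = \sum_i X i w)%R.
  rewrite sum_from1 sum_orders // => i; apply: leq_trans qn; exact: leq_bigmax.
under [X in nrm _ X]eq_fun do rewrite E.
have X2 : isL2 P (fun w => c + \sum_i X i w)%R.
  apply: isL2D; first exact: isL2_cst.
  by apply: isL2_sum => i _; case: (W i).
rewrite (@nrm_ae _ _ _ _ _ (fun=> 0%R)) ?nrm0 ?ltW //; [exact: isL2B | exact: isL2_0 |].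
by move: FE; apply: filterS => w ->; rewrite subrr.
Qed.

Lemma kernel_section_ae i : {ae mu, forall z,
  isL2 (mpow mu (q i).-1) (fun t : (q i).-1.-tuple Z => K (z :: t))}.
Proof.
have mU2 : seq_measurable (fun s => (K s ^+ 2)%:E : \bar R).
  by move=> n; apply: measurable_sqr; exact: mK.
have : \int[mpow mu (q i).-1.+1]_t (K t ^+ 2)%:E < +oo by exact: kernel_sqr.
rewrite (@ge0_integral_mpow_cons _ _ _ mu _ _ mU2) => [fin|s]; last by rewrite lee_fin sqr_ge0.
have mG : measurable_fun setT (fun z => \int[mpow mu (q i).-1]_t (K (z :: t) ^+ 2)%:E).
  apply: (@measurable_integral_r _ _ _ _ _ _ (fun z (t : (q i).-1.-tuple Z) => (K (z :: t) ^+ 2)%:E)) => //.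
  exact: (@seq_measurable_cons _ _ _ _ _ _ mU2).
have : mu.-integrable setT (fun z => \int[mpow mu (q i).-1]_t (K (z :: t) ^+ 2)%:E).
  apply/integrableP; split => //; under eq_integral => z _ do rewrite gee0_abs ?integral_sqr_ge0 //.
  exact: fin.
move=> /integrable_ae -/(_ measurableT); apply: filterS => z /(_ Logic.I) zfin.
split; first exact: (@seq_measurable_catl _ _ _ _ K [:: z] mK).
by rewrite -ge0_fin_numE // integral_sqr_ge0.
Qed.

(** The definition of the derivative provides kernels h of its own. By uniqueness h m is a m * K
    almost everywhere, so for almost every z the sections agree for all m simultaneously. Orders
    carrying no f_i have null sections and, by the isometry, null terms; the series reduces to the
    finite sum. *)
Lemma derivative_ofP (a : nat -> R) c X G DG :
  expansion c (fun m t => a m * K t)%R X G -> malliavin_derivative P mu eta G DG ->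
  (forall m, (0 < m)%N -> a m != 0%R) -> derivative_of a DG.
Proof.
move=> exG [h [/chaos_expansionP[X' exG'] _ mDG aeDG]] a0; split => //.
have mh m : (0 < m)%N -> measurable_fun setT (h m).
  by move=> m0; have [_ W _] := exG'; case: (W m m0) => -[].
pose u m s := (app_seq (h m) s - a m * K s)%R.
have mU m : (0 < m)%N -> seq_measurable (u m).
  move=> m0 n; apply: measurable_funB; first exact: (@seq_measurable_app _ _ _ _ _ (mh m m0) n).
  by apply: measurable_funM => //; exact: mK.
have u0 m : \int[mpow mu m.+1]_t (u m.+1 t ^+ 2)%:E = 0.
  have E := expansion_unique exG' exG (ltn0Sn m).
  rewrite -[RHS](nrm_eq0_integral _ E).
    by apply: eq_integral => t _; rewrite /u /app_seq valK.
  have [_ W _] := exG; have [_ W' _] := exG'.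
  by apply: isL2B; [case: (W' _ (ltn0Sn m)) | case: (W _ (ltn0Sn m))].
have ae1 : {ae mu, forall z, forall m, \int[mpow mu m]_t (u m.+1 (z :: t) ^+ 2)%:E = 0}.
  by apply: ae_foralln => m; apply: ae_section0 (u0 m); exact: mU.
have ae2 : {ae mu, forall z, forall i, isL2 (mpow mu (q i).-1) (fun t : (q i).-1.-tuple Z => K (z :: t))}.
  apply: filter_forall => i; exact: kernel_section_ae.
move: aeDG ae1 ae2; apply: filterS3 => z [I_ [WI cvI]] uz Kz.
have {}WI m : (0 < m)%N -> multiple_integral (fun t : m.-1.-tuple Z => app_seq (h m) (z :: t)) (I_ m).
  by move=> m0; apply: wiener_ito_multiple; exact: WI.
have DG2 : isL2 P (DG z) by case: cvI => /Lfun_isL2.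
have mKz m : isL2 (mpow mu m) (fun t : m.-tuple Z => K (z :: t)) ->
    nrm (mpow mu m) (fun t => a m.+1 * K (z :: t) - app_seq (h m.+1) (z :: t))%R = 0%R.
  by move=> _; rewrite nrmBC; exact: nrm_integral0 (uz m).
split => //; exists (fun i w => (a (q i))^-1 * I_ (q i) w)%R; split.
  move=> i; have qi := q_gt0 i; have ai := a0 _ qi.
  rewrite (_ : (fun t => _) = (fun t : (q i).-1.-tuple Z => (a (q i))^-1 * (a (q i) * K (z :: t))))%R.
    apply: multiple_integral_scale; apply: multiple_integral_ae (WI _ qi) _ _.
      exact: isL2Z.
    by have := mKz _ (Kz i); rewrite prednK.
  by apply/funext => t; rewrite mulKf.
apply: (@eq_of_small _ _ _ 1) => e e0 _; rewrite subr0 mul1r ger0_norm ?nrm_ge0 //.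
have I2 m : isL2 P (I_ m.+1) by case: (WI _ (ltn0Sn m)).
have [|n1 hn1] := cvg_L2_near _ cvI e0.
  move=> n; under eq_fun do rewrite sum_from1.
  by case: (@isL2_sum _ _ _ P _ (index_enum 'I_n) predT (fun (m : 'I_n) w => m.+1%:R * I_ m.+1 w)%R
    (fun m _ => isL2Z _ (I2 m))).
pose n := maxn n1 (\max_i q i)%N; have [S2 le_e] := hn1 n (leq_maxl _ _).
apply: le_trans le_e.
have E w : (\sum_i (a (q i) * (q i)%:R) * ((a (q i))^-1 * I_ (q i) w) =
    \sum_(m < n) \sum_(i | q i == m.+1) (q i)%:R * I_ (q i) w)%R.
  rewrite sum_orders => [|i]; last by rewrite leq_max leq_bigmax orbT.
  apply: eq_bigr => i _; by rewrite [X in (X * _)%R]mulrC -mulrA mulVKf // a0.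
have d2 (m : 'I_n) : isL2 P (fun w => m.+1%:R * I_ m.+1 w - \sum_(i | q i == m.+1) (q i)%:R * I_ (q i) w)%R.
  apply: isL2B; first exact/isL2Z/I2.
  by apply: isL2_sum => i /eqP ->; exact/isL2Z/I2.
have d0 (m : 'I_n) : nrm P (fun w => m.+1%:R * I_ m.+1 w - \sum_(i | q i == m.+1) (q i)%:R * I_ (q i) w)%R = 0%R.
  have [i /eqP qi|no] := pickP (fun i => q i == m.+1).
    rewrite -[RHS](nrm0 P); congr nrm; apply/funext => w.
    rewrite (big_pred1 i) => [|j]; first by rewrite qi subrr.
    by rewrite -qi (inj_eq qinj).
  have k0 s : size s = m.+1 -> K s = 0%R.
    by have [[i E']|h'] := order_cases m.+1; [have := no i; rewrite E' eqxx | exact: h'].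
  rewrite (_ : (fun w => _) = (fun w => m.+1%:R * I_ m.+1 w)%R); last first.
    by apply/funext => w; rewrite big_pred0 // subr0.
  rewrite nrmZ //; have := multiple_integral_norm eta_poisson Zborel mu_na (WI _ (ltn0Sn m)).
  have -> : nrm (mpow mu m.+1.-1) (fun t : m.+1.-1.-tuple Z => app_seq (h m.+1) (z :: t)) = 0%R.
    apply: nrm_integral0; rewrite -[RHS](uz m); apply: eq_integral => t _.
    by rewrite /u k0 ?mulr0 ?subr0 //= size_tuple.
  rewrite [in RHS]expr0n mulr0 => /eqP; rewrite expf_eq0 /= => /eqP E0.
  by rewrite (_ : nrm P _ = 0%R) ?mulr0.
have D2 : isL2 P (fun w => \sum_(m < n) (m.+1%:R * I_ m.+1 w - \sum_(i | q i == m.+1) (q i)%:R * I_ (q i) w))%R.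
  by apply: isL2_sum => m _; exact: d2.
rewrite (_ : (fun w => DG z w - _)%R = (fun w => (DG z w - \sum_(1 <= m < n.+1) m%:R * I_ m w) +
   \sum_(m < n) (m.+1%:R * I_ m.+1 w - \sum_(i | q i == m.+1) (q i)%:R * I_ (q i) w))%R); last first.
  by apply/funext => w; rewrite E sum_from1 sumrB; ring.
apply: le_trans (nrmD (isL2B DG2 S2) D2) _; rewrite -[leRHS]addr0 lerD2l.
by apply: le_trans (nrm_sum _ d2) _; rewrite big1.
Qed.

End Derivative.
End ChaosExpansion.

(** * Discretisation of the derivative *)

Section SymmetricData.
Context d (Z : measurableType d) (R : realType).
Variable mu : {sigma_finite_measure set Z -> \bar R}.
Context d' (Omega : measurableType d').
Variables (P : probability Omega R) (eta : R.-ker Omega ~> Z).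
Hypothesis eta_poisson : poisson_measure P mu eta.
Hypothesis Zborel : borel_space Z R.
Hypothesis mu_na : non_atomic mu.
Local Notation multiple_integral := (multiple_integral mu P eta).

(** The kernel is square integrable as a step function. For Y the symmetrised kernel is used: it has
    the same integral and falls under [data_isometry]. *)
Lemma elementary_isL2 n (g : n.-tuple Z -> R) Y : elementary_integral mu eta g Y ->
  isL2 (mpow mu n) g /\ isL2 P Y.
Proof.
move=> el; have [I0 [S0 [D0 [mS0 _ _ gD _]]]] := elementary_data (fun _ : unit => el).
have [I [S [D [mS dD sD sgD YD]]]] := elementary_data (fun _ : unit => elementary_symmetrize el).
split.
  rewrite (_ : g = (fun t => data_fun S0 (D0 tt) t)); last by apply/funext => t; exact: gD tt t.
  by apply: data_fun_isL2 => i; case: (mS0 i).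
have sym (k : unit) (s : 'S_n) (t : n.-tuple Z) :
    data_fun S (D k) (permute s t) = data_fun S (D k) t.
  by rewrite -(sgD k (permute s t)) -(sgD k t) symmetrize_perm.
have [+ _] := @data_isometry _ _ _ mu _ _ P eta eta_poisson Zborel mu_na I S (all_data D) n
  (fun i => (mS i).1) (fun i => (mS i).2) (disjoint_all_data dD)
  (sized_all_data sD (fun=> leqnn n)) (@all_data_perm _ _ _ _ S unit (fun=> n) D sD sym).
congr isL2; apply/funext => w; rewrite data_int_all (big_pred1 tt) => [|[] //].
by rewrite -(YD tt).
Qed.

Lemma multiple_integral_elementary n (g : n.-tuple Z -> R) Y :
  elementary_integral mu eta g Y -> (forall s t, g (permute s t) = g t) -> multiple_integral g Y.
Proof.
move=> el sg; have [g2 Y2] := elementary_isL2 el; split => // eps e0.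
exists g, Y; split => //.
- by under eq_fun do rewrite subrr; rewrite nrm0 ltW.
- by under eq_fun do rewrite subrr; rewrite nrm0 ltW.
Qed.

Variables (I : finType) (S : I -> set Z).
Hypothesis mS : forall i, measurable (S i) /\ mu (S i) < +oo.

Section OneOrder.
Variables (D : seq (R * seq I)) (n : nat).
Hypothesis dD : disjoint_data S D.
Hypothesis sD : forall p, p \in D -> size p.2 = n.
Hypothesis symD : forall (s : 'S_n) (t : n.-tuple Z), data_fun S D (permute s t) = data_fun S D t.

Lemma data_fun_perm_eq t t' : perm_eq t t' -> data_fun S D t = data_fun S D t'.
Proof.
move=> tt'; have [sz|sz] := eqVneq (size t') n; last first.
  have z u : size u != n -> data_fun S D u = 0%R.
    exact: (@data_fun_size _ _ _ _ S unit (fun=> n) (fun=> D) (fun=> sD) tt).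
  by rewrite !z // (perm_size tt').
have sz' : size t' == n by rewrite sz.
have /tuple_permP[p ->] : perm_eq t (Tuple sz') by [].
exact: symD p (Tuple sz').
Qed.

Lemma data_fun_cell c z t : cell (S := S) c z ->
  data_fun S (data_derivative D (val c)) t = ((size t).+1%:R * data_fun S D (z :: t))%R.
Proof.
move=> cz; rewrite /data_fun /data_derivative big_map mulr_sumr; apply: eq_bigr => -[a r] _ /=.
case: r => [|i r] /=; first by rewrite !mul0r !mulr0.
rewrite /at_point -(in_cell i cz) -mulnb natrM.
case: (boolP (rect _ _ _)) => [/rect_size ->|_]; last by rewrite !mulr0.
by rewrite /= !mulr1; ring.
Qed.

Lemma disjoint_derivative J : disjoint_data S (data_derivative D J).
Proof. by move=> p /mapP[[a [|i r]] /dD /= h ->] //=; case/andP: h. Qed.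

Lemma section_multiple_integral c z : (0 < n)%N -> cell (S := S) c z ->
  multiple_integral (fun t : n.-1.-tuple Z => n%:R * data_fun S D (z :: t))%R
    (data_int mu S eta (data_derivative D (val c))).
Proof.
move=> n0 cz; rewrite (_ : (fun t => _) =
  (fun t : n.-1.-tuple Z => data_fun S (data_derivative D (val c)) t)); last first.
  by apply/funext => t; rewrite (data_fun_cell _ cz) size_tuple prednK.
apply: multiple_integral_elementary.
  apply: elementary_of_data => //; first exact: disjoint_derivative.
  by move=> p /mapP[p' /sD <- ->] /=; rewrite size_behead.
move=> s t; rewrite !(data_fun_cell _ cz) !size_tuple; congr (_ * _)%R.
apply: data_fun_perm_eq; rewrite perm_cons; apply/tuple_permP.
by exists s.
Qed.

End OneOrder.

Definition scale_data (a : nat -> R) (D : seq (R * seq I)) := [seq (a (size p.2) * p.1, p.2)%R | p <- D].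

Lemma data_kernel_scale a D (s : seq (coarse S)) :
  data_kernel (scale_data a D) s = (a (size s) * data_kernel D s)%R.
Proof.
rewrite /data_kernel /scale_data big_map mulr_sumr; apply: eq_bigr => p _ /=.
by case: (boolP (rect _ _ _)) => [/rect_size ->|_]; rewrite ?mulr0 // mulrA.
Qed.

Lemma disjoint_scale a D : disjoint_data S D -> disjoint_data S (scale_data a D).
Proof. by move=> dD p /mapP[p' /dD h ->]. Qed.

Lemma sized_scale a n (D : seq (R * seq I)) : sized_data n D -> sized_data n (scale_data a D).
Proof. by move=> sD p /mapP[p' /sD h ->]. Qed.

End SymmetricData.

Section DerivativeApproximation.
Context d (Z : measurableType d) (R : realType).
Variable mu : {sigma_finite_measure set Z -> \bar R}.
Context d' (Omega : measurableType d').
Variables (P : probability Omega R) (eta : R.-ker Omega ~> Z).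
Hypothesis eta_poisson : poisson_measure P mu eta.
Hypothesis Zborel : borel_space Z R.
Hypothesis mu_na : non_atomic mu.
Local Notation multiple_integral := (multiple_integral mu P eta).
Variables (k : nat) (q : 'I_k -> nat).
Hypothesis q_gt0 : forall i, (0 < q i)%N.
Hypothesis q_incr : forall i j : 'I_k, (i < j)%N -> (q i < q j)%N.
Variable f : forall i : 'I_k, (q i).-tuple Z -> R.
Arguments f : clear implicits.
Hypothesis fL2 : forall i, L2_sym mu (f i).

Let K := chaos_kernel f predT.

Let mK : seq_measurable K.
Proof. exact: seq_measurable_kernel fL2 _. Qed.

Let qinj : injective q := q_inj q_incr.

Variables (I : finType) (S : I -> set Z).
Hypothesis mS : forall i, measurable (S i) /\ mu (S i) < +oo.
Variable D : 'I_k -> seq (R * seq I).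
Hypothesis dD : forall i, disjoint_data S (D i).
Hypothesis sD : forall i p, p \in D i -> size p.2 = q i.
Hypothesis symD : forall i (s : 'S_(q i)) (t : (q i).-tuple Z),
  data_fun S (D i) (permute s t) = data_fun S (D i) t.

(** Derivative of the elementary approximation, constant in z on each coarse cell and 0 outside. The
    factor a, depending on the order, lets D F and - D L^-1 F be treated alike. *)
Definition section_data (a : nat -> R) (z : Z) (om : Omega) : R :=
  (\sum_(c : coarse S) \1_(cell c) z *
     data_int mu S eta (data_derivative (scale_data a (all_data D)) (val c)) om)%R.

Lemma data_int_derivative_all a J om :
  data_int mu S eta (data_derivative (scale_data a (all_data D)) J) om
  = (\sum_i a (q i) * data_int mu S eta (data_derivative (D i) J) om)%R.
Proof.
rewrite /data_int /data_derivative /scale_data /all_data !big_map big_flatten big_map big_enum.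
apply: eq_bigr => i _; rewrite big_map mulr_sumr; apply: eq_big_seq => p pD /=.
by rewrite -(sD pD); ring.
Qed.

Lemma section_data_cell a (c : coarse S) z om : cell c z ->
  section_data a z om = data_int mu S eta (data_derivative (scale_data a (all_data D)) (val c)) om.
Proof.
move=> cz; rewrite /section_data (bigD1 c) //= indicE mem_set // mul1r big1 ?addr0 // => c' c'c.
rewrite indicE memNset ?mul0r // => c'z; have := cell_disjoint c'c.
by move/seteqP => [/(_ z)] + _; apply.
Qed.

Lemma section_data_out a z om : (forall c : coarse S, ~ cell c z) -> section_data a z om = 0%R.
Proof. by move=> no; rewrite /section_data big1 // => c _; rewrite indicE memNset ?mul0r. Qed.

Lemma section_data_measurable a :
  measurable_fun setT (fun x : Z * Omega => section_data a x.1 x.2).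
Proof.
apply: measurable_sum => c; apply: measurable_funM.
  apply: (@measurable_indic_comp _ _ _ _ _ (cell c)); last exact: measurable_fst.
  by apply: measurable_cell => i; case: (mS i).
have := @measurable_data_int _ _ _ mu I S _ _ eta (fun i => (mS i).1)
  (data_derivative (scale_data a (all_data D)) (val c)).
by move=> h; apply: (measurableT_comp h); exact: measurable_snd.
Qed.

(** Isometry in omega at fixed z for the difference of the sections: order q contributes q^2 (q -
    1)! = q * q! since |a| <= 1. *)
Lemma derivative_section_dist a U z (J : 'I_k -> Omega -> R) :
  (forall m, (`|a m| <= 1)%R) -> isL2 P (U z) ->
  (forall i, multiple_integral (fun t : (q i).-1.-tuple Z => K (z :: t)) (J i)) ->
  nrm P (fun w => U z w - \sum_i (a (q i) * (q i)%:R) * J i w)%R = 0%R ->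
  \int[P]_w ((U z w - section_data a z w) ^+ 2)%:E <=
  \sum_i ((q i)%:R * (q i)`!%:R)%:E *
    \int[mpow mu (q i).-1]_t ((K (z :: t) - data_fun S (D i) (z :: t)) ^+ 2)%:E.
Proof.
move=> a1 U2 WJ UJ.
have [Y [WY sY]] : exists Y : 'I_k -> Omega -> R,
    (forall i, multiple_integral (fun t : (q i).-1.-tuple Z => (q i)%:R * data_fun S (D i) (z :: t))%R (Y i)) /\
    (forall om, section_data a z om = \sum_i a (q i) * Y i om)%R.
  have [[c cz]|no] := pselect (exists c : coarse S, cell c z).
    exists (fun i => data_int mu S eta (data_derivative (D i) (val c))); split => [i|om].
      exact: (@section_multiple_integral _ _ _ mu _ _ P eta eta_poisson Zborel mu_na I S mS (D i) (q i)
        (@dD i) (@sD i) (@symD i) c z (q_gt0 i) cz).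
    by rewrite (section_data_cell _ _ cz) data_int_derivative_all.
  exists (fun _ _ => 0%R); split => [i|om]; last first.
    rewrite section_data_out => [|c cz]; last by apply: no; exists c.
    by rewrite big1 // => i _; rewrite mulr0.
  rewrite (_ : (fun t => _) = fun=> 0%R); first exact: multiple_integral0.
  apply/funext => t; rewrite /data_fun big1_seq ?mulr0 // => p /andP[_ /sD].
  case: p.2 => [|j r] /=; first by move=> E; have := q_gt0 i; rewrite -E.
  move=> _; rewrite /at_point; case: asboolP => [Sj|]; last by rewrite mulr0.
  by exfalso; apply: no; have [c cz] := cell_cover Sj; exists c.
pose V i w := (a (q i) * ((q i)%:R * J i w + (- 1) * Y i w))%R.
pose v i (t : (q i).-1.-tuple Z) := (a (q i) * ((q i)%:R * K (z :: t) +
   (- 1) * ((q i)%:R * data_fun S (D i) (z :: t))))%R.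
have WV i : multiple_integral (v i) (V i).
  apply: multiple_integral_scale; have := multiple_integral_lin (- 1) (WY i)
    (multiple_integral_scale (q i)%:R (WJ i)).
  rewrite /V /v; under eq_fun do rewrite addrC.
  by under [X in multiple_integral _ X -> _]eq_fun do rewrite addrC.
have V2 i : isL2 P (V i) by case: (WV i).
have SV2 : isL2 P (fun w => \sum_i V i w)%R by exact: isL2_sum.
have q1inj : injective (fun i => (q i).-1).
  by move=> i j ij; apply: qinj; rewrite -(prednK (q_gt0 i)) ij prednK.
have E := multiple_integral_isometry eta_poisson Zborel mu_na q1inj WV.
have SJ2 : isL2 P (fun w => \sum_i (a (q i) * (q i)%:R) * J i w)%R.
  by apply: isL2_sum => i _; apply: isL2Z; case: (WJ i).
have le_nrm : (nrm P (fun w => U z w - section_data a z w) <= nrm P (fun w => \sum_i V i w))%R.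
  rewrite (_ : (fun w => _) = (fun w => (U z w - \sum_i (a (q i) * (q i)%:R) * J i w) +
     \sum_i V i w))%R; last first.
    apply/funext => w; rewrite sY -addrA; congr (_ + _)%R.
    by rewrite -!sumrN -big_split /=; apply: eq_bigr => i _; rewrite /V; ring.
  by apply: le_trans (nrmD (isL2B U2 SJ2) SV2) _; rewrite UJ add0r.
have D2 : isL2 P (fun w => U z w - section_data a z w)%R.
  apply: isL2B => //; rewrite (_ : section_data a z = (fun om => \sum_i a (q i) * Y i om)%R).
    by apply: isL2_sum => i _; apply: isL2Z; case: (WY i).
  exact/funext.
rewrite isL2_sqr //; apply: (@le_trans _ _ (nrm P (fun w => \sum_i V i w) ^+ 2)%:E)%R.
  by rewrite lee_fin ler_pXn2r ?nnegrE ?nrm_ge0.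
rewrite E -sumEFin; apply: lee_sum => i _.
have v2 : isL2 (mpow mu (q i).-1) (v i) by case: (WV i).
rewrite [X in X <= _]EFinM -(isL2_sqr v2).
have mdiff : measurable_fun setT (fun t : (q i).-1.-tuple Z => K (z :: t) - data_fun S (D i) (z :: t))%R.
  apply: measurable_funB; first exact: (@seq_measurable_catl _ _ _ _ K [:: z] mK).
  have [[mY _] _ _] := WY i.
  have qi0 : ((q i)%:R != 0 :> R)%R by rewrite pnatr_eq0 -lt0n.
  rewrite (_ : (fun x => _) = (fun t : (q i).-1.-tuple Z => (q i)%:R^-1 * ((q i)%:R * data_fun S (D i) (z :: t))))%R.
    exact: measurable_funM.
  by apply/funext => t; rewrite mulKf.
have -> : \int[mpow mu (q i).-1]_x (v i x ^+ 2)%:E = ((a (q i) * (q i)%:R) ^+ 2)%:E *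
    \int[mpow mu (q i).-1]_t ((K (z :: t) - data_fun S (D i) (z :: t)) ^+ 2)%:E.
  rewrite -integral_sqr_scale //; apply: eq_integral => t _; congr (_ ^+ 2)%:E; rewrite /v; ring.
rewrite muleA -EFinM; apply: lee_wpmul2r; first exact: integral_sqr_ge0.
have -> : ((q i)`! = q i * (q i).-1`!)%N by rewrite -{1}(prednK (q_gt0 i)) factS prednK.
rewrite lee_fin natrM exprMn.
have a2 : (a (q i) ^+ 2 <= 1)%R by rewrite -real_normK ?num_real // expr_le1.
rewrite (_ : _ * (_ * _) = a (q i) ^+ 2 * ((q i)%:R * ((q i)%:R * (q i).-1`!%:R)))%R; last by ring.
by apply: ler_piMl => //; rewrite !mulr_ge0.
Qed.

(** Integrating over z restores the missing variable, so the bound is in terms of the kernels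
    themselves. *)
Lemma derivative_dist a U : (forall m, (`|a m| <= 1)%R) -> derivative_of mu P eta f a U ->
  \int[mu]_z \int[P]_w ((U z w - section_data a z w) ^+ 2)%:E <=
  \sum_i ((q i)%:R * (q i)`!%:R)%:E *
    \int[mpow mu (q i)]_t ((K t - data_fun S (D i) t) ^+ 2)%:E.
Proof.
move=> a1 [mU aeU].
have mdata i : seq_measurable (fun s => data_fun S (D i) s).
  move=> n; have [+ _] := @data_fun_isL2 _ _ _ mu I S (D i) (fun i => (mS i).1) (fun i => (mS i).2) n.
  exact.
have mu2 i : seq_measurable (fun s => ((K s - data_fun S (D i) s) ^+ 2)%:E : \bar R).
  by move=> n; apply: measurable_sqr; apply: measurable_funB; [exact: mK | exact: mdata].
have mG i : measurable_fun setT (fun z =>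
    \int[mpow mu (q i).-1]_t ((K (z :: t) - data_fun S (D i) (z :: t)) ^+ 2)%:E).
  apply: (@measurable_integral_r _ _ _ _ _ _ (fun z (t : (q i).-1.-tuple Z) =>
    ((K (z :: t) - data_fun S (D i) (z :: t)) ^+ 2)%:E)) => //.
  exact: (@seq_measurable_cons _ _ _ _ _ _ (mu2 i)).
apply: (@le_trans _ _ (\int[mu]_z \sum_i ((q i)%:R * (q i)`!%:R)%:E *
    \int[mpow mu (q i).-1]_t ((K (z :: t) - data_fun S (D i) (z :: t)) ^+ 2)%:E)).
  apply: integral_le_ge0_ae.
  - apply: (@measurable_integral_r _ _ _ _ _ _ (fun z w => ((U z w - section_data a z w) ^+ 2)%:E)) => //.
    apply: measurable_sqr; apply: measurable_funB => //; exact: section_data_measurable.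
  - by apply: emeasurable_sum => i; apply: measurable_funeM.
  - move=> z; apply: sume_ge0 => i _; rewrite mule_ge0 ?integral_sqr_ge0 // lee_fin mulr_ge0 //.
  move: aeU; apply: filterS => z [U2 [J [WJ UJ]]].
  exact: derivative_section_dist UJ.
rewrite ge0_integral_sum //; first last.
- by move=> i z _; rewrite mule_ge0 ?integral_sqr_ge0 // lee_fin mulr_ge0.
- by move=> i; apply: measurable_funeM.
apply: lee_sum => i _; rewrite ge0_integralZl_EFin ?mulr_ge0 //; last first.
  by move=> z _; exact: integral_sqr_ge0.
have -> : \int[mpow mu (q i)]_t ((K t - data_fun S (D i) t) ^+ 2)%:E =
    \int[mu]_z \int[mpow mu (q i).-1]_t ((K (z :: t) - data_fun S (D i) (z :: t)) ^+ 2)%:E.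
  rewrite -(@ge0_integral_mpow_cons _ _ _ mu _ _ (mu2 i)) => [|s]; last by rewrite lee_fin sqr_ge0.
  by rewrite prednK.
by [].
Qed.

End DerivativeApproximation.

Lemma positive_lower_bound (R : realFieldType) (J : finType) (F : J -> R) :
  (forall j, 0 < F j)%R -> exists2 e : R, (0 < e)%R & forall j, (e <= F j)%R.
Proof.
move=> F0; suff [e e0 h] : exists2 e : R, (0 < e)%R & forall j, j \in enum J -> (e <= F j)%R.
  by exists e => // j; apply: h; rewrite mem_enum.
elim: (enum J) => [|j s [e e0 h]]; first by exists 1%R.
exists (Num.min (F j) e); first by rewrite lt_min F0.
by move=> i; rewrite inE ge_min => /orP[/eqP ->|/h ->]; rewrite ?lexx ?orbT.
Qed.

(** * Processes constant in z on each atom *)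

Section Piecewise.
Context d (Z : measurableType d) (R : realType).
Variable mu : {sigma_finite_measure set Z -> \bar R}.
Context d' (Omega : measurableType d') (P : probability Omega R).
Variables (B : finType) (e : B -> set Z) (w : B -> R).
Hypothesis me : forall b, measurable (e b).
Hypothesis ew : forall b, mu (e b) = (w b)%:E.
Hypothesis de : forall b b', b != b' -> e b `&` e b' = set0.
Implicit Types E : B -> Omega -> R.

Definition piecewise E (x : Z * Omega) : R := (\sum_b \1_(e b) x.1 * E b x.2)%R.

Lemma piecewise_in E b z om : e b z -> piecewise E (z, om) = E b om.
Proof.
move=> bz; rewrite /piecewise (bigD1 b) //= indicE mem_set // mul1r big1 ?addr0 // => b' b'b.
rewrite indicE memNset ?mul0r // => b'z; have /seteqP[/(_ z) + _] := de b'b.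
by apply.
Qed.

Lemma piecewise_out E z om : (forall b, ~ e b z) -> piecewise E (z, om) = 0%R.
Proof. by move=> no; rewrite /piecewise big1 // => b _; rewrite indicE memNset ?mul0r. Qed.

Lemma piecewiseM E E' x : (piecewise E x * piecewise E' x)%R = piecewise (fun b om => E b om * E' b om)%R x.
Proof.
case: x => z om; have [[b bz]|no] := pselect (exists b, e b z).
  by rewrite !(piecewise_in _ _ bz).
by rewrite !piecewise_out ?mulr0 // => b bz; apply: no; exists b.
Qed.

Lemma piecewiseB E E' x : (piecewise E x - piecewise E' x)%R = piecewise (fun b om => E b om - E' b om)%R x.
Proof. by rewrite /piecewise -sumrB; apply: eq_bigr => b _; rewrite mulrBr. Qed.

Lemma measurable_piecewise E : (forall b, measurable_fun setT (E b)) -> measurable_fun setT (piecewise E).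
Proof.
move=> mE; apply: measurable_sum => b; apply: measurable_funM.
  by apply: (@measurable_indic_comp _ _ _ _ _ (e b)) => //; exact: measurable_fst.
by apply: (measurableT_comp (mE b)); exact: measurable_snd.
Qed.

Lemma integral_piecewise_sqr E : (forall b, measurable_fun setT (E b)) ->
  \int[mu \x P]_x (piecewise E x ^+ 2)%:E = \sum_b (w b)%:E * \int[P]_om (E b om ^+ 2)%:E.
Proof.
move=> mE.
have sq x : (piecewise E x ^+ 2)%:E = \sum_b (\1_(e b) x.1 * E b x.2 ^+ 2)%:E.
  by rewrite expr2 piecewiseM sumEFin.
have t0 b x : (0 <= \1_(e b) (x : Z * Omega).1 * E b x.2 ^+ 2)%R by rewrite mulr_ge0 ?sqr_ge0.
have mt b : measurable_fun setT (fun x : Z * Omega => \1_(e b) x.1 * E b x.2 ^+ 2)%R.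
  apply: measurable_funM.
    by apply: (@measurable_indic_comp _ _ _ _ _ (e b)) => //; exact: measurable_fst.
  by apply: measurable_funX; apply: (measurableT_comp (mE b)); exact: measurable_snd.
under eq_integral => x _ do rewrite sq.
rewrite ge0_integral_sum //; first last.
- by move=> b x _; rewrite lee_fin.
- by move=> b; apply/measurable_EFinP.
apply: eq_bigr => b _.
rewrite (@ge0_integral_prod _ _ _ _ _ mu P (fun z om => (\1_(e b) z * E b om ^+ 2)%:E)); first last.
- by move=> z om; rewrite lee_fin (t0 b (z, om)).
- by apply/measurable_EFinP; exact: mt.
transitivity (\int[mu]_z ((\1_(e b) z)%:E * \int[P]_om (E b om ^+ 2)%:E)).
  apply: eq_integral => z _; rewrite -ge0_integralZl_EFin //.
  - by move=> om _; rewrite lee_fin sqr_ge0.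
  - exact: measurable_sqr.
rewrite ge0_integralZr //.
- by congr (_ * _); exact: etrans (integral_indicT mu (me b)) (ew b).
- by apply/measurable_EFinP; exact: measurable_indic.
- exact: integral_sqr_ge0.
Qed.

End Piecewise.

Section KernelDifference.
Context d (Z : measurableType d) (R : realType).
Variable mu : {sigma_finite_measure set Z -> \bar R}.
Variables (k : nat) (q : 'I_k -> nat).
Hypothesis q_incr : forall i j : 'I_k, (i < j)%N -> (q i < q j)%N.
Variable f : forall i : 'I_k, (q i).-tuple Z -> R.
Arguments f : clear implicits.
Hypothesis fL2 : forall i, L2_sym mu (f i).

Let K := chaos_kernel f predT.

Let mK : seq_measurable K.
Proof. exact: seq_measurable_kernel fL2 _. Qed.

Let K2 n : \int[mpow mu n]_t (K t ^+ 2)%:E < +oo.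
Proof. exact: kernel_sqr. Qed.

Let qinj : injective q := q_inj q_incr.

Variables (I : finType) (S : I -> set Z).
Hypothesis mS : forall i, measurable (S i) /\ mu (S i) < +oo.

Let mcell (c : coarse S) : measurable (cell c).
Proof. by apply: measurable_cell => i; case: (mS i). Qed.

Let cellW (c : coarse S) : mu (cell c) = (cell_weight mu c)%:E.
Proof. by apply: cell_weightE => i; case: (mS i). Qed.

Definition cell_average (s : seq (coarse S)) : R :=
  average mu (cell (S := S)) (cell_weight mu (S := S)) K s.

Lemma cell_average_perm s s' : perm_eq s s' -> cell_average s = cell_average s'.
Proof. by apply: average_perm => //; exact: kernel_sym. Qed.

Lemma cell_average_size n s : (forall i, q i <= n)%N -> cell_average s != 0%R -> (size s <= n)%N.
Proof.
move=> qn; apply: contraNT; rewrite -ltnNge => ns; rewrite /cell_average /average.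
under eq_integral => t _.
  rewrite /K kernel0 => [|i _]; last by rewrite size_tuple; apply: contraTneq ns => ->; rewrite -leqNgt.
  rewrite mulr0; over.
by rewrite integral0 mul0r.
Qed.

Variable D : 'I_k -> seq (R * seq I).
Hypothesis dD : forall i, disjoint_data S (D i).
Hypothesis sD : forall i p, p \in D i -> size p.2 = q i.
Hypothesis symD : forall i (s : 'S_(q i)) (t : (q i).-tuple Z),
  data_fun S (D i) (permute s t) = data_fun S (D i) t.

Definition kernel_diff (a : nat -> R) (s : seq (coarse S)) : R :=
  (a (size s) * (data_kernel (all_data D) s - cell_average s))%R.

Lemma tbox_cell_measurable m (s : m.-tuple (coarse S)) : measurable (@tbox _ Z _ (@cell _ Z I S) m s).
Proof. exact: (measurable_tbox R). Qed.

Lemma tbox_cell_weight m (s : m.-tuple (coarse S)) :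
  mpow mu m (tbox (@cell _ Z I S) s) = (weight (cell_weight mu (S:=S)) s)%:E.
Proof. exact: tbox_weight. Qed.

Lemma tbox_cell_disjoint m (s s' : m.-tuple (coarse S)) : s != s' ->
  @tbox _ Z _ (@cell _ Z I S) m s `&` tbox (@cell _ Z I S) s' = set0.
Proof. by apply: tbox_disjoint; exact: cell_disjoint. Qed.

Lemma tsum_average_dist m :
  (tsum (cell_weight mu (S:=S)) m (fun s => (data_kernel (all_data D) s - cell_average s) ^+ 2)%R)%:E
  <= \int[mpow mu m]_t ((K t - data_fun S (all_data D) t) ^+ 2)%:E.
Proof.
rewrite tsum_tuple; under [leRHS]eq_integral => t _ do rewrite data_fun_step.
apply: (step_average_near (@tbox_cell_measurable m) (@tbox_cell_weight m) (@tbox_cell_disjoint m)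
  (@mK m) (@K2 m)) => s.
under eq_integral => t _ do rewrite tboxE.
exact: averageP.
Qed.

Lemma average_step_dist m :
  \int[mpow mu m]_t ((K t - step (fun s : m.-tuple (coarse S) => tbox (cell (S := S)) s)
     (fun s : m.-tuple (coarse S) => cell_average s) t) ^+ 2)%:E
  <= \int[mpow mu m]_t ((K t - data_fun S (all_data D) t) ^+ 2)%:E.
Proof.
under [leRHS]eq_integral => t _ do rewrite data_fun_step.
apply: (average_dist_le (@tbox_cell_measurable m) (@tbox_cell_weight m) (@tbox_cell_disjoint m)
  (@mK m) (@K2 m)) => s.
under eq_integral => t _ do rewrite tboxE.
exact: averageP.
Qed.

Lemma order_dist m : \int[mpow mu m]_t ((K t - data_fun S (all_data D) t) ^+ 2)%:E
  = \sum_(i | q i == m) \int[mpow mu (q i)]_t ((K t - data_fun S (D i) t) ^+ 2)%:E.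
Proof.
have [i /eqP qi|no] := pickP (fun i => q i == m).
  subst m; rewrite (big_pred1 i) => [|j]; last by rewrite (inj_eq qinj).
  by apply: eq_integral => t _; rewrite (data_fun_all_order S sD _ qinj).
rewrite big_pred0 // integral0_eq // => t _.
rewrite /K kernel0 => [|i _]; last by rewrite size_tuple eq_sym no.
rewrite data_fun_all big1 ?subrr ?expr0n // => i _.
by apply: (data_fun_size S sD); rewrite size_tuple eq_sym no.
Qed.

Variables (n N : nat) (w : coarse S * 'I_N -> R).
Hypothesis qn : forall i, (q i <= n)%N.
Variables (G : 'I_N -> set Z) (e : R).
Hypothesis grid : is_grid mu G w e.

Definition atom_diff a (s : seq (coarse S * 'I_N)) : R := kernel_diff a (map fst s).

Lemma atom_diff_perm a s s' : perm_eq s s' -> atom_diff a s = atom_diff a s'.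
Proof.
move=> ss'; rewrite /atom_diff /kernel_diff !size_map (perm_size ss'); congr (_ * (_ - _))%R.
  by apply: (all_data_perm sD symD); exact: perm_map.
by apply: cell_average_perm; exact: perm_map.
Qed.

Lemma atom_diff_size a s : atom_diff a s != 0%R -> (size s <= n)%N.
Proof.
apply: contraNT => ns; rewrite /atom_diff /kernel_diff.
have -> : data_kernel (all_data D) (map fst s) = 0%R.
  apply/eqP; apply: contraNT ns => /(data_kernel_size (sized_all_data sD qn)).
  by rewrite size_map.
have -> : cell_average (map fst s) = 0%R; last by rewrite subrr mulr0.
by apply/eqP; apply: contraNT ns => /(cell_average_size qn); rewrite size_map.
Qed.

(** Sums over distinct atoms are bounded by sums over all tuples, which collapse to cells; there the
    distance between the elementary kernel and the averages of K is at most its distance to K,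
    averaging being a projection. *)
Lemma atom_diff_energy a : (forall m, (`|a m| <= 1)%R) ->
  (energy w (sym_kernel (atom_diff a)))%:E <=
  \sum_i ((q i)`!%:R)%:E * \int[mpow mu (q i)]_t ((K t - data_fun S (D i) t) ^+ 2)%:E.
Proof.
move=> a1; rewrite (energy_sym_kernel (@atom_diff_perm a) (@atom_diff_size a)).
pose H i := ((q i)`!%:R)%:E * \int[mpow mu (q i)]_t ((K t - data_fun S (D i) t) ^+ 2)%:E.
have HE : \sum_i H i = \sum_(m < n.+1) \sum_(i | q i == m) H i.
  rewrite (exchange_big_dep predT) //=; apply: eq_bigr => i _.
  by rewrite (big_pred1 (Ordinal (qn i : (q i < n.+1)%N))) // => m; rewrite -val_eqE eq_sym.
rewrite -/(H _) HE -sumEFin; apply: lee_sum => m _.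
have -> : \sum_(i | q i == m) H i = (m`!%:R)%:E *
    \int[mpow mu m]_t ((K t - data_fun S (all_data D) t) ^+ 2)%:E.
  rewrite order_dist ge0_sume_distrr => [|i _]; last exact: integral_sqr_ge0.
  by apply: eq_bigr => i /eqP <-.
rewrite EFinM; apply: lee_wpmul2l; first by rewrite lee_fin.
apply: le_trans (tsum_average_dist m); rewrite lee_fin.
apply: (@le_trans _ _ (tsum w m (fun s => atom_diff a s ^+ 2)%R)).
  by apply: gsum_le_tsum => [b|s _]; [exact: (atom_ge0 grid) | exact: sqr_ge0].
rewrite /atom_diff (tsum_fst w m (fun s => kernel_diff a s ^+ 2)%R).
have -> : (fun c : coarse S => \sum_b w (c, b))%R = cell_weight mu (S := S).
  by apply/funext => c; apply: (sum_atom_weight _ _ grid) => i; case: (mS i).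
apply: ler_tsum => [c|s _].
  by rewrite -lee_fin -cellW measure_ge0.
rewrite /kernel_diff exprMn ler_piMl ?sqr_ge0 //.
by rewrite -real_normK ?num_real // expr_le1.
Qed.

End KernelDifference.

Lemma chaosB (R : comNzRingType) (A : finType) (x : A -> R) k k' :
  (chaos x k - chaos x k' = chaos x (fun S => k S - k' S))%R.
Proof. by rewrite /chaos -sumrB; apply: eq_bigr => S _; rewrite mulrBl. Qed.

Section Discretization.
Context d (Z : measurableType d) (R : realType).
Variable mu : {sigma_finite_measure set Z -> \bar R}.
Context d' (Omega : measurableType d').
Variables (P : probability Omega R) (eta : R.-ker Omega ~> Z).
Hypothesis eta_poisson : poisson_measure P mu eta.
Hypothesis Zborel : borel_space Z R.
Hypothesis mu_na : non_atomic mu.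
Local Notation multiple_integral := (multiple_integral mu P eta).
Variables (k : nat) (q : 'I_k -> nat).
Hypothesis q_gt0 : forall i, (0 < q i)%N.
Hypothesis q_incr : forall i j : 'I_k, (i < j)%N -> (q i < q j)%N.
Variable f : forall i : 'I_k, (q i).-tuple Z -> R.
Arguments f : clear implicits.
Hypothesis fL2 : forall i, L2_sym mu (f i).
Variable n : nat.
Hypothesis qn : forall i, (q i <= n)%N.

Let K := chaos_kernel f predT.

Let qinj : injective q := q_inj q_incr.

(** Built from averages of the f_i and not from their elementary approximations, because averages
    inherit the contraction bounds. The elementary data serve to fix the cells and as an
    intermediate term of comparison. *)
Definition grid_kernel (I : finType) (S : I -> set Z) N (a : nat -> R) (A : {set coarse S * 'I_N}) : R :=
  (a #|A| * ((#|A|)`!%:R * cell_average mu f (map fst (enum A))))%R.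

Section FixedData.
Variables (I : finType) (S : I -> set Z).
Hypothesis mS : forall i, measurable (S i) /\ mu (S i) < +oo.
Variable D : 'I_k -> seq (R * seq I).
Hypothesis dD : forall i, disjoint_data S (D i).
Hypothesis sD : forall i p, p \in D i -> size p.2 = q i.
Hypothesis symD : forall i (s : 'S_(q i)) (t : (q i).-tuple Z),
  data_fun S (D i) (permute s t) = data_fun S (D i) t.

Let dA := disjoint_all_data dD.
Let sA := sized_all_data sD qn.
Let pA := all_data_perm sD symD.

Lemma data_sum_diff N (x : coarse S * 'I_N -> R) :
  (data_sum x (all_data D) - chaos x (grid_kernel (fun=> 1))
   = chaos x (sym_kernel (atom_diff mu f D (fun=> 1))))%R.
Proof.
rewrite (data_sum_chaos x dA sA pA) chaosB; congr chaos; apply/funext => A.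
rewrite /sym_kernel /grid_kernel /atom_kernel /atom_diff /kernel_diff; ring.
Qed.

Lemma data_derivative_diff N (x : coarse S * 'I_N -> R) a b :
  (data_sum x (data_derivative (scale_data a (all_data D)) (val b.1))
   - chaos x (dkern (grid_kernel a) b) = chaos x (dkern (sym_kernel (atom_diff mu f D a)) b))%R.
Proof.
rewrite (data_derivative_chaos x (disjoint_scale dA) (sized_scale sA)); last first.
  by move=> s s' ss'; rewrite !data_kernel_scale (perm_size ss') (pA ss').
rewrite chaosB; congr chaos; apply/funext => A; rewrite /dkern; case: ifP => _; first by rewrite subr0.
rewrite /sym_kernel /grid_kernel /atom_kernel /atom_diff /kernel_diff data_kernel_scale.
by rewrite size_map -cardE; ring.
Qed.

Variable e1 : R.
Hypothesis e1_ge0 : (0 <= e1)%R.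
Hypothesis De1 : forall i, \int[mpow mu (q i)]_t ((K t - data_fun S (D i) t) ^+ 2)%:E <= (e1 ^+ 2)%:E.

Definition order_const : R := (\sum_i (q i)%:R * (q i)`!%:R)%R.

Lemma order_const_ge0 : (0 <= order_const)%R.
Proof. by apply: sumr_ge0 => i _; rewrite mulr_ge0. Qed.

Lemma factorial_dist : \sum_i ((q i)`!%:R)%:E *
    \int[mpow mu (q i)]_t ((K t - data_fun S (D i) t) ^+ 2)%:E <= (order_const * e1 ^+ 2)%:E.
Proof.
rewrite /order_const mulr_suml -sumEFin; apply: lee_sum => i _.
apply: (@le_trans _ _ (((q i)`!%:R)%:E * (e1 ^+ 2)%:E)); first by apply: lee_wpmul2l; rewrite ?lee_fin.
by rewrite -EFinM lee_fin ler_wpM2r ?sqr_ge0 // ler_peMl // ler1n.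
Qed.

Lemma section_dist a U : (forall m, (`|a m| <= 1)%R) -> derivative_of mu P eta f a U ->
  \int[mu \x P]_x ((U x.1 x.2 - section_data mu eta S D a x.1 x.2) ^+ 2)%:E
  <= (order_const * e1 ^+ 2)%:E.
Proof.
move=> a1 UD; have [mU _] := UD.
rewrite (@ge0_integral_prod _ _ _ _ _ mu P
  (fun z om => ((U z om - section_data mu eta S D a z om) ^+ 2)%:E)); first last.
- by move=> z om; rewrite lee_fin sqr_ge0.
- by apply: measurable_sqr; apply: measurable_funB => //; exact: section_data_measurable.
apply: le_trans (derivative_dist eta_poisson Zborel mu_na q_gt0 q_incr fL2 mS dD sD symD a1 UD) _.
rewrite /order_const mulr_suml -sumEFin; apply: lee_sum => i _.
by rewrite [leRHS]EFinM; apply: lee_wpmul2l; rewrite ?lee_fin ?mulr_ge0.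
Qed.

Variables (N : nat) (G : 'I_N -> set Z) (w : coarse S * 'I_N -> R) (e : R).
Hypothesis grid : is_grid mu G w e.
Hypothesis e2 : (2 * e <= 1)%R.
Local Notation x om := (void_var eta (atom G) w om).

Let me (b : coarse S * 'I_N) : measurable (atom G b).
Proof. by apply: (measurable_atom _ grid) => i; case: (mS i). Qed.

Let w2 b : (2 * w b <= 1)%R.
Proof. by apply: le_trans e2; rewrite ler_pM2l //; exact: (atom_le grid). Qed.

Let mX k' : measurable_fun setT (fun om => chaos (x om) k').
Proof. by apply: measurable_chaos_void; exact: me. Qed.

Lemma diff_energy_le a : (forall m, (`|a m| <= 1)%R) ->
  (energy w (sym_kernel (atom_diff mu f D a)) <= order_const * e1 ^+ 2)%R.
Proof.
move=> a1; rewrite -lee_fin; apply: le_trans factorial_dist.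
exact: (atom_diff_energy q_incr fL2 mS sD symD qn grid).
Qed.

Lemma data_sum_near : (nrm P (fun om => data_sum (x om) (all_data D) -
   chaos (x om) (grid_kernel (fun=> 1))) <= (order_const + 1) * e1)%R.
Proof.
apply: nrm_le; first by rewrite mulr_ge0 // addr_ge0 // order_const_ge0.
under eq_integral => om _ do rewrite data_sum_diff.
rewrite (chaos_void_energy eta_poisson me (atom_mu grid) (atom_disjoint grid) w2) lee_fin.
apply: (le_trans (diff_energy_le _)) => [m|]; first by rewrite normr1.
rewrite exprMn ler_wpM2r ?sqr_ge0 //; have := order_const_ge0; nra.
Qed.

Lemma derivative_sum_near a : (forall m, (`|a m| <= 1)%R) ->
  \int[mu \x P]_y (piecewise (atom G) (fun b om =>
     data_sum (x om) (data_derivative (scale_data a (all_data D)) (val b.1)) -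
     chaos (x om) (dkern (grid_kernel a) b)) y ^+ 2)%:E <= (n%:R * (order_const * e1 ^+ 2))%:E.
Proof.
move=> a1; rewrite (_ : (fun b om => _) =
   (fun b om => chaos (x om) (dkern (sym_kernel (atom_diff mu f D a)) b))); last first.
  by apply/funext => b; apply/funext => om; rewrite data_derivative_diff.
rewrite (integral_piecewise_sqr P me (atom_mu grid) (atom_disjoint grid)); last by move=> b; exact: mX.
under eq_bigr => b _ do
  rewrite (chaos_void_energy eta_poisson me (atom_mu grid) (atom_disjoint grid) w2) -EFinM.
rewrite sumEFin lee_fin.
have sz := @atom_diff_size _ _ _ mu _ _ f _ S D sD n N qn a.
have h := sum_energy_dkern_le sz (w := w) (fun b => atom_ge0 grid b).
apply: le_trans h _.
by rewrite ler_wpM2l // diff_energy_le.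
Qed.

Lemma sum_atom_weights : (\sum_b w b = \sum_c cell_weight mu (S := S) c)%R.
Proof.
rewrite (eq_bigr (fun p => w (p.1, p.2))) => [|[] //].
rewrite -(pair_bigA _ (fun c b => w (c, b))) /=; apply: eq_bigr => c _.
by apply: (sum_atom_weight _ _ grid) => i; case: (mS i).
Qed.

Lemma section_data_atoms a (y : Z * Omega) : section_data mu eta S D a y.1 y.2 = piecewise (atom G)
  (fun (b : coarse S * 'I_N) om => data_int mu S eta (data_derivative (scale_data a (all_data D)) (val b.1)) om) y.
Proof.
case: y => z om /=; have [[b bz]|no] := pselect (exists b : coarse S * 'I_N, atom G b z).
  by rewrite (piecewise_in (atom_disjoint grid) _ _ bz); apply: section_data_cell; case: bz.
rewrite piecewise_out => [|b bz]; last by apply: no; exists b.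
by apply: section_data_out => c /(atom_cover grid)[i iz]; apply: no; exists (c, i).
Qed.

Lemma section_atoms_near a d2 :
  (forall c : coarse S, \int[P]_om ((data_int mu S eta (data_derivative (scale_data a (all_data D)) (val c)) om -
     data_sum (x om) (data_derivative (scale_data a (all_data D)) (val c))) ^+ 2)%:E <= d2%:E) ->
  \int[mu \x P]_y (piecewise (atom G) (fun (b : coarse S * 'I_N) om =>
    data_int mu S eta (data_derivative (scale_data a (all_data D)) (val b.1)) om -
    data_sum (x om) (data_derivative (scale_data a (all_data D)) (val b.1))) y ^+ 2)%:E
  <= ((\sum_c cell_weight mu (S := S) c) * d2)%:E.
Proof.
move=> h; rewrite (integral_piecewise_sqr P me (atom_mu grid) (atom_disjoint grid)); last first.
  move=> b; apply: measurable_funB; first by apply: measurable_data_int => i; case: (mS i).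
  exact: (@measurable_data_sum _ _ _ _ _ _ _ _ eta (fun i => (mS i).1) _ _ _ _ _ grid).
rewrite -sum_atom_weights mulr_suml -sumEFin; apply: lee_sum => b _; rewrite EFinM.
by apply: lee_wpmul2l; [rewrite lee_fin; exact: (atom_ge0 grid) | exact: h].
Qed.

(** Three comparisons: U with the derivative of the elementary integrals, compensated masses with
    void variables on each cell, elementary kernels with averages. The factors 2 come from squares
    of sums. *)
Lemma grid_derivative_near a U d2 : (forall m, (`|a m| <= 1)%R) -> derivative_of mu P eta f a U ->
  (forall c : coarse S, \int[P]_om ((data_int mu S eta (data_derivative (scale_data a (all_data D)) (val c)) om -
     data_sum (x om) (data_derivative (scale_data a (all_data D)) (val c))) ^+ 2)%:E <= d2%:E) ->
  \int[mu \x P]_y ((U y.1 y.2 - piecewise (atom G)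
     (fun b om => chaos (x om) (dkern (grid_kernel a) b)) y) ^+ 2)%:E
  <= (2 * (order_const * e1 ^+ 2) + 2 * (2 * ((\sum_c cell_weight mu (S := S) c) * d2) +
       2 * (n%:R * (order_const * e1 ^+ 2))))%:E.
Proof.
move=> a1 UD h; have [mU _] := UD.
set A := piecewise _ _.
pose Y y := section_data mu eta S D a y.1 y.2.
pose F (b : coarse S * 'I_N) om := data_int mu S eta (data_derivative (scale_data a (all_data D)) (val b.1)) om.
pose H (b : coarse S * 'I_N) om := data_sum (x om) (data_derivative (scale_data a (all_data D)) (val b.1)).
have mF b : measurable_fun setT (F b) by apply: measurable_data_int => i; case: (mS i).
have mH b : measurable_fun setT (H b) by exact: (@measurable_data_sum _ _ _ _ _ _ _ _ eta (fun i => (mS i).1) _ _ _ _ _ grid).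
have mA : measurable_fun setT A by apply: measurable_piecewise => // b; exact: mX.
have mY : measurable_fun setT Y by exact: section_data_measurable.
have mPH : measurable_fun setT (piecewise (atom G) H) by exact: measurable_piecewise.
have -> : (fun y => ((U y.1 y.2 - A y) ^+ 2)%:E) =
   (fun y => ((((U y.1 y.2 - Y y) + ((Y y - piecewise (atom G) H y) + (piecewise (atom G) H y - A y)))) ^+ 2)%:E)%R.
  by apply/funext => y; congr (_ ^+ 2)%:E; ring.
have m1 : measurable_fun setT (fun y => U y.1 y.2 - Y y)%R by exact: measurable_funB.
have m2 : measurable_fun setT (fun y => Y y - piecewise (atom G) H y)%R by exact: measurable_funB.
have m3 : measurable_fun setT (fun y => piecewise (atom G) H y - A y)%R by exact: measurable_funB.
apply: le_trans (integral_sqr_add_le _ m1 (measurable_funD m2 m3)) _.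
rewrite [leRHS]EFinD; apply: leeD.
  by rewrite [leRHS]EFinM; apply: lee_wpmul2l => //; exact: section_dist.
rewrite [leRHS]EFinM; apply: lee_wpmul2l => //.
apply: le_trans (integral_sqr_add_le _ m2 m3) _; rewrite [leRHS]EFinD; apply: leeD.
  rewrite [leRHS]EFinM; apply: lee_wpmul2l => //; apply: le_trans (section_atoms_near h).
  rewrite le_eqVlt; apply/orP; left; apply/eqP; apply: eq_integral => y _.
  by rewrite /Y section_data_atoms piecewiseB.
rewrite [leRHS]EFinM; apply: lee_wpmul2l => //; apply: le_trans (derivative_sum_near a1).
rewrite le_eqVlt; apply/orP; left; apply/eqP; apply: eq_integral => y _.
by rewrite /A piecewiseB.
Qed.

End FixedData.

Variables (L : finType) (a : L -> nat -> R) (U : L -> Z -> Omega -> R) (X : 'I_k -> Omega -> R).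
Hypothesis a1 : forall l m, (`|a l m| <= 1)%R.
Hypothesis UD : forall l, derivative_of mu P eta f (a l) (U l).
Hypothesis WX : forall i, multiple_integral (f i) (X i).

(** The order of the choices matters: e1 fixes the elementary kernels and thereby the cells, whose
    number and mass then determine d2 and the mesh. Finitely many derivatives are treated together
    so that they share one grid. *)
Lemma discretization (delta : R) : (0 < delta)%R ->
  exists (I : finType) (S : I -> set Z),
  [/\ forall i, measurable (S i) /\ mu (S i) < +oo,
      forall m, \int[mpow mu m]_t ((K t - step (fun s : m.-tuple (coarse S) => tbox (cell (S := S)) s)
        (fun s : m.-tuple (coarse S) => cell_average mu f s) t) ^+ 2)%:E <= delta%:E &
      exists2 eps : R, (0 < eps)%R & forall N (G : 'I_N -> set Z) (w : coarse S * 'I_N -> R) e,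
        is_grid mu G w e -> (0 <= e)%R -> (2 * e <= 1)%R -> (e <= eps)%R ->
        (nrm P (fun om => \sum_i X i om -
            chaos (void_var eta (atom G) w om) (grid_kernel (fun=> 1))) <= delta)%R /\
        forall l, \int[mu \x P]_y ((U l y.1 y.2 - piecewise (atom G)
          (fun b om => chaos (void_var eta (atom G) w om) (dkern (grid_kernel (a l)) b)) y) ^+ 2)%:E
          <= delta%:E].
Proof.
move=> d0; pose B := order_const; have B0 := order_const_ge0; rewrite -/B in B0.
(* Collects the factors of e1 in both estimates. The 2 in front of the last group keeps it below
   delta / 2 and leaves the other half for the term with d2. *)
pose C : R := (k%:R + 2 + B + 2 * (2 * B + 4 * (n%:R * B)))%R.
have nB0 : (0 <= n%:R * B)%R by rewrite mulr_ge0.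
have k0 : (0 <= k%:R :> R)%R by [].
have C0 : (0 < C)%R by rewrite /C; lra.
pose e1 := Num.min 1%R (delta / C)%R.
have e10 : (0 < e1)%R by rewrite lt_min ltr01 divr_gt0.
have e1C : (C * e1 <= delta)%R by rewrite mulrC -ler_pdivlMr // ge_min lexx orbT.
have e11 : (e1 ^+ 2 <= e1)%R by rewrite expr2 ler_piMr ?(ltW e10) // ge_min lexx.
have /choice[Y hY] i : exists Y, exists g : (q i).-tuple Z -> R,
    [/\ elementary_integral mu eta g Y, forall s t, g (permute s t) = g t,
        isL2 (mpow mu (q i)) g /\ isL2 P Y,
        (nrm (mpow mu (q i)) (fun t => f i t - g t) <= e1)%R &
        (nrm P (fun om => X i om - Y om) <= e1)%R].
  by case: (WX i) => _ _ /(_ _ e10)[g [Y h]]; exists Y, g.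
pose g i := sval (cid (hY i)); have hg i := svalP (cid (hY i)).
have {hg} hg i : [/\ elementary_integral mu eta (g i) (Y i), forall s t, g i (permute s t) = g i t,
        isL2 (mpow mu (q i)) (g i) /\ isL2 P (Y i),
        (nrm (mpow mu (q i)) (fun t => f i t - g i t) <= e1)%R &
        (nrm P (fun om => X i om - Y i om) <= e1)%R] by exact: hg.
move: g hg => g hg.
have el i : elementary_integral mu eta (g i) (Y i) by case: (hg i).
have [I [S [D [mS dD sD gD YD]]]] := elementary_data el.
have symD i (s : 'S_(q i)) (t : (q i).-tuple Z) :
    data_fun S (D i) (permute s t) = data_fun S (D i) t.
  by rewrite -(gD i (permute s t)) -(gD i t); case: (hg i).
have De1 i : \int[mpow mu (q i)]_t ((K t - data_fun S (D i) t) ^+ 2)%:E <= (e1 ^+ 2)%:E.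
  have [_ _ [g2 _] h _] := hg i; have [f2 _ _] := WX i.
  apply: le_trans (sqr_nrm_lt (isL2B f2 g2) h); rewrite le_eqVlt; apply/orP; left; apply/eqP.
  by apply: eq_integral => t _; rewrite gD /K kernel_tuple.
exists I, S; split => //.
  move=> m; apply: le_trans (average_step_dist q_incr fL2 mS D m) _.
  rewrite (order_dist mu q_incr f S sD m).
  have [i /eqP qi|no] := pickP (fun i => q i == m).
    rewrite (big_pred1 i) => [|j]; last by rewrite -qi (inj_eq qinj).
    by apply: le_trans (De1 i) _; rewrite lee_fin; apply: le_trans e11 _; rewrite /C in e1C; nra.
  by rewrite big_pred0 // lee_fin ltW.
pose Tot := (\sum_c cell_weight mu (S := S) c)%R.
have Tot0 : (0 <= Tot)%R.
  apply: sumr_ge0 => c _; rewrite -lee_fin -cell_weightE ?measure_ge0 // => i; by case: (mS i).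
pose d2 := (delta / (8 * (Tot + 1)))%R.
have d20 : (0 < d2)%R by rewrite divr_gt0 // mulr_gt0 // ltr_wpDl.
have Td2 : (4 * (Tot * d2) <= delta / 2)%R.
  rewrite /d2 (_ : 4 * _ = delta / 2 * (Tot / (Tot + 1)))%R; last by field; rewrite gt_eqF // ltr_wpDl.
  by rewrite ler_piMr ?divr_ge0 ?(ltW d0) // ler_pdivrMr ?ltr_wpDl // mul1r lerDl.
have [eps0 eps00 H0] := data_close eta_poisson (fun i => (mS i).1) (fun i => (mS i).2) (all_data D) (exprn_gt0 2 e10).
have epE (lc : L * coarse S) : exists ep : R, (0 < ep)%R /\
    close_on mu P (data_int mu S eta (data_derivative (scale_data (a lc.1) (all_data D)) (val lc.2)))
      (fun N G (w : coarse S * 'I_N -> R) om => data_sum (void_var eta (atom G) w om)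
         (data_derivative (scale_data (a lc.1) (all_data D)) (val lc.2))) ep d2.
  have [ep ep0 h] := data_close eta_poisson (fun i => (mS i).1) (fun i => (mS i).2)
    (data_derivative (scale_data (a lc.1) (all_data D)) (val lc.2)) d20.
  by exists ep.
have [ep hep] := choice epE.
have [eps1 eps10 H1] := positive_lower_bound (fun lc => (hep lc).1).
exists (Num.min eps0 eps1); first by rewrite lt_min eps00.
move=> N G w e grid e0 e2; rewrite le_min => /andP[ee0 ee1]; split => [|l].
  have X2 i : isL2 P (X i) by case: (WX i).
  have Y2 i : isL2 P (Y i) by case: (hg i) => _ _ [].
  pose V om := data_int mu S eta (all_data D) om.
  pose W om := data_sum (void_var eta (atom G) w om) (all_data D).
  have VE : V = (fun om => \sum_i Y i om)%R.
    by apply/funext => om; rewrite /V data_int_all; apply: eq_bigr => i _; rewrite YD.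
  have V2 : isL2 P V by rewrite VE; apply: isL2_sum.
  have XS2 : isL2 P (fun om => \sum_i X i om)%R by apply: isL2_sum.
  have VW : \int[P]_om ((V om - W om) ^+ 2)%:E <= (e1 ^+ 2)%:E by apply: H0 grid _ _ _.
  have VW2 : isL2 P (fun om => V om - W om)%R.
    apply: isL2_le VW; apply: measurable_funB; first by case: V2.
    exact: (@measurable_data_sum _ _ _ _ _ _ _ _ eta (fun i => (mS i).1) _ _ _ _ _ grid).
  have Wnear := data_sum_near mS dD sD symD (ltW e10) De1 grid e2.
  have Wd2 : isL2 P (fun om => W om - chaos (void_var eta (atom G) w om) (grid_kernel (fun=> 1)))%R.
    rewrite /W; under eq_fun do rewrite (data_sum_diff dD sD symD).
    have me (b : coarse S * 'I_N) : measurable (atom G b) by apply: (measurable_atom _ grid) => i; case: (mS i).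
    split; first by apply: measurable_chaos_void; exact: me.
    rewrite (chaos_void_energy eta_poisson me (atom_mu grid) (atom_disjoint grid)) ?ltry // => b.
    by apply: le_trans e2; rewrite ler_pM2l //; exact: (atom_le grid).
  rewrite (_ : (fun om => _) = (fun om => (\sum_i X i om - V om) + ((V om - W om) +
     (W om - chaos (void_var eta (atom G) w om) (grid_kernel (fun=> 1)))))%R); last first.
    by apply/funext => om; ring.
  apply: le_trans (nrmD (isL2B XS2 V2) (isL2D VW2 Wd2)) _.
  have h1 : (nrm P (fun om => \sum_i X i om - V om) <= k%:R * e1)%R.
    rewrite VE; under [X in nrm _ X]eq_fun do rewrite -sumrB.
    apply: le_trans (nrm_sum _ (fun i => isL2B (X2 i) (Y2 i))) _.
    apply: (@le_trans _ _ (\sum_(i < k) e1)%R).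
      by apply: ler_sum => i _; case: (hg i).
    by rewrite sumr_const card_ord -[leLHS]mulr_natl.
  have h2 : (nrm P (fun om => V om - W om) <= e1)%R by apply: nrm_le => //; exact: ltW.
  have h3 := nrmD VW2 Wd2.
  rewrite -/B in Wnear; rewrite /C in e1C; apply: le_trans e1C.
  apply: (@le_trans _ _ (k%:R * e1 + (e1 + (B + 1) * e1)))%R; last by nra.
  by apply: lerD => //; apply: le_trans h3 _; apply: lerD.
apply: le_trans (grid_derivative_near mS dD sD symD De1 grid e2 (a1 l) (UD l) (d2 := d2) _) _.
  by move=> c; have [_ h] := hep (l, c); apply: h grid _ _ _ => //; exact: le_trans ee1 (H1 (l, c)).
rewrite lee_fin -/B -/Tot.
have : (B * e1 ^+ 2 <= B * e1)%R by rewrite ler_wpM2l.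
have : (n%:R * (B * e1 ^+ 2) <= n%:R * B * e1)%R by rewrite -mulrA ler_wpM2l // ler_wpM2l.
have : (0 <= k%:R * e1)%R by rewrite mulr_ge0 // ltW.
have : (0 <= B * e1)%R by rewrite mulr_ge0 // ltW.
move: e1C Td2 e10; rewrite /C; lra.
Qed.

End Discretization.

(** * Passage to the limit *)

Section SquareLimits.
Context d (T : measurableType d) (R : realType) (m : {measure set T -> \bar R}).
Implicit Types f g X Y : T -> R.

Lemma measurable_abs_EFin f : measurable_fun setT f -> measurable_fun setT (fun x => `|f x|%:E : \bar R).
Proof. by move=> mf; apply/measurable_EFinP; apply: (measurableT_comp _ mf). Qed.

Lemma abs_product_le f g : isL2 m f -> isL2 m g ->
  \int[m]_x `|f x * g x|%:E <= (nrm m f * nrm m g)%:E.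
Proof.
move=> [mf f2] [mg g2].
have mf' : measurable_fun setT (fun x => `|f x|%R) by apply: (measurableT_comp _ mf).
have mg' : measurable_fun setT (fun x => `|g x|%R) by apply: (measurableT_comp _ mg).
have sq (h : T -> R) : \int[m]_x (`|h x|%R ^+ 2)%:E = \int[m]_x (h x ^+ 2)%:E.
  by apply: eq_integral => x _; rewrite real_normK ?num_real.
have f2' : \int[m]_x (`|f x|%R ^+ 2)%:E < +oo by rewrite sq.
have g2' : \int[m]_x (`|g x|%R ^+ 2)%:E < +oo by rewrite sq.
under eq_integral => x _ do rewrite normrM.
have i := sqr_mul_integrable mf' mg' f2' g2'.
rewrite -(fineK (integrable_fin_num measurableT i)) lee_fin.
have I0 : (0 <= fine (\int[m]_x (`|f x| * `|g x|)%:E))%R.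
  by rewrite fine_ge0 // integral_ge0 // => x _; rewrite lee_fin mulr_ge0.
rewrite -(@ler_pXn2r _ 2) ?nnegrE ?mulr_ge0 ?nrm_ge0 // exprMn !nrm_sqr.
by have := integral_cauchy_schwarz mf' mg' f2' g2'; rewrite /sqnorm !sq.
Qed.

Lemma product_dist_le f g f' g' (e : R) : isL2 m f -> isL2 m g -> isL2 m f' -> isL2 m g' ->
  (e <= 1)%R -> (nrm m (fun x => f x - f' x) <= e)%R -> (nrm m (fun x => g x - g' x) <= e)%R ->
  \int[m]_x `|f x * g x - f' x * g' x|%:E <= ((nrm m f + 1 + nrm m g) * e)%:E.
Proof.
move=> f2 g2 f'2 g'2 e1 fe ge.
have e0 : (0 <= e)%R by exact: le_trans (nrm_ge0 _ _) fe.
have F2 := isL2B f2 f'2; have G2 := isL2B g2 g'2.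
have mp u v : isL2 m u -> isL2 m v -> measurable_fun setT (fun x => `|u x * v x|%:E : \bar R).
  by move=> [mu' _] [mv _]; apply: measurable_abs_EFin; exact: measurable_funM.
apply: (@le_trans _ _ (\int[m]_x (`|(f x - f' x) * g x|%:E + `|f' x * (g x - g' x)|%:E))).
  apply: ge0_le_integral => //.
  - apply: measurable_abs_EFin; case: f2 g2 f'2 g'2 => [? _] [? _] [? _] [? _].
    by apply: measurable_funB; exact: measurable_funM.
  - by apply: emeasurable_funD; [apply: (mp _ _ F2 g2) | apply: (mp _ _ f'2 G2)].
  move=> x _; rewrite -EFinD lee_fin; apply: le_trans (ler_normD _ _).
  by rewrite le_eqVlt; apply/orP; left; apply/eqP; congr (`| _ |)%R; ring.
rewrite ge0_integralD //; [|exact: (mp _ _ F2 g2)|exact: (mp _ _ f'2 G2)].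
apply: le_trans (leeD (abs_product_le F2 g2) (abs_product_le f'2 G2)) _.
rewrite -EFinD lee_fin.
have f'n : (nrm m f' <= nrm m f + 1)%R.
  have := nrmB_dist f2 f'2; rewrite ler_norml => /andP[h _].
  have := le_trans fe e1; lra.
have := nrm_ge0 m g; have := nrm_ge0 m f'; have := nrm_ge0 m (fun x => g x - g' x)%R; nra.
Qed.

(** Approximation in L^1 suffices. For the truncation u = min(|X|, n) one has u^2 <= Y^2 + 2 n |X -
    Y|, so the integral of u^2 is at most M, and monotone convergence concludes. Fourth moments thus
    pass to the limit although the derivatives converge in L^2 only. *)
Lemma sqr_integral_lsc X (M : R) : measurable_fun setT X ->
  (forall e : R, (0 < e)%R -> exists Y, [/\ measurable_fun setT Y,
     \int[m]_x `|X x - Y x|%:E <= e%:E & \int[m]_x (Y x ^+ 2)%:E <= (M + e)%:E]) ->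
  \int[m]_x (X x ^+ 2)%:E <= M%:E.
Proof.
move=> mX app.
pose u n x := Num.min `|X x|%R (n%:R : R).
have mu' n : measurable_fun setT (u n).
  by apply: measurable_funrpos_min || apply: measurable_minr => //; apply: (measurableT_comp _ mX).
have u0 n x : (0 <= u n x)%R by rewrite le_min normr_ge0 ler0n.
have un n : \int[m]_x (u n x ^+ 2)%:E <= M%:E.
  apply/lee_addgt0Pr => e e0.
  pose d' := (e / (2 * n%:R + 1))%R.
  have n0 : (0 < 2 * n%:R + 1 :> R)%R by rewrite ltr_wpDl // mulr_ge0.
  have d0 : (0 < d')%R by rewrite divr_gt0.
  have [Y [mY XY Y2]] := app _ d0.
  apply: (@le_trans _ _ (\int[m]_x ((Y x ^+ 2)%:E + (2 * n%:R)%:E * `|X x - Y x|%:E))).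
    apply: ge0_le_integral => //.
    - by move=> x _; rewrite lee_fin sqr_ge0.
    - exact: measurable_sqr.
    - apply: emeasurable_funD; first exact: measurable_sqr.
      by apply: measurable_funeM; apply: measurable_abs_EFin; exact: measurable_funB.
    move=> x _; rewrite -EFinM -EFinD lee_fin.
    have := u0 n x; have : (u n x <= `|X x|)%R by rewrite ge_min lexx.
    have : (u n x <= n%:R)%R by rewrite ge_min lexx orbT.
    have : (`|X x| - `|Y x| <= `|X x - Y x|)%R by exact: lerB_dist.
    rewrite -(real_normK (num_real (Y x))); move: (u n x) (normr_ge0 (Y x)) (normr_ge0 (X x - Y x)%R).
    move: (`|Y x|%R) (`|X x - Y x|%R) (`|X x|%R) (n%:R : R) => y z a b c y0 z0 h1 h2 h3 h4.
    have [cy|yc] := lerP c y; first by nra.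
    by nra.
  rewrite ge0_integralD //; first last.
  - by apply: measurable_funeM; apply: measurable_abs_EFin; exact: measurable_funB.
  - exact: measurable_sqr.
  - by move=> x _; rewrite lee_fin sqr_ge0.
  rewrite ge0_integralZl_EFin ?mulr_ge0 //; last by apply: measurable_abs_EFin; exact: measurable_funB.
  apply: (@le_trans _ _ ((M + d')%:E + (2 * n%:R)%:E * d'%:E)).
    by apply: leeD => //; apply: lee_wpmul2l => //; rewrite lee_fin mulr_ge0.
  rewrite -EFinM -!EFinD lee_fin -addrA lerD2l.
  by rewrite (_ : _ + _ = e)%R // /d'; field; rewrite gt_eqF.
have nd x : nondecreasing_seq (fun n => (u n x ^+ 2)%:E).
  move=> a b ab; rewrite lee_fin ler_pXn2r ?nnegrE //.
  by rewrite le_min !ge_min lexx /= ler_nat ab orbT.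
have lim x : limn (fun n => (u n x ^+ 2)%:E) = (X x ^+ 2)%:E.
  apply: cvg_lim => //; apply: cvg_near_cst.
  exists (Num.truncn `|X x|%R).+1 => // n /= nx.
  rewrite -(real_normK (num_real (X x))) /u; congr (_ ^+ 2)%:E.
  apply/min_idPl; apply/ltW; apply: lt_le_trans (truncnS_gt _) _; by rewrite ler_nat.
rewrite (_ : \int[m]_x _ = \int[m]_x limn (fun n => (u n x ^+ 2)%:E)); last first.
  by apply: eq_integral => x _; rewrite lim.
rewrite monotone_convergence //; first last.
- by move=> n x _; rewrite lee_fin sqr_ge0.
- by move=> n; exact: measurable_sqr.
apply: lime_le; last by exists 0%N => // n _; exact: un.
apply: ereal_nondecreasing_is_cvgn => a b ab.
apply: ge0_le_integral => //; try exact: measurable_sqr.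
- by move=> x _; rewrite lee_fin sqr_ge0.
- by move=> x _; exact: nd.
Qed.

End SquareLimits.

(** * Splitting off the deterministic part of the derivative *)

Section OrderOne.
Context d (Z : measurableType d) (R : realType).
Variable mu : {sigma_finite_measure set Z -> \bar R}.
Context d' (Omega : measurableType d').
Variables (P : probability Omega R) (eta : R.-ker Omega ~> Z).
Hypothesis eta_poisson : poisson_measure P mu eta.
Hypothesis Zborel : borel_space Z R.
Hypothesis mu_na : non_atomic mu.
Variables (k : nat) (q : 'I_k -> nat).
Hypothesis q_gt0 : forall i, (0 < q i)%N.
Hypothesis q_incr : forall i j : 'I_k, (i < j)%N -> (q i < q j)%N.
Variable f : forall i : 'I_k, (q i).-tuple Z -> R.
Arguments f : clear implicits.
Hypothesis fL2 : forall i, L2_sym mu (f i).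

Let K := chaos_kernel f predT.

Lemma measurable_kernel1 : measurable_fun setT (fun z => K [:: z]).
Proof.
have h := @seq_measurable_cons _ _ _ _ K 0 (seq_measurable_kernel fL2 predT).
have mp : measurable_fun setT (fun z : Z => (z, [tuple] : 0.-tuple Z)) by exact: measurable_pair2 || exact: measurable_fun_pair.
exact: (measurableT_comp h mp).
Qed.

(** The derivative of an integral of order one is the deterministic function a 1 * K [:: z], an
    integral of order zero. It is split off because its fourth moment would bring in the L^4 norm of
    the kernel of order one. *)
Lemma derivative_first (a : nat -> R) U : derivative_of mu P eta f a U ->
  derivative_of mu P eta f (fun m => if m == 1%N then 0 else a m)%R
    (fun z w => U z w - a 1%N * K [:: z])%R.
Proof.
move=> [mU aeU]; split.
  apply: measurable_funB => //; apply: measurable_funM => //.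
  by apply: (measurableT_comp measurable_kernel1); exact: measurable_fst.
move: aeU; apply: filterS => z [U2 [J [WJ UJ]]].
have c2 : isL2 P (fun=> a 1%N * K [:: z])%R by exact: (isL2_cst mu P eta).
have J2 i : isL2 P (J i) by case: (WJ i).
split; first exact: isL2B; exists J; split => //.
have S2 : isL2 P (fun w => \sum_i (a (q i) * (q i)%:R) * J i w)%R.
  by apply: isL2_sum => i _; exact: isL2Z.
have D2 : isL2 P (fun w => U z w - \sum_i (a (q i) * (q i)%:R) * J i w)%R by exact: isL2B.
pose b m := (if m == 1%N then 0 else a m)%R.
pose V w := (\sum_(i | q i == 1%N) a 1%N * J i w - a 1%N * K [:: z])%R.
have VE w : (U z w - a 1%N * K [:: z] - \sum_i (b (q i) * (q i)%:R) * J i w =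
    (U z w - \sum_i (a (q i) * (q i)%:R) * J i w) + V w)%R.
  rewrite /V (bigID (fun i => q i == 1%N)) /= [in RHS](bigID (fun i => q i == 1%N)) /=.
  rewrite big1 => [|i /eqP qi]; last by rewrite /b qi eqxx !mul0r.
  rewrite (eq_bigr (fun i => (a (q i) * (q i)%:R) * J i w)%R) => [|i /negbTE qi]; last by rewrite /b qi.
  rewrite [in RHS](eq_bigr (fun i => a 1%N * J i w)%R) => [|i /eqP qi]; last by rewrite qi mulr1.
  ring.
have V2 : isL2 P V by apply: isL2B => //; apply: isL2_sum => i _; exact: isL2Z.
have V0 : nrm P V = 0%R.
  have [i /eqP qi|no] := pickP (fun i => q i == 1%N); last first.
    rewrite -[RHS](nrm0 P); congr nrm; apply/funext => w; rewrite /V big_pred0 //.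
    rewrite /K kernel0 ?mulr0 ?subr0 // => i _; by rewrite eq_sym no.
  have WJ0 : multiple_integral mu P eta (fun t : 0.-tuple Z => K (z :: t)) (J i).
    by have := WJ i; rewrite qi.
  have WD := multiple_integral_lin (- 1) (multiple_integral_cst mu P eta (K [:: z])) WJ0.
  have E := multiple_integral_norm eta_poisson Zborel mu_na WD.
  have D0 : nrm P (fun w => - 1 * K [:: z] + J i w)%R = 0%R.
    apply/eqP; rewrite -sqrf_eq0 E.
    rewrite (_ : (fun t : 0.-tuple Z => - 1 * K [:: z] + K (z :: t))%R = fun=> 0%R).
      by rewrite nrm0 expr0n mulr0.
    by apply/funext => t; rewrite [t]tuple0 /=; ring.
  rewrite (_ : V = fun w => a 1%N * (- 1 * K [:: z] + J i w))%R; last first.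
    apply/funext => w; rewrite /V (big_pred1 i) => [|j]; first by ring.
    by rewrite -qi (inj_eq (q_inj q_incr)).
  by rewrite nrmZ ?D0 ?mulr0 //; case: WD.
apply/eqP; rewrite eq_le nrm_ge0 andbT.
rewrite (_ : (fun w => _) = (fun w => (U z w - \sum_i (a (q i) * (q i)%:R) * J i w) + V w))%R; last first.
  by apply/funext => w; exact: VE.
by apply: le_trans (nrmD D2 V2) _; rewrite UJ V0 addr0.
Qed.

End OrderOne.

Lemma bounded_on_seqs (R : numDomainType) (C : finType) (n : nat) (f : seq C -> R) :
  (forall s, f s != 0 -> (size s <= n)%N)%R -> exists2 B : R, (0 <= B)%R & forall s, (`|f s| <= B)%R.
Proof.
move=> fs; exists (\sum_(m < n.+1) \sum_(t : m.-tuple C) `|f t|)%R.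
  by apply: sumr_ge0 => m _; apply: sumr_ge0.
move=> s; have [->|s0] := eqVneq (f s) 0%R.
  by rewrite normr0; apply: sumr_ge0 => m _; apply: sumr_ge0.
have sn : (size s < n.+1)%N by rewrite ltnS fs.
rewrite (bigD1 (Ordinal sn)) //= (bigD1 (in_tuple s)) //= -addrA lerDl.
by rewrite addr_ge0 // ?sumr_ge0 // => m _; apply: sumr_ge0.
Qed.

Lemma scale_error_small (R : realFieldType) n (K Tot delta : R) : (1 <= Tot)%R -> (0 < delta)%R ->
  exists2 e0 : R, (0 < e0)%R & forall e, (0 <= e)%R -> (e <= e0)%R -> (scale_error n K e Tot <= delta)%R.
Proof.
move=> T1 d0; have T0 : (0 <= Tot)%R by exact: le_trans ler01 T1.
pose c := ((K ^+ 2 * (n * (n + n + n + n))%:R * Tot ^+ n) ^+ 2 * Tot ^+ (n + n + n))%R.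
have c0 : (0 <= c)%R by rewrite mulr_ge0 ?sqr_ge0 // exprn_ge0.
exists (Num.min 1 (delta / (c + 1)))%R; first by rewrite lt_min ltr01 divr_gt0 // ltr_wpDl.
move=> e e0; rewrite le_min => /andP[e1]; rewrite ler_pdivlMr ?ltr_wpDl // => ec.
have -> : scale_error n K e Tot = (e ^+ 2 * c)%R by rewrite /scale_error /c; ring.
have ee : (e ^+ 2 * c <= e * c)%R by rewrite expr2 -mulrA ler_piMl // mulr_ge0.
apply: le_trans ee _; apply: le_trans ec; lra.
Qed.

(** * Energy bounds for averaged kernels *)

Section GridBounds.
Context d (Z : measurableType d) (R : realType).
Variable mu : {sigma_finite_measure set Z -> \bar R}.
Variables (k : nat) (q : 'I_k -> nat).
Hypothesis q_gt0 : forall i, (0 < q i)%N.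
Hypothesis q_incr : forall i j : 'I_k, (i < j)%N -> (q i < q j)%N.
Variable f : forall i : 'I_k, (q i).-tuple Z -> R.
Arguments f : clear implicits.
Hypothesis fL2 : forall i, L2_sym mu (f i).
Variable n : nat.
Hypothesis qn : forall i, (q i <= n)%N.
Variables (I : finType) (S : I -> set Z).
Hypothesis mS : forall i, measurable (S i) /\ mu (S i) < +oo.
Variable pr : pred 'I_k.

Let K := chaos_kernel f pr.

Let mK : seq_measurable K.
Proof. exact: seq_measurable_kernel fL2 _. Qed.

Let K2 j : \int[mpow mu j]_t (K t ^+ 2)%:E < +oo.
Proof. exact: kernel_sqr. Qed.

Let mcell (c : coarse S) : measurable (cell c).
Proof. by apply: measurable_cell => i; case: (mS i). Qed.

Let cellW (c : coarse S) : mu (cell c) = (cell_weight mu c)%:E.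
Proof. by apply: cell_weightE => i; case: (mS i). Qed.

Let dcell := @cell_disjoint _ Z I S.

Definition family_average (s : seq (coarse S)) : R :=
  average mu (cell (S := S)) (cell_weight mu (S := S)) K s.

Lemma family_average_perm s s' : perm_eq s s' -> family_average s = family_average s'.
Proof. by apply: average_perm => //; exact: kernel_sym. Qed.

Lemma family_average_size s : family_average s != 0%R -> (size s <= n)%N.
Proof.
apply: contraNT; rewrite -ltnNge => ns; rewrite /family_average /average.
under eq_integral => t _.
  rewrite /K kernel0 => [|i _]; last by rewrite size_tuple; apply: contraTneq ns => ->; rewrite -leqNgt.
  rewrite mulr0; over.
by rewrite integral0 mul0r.
Qed.

(** Dominates, for all orders up to n at once, the L^2 norm that multiplies the approximation error
    in [gram4_theta_le]. *)
Definition kernel_mass : R := (\sum_(j < n.+1) nrm (mpow mu j) (fun t => K t) ^+ 2)%R.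

Lemma kernel_mass_ge0 : (0 <= kernel_mass)%R.
Proof. by apply: sumr_ge0 => j _; exact: sqr_ge0. Qed.

Variable m : R.
Hypothesis m0 : (0 <= m)%R.
Hypothesis m1 : max1 mu f <= m%:E.
Hypothesis m2 : max2 mu f <= m%:E.

Variables (N : nat) (G : 'I_N -> set Z) (w : coarse S * 'I_N -> R) (e : R).
Hypothesis grid : is_grid mu G w e.

Let WE : (fun c => \sum_b w (c, b))%R = cell_weight mu (S := S).
Proof. by apply/funext => c; apply: (sum_atom_weight _ _ grid) => i; case: (mS i). Qed.

Lemma average_gram l g u : (0 < l)%N -> (0 < g + u)%N ->
  (gram4 (fun c => \sum_b w (c, b)) family_average l g u u <= m ^+ 2)%R.
Proof.
move=> l0 gu; rewrite WE -lee_fin.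
apply: le_trans (gram4_le_contraction mcell cellW dcell mK K2 l g u) _.
exact: (kernel_gram q_incr fL2 pr m0 m1 m2 l0 gu).
Qed.

Lemma average_fourth g : (forall i, pr i -> normf mu f 4 i ^+ 2 <= m%:E) ->
  (gram4 (fun c => \sum_b w (c, b)) family_average 0 g 0 0 <= m ^+ 2)%R.
Proof.
move=> m4; rewrite WE -lee_fin.
apply: le_trans (gram4_average_fourth mcell cellW dcell mK K2 g) _.
exact: (kernel_fourth q_incr m4 g).
Qed.

Lemma average_theta delta l v :
  (forall j, \int[mpow mu j]_t ((K t - step (fun s : j.-tuple (coarse S) => tbox (cell (S := S)) s)
        (fun s : j.-tuple (coarse S) => family_average s) t) ^+ 2)%:E <= delta%:E) ->
  (0 < l)%N -> (0 < v)%N -> (l + v <= n)%N ->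
  (gram4 (fun c => \sum_b w (c, b)) family_average l 0 0 v <= 2 * m ^+ 2 + 2 * (delta * kernel_mass))%R.
Proof.
move=> H l0 v0 lv; rewrite WE -lee_fin.
apply: le_trans (gram4_theta_le mcell cellW dcell mK K2 l v) _.
rewrite [leRHS]EFinD; apply: leeD.
  by rewrite [leRHS]EFinM; apply: lee_wpmul2l => //; exact: (kernel_theta q_incr fL2 pr m0 m1 m2 l0 v0).
rewrite [leRHS]EFinM; apply: lee_wpmul2l => //.
rewrite [leRHS]EFinM; apply: lee_pmul; [exact: integral_sqr_ge0 | exact: integral_sqr_ge0 | exact: H |].
have lvn : (l + v < n.+1)%N by [].
have KL : isL2 (mpow mu (l + v)) (fun t => K t) by split; [exact: mK | exact: K2].
rewrite (isL2_sqr KL) lee_fin /kernel_mass (bigD1 (Ordinal lvn)) //= lerDl.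
by apply: sumr_ge0 => j _; exact: sqr_ge0.
Qed.

Variables (e_ge0 : (0 <= e)%R) (B Tot : R).
Hypothesis B0 : (0 <= B)%R.
Hypothesis avgB : forall s, (`|family_average s| <= B)%R.
Hypothesis w_tot : (\sum_a w a <= Tot)%R.
Hypothesis Tot1 : (1 <= Tot)%R.
Variable kap : coarse S * 'I_N -> R.
Hypothesis kap2 : forall a, (`|kap a| <= 2)%R.

Lemma family_fourth (c : nat -> R) (k' : {set coarse S * 'I_N} -> R) :
  (forall i, pr i -> normf mu f 4 i ^+ 2 <= m%:E) -> (forall j, (`|c j| <= 1)%R) ->
  (forall A, k' A = c #|A| * ((#|A|)`!%:R * family_average (map fst (enum A))))%R ->
  (\sum_b w b * energy w (collect kap (set_contract w (dkern k' b) (dkern k' b)))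
   <= fourth_const R n * (m ^+ 2 + scale_error n B e Tot))%R.
Proof.
move=> m4 c1 kE; have m20 : (0 <= m ^+ 2)%R by exact: sqr_ge0.
apply: (derivative_fourth (fun a => atom_ge0 grid a) e_ge0 (fun a => atom_le grid a) w_tot Tot1 B0
  avgB family_average_perm family_average_size kap2 m20 _ _ (c := fun j => (c j * j`!%:R)%R)).
- by move=> l g u l0 gu _; exact: average_gram.
- by move=> g _; exact: average_fourth.
- move=> j jn; rewrite normrM (ger0_norm (ler0n _ _)); apply: (@le_trans _ _ (1 * j`!%:R)%R).
    by rewrite ler_wpM2r.
  by rewrite mul1r ler_nat leq_fact.
- by move=> A; rewrite kE mulrA.
Qed.

Lemma family_fluctuation delta (k1 k2 : {set coarse S * 'I_N} -> R) : (0 <= delta)%R ->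
  (forall j, \int[mpow mu j]_t ((K t - step (fun s : j.-tuple (coarse S) => tbox (cell (S := S)) s)
        (fun s : j.-tuple (coarse S) => family_average s) t) ^+ 2)%:E <= delta%:E) ->
  (forall A, k1 A = (#|A|)`!%:R * family_average (map fst (enum A)))%R ->
  (forall A, k2 A = (#|A|.-1)`!%:R * family_average (map fst (enum A)))%R ->
  (energy w (collect kap (derivative_product w k1 k2))
   <= fluctuation_const R n * (2 * m ^+ 2 + 2 * (delta * kernel_mass) + scale_error n B e Tot))%R.
Proof.
move=> d0 H k1E k2E; have m20 : (0 <= m ^+ 2)%R by exact: sqr_ge0.
have dm : (0 <= delta * kernel_mass)%R by rewrite mulr_ge0 // kernel_mass_ge0.
rewrite (_ : k1 = (fun A => (#|A|)`!%:R * lift_kernel family_average A)%R); last exact/funext.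
rewrite (_ : k2 = (fun A => (#|A|.-1)`!%:R * lift_kernel family_average A)%R); last exact/funext.
apply: (fluctuation_energy (fun a => atom_ge0 grid a) e_ge0 (fun a => atom_le grid a) w_tot Tot1 B0
  avgB family_average_perm family_average_size kap2).
- by rewrite addr_ge0 // mulr_ge0.
- move=> l g u l0 gu _; apply: le_trans (average_gram l0 gu) _; lra.
- by move=> l v l0 v0 lv; exact: average_theta.
Qed.

End GridBounds.

Section SectionIntegrals.
Context d (Z : measurableType d) (R : realType).
Variable mu : {sigma_finite_measure set Z -> \bar R}.
Context d' (Omega : measurableType d') (P : probability Omega R).

Definition section_integral (h : Z * Omega -> R) (om : Omega) : R := fine (\int[mu]_z (h (z, om))%:E).

Lemma section_integral_measurable h : (mu \x P).-integrable setT (EFin \o h) ->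
  measurable_fun setT (section_integral h).
Proof.
move=> ih; have mG := measurable_fubini_G ih.
exact: (measurableT_comp (fine_measurable measurableT) mG).
Qed.

Lemma section_integral_dist h h' : (mu \x P).-integrable setT (EFin \o h) ->
  (mu \x P).-integrable setT (EFin \o h') ->
  \int[P]_om `|section_integral h om - section_integral h' om|%:E
  <= \int[mu \x P]_y `|h y - h' y|%:E.
Proof.
move=> ih ih'; pose D y := (h y - h' y)%R.
have mh : measurable_fun setT h by apply/measurable_EFinP; exact: measurable_int ih.
have mh' : measurable_fun setT h' by apply/measurable_EFinP; exact: measurable_int ih'.
have mD : measurable_fun setT (fun y => `|D y|%:E : \bar R).
  by apply: measurable_abs_EFin; exact: measurable_funB.
have -> : \int[mu \x P]_y `|h y - h' y|%:E = \int[P]_om \int[mu]_z `|D (z, om)|%:E.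
  by rewrite (@fubini_tonelli2 _ _ _ _ _ mu P (fun y => `|D y|%:E)).
apply: integral_le_ge0_ae.
- apply: measurable_abs_EFin; apply: measurable_funB; exact: section_integral_measurable.
- exact: (@measurable_fun_fubini_tonelli_G _ _ _ _ _ mu (fun y => `|D y|%:E)).
- by move=> om; apply: integral_ge0.
have := ae_integrable2 ih'; move: (ae_integrable2 ih); apply: filterS2 => om i i'.
have E := integralB_EFin measurableT i i'.
have iD : mu.-integrable setT (fun z => (D (z, om))%:E).
  have := integrableB measurableT i i'; apply: eq_integrable => // z _; by rewrite -EFinB.
have -> : (section_integral h om - section_integral h' om)%R = fine (\int[mu]_z (D (z, om))%:E).
  rewrite /section_integral -fineB; [|exact: integrable_fin_num..].
  by congr fine; rewrite -E.
rewrite -[X in X <= _]/(`|(fine (\int[mu]_z (D (z, om))%:E))%:E|).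
rewrite fineK; last exact: integrable_fin_num.
exact: (le_abse_integral mu measurableT (measurable_int _ iD)).
Qed.

Variables (B : finType) (e : B -> set Z) (w : B -> R).
Hypothesis me : forall b, measurable (e b).
Hypothesis ew : forall b, mu (e b) = (w b)%:E.

Lemma section_integral_piecewise E om :
  section_integral (piecewise e E) om = (\sum_b w b * E b om)%R.
Proof.
have ib b : mu.-integrable setT (fun z => (\1_(e b) z)%:E).
  apply/integrableP; split; first by apply/measurable_EFinP; exact: measurable_indic.
  under eq_integral => z _ do rewrite gee0_abs ?lee_fin //.
  by rewrite (integral_indicT mu (me b)) ; apply: (le_lt_trans _ (ltry (w b))); rewrite le_eqVlt -ew eqxx.
have ibE b : mu.-integrable setT (fun z => (E b om * \1_(e b) z)%:E).
  exact: (integrableZl measurableT (E b om) (ib b)).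
rewrite /section_integral.
rewrite (_ : \int[mu]_z _ = (\sum_b w b * E b om)%R%:E) //.
transitivity (\int[mu]_z \sum_b (E b om * \1_(e b) z)%:E).
  apply: eq_integral => z _; rewrite sumEFin; congr EFin; apply: eq_bigr => b _; exact: mulrC.
rewrite (integral_sum measurableT ibE) -sumEFin; apply: eq_bigr => b _.
rewrite (integralZl measurableT (ib b)) (integral_indicT mu (me b)).
by rewrite mulrC EFinM; congr (_ * _); exact: ew.
Qed.

End SectionIntegrals.

Section MomentBounds.
Context d (Z : measurableType d) (R : realType).
Variable mu : {sigma_finite_measure set Z -> \bar R}.
Context d' (Omega : measurableType d').
Variables (P : probability Omega R) (eta : R.-ker Omega ~> Z).
Hypothesis eta_poisson : poisson_measure P mu eta.
Hypothesis Zborel : borel_space Z R.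
Hypothesis mu_na : non_atomic mu.
Variables (k : nat) (q : 'I_k -> nat).
Hypothesis q_gt0 : forall i, (0 < q i)%N.
Hypothesis q_incr : forall i j : 'I_k, (i < j)%N -> (q i < q j)%N.
Variable f : forall i : 'I_k, (q i).-tuple Z -> R.
Arguments f : clear implicits.
Hypothesis fL2 : forall i, L2_sym mu (f i).
Variable n : nat.
Hypothesis qn : forall i, (q i <= n)%N.
Variable X : 'I_k -> Omega -> R.
Hypothesis WX : forall i, multiple_integral mu P eta (f i) (X i).

Let K := chaos_kernel f predT.

Definition approx_derivative (I : finType) (S : I -> set Z) N (G : 'I_N -> set Z)
    (w : coarse S * 'I_N -> R) (a : nat -> R) : Z * Omega -> R :=
  piecewise (atom G) (fun b om => chaos (void_var eta (atom G) w om) (dkern (grid_kernel mu f a) b)).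

(** What a passage to the limit takes from a discretisation: closeness of the kernels, of the sum of
    the integrals and of the derivatives on one common grid, and a mesh making [scale_error] small.
    B and Tot depend on the cells only, so they are known before the mesh is chosen. *)
Record good_grid (L : finType) (a : L -> nat -> R) (U : L -> Z -> Omega -> R) (pr : pred 'I_k)
    (delta : R) (I : finType) (S : I -> set Z) N (G : 'I_N -> set Z)
    (w : coarse S * 'I_N -> R) (e B Tot : R) : Prop := GoodGrid {
  good_sets : forall i, measurable (S i) /\ mu (S i) < +oo;
  good_is_grid : is_grid mu G w e;
  good_ge0 : (0 <= e)%R;
  good_small : (2 * e <= 1)%R;
  good_step : forall m, \int[mpow mu m]_t ((K t - step (fun s : m.-tuple (coarse S) => tbox (cell (S := S)) s)
        (fun s : m.-tuple (coarse S) => cell_average mu f s) t) ^+ 2)%:E <= delta%:E;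
  good_bound_ge0 : (0 <= B)%R;
  good_bound : forall s, (`|family_average mu f (S := S) pr s| <= B)%R;
  good_total : (\sum_b w b <= Tot)%R;
  good_total1 : (1 <= Tot)%R;
  good_error : (scale_error n B e Tot <= delta)%R;
  good_sum : (nrm P (fun om => (\sum_i X i om)%R -
            chaos (void_var eta (atom G) w om) (grid_kernel mu f (fun=> 1))) <= delta)%R;
  good_derivative : forall l, isL2 (mu \x P) (approx_derivative G w (a l)) /\
     (nrm (mu \x P) (fun y => U l y.1 y.2 - approx_derivative G w (a l) y) <= delta)%R }.

Section Atoms.
Variables (I : finType) (S : I -> set Z).
Hypothesis mS : forall i, measurable (S i) /\ mu (S i) < +oo.
Variables (N : nat) (G : 'I_N -> set Z) (w : coarse S * 'I_N -> R) (e : R).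
Hypothesis grid : is_grid mu G w e.
Hypothesis e2 : (2 * e <= 1)%R.

Lemma grid_atom_measurable (b : coarse S * 'I_N) : measurable (atom G b).
Proof. by apply: (measurable_atom _ grid) => i; case: (mS i). Qed.

Lemma grid_atom_small b : (2 * w b <= 1)%R.
Proof. by apply: le_trans e2; rewrite ler_pM2l //; exact: (atom_le grid). Qed.

Lemma grid_chaos_measurable k' : measurable_fun setT (fun om => chaos (void_var eta (atom G) w om) k').
Proof. by apply: measurable_chaos_void; exact: grid_atom_measurable. Qed.

Lemma grid_chaos_energy k' : \int[P]_om (chaos (void_var eta (atom G) w om) k' ^+ 2)%:E = (energy w k')%:E.
Proof.
exact: (chaos_void_energy eta_poisson grid_atom_measurable (atom_mu grid) (atom_disjoint grid) grid_atom_small).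
Qed.

Lemma grid_chaos_isL2 k' : isL2 P (fun om => chaos (void_var eta (atom G) w om) k').
Proof. by split; [exact: grid_chaos_measurable | rewrite grid_chaos_energy ltry]. Qed.

Lemma approx_derivative_isL2 a : isL2 (mu \x P) (approx_derivative G w a).
Proof.
split.
  apply: (measurable_piecewise grid_atom_measurable) => b; exact: grid_chaos_measurable.
rewrite (integral_piecewise_sqr P grid_atom_measurable (atom_mu grid) (atom_disjoint grid)) => [|b]; last first.
  exact: grid_chaos_measurable.
by under eq_bigr => b _ do rewrite grid_chaos_energy -EFinM; rewrite sumEFin ltry.
Qed.

End Atoms.

(** [derivative_of] controls almost every section only; joint square integrability follows from one
    discrete process at finite distance. *)
Lemma derivative_isL2 a U : (forall m, (`|a m| <= 1)%R) -> derivative_of mu P eta f a U ->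
  isL2 (mu \x P) (fun y => U y.1 y.2).
Proof.
move=> a1 UD; have [mU _] := UD.
have [I [S [mS _ [eps eps0 H]]]] := discretization eta_poisson Zborel mu_na q_gt0 q_incr fL2 qn
  (L := unit) (fun=> a1) (fun=> UD) WX ltr01.
pose e := Num.min eps 2^-1%R.
have e0 : (0 < e)%R by rewrite lt_min eps0 invr_gt0 ltr0n.
have e2 : (2 * e <= 1)%R by rewrite mulrC -ler_pdivlMr // mul1r ge_min lexx orbT.
have [N [G [w grid]]] := grid_exists (fun i => (mS i).1) (fun i => (mS i).2) Zborel mu_na e0.
have ee : (e <= eps)%R by rewrite ge_min lexx.
have [_ /(_ tt) h] := H N G w e grid (ltW e0) e2 ee.
have A2 := approx_derivative_isL2 mS grid e2 a.
have D2 : isL2 (mu \x P) (fun y => U y.1 y.2 - approx_derivative G w a y)%R.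
  by apply: isL2_le h; apply: measurable_funB => //; case: A2.
rewrite (_ : (fun y => U y.1 y.2) = (fun y => U y.1 y.2 - approx_derivative G w a y) \+ approx_derivative G w a)%R.
  exact: isL2D.
by apply/funext => y /=; rewrite subrK.
Qed.

Lemma good_grid_exists (L : finType) (a : L -> nat -> R) (U : L -> Z -> Omega -> R) pr delta :
  (forall l m, (`|a l m| <= 1)%R) -> (forall l, derivative_of mu P eta f (a l) (U l)) ->
  (0 < delta)%R -> (delta <= 1)%R ->
  exists (I : finType) (S : I -> set Z) N (G : 'I_N -> set Z) (w : coarse S * 'I_N -> R) e B Tot,
    good_grid a U pr delta G w e B Tot.
Proof.
(* [discretization] bounds squared distances between derivatives, so it is applied with delta^2,
   which is at most delta. *)
move=> a1 UD d0 d1; have dd : (delta ^+ 2 <= delta)%R by rewrite expr2 ler_piMr // ltW.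
have [I [S [mS step_le [eps eps0 H]]]] := discretization eta_poisson Zborel mu_na q_gt0 q_incr fL2 qn
  a1 UD WX (exprn_gt0 2 d0).
have [B B0 BB] := bounded_on_seqs (@family_average_size _ _ _ mu _ _ f _ qn _ S pr).
pose Tot := (\sum_c cell_weight mu (S := S) c + 1)%R.
have Tot1 : (1 <= Tot)%R.
  rewrite lerDr; apply: sumr_ge0 => c _; rewrite -lee_fin -cell_weightE ?measure_ge0 // => i; by case: (mS i).
have [e1 e10 err] := @scale_error_small R n B Tot delta Tot1 d0.
pose e := Num.min (Num.min eps e1) 2^-1%R.
have e0 : (0 < e)%R by rewrite !lt_min eps0 e10 invr_gt0 ltr0n.
have e2 : (2 * e <= 1)%R by rewrite mulrC -ler_pdivlMr // mul1r ge_min lexx orbT.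
have ee : (e <= eps)%R by rewrite !ge_min lexx.
have ee1 : (e <= e1)%R by rewrite !ge_min lexx orbT.
have [N [G [w grid]]] := grid_exists (fun i => (mS i).1) (fun i => (mS i).2) Zborel mu_na e0.
have [sum_le der_le] := H N G w e grid (ltW e0) e2 ee.
exists I, S, N, G, w, e, B, Tot; split => //.
- exact: ltW.
- by move=> m; apply: le_trans (step_le m) _; rewrite lee_fin.
- by rewrite (sum_atom_weights mS grid) lerDl.
- by apply: err => //; exact: ltW.
- exact: le_trans sum_le dd.
- move=> l; split; first exact: (approx_derivative_isL2 mS grid e2).
  by apply: nrm_le; [exact: ltW | exact: der_le].
Qed.

Variable m : R.
Hypothesis m0 : (0 <= m)%R.
Hypothesis m1 : max1 mu f <= m%:E.
Hypothesis m2 : max2 mu f <= m%:E.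

Lemma fourth_const_ge0 : (0 <= fourth_const R n)%R.
Proof. by rewrite /fourth_const !mulr_ge0 ?sqr_ge0. Qed.

Lemma fluctuation_const_ge0 : (0 <= fluctuation_const R n)%R.
Proof. by rewrite /fluctuation_const !mulr_ge0 ?sqr_ge0. Qed.

Lemma family_average_first (I : finType) (S : I -> set Z) (s : seq (coarse S)) : size s != 1%N ->
  family_average mu f (fun i => q i != 1%N) s = family_average mu f predT s.
Proof.
move=> s1; rewrite /family_average /average; congr (fine _ / _)%R; apply: eq_integral => t _.
congr (_ * _)%:E; rewrite /chaos_kernel big_mkcond; apply: eq_bigr => i _.
case: eqVneq => // qi; rewrite /app_seq insubF // size_tuple qi; exact/negbTE.
Qed.

(** As c 1 = 0, the kernel of order one is dropped from the averaged family and its L^4 norm does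
    not enter. The squares of the discrete derivatives converge to U^2 in L^1, and
    [sqr_integral_lsc] transfers the bound. *)
Lemma derivative_fourth_moment (c : nat -> R) (U : Z -> Omega -> R) :
  (forall j, (`|c j| <= 1)%R) -> c 1%N = 0%R -> derivative_of mu P eta f c U ->
  (forall i, q i != 1%N -> normf mu f 4 i ^+ 2 <= m%:E) ->
  \int[mu \x P]_y ((U y.1 y.2 ^+ 2) ^+ 2)%:E <= (fourth_const R n * m ^+ 2)%:E.
Proof.
move=> c1 c10 UD m4; have U2 := derivative_isL2 c1 UD.
pose C := fourth_const R n; have C0 : (0 <= C)%R by exact: fourth_const_ge0.
have mU : measurable_fun setT (fun y : Z * Omega => U y.1 y.2) by case: U2.
apply: sqr_integral_lsc => [|e e0]; first exact: measurable_funX.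
set nU := nrm (mu \x P) (fun y => U y.1 y.2).
have nU0 : (0 <= nU)%R by exact: nrm_ge0.
pose c' := (2 * nU + 1 + C)%R; have c'0 : (0 < c')%R by rewrite /c'; lra.
pose delta := Num.min 1%R (e / c')%R.
have d0 : (0 < delta)%R by rewrite lt_min ltr01 divr_gt0.
have d1 : (delta <= 1)%R by rewrite ge_min lexx.
have de : (c' * delta <= e)%R by rewrite mulrC -ler_pdivlMr // ge_min lexx orbT.
have [I [S [N [G [w [ew [B [Tot gg]]]]]]]] := good_grid_exists (L := unit)
  (fun i => q i != 1%N) (fun=> c1) (fun=> UD) d0 d1.
have [A2 UA] := good_derivative gg tt.
have mS := good_sets gg; have grid := good_is_grid gg; have e2 := good_small gg.
have ma := grid_atom_measurable mS grid.
set A := approx_derivative G w c in A2 UA.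
exists (fun y => A y ^+ 2)%R; split.
- by apply: measurable_funX; case: A2.
- have := product_dist_le U2 U2 A2 A2 d1 UA UA; rewrite -/nU => h.
  under eq_integral => y _ do rewrite !expr2.
  apply: le_trans h _; rewrite lee_fin; apply: le_trans de.
  by rewrite ler_wpM2r ?(ltW d0) // /c'; lra.
pose E b om := (chaos (void_var eta (atom G) w om) (dkern (grid_kernel mu f c) b) ^+ 2)%R.
rewrite (_ : (fun y => _) = (fun y => (piecewise (atom G) E y ^+ 2)%:E)); last first.
  apply/funext => y; congr (_ ^+ 2)%:E; rewrite expr2 /A /approx_derivative.
  by rewrite (piecewiseM (atom_disjoint grid)).
rewrite (integral_piecewise_sqr P ma (atom_mu grid) (atom_disjoint grid)); last first.
  by move=> b; apply: measurable_funX; exact: (grid_chaos_measurable mS grid).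
under eq_bigr => b _.
  under eq_integral => om _ do rewrite /E (chaos_void_sqr eta (atom_mu grid)).
  rewrite (grid_chaos_energy mS grid e2) -EFinM; over.
rewrite sumEFin lee_fin.
have h := @family_fourth _ _ _ mu _ _ q_incr f fL2 n qn I S mS (fun i => q i != 1%N) m m0 m1 m2 N G w ew
  grid (good_ge0 gg) B Tot (good_bound_ge0 gg) (good_bound gg) (good_total gg) (good_total1 gg)
  (void_coef w) (void_coef_le (atom_mu grid) (grid_atom_small grid e2)) c (grid_kernel mu f c) m4 c1.
apply: le_trans (h _) _ => [B'|].
  rewrite /grid_kernel; have [B1|B1] := eqVneq #|B'| 1%N; first by rewrite B1 c10 !mul0r.
  by rewrite family_average_first // size_map -cardE.
rewrite mulrDr lerD2l; apply: le_trans de.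
apply: (@le_trans _ _ (C * delta)%R); first by rewrite ler_wpM2l // (good_error gg).
by rewrite ler_wpM2r ?(ltW d0) // /c'; lra.
Qed.

End MomentBounds.

(** * Variance of the pairing of the two derivatives *)

Section FluctuationBound.
Context d (Z : measurableType d) (R : realType).
Variable mu : {sigma_finite_measure set Z -> \bar R}.
Context d' (Omega : measurableType d').
Variables (P : probability Omega R) (eta : R.-ker Omega ~> Z).
Hypothesis eta_poisson : poisson_measure P mu eta.
Hypothesis Zborel : borel_space Z R.
Hypothesis mu_na : non_atomic mu.
Variables (k : nat) (q : 'I_k -> nat).
Hypothesis q_gt0 : forall i, (0 < q i)%N.
Hypothesis q_incr : forall i j : 'I_k, (i < j)%N -> (q i < q j)%N.
Variable f : forall i : 'I_k, (q i).-tuple Z -> R.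
Arguments f : clear implicits.
Hypothesis fL2 : forall i, L2_sym mu (f i).
Variable n : nat.
Hypothesis qn : forall i, (q i <= n)%N.
Variable X : 'I_k -> Omega -> R.
Hypothesis WX : forall i, multiple_integral mu P eta (f i) (X i).

Variable m : R.
Hypothesis m0 : (0 <= m)%R.
Hypothesis m1 : max1 mu f <= m%:E.
Hypothesis m2 : max2 mu f <= m%:E.

Lemma family_average_nil (I : finType) (S : I -> set Z) pr : family_average mu f (S := S) pr [::] = 0%R.
Proof.
rewrite /family_average /average.
under eq_integral => t _.
  rewrite kernel0 => [|i _]; last by rewrite size_tuple; rewrite eq_sym -lt0n q_gt0.
  rewrite mulr0; over.
by rewrite integral0 mul0r.
Qed.

Lemma inv_nat_le1 (j : nat) : (`|(j%:R : R)^-1| <= 1)%R.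
Proof.
case: j => [|j]; first by rewrite invr0 normr0.
by rewrite ger0_norm // invf_le1 // ler1n.
Qed.

(** The discrete pairing is a constant E0 plus a fluctuation W. E0 is the discrete variance, close
    to sigma^2 since the discrete sums are close to the centred F, and W is bounded by
    [family_fluctuation]. *)
Lemma derivative_fluctuation (sigma : R) (U V : Z -> Omega -> R) : (0 <= sigma)%R ->
  nrm P (fun om => \sum_i X i om)%R = sigma ->
  derivative_of mu P eta f (fun=> 1%R) U -> derivative_of mu P eta f (fun j => j%:R^-1)%R V ->
  \int[P]_om ((sigma ^+ 2 - section_integral mu (fun y => U y.1 y.2 * V y.1 y.2) om) ^+ 2)%:E
  <= (4 * fluctuation_const R n * m ^+ 2)%:E.
Proof.
move=> s0; have s21 : (0 <= 2 * sigma + 1)%R by lra.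
move=> Xs UD VD.
have one1 (j : nat) : (`|1 : R| <= 1)%R by rewrite normr1.
have U2 := derivative_isL2 eta_poisson Zborel mu_na q_gt0 q_incr fL2 qn WX one1 UD.
have V2 := derivative_isL2 eta_poisson Zborel mu_na q_gt0 q_incr fL2 qn WX inv_nat_le1 VD.
have X2 : isL2 P (fun om => \sum_i X i om)%R by apply: isL2_sum => i _; case: (WX i).
pose C := fluctuation_const R n; have C0 : (0 <= C)%R by exact: fluctuation_const_ge0.
pose Q := kernel_mass mu f n predT; have Q0 : (0 <= Q)%R by exact: kernel_mass_ge0.
set nU := nrm (mu \x P) (fun y => U y.1 y.2); set nV := nrm (mu \x P) (fun y => V y.1 y.2).
have nU0 : (0 <= nU)%R by exact: nrm_ge0.
have nV0 : (0 <= nV)%R by exact: nrm_ge0.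
have intp (u v : Z * Omega -> R) : isL2 (mu \x P) u -> isL2 (mu \x P) v ->
    (mu \x P).-integrable setT (EFin \o (fun y => u y * v y)%R).
  by move=> [mu' u2] [mv v2]; exact: sqr_mul_integrable.
have iUV := intp _ _ U2 V2.
apply: sqr_integral_lsc => [|e e0].
  apply: measurable_funB; first exact: measurable_cst.
  exact: (section_integral_measurable iUV).
pose c' := (nU + 1 + nV + (2 * (2 * sigma + 1) ^+ 2 + 2 * C * (2 * Q + 1)))%R.
have s2 : (0 <= 2 * (2 * sigma + 1) ^+ 2)%R by rewrite mulr_ge0 ?sqr_ge0.
have CQ : (0 <= 2 * C * (2 * Q + 1))%R by rewrite !mulr_ge0 // addr_ge0 // mulr_ge0.
have c'0 : (0 < c')%R by rewrite /c' ltr_wpDr ?addr_ge0 // ltr_wpDr // ltr_wpDl.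
pose delta := Num.min 1%R (e / c')%R.
have d0 : (0 < delta)%R by rewrite lt_min ltr01 divr_gt0.
have d1 : (delta <= 1)%R by rewrite ge_min lexx.
have de : (c' * delta <= e)%R by rewrite mulrC -ler_pdivlMr // ge_min lexx orbT.
pose a (l : bool) : nat -> R := if l then fun=> 1%R else (fun j => j%:R^-1)%R.
have [I [S [N [G [w [ew [B [Tot gg]]]]]]]] := good_grid_exists eta_poisson Zborel mu_na q_gt0 q_incr fL2 qn WX
  (a := a) (U := fun l : bool => if l then U else V) predT
  (fun l => if l return forall j, (`|a l j| <= 1)%R then one1 else inv_nat_le1)
  (fun l => if l return derivative_of mu P eta f (a l) (if l then U else V) then UD else VD) d0 d1.
have [A2 UA] := good_derivative gg true; have [B2' VB] := good_derivative gg false.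
have mS := good_sets gg; have grid := good_is_grid gg; have e2 := good_small gg.
have ma := grid_atom_measurable mS grid.
rewrite /a in A2 UA B2' VB.
set A := approx_derivative _ _ _ _ _ (fun=> 1%R) in A2 UA.
set B' := approx_derivative _ _ _ _ _ (fun j => j%:R^-1)%R in B2' VB.
pose kA : {set coarse S * 'I_N} -> R := grid_kernel mu f (fun=> 1%R).
pose kB : {set coarse S * 'I_N} -> R := grid_kernel mu f (fun j => j%:R^-1)%R.
pose x om := void_var eta (atom G) w om.
pose W om := chaos (x om) (collect (void_coef w) (derivative_product w kA kB)).
have avg0 : cell_average mu f (S := S) [::] = 0%R by exact: (family_average_nil S predT).
(* Dividing by the order undoes the multiplicity in the constant term of the pairing, which thus is
   the energy of kA. On the empty set both sides vanish, all orders being positive. *)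
have kAB D : (kB D *+ #|D| = kA D)%R.
  rewrite /kA /kB /grid_kernel mul1r -[LHS]mulr_natl mulrA.
  have [D0|D0] := eqVneq #|D| 0%N; last by rewrite divff ?mul1r // pnatr_eq0.
  have -> : enum D = [::] by apply/eqP; rewrite -size_eq0 -cardE D0.
  by rewrite /= avg0 !mulr0.
pose E0 := energy w kA.
have ZE om : section_integral mu (fun y => A y * B' y)%R om = (E0 + W om)%R.
  rewrite (_ : (fun y => A y * B' y)%R = piecewise (atom G)
    (fun b om => chaos (x om) (dkern kA b) * chaos (x om) (dkern kB b))%R); last first.
    by apply/funext => y; rewrite /A /B' /approx_derivative (piecewiseM (atom_disjoint grid)).
  rewrite (section_integral_piecewise ma (atom_mu grid)).
  rewrite (sum_derivative_product (void_var_sqr eta (atom_mu grid) om)); congr (_ + _)%R.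
  by rewrite /E0 /energy; apply: eq_bigr => D _; rewrite -mulrnAr (kAB D) expr2 -mulrA.
exists (fun om => sigma ^+ 2 - section_integral mu (fun y => A y * B' y) om)%R; split.
- apply: measurable_funB; first exact: measurable_cst.
  by apply: (section_integral_measurable (P := P)); exact: intp.
- have h := product_dist_le U2 V2 A2 B2' d1 UA VB; rewrite -/nU -/nV in h.
  apply: (@le_trans _ _ (((nU + 1 + nV) * delta)%:E)); last first.
    by rewrite lee_fin; apply: le_trans de; rewrite ler_wpM2r ?(ltW d0) // /c' lerDl addr_ge0.
  apply: le_trans h; apply: le_trans (section_integral_dist iUV (intp _ _ A2 B2')).
  rewrite le_eqVlt; apply/orP; left; apply/eqP; apply: eq_integral => om _.
  by congr EFin; rewrite -normrN; congr (`| _ |)%R; ring.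
have W2 : \int[P]_om (W om ^+ 2)%:E <= (C * (2 * m ^+ 2 + 2 * (delta * Q) + delta))%:E.
  rewrite (grid_chaos_energy eta_poisson mS grid e2) lee_fin.
  have h := @family_fluctuation _ _ _ mu _ _ q_incr f fL2 n qn I S mS predT m m0 m1 m2 N G w ew grid
    (good_ge0 gg) B Tot (good_bound_ge0 gg) (good_bound gg) (good_total gg) (good_total1 gg)
    (void_coef w) (void_coef_le (atom_mu grid) (grid_atom_small grid e2)) delta kA kB (ltW d0) (good_step gg).
  apply: le_trans (h _ _) _ => [D|D|].
  - by rewrite /kA /grid_kernel mul1r.
  - rewrite /kB /grid_kernel; have [D0|D0] := posnP #|D|.
      have -> : enum D = [::] by apply/eqP; rewrite -size_eq0 -cardE D0.
      by rewrite /= avg0 (family_average_nil S predT) !mulr0.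
    rewrite mulrA; congr (_ * _)%R; rewrite -{2}(prednK D0) factS prednK // natrM mulKf //.
    by rewrite pnatr_eq0 -lt0n.
  by rewrite ler_wpM2l // lerD2l; exact: (good_error gg).
have E0near : (`|sigma ^+ 2 - E0| <= (2 * sigma + 1) * delta)%R.
  have k2 := grid_chaos_isL2 eta_poisson mS grid e2 kA.
  have <- : (nrm P (fun om => chaos (void_var eta (atom G) w om) kA) ^+ 2 = E0)%R.
    by apply: EFin_inj; rewrite -isL2_sqr // (grid_chaos_energy eta_poisson mS grid e2).
  apply: sqr_dist_le => //; first exact: nrm_ge0.
  rewrite -Xs; apply: le_trans (nrmB_dist X2 k2) _; exact: (good_sum gg).
have mW : measurable_fun setT (fun om => - 1 * W om)%R.
  by apply: measurable_funM => //; exact: (grid_chaos_measurable eta mS grid).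
rewrite (_ : \int[P]_om _ = \int[P]_om ((((fun=> sigma ^+ 2 - E0) om : R) + (- 1 * W om))%R ^+ 2)%:E); last first.
  by apply: eq_integral => om _; rewrite ZE; congr (_ ^+ 2)%:E; ring.
apply: le_trans (integral_sqr_add_le P (@measurable_cst _ _ _ _ setT (sigma ^+ 2 - E0)%R) mW) _.
have -> : \int[P]_om (cst (sigma ^+ 2 - E0)%R om ^+ 2)%:E = ((sigma ^+ 2 - E0) ^+ 2)%R%:E.
  transitivity (\int[P]_om cst ((sigma ^+ 2 - E0) ^+ 2)%R%:E om) => //.
  rewrite integral_cst // -[RHS]mule1; congr (_ * _); exact: probability_setT.
rewrite integral_sqr_scale; last exact: (grid_chaos_measurable eta mS grid).
rewrite sqrrN expr1n mul1e.
apply: (@le_trans _ _ (2%:E * (((2 * sigma + 1) * delta) ^+ 2)%:E +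
   2%:E * (C * (2 * m ^+ 2 + 2 * (delta * Q) + delta))%:E)).
  apply: leeD; apply: lee_wpmul2l => //; rewrite lee_fin.
  rewrite -[leLHS]real_normK ?num_real // ler_pXn2r ?nnegrE //.
  by rewrite mulr_ge0 ?(ltW d0).
rewrite -!EFinM -EFinD lee_fin.
have dd : (delta ^+ 2 <= delta)%R by rewrite expr2 ler_piMr // ltW.
have h1 : (((2 * sigma + 1) * delta) ^+ 2 <= (2 * sigma + 1) ^+ 2 * delta)%R.
  by rewrite exprMn ler_wpM2l ?sqr_ge0.
(* The 4 is the product of the 2 from the square of a sum and the 2 in front of m^2 in
   [family_fluctuation]; everything else is a multiple of delta. *)
apply: (@le_trans _ _ (4 * C * m ^+ 2 + (2 * (2 * sigma + 1) ^+ 2 + 2 * C * (2 * Q + 1)) * delta))%R.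
  move: h1; set t := ((_ * _) ^+ 2)%R; set t' := ((2 * sigma + 1) ^+ 2)%R => h1.
  rewrite (_ : 4 * C * m ^+ 2 + _ = 2 * (t' * delta) + 2 * (C * (2 * m ^+ 2 + 2 * (delta * Q) + delta)))%R; last by ring.
  by rewrite lerD2r ler_pM2l.
rewrite -mulrA mulrA lerD2l; apply: le_trans de; rewrite ler_wpM2r ?(ltW d0) // /c' lerDr !addr_ge0 //.
Qed.

End FluctuationBound.

Lemma sqr_mul_le_cubes (R : realFieldType) (a b : R) : (0 <= a -> 0 <= b -> a ^+ 2 * b <= a ^+ 3 + b ^+ 3)%R.
Proof.
move=> a0 b0; have a30 : (0 <= a ^+ 3)%R by exact: exprn_ge0.
have b30 : (0 <= b ^+ 3)%R by exact: exprn_ge0.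
have [ab|/ltW ba] := lerP a b.
  apply: (@le_trans _ _ (b ^+ 3)%R); last by rewrite lerDr.
  by rewrite [leRHS]exprSr ler_wpM2r // ler_pXn2r.
by apply: (@le_trans _ _ (a ^+ 3)%R); rewrite ?lerDl // [leRHS]exprSr ler_wpM2l // exprn_ge0.
Qed.

Lemma cube_add_le (R : realFieldType) (a b : R) : (0 <= a -> 0 <= b ->
  (a + b) ^+ 3 <= 4 * a ^+ 3 + 4 * b ^+ 3)%R.
Proof.
move=> a0 b0; rewrite -subr_ge0 (_ : _ - _ = 3 * (a + b) * (a - b) ^+ 2)%R; last by ring.
by rewrite mulr_ge0 ?sqr_ge0 // mulr_ge0 // addr_ge0.
Qed.

(** Interpolation of the third moment between the second and the fourth: the difference of the two
    sides is a multiple of |g|^2 (theta |g| - 1)^2. *)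
Lemma cube_le_young (R : realFieldType) (theta g : R) : (0 < theta)%R ->
  (`|g| ^+ 3 <= theta / 2 * (g ^+ 2) ^+ 2 + (2 * theta)^-1 * g ^+ 2)%R.
Proof.
move=> t0; rewrite -(real_normK (num_real g)) -subr_ge0.
rewrite (_ : _ - _ = (2 * theta)^-1 * (`|g| * (theta * `|g| - 1)) ^+ 2)%R; last by field; rewrite gt_eqF.
by rewrite mulr_ge0 ?sqr_ge0 // invr_ge0 mulr_ge0 // ltW.
Qed.

(** Here h is the deterministic part common to both derivatives. From x^2 y <= x^3 + y^3 and the
    convexity of the cube, h is counted twice, whence 8 = 4 + 4. *)
Lemma product_cubes_le (R : realFieldType) (h g g' : R) :
  ((h + g) ^+ 2 * `|h + g'| <= 8 * `|h| ^+ 3 + 4 * `|g| ^+ 3 + 4 * `|g'| ^+ 3)%R.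
Proof.
have t (x y : R) : (`|x + y| ^+ 3 <= 4 * `|x| ^+ 3 + 4 * `|y| ^+ 3)%R.
  apply: le_trans (cube_add_le (normr_ge0 x) (normr_ge0 y)).
  by rewrite ler_pXn2r ?nnegrE ?addr_ge0 // ler_normD.
have := sqr_mul_le_cubes (normr_ge0 (h + g)%R) (normr_ge0 (h + g')%R).
rewrite real_normK ?num_real // => /le_trans; apply.
apply: le_trans (lerD (t h g) (t h g')) _; lra.
Qed.

(** * Third moments and the cubic term *)

Section ThirdMoment.
Context d (Z : measurableType d) (R : realType).
Variable mu : {sigma_finite_measure set Z -> \bar R}.
Context d' (Omega : measurableType d').
Variables (P : probability Omega R) (eta : R.-ker Omega ~> Z).
Hypothesis eta_poisson : poisson_measure P mu eta.
Hypothesis Zborel : borel_space Z R.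
Hypothesis mu_na : non_atomic mu.
Variables (k : nat) (q : 'I_k -> nat).
Hypothesis q_gt0 : forall i, (0 < q i)%N.
Hypothesis q_incr : forall i j : 'I_k, (i < j)%N -> (q i < q j)%N.
Variable f : forall i : 'I_k, (q i).-tuple Z -> R.
Arguments f : clear implicits.
Hypothesis fL2 : forall i, L2_sym mu (f i).
Variable n : nat.
Hypothesis qn : forall i, (q i <= n)%N.
Variable X : 'I_k -> Omega -> R.
Hypothesis WX : forall i, multiple_integral mu P eta (f i) (X i).

Lemma derivative_ofN (a : nat -> R) U : derivative_of mu P eta f a U ->
  derivative_of mu P eta f (fun j => - a j)%R (fun z w => - U z w)%R.
Proof.
move=> [mU aeU]; split; first exact: measurableT_comp.
move: aeU; apply: filterS => z [U2 [J [WJ UJ]]]; split.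
  rewrite (_ : (fun w => - U z w)%R = (fun w => - 1 * U z w)%R); first exact: isL2Z.
  by apply/funext => w; rewrite mulN1r.
exists J; split => //; rewrite -[RHS]UJ -nrmN; congr nrm; apply/funext => w.
by rewrite opprD opprK; congr (_ - _)%R; rewrite -sumrN; apply: eq_bigr => i _; rewrite !mulNr opprK.
Qed.

(** [derivative_dist] is used with an empty family of sets and empty data: the comparison process is
    0, and the bound is the sum of q_i * q_i! times the squared norms of the f_i, at most n times
    the second moment by the isometry. *)
Lemma derivative_mass (a : nat -> R) U : (forall j, (`|a j| <= 1)%R) -> derivative_of mu P eta f a U ->
  \int[mu \x P]_y (U y.1 y.2 ^+ 2)%:E <= (n%:R * nrm P (fun om => \sum_i X i om)%R ^+ 2)%:E.
Proof.
move=> a1 UD; have [mU _] := UD; pose S (i : 'I_0) : set Z := set0.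
pose D (i : 'I_k) : seq (R * seq 'I_0) := [::].
have S0 (i : 'I_0) : measurable (S i) /\ mu (S i) < +oo by case: i.
have D0 : all_data D = [::] by rewrite /all_data; elim: (enum 'I_k).
have dD i : disjoint_data S (D i) by [].
have sD i p : p \in D i -> size p.2 = q i by [].
have zD i (t : seq Z) : data_fun S (D i) t = 0%R by rewrite /data_fun big_nil.
have symD i (s : 'S_(q i)) (t : (q i).-tuple Z) :
  data_fun S (D i) (permute s t) = data_fun S (D i) t by rewrite !zD.
have h := derivative_dist eta_poisson Zborel mu_na q_gt0 q_incr fL2 S0 dD sD symD a1 UD.
have sec z om : section_data mu eta S D a z om = 0%R.
  by apply: section_data_out => c; have /andP[/set0Pn[[]]] := valP c.
rewrite (@ge0_integral_prod _ _ _ _ _ mu P (fun z om => (U z om ^+ 2)%:E)); first last.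
- by move=> z om; rewrite lee_fin sqr_ge0.
- exact: measurable_sqr.
under eq_integral => z _ do under eq_integral => om _ do rewrite -[U z om]subr0 -(sec z om).
apply: le_trans h _.
rewrite (multiple_integral_isometry eta_poisson Zborel mu_na (q_inj q_incr) WX) mulr_sumr -sumEFin.
apply: lee_sum => i _; under eq_integral => t _ do rewrite zD subr0 kernel_tuple //.
have [f2 _ _] := WX i; rewrite (isL2_sqr f2) -EFinM lee_fin -mulrA ler_wpM2r ?ler_nat //.
by rewrite mulr_ge0 ?sqr_ge0.
Qed.

Variable m : R.
Hypothesis m_gt0 : (0 < m)%R.
Hypothesis m1 : max1 mu f <= m%:E.
Hypothesis m2 : max2 mu f <= m%:E.
Hypothesis m4 : forall i, q i != 1%N -> normf mu f 4 i ^+ 2 <= m%:E.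

Lemma derivative_third_moment (sigma : R) (c : nat -> R) U : (0 < sigma)%R ->
  nrm P (fun om => \sum_i X i om)%R = sigma ->
  (forall j, (`|c j| <= 1)%R) -> c 1%N = 0%R -> derivative_of mu P eta f c U ->
  \int[mu \x P]_y (`|U y.1 y.2| ^+ 3)%:E <= (sigma * m * (fourth_const R n + n%:R) / 2)%:E.
Proof.
(* The ratio sigma / m balances the terms: the fourth moment is of order m^2 and the second of order
   sigma^2, so both become multiples of sigma * m. *)
move=> s0 Xs c1 c10 UD; have [mU _] := UD; pose th := (sigma / m)%R.
have th0 : (0 < th)%R by rewrite divr_gt0.
have mU2 : measurable_fun setT (fun y : Z * Omega => U y.1 y.2 ^+ 2)%R by exact: measurable_funX.
have a0 : (0 <= th / 2)%R by rewrite divr_ge0 // ltW.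
have b0 : (0 <= (2 * th)^-1)%R by rewrite invr_ge0 mulr_ge0 // ltW.
apply: (@le_trans _ _ (\int[mu \x P]_y ((th / 2)%:E * ((U y.1 y.2 ^+ 2) ^+ 2)%:E +
    ((2 * th)^-1)%:E * (U y.1 y.2 ^+ 2)%:E))).
  apply: ge0_le_integral => //.
  - by apply/measurable_EFinP; apply: measurable_funX; exact: (measurableT_comp _ mU).
  - apply: emeasurable_funD; apply: measurable_funeM; first exact: measurable_sqr.
    exact/measurable_EFinP.
  by move=> y _; rewrite -!EFinM -EFinD lee_fin; exact: cube_le_young.
rewrite ge0_integralD //; first last.
- by apply: measurable_funeM; exact/measurable_EFinP.
- by move=> y _; rewrite -EFinM lee_fin mulr_ge0 ?sqr_ge0.
- by apply: measurable_funeM; exact: measurable_sqr.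
- by move=> y _; rewrite -EFinM lee_fin mulr_ge0 ?sqr_ge0.
rewrite (ge0_integralZl_EFin _ measurableT) //; try exact: measurable_sqr; try by move=> y _; rewrite lee_fin sqr_ge0.
rewrite (ge0_integralZl_EFin _ measurableT) //; try exact/measurable_EFinP; try by move=> y _; rewrite lee_fin sqr_ge0.
have h4 := derivative_fourth_moment eta_poisson Zborel mu_na q_gt0 q_incr fL2 qn WX (ltW m_gt0) m1 m2 c1 c10 UD m4.
have h2 := derivative_mass c1 UD; rewrite Xs in h2.
apply: le_trans (leeD (lee_wpmul2l _ h4) (lee_wpmul2l _ h2)) _; rewrite ?lee_fin //.
rewrite le_eqVlt; apply/orP; left; apply/eqP.
by rewrite /th; field; rewrite !gt_eqF.
Qed.

(** Both derivatives have the same part of order one because 1^-1 = 1; it contributes the integral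
    of |f_1|^3, and the remainders fall under [derivative_third_moment]. *)
Lemma derivative_product_third (sigma : R) U V : (0 < sigma)%R ->
  nrm P (fun om => \sum_i X i om)%R = sigma ->
  \int[mu]_z (`|chaos_kernel f predT [:: z]| ^+ 3)%:E <= (m * sigma)%:E ->
  derivative_of mu P eta f (fun=> 1%R) U -> derivative_of mu P eta f (fun j => j%:R^-1)%R V ->
  \int[mu \x P]_y (U y.1 y.2 ^+ 2 * `|V y.1 y.2|)%:E
  <= (sigma * m * (8 + 4 * (fourth_const R n + n%:R)))%:E.
Proof.
move=> s0 Xs h3 UD VD; have [mU _] := UD; have [mV _] := VD.
pose h (y : Z * Omega) := chaos_kernel f predT [:: y.1].
have UD' := derivative_first eta_poisson Zborel mu_na q_incr fL2 UD.
have VD' := derivative_first eta_poisson Zborel mu_na q_incr fL2 VD.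
pose c (a : nat -> R) j := (if j == 1%N then 0 else a j)%R.
have c1 a : (forall j, `|a j| <= 1)%R -> forall j, (`|c a j| <= 1)%R.
  by move=> a1 j; rewrite /c; case: eqP => _ //; rewrite normr0.
have one1 (j : nat) : (`|1 : R| <= 1)%R by rewrite normr1.
have hU := derivative_third_moment s0 Xs (c1 _ one1) (erefl _ : c _ 1%N = 0%R) UD'.
have hV := derivative_third_moment s0 Xs (c1 _ (@inv_nat_le1 R)) (erefl _ : c _ 1%N = 0%R) VD'.
have [mU' _] := UD'; have [mV' _] := VD'.
have mh : measurable_fun setT h.
  by apply: (measurableT_comp (measurable_kernel1 fL2)); exact: measurable_fst.
have mc (u : Z * Omega -> R) : measurable_fun setT u -> measurable_fun setT (fun y => (`|u y| ^+ 3)%:E : \bar R).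
  by move=> mu'; apply/measurable_EFinP; apply: measurable_funX; exact: (measurableT_comp _ mu').
pose g (y : Z * Omega) := (U y.1 y.2 - 1 * h y)%R.
pose g' (y : Z * Omega) := (V y.1 y.2 - 1%:R^-1 * h y)%R.
have p0 (r : R) (u : Z * Omega -> R) y : (0 <= r)%R -> 0 <= r%:E * (`|u y| ^+ 3)%:E.
  by move=> r0; rewrite -EFinM lee_fin mulr_ge0 // exprn_ge0.
apply: (@le_trans _ _ (\int[mu \x P]_y (8%:E * (`|h y| ^+ 3)%:E + (4%:E * (`|g y| ^+ 3)%:E + 4%:E * (`|g' y| ^+ 3)%:E)))).
  apply: ge0_le_integral => //.
  - by move=> y _; rewrite lee_fin mulr_ge0 ?sqr_ge0.
  - apply/measurable_EFinP; apply: measurable_funM; first exact: measurable_funX.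
    exact: (measurableT_comp _ mV).
  - apply: emeasurable_funD; first by apply: measurable_funeM; exact: mc.
    by apply: emeasurable_funD; apply: measurable_funeM; exact: mc.
  move=> y _; rewrite -!EFinM -!EFinD lee_fin addrA.
  have := product_cubes_le (h y) (g y) (g' y); rewrite /g /g' invr1 !mul1r.
  by rewrite !(addrC (h y)) !subrK.
rewrite ge0_integralD //; try (by apply: measurable_funeM; exact: mc);
  try (by move=> y _; rewrite adde_ge0 ?p0);
  try by apply: emeasurable_funD; apply: measurable_funeM; exact: mc.
rewrite ge0_integralD //; try by apply: measurable_funeM; exact: mc.
have e3 (u : Z * Omega -> R) y : setT y -> 0 <= (`|u y| ^+ 3)%:E by move=> _; rewrite lee_fin exprn_ge0.
rewrite (ge0_integralZl_EFin _ measurableT (e3 h) (mc _ mh)) //.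
rewrite (ge0_integralZl_EFin _ measurableT (e3 g) (mc _ mU')) //.
rewrite (ge0_integralZl_EFin _ measurableT (e3 g') (mc _ mV')) //.
have hh : \int[mu \x P]_y (`|h y| ^+ 3)%:E <= (m * sigma)%:E.
  rewrite (@ge0_integral_prod _ _ _ _ _ mu P (fun z om => (`|chaos_kernel f predT [:: z]| ^+ 3)%:E)); first last.
  - by move=> z om; rewrite lee_fin exprn_ge0.
  - exact: (mc _ mh).
  apply: le_trans h3; rewrite le_eqVlt; apply/orP; left; apply/eqP; apply: eq_integral => z _.
  rewrite integral_cst // -[RHS]mule1; congr (_ * _); exact: probability_setT.
apply: le_trans (leeD (lee_wpmul2l _ hh) (leeD (lee_wpmul2l _ hU) (lee_wpmul2l _ hV))) _; rewrite ?lee_fin //.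
by rewrite le_eqVlt; apply/orP; left; apply/eqP; field.
Qed.

End ThirdMoment.

Lemma bigmaxe_ge0 (R : realType) (I : Type) (r : seq I) (Q : pred I) (F : I -> \bar R) :
  0 <= \big[maxe/0]_(i <- r | Q i) F i.
Proof. by elim/big_rec: _ => // i x _ x0; rewrite le_max x0 orbT. Qed.

Lemma eq_sqre (R : realType) (x : \bar R) (r : R) : 0 <= x -> (0 <= r)%R ->
  x ^+ 2 = (r ^+ 2)%:E -> x = r%:E.
Proof.
move=> x0 r0 E; have := sqrte_sqr x; rewrite E EFin_expe sqrte_sqr gee0_abs ?lee_fin //.
by rewrite gee0_abs.
Qed.

(** * Assembling the two terms of the bound *)

Section SteinBound.
Context d (Z : measurableType d) (R : realType).
Variable mu : {sigma_finite_measure set Z -> \bar R}.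
Context d' (Omega : measurableType d').
Variables (P : probability Omega R) (eta : R.-ker Omega ~> Z).
Hypothesis eta_poisson : poisson_measure P mu eta.
Hypothesis Zborel : borel_space Z R.
Hypothesis mu_na : non_atomic mu.
Variables (k : nat) (q : 'I_k -> nat).
Hypothesis q_gt0 : forall i, (0 < q i)%N.
Hypothesis q_incr : forall i j : 'I_k, (i < j)%N -> (q i < q j)%N.
Variable f : forall i : 'I_k, (q i).-tuple Z -> R.
Arguments f : clear implicits.
Hypothesis fL2 : forall i, L2_sym mu (f i).
Variable n : nat.
Hypothesis qn : forall i, (q i <= n)%N.
Variable X : 'I_k -> Omega -> R.
Hypothesis WX : forall i, multiple_integral mu P eta (f i) (X i).

Let qinj : injective q := q_inj q_incr.

Lemma normf2_nrm i : normf mu f 2 i = (nrm (mpow mu (q i)) (f i))%:E.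
Proof.
have [f2 _ _] := WX i; apply: eq_sqre; rewrite ?Lnorm_ge0 ?nrm_ge0 //.
by rewrite -(isL2_sqr f2) /normf Lnorm2_sqr.
Qed.

Lemma normf3_cube i : normf mu f 3 i ^+ 3 = \int[mpow mu (q i)]_t (`|f i t| ^+ 3)%:E.
Proof.
by rewrite /normf (Lnorm_nat _ 2); apply: eq_integral => t _; rewrite -EFin_expe.
Qed.

Lemma normf4_sqr i : (normf mu f 4 i ^+ 2) ^+ 2 = \int[mpow mu (q i)]_t ((f i t ^+ 2) ^+ 2)%:E.
Proof.
transitivity (normf mu f 4 i ^+ 4); first by rewrite !expeS !expe0 !mule1 !muleA.
rewrite /normf (Lnorm_nat _ 3); apply: eq_integral => t _.
by rewrite -[LHS]EFin_expe -(real_normK (num_real (f i t))) -exprM.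
Qed.

Lemma nrm_gt0 i : ~ {ae mpow mu (q i), forall t, f i t = 0%R} -> (0 < nrm (mpow mu (q i)) (f i))%R.
Proof.
move=> nz; rewrite lt_neqAle nrm_ge0 andbT; apply/eqP => n0; apply: nz.
have [f2 _ _] := WX i; have [mf _] := f2.
have E := nrm_eq0_integral f2 (esym n0).
have : \int[mpow mu (q i)]_t `|(f i t ^+ 2)%:E| = 0.
  by rewrite -[RHS]E; apply: eq_integral => t _; rewrite gee0_abs ?lee_fin ?sqr_ge0.
move/(ae_eq_integral_abs _ measurableT (measurable_sqr mf)).
apply: filterS => t /(_ Logic.I) /eqP; rewrite eqe sqrf_eq0 => /eqP.
by [].
Qed.

(** Cauchy-Schwarz for |f| and f^2; there is nothing to prove if the L^4 norm is infinite. *)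
Lemma normf3_le_normf4 i : ~ {ae mpow mu (q i), forall t, f i t = 0%R} ->
  normf mu f 3 i ^+ 3 / normf mu f 2 i <= normf mu f 4 i ^+ 2.
Proof.
move=> /nrm_gt0 n2; rewrite normf2_nrm inver gt_eqF // lee_pdivrMr // normf3_cube.
have [f2 _ _] := WX i; have [mf _] := f2.
have n40 : 0 <= normf mu f 4 i ^+ 2 by apply: expe_ge0; exact: Lnorm_ge0.
case E4 : (normf mu f 4 i ^+ 2) => [r| |]; last by rewrite E4 in n40.
  have ff : isL2 (mpow mu (q i)) (fun t => f i t ^+ 2)%R.
    split; first exact: measurable_funX.
    by rewrite -normf4_sqr E4 -EFin_expe ltry.
  have r0 : (0 <= r)%R by rewrite -lee_fin -E4.
  have rE : r = nrm (mpow mu (q i)) (fun t => f i t ^+ 2)%R.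
    apply: EFin_inj; rewrite -E4; apply: eq_sqre; rewrite ?nrm_ge0 //.
    by rewrite normf4_sqr (isL2_sqr ff).
  rewrite -EFinM rE mulrC; apply: le_trans (abs_product_le f2 ff).
  rewrite le_eqVlt; apply/orP; left; apply/eqP; apply: eq_integral => t _.
  by rewrite normrM normrX -exprS.
by rewrite gt0_mulye ?leey // lte_fin.
Qed.

Variables (sigma m : R).
Hypothesis s0 : (0 < sigma)%R.
Hypothesis Xs : nrm P (fun om => \sum_i X i om)%R = sigma.

Lemma nrm_le_sigma i : (nrm (mpow mu (q i)) (f i) <= sigma)%R.
Proof.
rewrite -(@ler_pXn2r _ 2) ?nnegrE ?nrm_ge0 ?(ltW s0) // -Xs.
rewrite (multiple_integral_isometry eta_poisson Zborel mu_na qinj WX) (bigD1 i) //=.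
rewrite ler_wpDr //; first by apply: sumr_ge0 => j _; rewrite mulr_ge0 ?sqr_ge0.
by rewrite ler_peMl ?sqr_ge0 // ler1n fact_gt0.
Qed.

(** Chosen by the order and not by the index, so that it makes sense whatever the smallest order is;
    at most the kernel of index 0 has order one. *)
Definition kernel_size_norm i : \bar R :=
  if q i == 1%N then normf mu f 3 i ^+ 3 / normf mu f 2 i else normf mu f 4 i ^+ 2.

Hypothesis f_neq0 : forall i, ~ {ae mpow mu (q i), forall t, f i t = 0%R}.
Hypothesis m_gt0 : (0 < m)%R.
Hypothesis m1 : max1 mu f <= m%:E.
Hypothesis m2 : max2 mu f <= m%:E.
Hypothesis ma : forall i, kernel_size_norm i <= m%:E.

(** Multiplying [ma] by the L^2 norm of f_1 leaves m times this norm, which the isometry bounds by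
    sigma. *)
Lemma first_kernel_third : \int[mu]_z (`|chaos_kernel f predT [:: z]| ^+ 3)%:E <= (m * sigma)%:E.
Proof.
have [i /eqP qi|no] := pickP (fun i => q i == 1%N); last first.
  rewrite integral0_eq ?lee_fin ?mulr_ge0 ?(ltW s0) ?(ltW m_gt0) // => z _.
  by rewrite kernel0 ?normr0 ?expr0n // => i _; rewrite eq_sym no.
have n2 := nrm_gt0 (f_neq0 (i := i)).
have mK3 : seq_measurable (fun s => (`|chaos_kernel f predT s| ^+ 3)%:E : \bar R).
  move=> j; apply/measurable_EFinP; apply: measurable_funX.
  have mj : measurable_fun setT (fun t : j.-tuple Z => chaos_kernel f predT t).
    exact: (seq_measurable_kernel fL2 predT).
  exact: (measurableT_comp (@normr_measurable R setT) mj).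
have -> : \int[mu]_z (`|chaos_kernel f predT [:: z]| ^+ 3)%:E
    = \int[mpow mu 1]_t (`|chaos_kernel f predT t| ^+ 3)%:E.
  rewrite (@ge0_integral_mpow_cons _ _ _ mu 0 _ mK3) => [|s]; last by rewrite lee_fin exprn_ge0.
  apply: eq_integral => z _.
  by rewrite (@integral_mpow_nil _ _ _ mu (fun t => (`|chaos_kernel f predT (z :: t)| ^+ 3)%:E)).
have -> : \int[mpow mu 1]_t (`|chaos_kernel f predT t| ^+ 3)%:E = normf mu f 3 i ^+ 3.
  by rewrite normf3_cube -qi; apply: eq_integral => t _; rewrite kernel_tuple.
have := ma i; rewrite /kernel_size_norm qi eqxx normf2_nrm inver gt_eqF // lee_pdivrMr //.
move/le_trans; apply; rewrite -EFinM lee_fin ler_wpM2l ?(ltW m_gt0) //; exact: nrm_le_sigma.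
Qed.

(** The square root belongs to the first term of [B2], the other summand is the constant of
    [derivative_product_third]. Only the bound n on the orders enters. *)
Definition stein_const : R :=
  (Num.sqrt (4 * fluctuation_const R n) + (8 + 4 * (fourth_const R n + n%:R)))%R.

Lemma B2_le (DF DLF : Z -> Omega -> R) : derivative_of mu P eta f (fun=> 1%R) DF ->
  derivative_of mu P eta f (fun j => j%:R^-1)%R (fun z w => - DLF z w)%R ->
  B2 P mu sigma DF DLF <= (sigma^-1 * m * stein_const)%:E.
Proof.
move=> UD VD; have [mU _] := UD; have [mV _] := VD.
have one1 (j : nat) : (`|1 : R| <= 1)%R by rewrite normr1.
have U2 := derivative_isL2 eta_poisson Zborel mu_na q_gt0 q_incr fL2 qn WX one1 UD.
have V2 := derivative_isL2 eta_poisson Zborel mu_na q_gt0 q_incr fL2 qn WX (@inv_nat_le1 R) VD.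
have iUV : (mu \x P).-integrable setT (EFin \o (fun y => DF y.1 y.2 * - DLF y.1 y.2)%R).
  by case: U2 V2 => mU' u2 [mV' v2]; exact: sqr_mul_integrable.
have C0 := fluctuation_const_ge0 R n.
have si : (0 <= sigma^-1)%R by rewrite invr_ge0 ltW.
have m4 i : q i != 1%N -> normf mu f 4 i ^+ 2 <= m%:E.
  by move=> /negbTE qi; have := ma i; rewrite /kernel_size_norm qi.
have first_term : \int[P]_w ((sigma ^+ 2)%:E - \int[mu]_z (DF z w * - DLF z w)%:E) ^+ 2
    <= (4 * fluctuation_const R n * m ^+ 2)%:E.
  apply: le_trans (derivative_fluctuation eta_poisson Zborel mu_na q_gt0 q_incr fL2 qn WX
    (ltW m_gt0) m1 m2 (ltW s0) Xs UD VD).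
  have mG := measurable_fubini_G iUV.
  have mD : measurable_fun setT (fun w => (sigma ^+ 2)%:E - \int[mu]_z (DF z w * - DLF z w)%:E).
    by apply: emeasurable_funB => //; exact: mG.
  apply: integral_le_ge0_ae.
  - by under eq_fun do rewrite expe2; exact: emeasurable_funM.
  - apply: measurable_sqr; apply: measurable_funB => //; exact: (section_integral_measurable iUV).
  - by move=> w; rewrite lee_fin sqr_ge0.
  (* [B2] integrates the square of an extended real, which is a real number for almost every w only;
     the comparison of integrals needs no more. *)
  have := ae_integrable2 iUV; apply: filterS => w iw.
  have -> : \int[mu]_z (DF z w * - DLF z w)%:E = (\int[mu]_z (DF z w * - DLF z w))%:E.
    by rewrite fineK //; exact: integrable_fin_num.
  by rewrite -EFinB -EFin_expe.
have second_term : \int[mu]_z 'E_P[(fun w => DF z w ^+ 2 * `|DLF z w|)%R]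
    <= (sigma * m * (8 + 4 * (fourth_const R n + n%:R)))%:E.
  apply: le_trans (derivative_product_third eta_poisson Zborel mu_na q_gt0 q_incr fL2 qn WX
    m_gt0 m1 m2 m4 s0 Xs first_kernel_third UD VD).
  rewrite (@ge0_integral_prod _ _ _ _ _ mu P (fun z om => (DF z om ^+ 2 * `|- DLF z om|)%:E)); first last.
  - by move=> z om; rewrite lee_fin mulr_ge0 ?sqr_ge0.
  - apply/measurable_EFinP; apply: measurable_funM; first exact: measurable_funX.
    exact: (measurableT_comp _ mV).
  rewrite le_eqVlt; apply/orP; left; apply/eqP; apply: eq_integral => z _.
  by rewrite unlock; apply: eq_integral => om _; rewrite normrN.
have sqrt_term : sqrte (\int[P]_w ((sigma ^+ 2)%:E - \int[mu]_z (DF z w * - DLF z w)%:E) ^+ 2)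
    <= (Num.sqrt (4 * fluctuation_const R n) * m)%:E.
  apply: (@le_trans _ _ (sqrte (4 * fluctuation_const R n * m ^+ 2)%:E)).
    have y0 : 0 <= (4 * fluctuation_const R n * m ^+ 2)%:E.
      by rewrite lee_fin mulr_ge0 ?sqr_ge0 // mulr_ge0.
    by rewrite (lee_sqrt _ y0).
  by rewrite /= lee_fin sqrtrM ?mulr_ge0 // sqrtr_sqr ger0_norm // ltW.
apply: le_trans (leeD (lee_wpmul2l _ sqrt_term) (lee_wpmul2l _ second_term)) _.
- by rewrite lee_fin.
- by rewrite lee_fin invr_ge0 sqr_ge0.
rewrite -!EFinM -EFinD lee_fin /stein_const le_eqVlt; apply/orP; left; apply/eqP.
by field; rewrite gt_eqF.
Qed.

End SteinBound.

(** * Kernels of the inverse generator, and the variance *)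

Section InverseGenerator.
Context d (Z : measurableType d) (R : realType).
Variable mu : {sigma_finite_measure set Z -> \bar R}.
Context d' (Omega : measurableType d').
Variables (P : probability Omega R) (eta : R.-ker Omega ~> Z).
Hypothesis eta_poisson : poisson_measure P mu eta.
Hypothesis Zborel : borel_space Z R.
Hypothesis mu_na : non_atomic mu.
Variables (k : nat) (q : 'I_k -> nat).
Hypothesis q_gt0 : forall i, (0 < q i)%N.
Hypothesis q_incr : forall i j : 'I_k, (i < j)%N -> (q i < q j)%N.
Variable f : forall i : 'I_k, (q i).-tuple Z -> R.
Arguments f : clear implicits.
Variables (X : 'I_k -> Omega -> R) (c : R) (F : Omega -> R).
Hypothesis F2 : isL2 P F.
Hypothesis WX : forall i, multiple_integral mu P eta (f i) (X i).
Hypothesis FE : {ae P, forall w, F w = (c + \sum_i X i w)%R}.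

(** Uniqueness for F identifies the given kernels with the f_i, orders without f_i receiving the
    kernel 0; each term is multiplied by - m^-1. *)
Lemma inverse_generator_expansion G : inverse_generator P mu eta F G -> exists Y,
  expansion mu P eta 0 (fun m t => - m%:R^-1 * chaos_kernel f predT t)%R Y G.
Proof.
move=> [h [J [/chaos_expansionP[Y eF] WJ cvG]]].
have eK := finite_expansion q_gt0 q_incr F2 WX FE.
exists (fun m w => - m%:R^-1 * J m w)%R; apply: cvg_L2_expansion => [m m0|].
  apply: multiple_integral_scale.
  have [_ /(_ m m0)[K2 _ _] _] := eK.
  have := multiple_integral_ae (wiener_ito_multiple (WJ m m0)) K2
    (expansion_unique eta_poisson Zborel mu_na eK eF m0).
  by under eq_fun do rewrite mul1r.
rewrite (_ : (fun n w => _) = (fun n w => - \sum_(1 <= m < n.+1) m%:R^-1 * J m w)%R) //.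
apply/funext => n; apply/funext => w; rewrite add0r -sumrN.
by apply: eq_bigr => m _; rewrite mulNr.
Qed.

Lemma variance_nrm (X2 : forall i, isL2 P (X i)) : c = fine 'E_P[F] ->
  'V_P[F] = (nrm P (fun w => \sum_i X i w) ^+ 2)%:E.
Proof.
move=> cE; have S2 : isL2 P (fun w => \sum_i X i w)%R by exact: isL2_sum.
have Fc2 : isL2 P (fun w => F w - c)%R by apply: isL2B => //; exact: (isL2_cst mu P eta).
rewrite /variance covariance.unlock -cE unlock -(nrm_ae Fc2 S2); last first.
  by move: FE; apply: filterS => w ->; ring.
by rewrite -isL2_sqr //; apply: eq_integral => w _; rewrite expr2.
Qed.

End InverseGenerator.

Lemma stein_const_gt0 (R : realType) n : (0 < stein_const R n)%R.
Proof.
have a := sqrtr_ge0 (4 * fluctuation_const R n)%R.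
have b := fourth_const_ge0 R n; have e : (0 <= n%:R :> R)%R by [].
rewrite /stein_const; lra.
Qed.

Lemma B3_with_le d (Z : measurableType d) (R : realType)
    (mu : {sigma_finite_measure set Z -> \bar R}) (k : nat) (q : 'I_k -> nat)
    (f : forall i : 'I_k, (q i).-tuple Z -> R) (sigma : R) (a b : 'I_k -> \bar R) :
  (0 < sigma)%R -> (forall i, a i <= b i) -> B3_with mu f sigma a <= B3_with mu f sigma b.
Proof.
move=> s0 ab; apply: lee_wpmul2l; first by rewrite lee_fin invr_ge0 ltW.
apply: leeD => //; elim/big_ind2: _ => // x y u v xy uv.
by rewrite ge_max !le_max xy uv orbT.
Qed.

Theorem theorem3p5 (R : realType) (k : nat) (q : 'I_k -> nat)
    (k_gt0 : (0 < k)%N)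
    (q_gt0 : forall i, (0 < q i)%N)
    (q_incr : forall i j : 'I_k, (i < j)%N -> (q i < q j)%N) :
  exists2 C0 : R, (0 < C0)%R &
  forall (d d' : measure_display)
    (Z : measurableType d) (Omega : measurableType d')
    (mu : {sigma_finite_measure set Z -> \bar R})
    (P : probability Omega R) (eta : R.-ker Omega ~> Z)
    (f : forall i : 'I_k, (q i).-tuple Z -> R)
    (I : 'I_k -> Omega -> R) (F : {RV P >-> R}) (LF : Omega -> R)
    (DF DLF : Z -> Omega -> R) (sigma : R),
  borel_space Z R -> non_atomic mu -> poisson_measure P mu eta ->
  (forall i, L2_sym mu (f i)) ->
  (forall i, ~ {ae mpow mu (q i), forall t, f i t = 0%R}) ->
  assumption_i mu f -> assumption_ii mu f -> assumption_iii mu f ->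
  eta_measurable P eta F ->
  (forall i, wiener_ito P mu eta (f i) (I i)) ->
  {ae P, forall w, F w = (fine 'E_P[F] + \sum_(i < k) I i w)%R} ->
  malliavin_derivative P mu eta F DF ->
  inverse_generator P mu eta F LF ->
  malliavin_derivative P mu eta LF DLF ->
  (0 < sigma)%R -> (sigma ^+ 2)%:E = 'V_P[F] ->
  B2 P mu sigma DF DLF <= C0%:E * B3 mu f sigma /\
  (q (Ordinal k_gt0) = 1%N ->
    (normf mu f 3 (Ordinal k_gt0) ^+ 3 / normf mu f 2 (Ordinal k_gt0)
       <= normf mu f 4 (Ordinal k_gt0) ^+ 2) /\
    B2 P mu sigma DF DLF <= C0%:E * B3_first mu f sigma).
Proof.
pose n := (\max_(i < k) q i)%N; exists (stein_const R n); first exact: stein_const_gt0.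
move=> d d' Z Omega mu P eta f X F LF DF DLF sigma Zborel mu_na eta_poisson fL2 f0 _ _ _ _.
move=> WI FE DFd LFd DLFd s0 sV.
have WX i : multiple_integral mu P eta (f i) (X i) by exact/wiener_ito_multiple/WI.
have X2 i : isL2 P (X i) by case: (WX i).
have F2 : isL2 P F by case: LFd => [h [J [/chaos_expansionP[Y []]]]].
have qn i : (q i <= n)%N by rewrite /n (bigD1 i) //= leq_maxl.
have eF := finite_expansion q_gt0 q_incr F2 WX FE.
have [Y eG] := inverse_generator_expansion eta_poisson Zborel mu_na q_gt0 q_incr F2 WX FE LFd.
have UD : derivative_of mu P eta f (fun=> 1%R) DF.
  by apply: (derivative_ofP eta_poisson Zborel mu_na q_gt0 q_incr fL2 eF DFd) => m _.
have VD : derivative_of mu P eta f (fun j => j%:R^-1)%R (fun z w => - DLF z w)%R.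
  have a0 m : (0 < m)%N -> (- m%:R^-1 != 0 :> R)%R.
    by move=> m0; rewrite oppr_eq0 invr_eq0 pnatr_eq0 -lt0n.
  have VN : derivative_of mu P eta f (fun m => - m%:R^-1)%R DLF.
    exact: (derivative_ofP eta_poisson Zborel mu_na q_gt0 q_incr fL2 eG DLFd a0).
  have := derivative_ofN VN.
  by under [X in derivative_of _ _ _ _ X]eq_fun do rewrite opprK.
have Xs : nrm P (fun w => \sum_i X i w)%R = sigma.
  have := variance_nrm mu eta F2 FE X2 erefl; rewrite -sV => -[] /eqP.
  by rewrite eqrXn2 ?nrm_ge0 ?(ltW s0) // => /eqP.
have C0 := stein_const_gt0 R n.
(* The bound with the L^3 quantity for order one is the stronger one; both claims follow from it,
   the general one by [normf3_le_normf4]. *)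
have main : B2 P mu sigma DF DLF
    <= (stein_const R n)%:E * B3_with mu f sigma (kernel_size_norm mu f).
  rewrite /B3_with; set x := max1 mu f; set y := max2 mu f; set u := \big[maxe/0]_i _.
  have x0 : 0 <= x by exact: bigmaxe_ge0.
  have y0 : 0 <= y by exact: bigmaxe_ge0.
  have u0 : 0 <= u by exact: bigmaxe_ge0.
  have si : (0 < sigma^-1)%R by rewrite invr_gt0.
  have s00 : 0 <= x + y + u by rewrite !adde_ge0.
  case E : (x + y + u) => [s| |]; last by rewrite E in s00.
    rewrite E lee_fin in s00; rewrite -!EFinM; apply/lee_addgt0Pr => e e0.
    have C1 : (0 < sigma^-1 * stein_const R n)%R by exact: mulr_gt0.
    (* [B2_le] asks for a positive m, while the three maxima may all vanish. m is taken slightly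
       above their sum, with a surplus e' scaled so as to cost exactly e. *)
    pose e' := (e / (sigma^-1 * stein_const R n))%R; have e'0 : (0 < e')%R by exact: divr_gt0.
    have le_m v w : v + w = s%:E -> 0 <= w -> v <= (s + e')%:E.
      move=> E1 w0; apply: (@le_trans _ _ s%:E); first by rewrite -E1 leeDl.
      by rewrite lee_fin lerDl ltW.
    have xm : x <= (s + e')%:E by apply: le_m (y + u) _ _; rewrite ?addeA // adde_ge0.
    have ym : y <= (s + e')%:E by apply: le_m (x + u) _ _; rewrite ?adde_ge0 // addeCA addeA.
    have um : u <= (s + e')%:E by apply: le_m (x + y) _ _; rewrite ?adde_ge0 // addeC.
    have am i : kernel_size_norm mu f i <= (s + e')%:E.
      by apply: le_trans um; apply: (@maxe_sup _ _ _ _ _ i) => //; exact: mem_index_enum.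
    have m0 : (0 < s + e')%R by exact: ltr_wpDl.
    apply: le_trans (B2_le eta_poisson Zborel mu_na q_gt0 q_incr fL2 qn WX s0 Xs f0 m0 xm ym am UD VD) _.
    rewrite -EFinD lee_fin le_eqVlt; apply/orP; left; apply/eqP.
    by rewrite /e'; field; rewrite !gt_eqF.
  (* If the sum of the three maxima is infinite, so is the right side. *)
  by rewrite !gt0_muley ?leey ?lte_fin.
have a34 i : normf mu f 3 i ^+ 3 / normf mu f 2 i <= normf mu f 4 i ^+ 2.
  exact: (normf3_le_normf4 WX).
split.
  apply: le_trans main _; apply: lee_wpmul2l; first by rewrite lee_fin ltW.
  by apply: B3_with_le => // i; rewrite /kernel_size_norm; case: ifP.
move=> q1; split=> //; apply: le_trans main _.
rewrite (_ : kernel_size_norm mu f = (fun i => if i == 0%N :> nat then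
  normf mu f 3 i ^+ 3 / normf mu f 2 i else normf mu f 4 i ^+ 2)) //.
(* As the smallest order is 1 and the orders increase strictly, having order one and having index 0
   are the same. *)
apply/funext => i; rewrite /kernel_size_norm; case: (posnP i) => [i0|i0].
  by rewrite (_ : i = Ordinal k_gt0) ?q1 //; exact: val_inj.
have := q_incr (Ordinal k_gt0) i i0; rewrite q1 => qi.
by rewrite (gtn_eqF qi).
Qed.
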